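(* Let $\vec X(t)\in\mathbb R^n$ satisfy the general Itô stochastic differential equation $$d\vec X=\vec a(t,\vec X)\,dt+\vec b(t,\vec X)\,dW,$$ where $W$ is a scalar Wiener process and the drift $\vec a(t,\vec x)$ and volatility $\vec b(t,\vec x)$ are sufficiently smooth functions of their arguments. Then the Runge--Kutta like numerical scheme (modified Improved Euler scheme, defined in the context) with time step $h$ and random signs $S_k=\pm1$ generally has global error $O(h)$ when applied to this stochastic differential equation.
   Context: Scheme: given a time step $h$ and the value $\vec X(t_k)=\vec X_k$, estimate $\vec X(t_{k+1})$, where $t_{k+1}=t_k+h$, by $\vec X_{k+1}$ computed via $$\vec K_1=h\,\vec a(t_k,\vec X_k)+(\Delta W_k-S_k\sqrt h)\,\vec b(t_k,\vec X_k),$$ $$\vec K_2=h\,\vec a(t_{k+1},\vec X_k+\vec K_1)+(\Delta W_k+S_k\sqrt h)\,\vec b(t_{k+1},\vec X_k+\vec K_1),$$ $$\vec X_{k+1}=\vec X_k+\tfrac12(\vec K_1+\vec K_2).$$ Here $\Delta W_k=W(t_{k+1})-W(t_k)=\sqrt h\,Z_k$ with $Z_k\sim N(0,1)$, and $S_k=\pm1$, each alternative chosen with probability $1/2$, independently of the noise $W$. The step is repeated $(t_m-t_0)/h$ times to integrate from time $t_0$ to a fixed end time $t_m$. The global error is the difference between the numerical value $\vec X_m$ and the exact solution $\vec X(t_m)$ for the same realisation of $W$; global error $O(h)$ is meant in the strong sense that this difference has mean $O(h)$ and variance $O(h^2)$ as $h\to0$ (so root-mean-square size $O(h)$). ''Sufficiently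 smooth'' is not quantified further.
   Formalization: ''Sufficiently smooth'' is taken as: C^N for some fixed N, globally Lipschitz in x uniformly in t, with derivatives up to order N of at most polynomial growth in x; X(t_0) has finite moments of all orders. Without such growth and moment conditions the claim fails (e.g. dX = -X^3 dt + dW). *)

(* Defs.v *)
From HB Require Import structures.
From mathcomp Require Import all_boot all_order all_algebra.
From mathcomp Require Import all_classical all_reals all_analysis.

Set Implicit Arguments.
Unset Strict Implicit.
Unset Printing Implicit Defensive.

Import Order.TTheory GRing.Theory Num.Theory.
Import numFieldNormedType.Exports.

Local Open Scope classical_set_scope.
Local Open Scope ring_scope.

Section Coefficients.
Context {R : realType} {n : nat}.
Implicit Types (f : R * 'rV[R]_n -> R) (a : R -> 'rV[R]_n -> 'rV[R]_n).

Definition poly_growth (t0 tm : R) f : Prop :=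
  exists (K : R) (p : nat), forall t x,
    t0 <= t <= tm -> `|f (t, x)| <= K * (1 + `|x| ^+ p).

(* [f] is of class C^N on R x R^n and, for t in [t0, tm], f and its iterated
   derivatives up to order N grow at most polynomially in x. Directional
   derivatives in every direction of R x R^n are used; by linearity in the
   direction this is the same as using the coordinate partial derivatives. *)
Fixpoint smooth (N : nat) (t0 tm : R) f : Prop :=
  [/\ continuous f, poly_growth t0 tm f &
      if N is N'.+1 then
        forall v : R * 'rV[R]_n,
          (forall x, derivable f x v) /\
          smooth N' t0 tm (fun x => 'D_v f x)
      else True].

Definition lipschitz_in_space (t0 tm : R) a : Prop :=
  exists L : R, forall t x y,
    t0 <= t <= tm -> `|a t x - a t y| <= L * `|x - y|.

(* The global Lipschitz bound is the standard condition ruling out explosion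
   of the solution and of the moments of explicit schemes. *)
Definition sufficiently_smooth (N : nat) (t0 tm : R) a : Prop :=
  lipschitz_in_space t0 tm a /\
  forall i, smooth N t0 tm (fun z => a z.1 z.2 0 i).

End Coefficients.

Section Independence.
Context {R : realType} {d : measure_display} {T : measurableType d}.

Definition sigma_rv (Y : T -> R) : set (set T) :=
  preimage_set_system setT Y measurable.

Definition independent (P : probability T R) (G H : set (set T)) : Prop :=
  forall A B, G A -> H B -> P (A `&` B) = (P A * P B)%E.

Definition mutually_independent (P : probability T R) (I : eqType)
    (G : I -> set (set T)) : Prop :=
  forall (s : seq I) (A : I -> set T), uniq s ->
    (forall i, i \in s -> G i (A i)) ->
    P (\big[setI/setT]_(i <- s) A i) = (\prod_(i <- s) fine (P (A i)))%:E.

End Independence.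

Section Stochastic.
Context {R : realType} {d : measure_display} {T : measurableType d}.
Variable P : probability T R.
Implicit Types (F : R -> set (set T)) (W Y : R -> T -> R).

(* Only indices t >= 0 are relevant. *)
Record filtration F : Prop := Filtration {
  filtration_sigma : forall t, 0 <= t -> sigma_algebra setT (F t) ;
  filtration_sub : forall t, 0 <= t -> F t `<=` measurable ;
  filtration_mono : forall s t, 0 <= s -> s <= t -> F s `<=` F t }.

Definition rv_measurable (G : set (set T)) (Y : T -> R) : Prop :=
  sigma_rv Y `<=` G.

(* The second parameter of [normal_prob] is the standard deviation. *)
Record wiener F W : Prop := Wiener {
  wiener_adapted : forall t, 0 <= t -> rv_measurable (F t) (W t) ;
  wiener_start : {ae P, forall w, W 0 w = 0} ;
  wiener_increment : forall s t, 0 <= s -> s < t ->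
    forall B : set (measurableTypeR R), measurable B ->
      P ((fun w => W t w - W s w) @^-1` B) =
      normal_prob 0 (Num.sqrt (t - s)) B ;
  wiener_indep : forall s t, 0 <= s -> s < t ->
    independent P (F s) (sigma_rv (fun w => W t w - W s w)) ;
  wiener_continuous :
    {ae P, forall w, {within `[0, +oo[, continuous (fun t => W t w)}} }.

(* An elementary process equals [sp_val k] on [sp_grid k, sp_grid k.+1[ for
   k < sp_size. *)
Record simple_process := SimpleProcess {
  sp_size : nat ;
  sp_grid : nat -> R ;
  sp_val : nat -> T -> R }.

Record elementary F (u v : R) (phi : simple_process) : Prop := Elementary {
  elementary_first : sp_grid phi 0 = u ;
  elementary_last : sp_grid phi (sp_size phi) = v ;
  elementary_nondecreasing : forall k, (k < sp_size phi)%N ->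
    sp_grid phi k <= sp_grid phi k.+1 ;
  elementary_adapted : forall k, (k < sp_size phi)%N ->
    rv_measurable (F (sp_grid phi k)) (sp_val phi k) ;
  elementary_bounded : exists M : R, forall k w, (k < sp_size phi)%N ->
    `|sp_val phi k w| <= M }.

Definition sp_eval (phi : simple_process) (t : R) (w : T) : R :=
  \sum_(k < sp_size phi)
    sp_val phi k w * (sp_grid phi k <= t < sp_grid phi k.+1)%R%:R.

Definition sp_integral W (phi : simple_process) (w : T) : R :=
  \sum_(k < sp_size phi)
    sp_val phi k w * (W (sp_grid phi k.+1) w - W (sp_grid phi k) w).

(* The class of Ito integrands on [u, v]: jointly measurable, adapted and
   square integrable processes. *)
Record ito_class F (u v : R) Y : Prop := ItoClass {
  ito_class_measurable :
    measurable_fun (`[u, v] `*` setT)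
      (fun z : measurableTypeR R * T => Y z.1 z.2) ;
  ito_class_adapted : forall t, u <= t <= v -> rv_measurable (F t) (Y t) ;
  ito_class_square :
    (\int[P]_w \int[lebesgue_measure]_(t in `[u, v]) (Y t w ^+ 2)%:E
       < +oo)%E }.

(* [J] is (a version of) the Ito integral of [Y] against [W] over [u, v],
   i.e. the L^2 limit of integrals of elementary processes approximating [Y]
   in L^2(dP x dt). *)
Definition ito_integral F W (u v : R) Y (J : T -> R) : Prop :=
  ito_class F u v Y /\ measurable_fun setT J /\
  exists phi : nat -> simple_process,
    [/\ forall j, elementary F u v (phi j),
        (fun j => \int[P]_w \int[lebesgue_measure]_(t in `[u, v])
            ((Y t w - sp_eval (phi j) t w) ^+ 2)%:E)%E @ \oo --> 0%E &
        (fun j => \int[P]_w ((J w - sp_integral W (phi j) w) ^+ 2)%:E)%E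
          @ \oo --> 0%E].

(* [X] is a solution on [t0, tm] of dX = a(t, X) dt + b(t, X) dW. *)
Record ito_solution (n : nat) F W (a b : R -> 'rV[R]_n -> 'rV[R]_n)
    (t0 tm : R) (X : R -> T -> 'rV[R]_n) : Prop := ItoSolution {
  solution_class : forall i, ito_class F t0 tm (fun t w => X t w 0 i) ;
  solution_continuous :
    {ae P, forall w, {within `[t0, tm], continuous (fun t => X t w)}} ;
  solution_eq : forall t i, t0 <= t <= tm ->
    exists J : T -> R,
      ito_integral F W t0 t (fun s w => b s (X s w) 0 i) J /\
      {ae P, forall w, X t w 0 i =
        X t0 w 0 i + \int[lebesgue_measure]_(s in `[t0, t]) a s (X s w) 0 i
          + J w} }.

(* The sigma-algebra generated by the initial value and the Wiener process. *)
Definition noise_sigma (n : nat) W (x0 : T -> 'rV[R]_n) : set (set T) :=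
  <<s \bigcup_(i in [set: 'I_n]) sigma_rv (fun w => x0 w 0 i) `|`
      \bigcup_(t in [set t : R | 0 <= t]) sigma_rv (W t) >>.

(* The signs are fair and (S 0, S 1, ...) together with the noise (index
   [None]) form an independent family. *)
Definition random_signs (n : nat) W (x0 : T -> 'rV[R]_n)
    (S : nat -> {RV P >-> R}) : Prop :=
  (forall k, P [set w | S k w = 1] = (2^-1)%:E /\
             P [set w | S k w = -1] = (2^-1)%:E) /\
  mutually_independent P (fun o : option nat =>
    if o is Some k then sigma_rv (S k) else noise_sigma W x0).

End Stochastic.

Section Scheme.
Context {R : realType} {n : nat}.
Implicit Types a b : R -> 'rV[R]_n -> 'rV[R]_n.

Definition rk_step a b (h t t' dW s : R) (x : 'rV[R]_n) : 'rV[R]_n :=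
  let K1 := h *: a t x + (dW - s * Num.sqrt h) *: b t x in
  let K2 := h *: a t' (x + K1) + (dW + s * Num.sqrt h) *: b t' (x + K1) in
  x + 2^-1 *: (K1 + K2).

Definition grid (t0 h : R) (k : nat) : R := t0 + k%:R * h.

(* [rk_scheme a b t0 h W S x0 k] is X_k for one realisation of the Wiener
   path [W], the signs [S] and the initial value [x0]. *)
Fixpoint rk_scheme a b (t0 h : R) (W : R -> R) (S : nat -> R)
    (x0 : 'rV[R]_n) (k : nat) : 'rV[R]_n :=
  if k is k'.+1 then
    rk_step a b h (grid t0 h k') (grid t0 h k)
      (W (grid t0 h k) - W (grid t0 h k')) (S k')
      (rk_scheme a b t0 h W S x0 k')
  else x0.

Definition global_error {T : Type} a b (t0 tm : R) (W : R -> T -> R)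
    (S : nat -> T -> R) (X : R -> T -> 'rV[R]_n) (m : nat) (w : T) :
    'rV[R]_n :=
  rk_scheme a b t0 ((tm - t0) / m%:R) (W ^~ w) (S ^~ w) (X t0 w) m - X tm w.

End Scheme.

(* Main.v *)
(* Since (dW - S sqrt h)(dW + S sqrt h) = dW^2 - h, a Taylor expansion shows that
   one Runge-Kutta step is a Milstein step, plus a term of size h^(3/2) whose mean
   given the past vanishes (averaging over dW and S), plus a remainder O(h^2).
   Expanding the square of the error, the h^(3/2) terms are therefore orthogonal to
   the error made so far, so that e' <= (1 + C h) e + C h^3 for the mean square
   distance e to the Milstein scheme driven by the same noise, and the discrete
   Gronwall lemma gives e = O(h^2).
   The same comparison of one Milstein step with two steps of half the size shows
   that halving the mesh moves the Milstein scheme by O(h) in L^2. Summing over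
   successive halvings, the scheme with mesh h is within O(h) of every dyadic
   refinement, uniformly in the refinement. Hence it is enough to know that the
   Milstein scheme converges to X in L^2, without any rate, and for this the Ito
   isometry and the continuity of the paths are sufficient: neither Ito's formula
   nor an Ito-Taylor expansion of X is needed.
   The signs are independent of the noise, so expectations over them are finite
   averages over deterministic sign sequences. *)
Require Import Defs.
From HB Require Import structures.
From mathcomp Require Import all_boot all_order all_algebra.
From mathcomp Require Import all_classical all_reals all_analysis.
From mathcomp Require Import measurable_realfun.
From mathcomp Require Import ring lra.

Set Implicit Arguments.
Unset Strict Implicit.
Unset Printing Implicit Defensive.

Import Order.TTheory GRing.Theory Num.Theory.
Import numFieldNormedType.Exports.

Local Open Scope classical_set_scope.
Local Open Scope ring_scope.

(** * Gaussian moments and independence *)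

(** Stability in the starting point is asked of the Milstein step only. The Runge-Kutta step always
    starts from the Runge-Kutta state, and its distance there to a Milstein step is the local error.
    The coefficients of this local error are derivatives of a and b, which may grow polynomially, so
    moments of every order of the schemes have to be bounded uniformly in the mesh. They are
    obtained from powers of 1 + |x|^2: the Lipschitz condition gives linear growth, and relative to
    this weight one step is a perturbation of size O(sqrt h) whose leading part has mean zero.
    Conditional expectations do not appear. That a term has conditional mean zero is expressed by
    its orthogonality to every U that is measurable at the beginning of the step and has all
    moments. Convergence without rate suffices because its accuracy may be chosen after the mesh:
    for given h the refinement is taken so fine that its distance to X is at most h, and the
    constant between the mesh h and the refinement does not see how fine it is. *)

Section GaussianMoments.
Context {R : realType}.
Local Notation mu := (@lebesgue_measure R).

(** The law is dominated by Lebesgue measure, and its Radon-Nikodym derivative agrees almost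
    everywhere with [normal_pdf] because both have the same integral over every measurable set. *)
Lemma ge0_integral_normal_prob (m s : R) (f : measurableTypeR R -> \bar R) :
  measurable_fun setT f -> (forall x, 0 <= f x)%E ->
  (\int[normal_prob m s]_x f x = \int[mu]_x (f x * (normal_pdf m s x)%:E))%E.
Proof.
move=> mf f0.
have dom := normal_prob_dominates m s.
rewrite -(Radon_Nikodym_SigmaFinite.change_of_variables dom)//=.
have mpdf : measurable_fun setT (EFin \o normal_pdf m s).
  by apply/measurable_EFinP; exact: measurable_normal_pdf.
have irn := Radon_Nikodym_SigmaFinite.f_integrable dom.
apply: ae_eq_integral => //.
- by apply: emeasurable_funM => //; exact: measurable_int irn.
- exact: emeasurable_funM.
- apply: ae_eqe_mul2l => /=; apply: integral_ae_eq => //=.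
  by move=> E _ mE; rewrite -Radon_Nikodym_SigmaFinite.f_integral.
Qed.

(** Lebesgue measure is invariant under reflection; this makes the odd Gaussian moments vanish. *)
Lemma ge0_integral_oppT (f : R -> \bar R) : measurable_fun setT f ->
  (forall x, 0 <= f x)%E -> (\int[mu]_x f (- x)%R = \int[mu]_x f x)%E.
Proof.
move=> mf f0.
transitivity (\int[pushforward mu (-%R : _ -> measurableTypeR R)]_x f x)%E.
  by rewrite ge0_integral_pushforward.
by apply: eq_measure_integral => A mA _; exact: lebesgue_measureN.
Qed.

Lemma normal_pdf_scale (s x : R) : 0 < s ->
  normal_pdf 0 s x = normal_pdf 0 1 (x / s) / s.
Proof.
move=> s0; rewrite !normal_pdfE ?gt_eqF// /normal_peak /normal_fun !subr0.
rewrite expr1n mul1r [RHS]mulrAC; congr (_ * _).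
  by rewrite -mulrnAr sqrtrM ?sqr_ge0// sqrtr_sqr ger0_norm ?(ltW s0)// invfM mulrC.
congr expR; rewrite expr_div_n !mulNr; congr (- _).
by rewrite -[s ^+ 2 *+ 2]mulr_natr invfM mulrA.
Qed.

Lemma normal_pdf01E (x : R) :
  normal_pdf 0 1 x = normal_peak 1 * expR (- (x ^+ 2 / 2)).
Proof. by rewrite normal_pdfE ?oner_neq0// /normal_fun subr0 expr1n mulNr. Qed.

Lemma ge0_integral_normal_scale (s : R) (f : R -> R) : 0 < s ->
  (forall x, 0 <= f x) -> continuous f ->
  (\int[mu]_x (f x * normal_pdf 0 s x)%:E =
   \int[mu]_x (f (s * x) * normal_pdf 0 1 x)%:E)%E.
Proof.
move=> s0 f0 cf.
have sV0 : 0 < s^-1 by rewrite invr_gt0.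
have dF (x : R) : is_derive x 1 ( *%R^~ s^-1 : R -> R) s^-1.
  have := is_deriveM (is_derive_id x 1) (is_derive_cst s^-1 x 1).
  by rewrite scaler0 add0r /GRing.scale/= mulr1.
have F'E : ( *%R^~ s^-1 : R -> R)^`()%classic = cst s^-1.
  by apply/funext => x; rewrite derive1E derive_val.
rewrite [RHS](@increasing_ge0_integration_by_substitutionT _ ( *%R^~ s^-1)).
- apply: eq_integral => x _; congr EFin.
  rewrite F'E; change (f x * normal_pdf 0 s x = f (s * (x / s)) * normal_pdf 0 1 (x / s) / s).
  by rewrite -[RHS]mulrA -normal_pdf_scale// mulrCA divff ?mulr1// gt_eqF.
- by move=> x y xy; rewrite ltr_pM2r.
- by rewrite F'E => x; exact: cvg_cst.
- by rewrite F'E; exact: is_cvg_cst.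
- by rewrite F'E; exact: is_cvg_cst.
- by move=> x; exact: ex_derive.
- by apply/gt0_cvgMlNy => //; exact: cvg_id.
- by apply/gt0_cvgMly => //; exact: cvg_id.
- move=> x; apply: cvgM; last by apply: continuous_normal_pdf; rewrite oner_neq0.
  by apply: (@continuous_comp _ _ _ ( *%R s) f); [exact: mulrl_continuous|exact: cf].
- by move=> x; rewrite mulr_ge0 ?normal_pdf_ge0.
Qed.

Definition gauss_moment (q : nat) : R :=
  fine (\int[mu]_x (x ^+ q.*2 * normal_pdf 0 1 x)%:E)%E.

Lemma even_expr_ge0 (q : nat) (x : R) : 0 <= x ^+ q.*2.
Proof. by rewrite -mul2n exprM exprn_ge0 ?sqr_ge0. Qed.

(** Half of the exponent is kept as a normal density of variance 2; the other half, exp(-x^2/4),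
    absorbs the power of x. *)
Lemma gauss_moment_fin (q : nat) :
  (\int[mu]_x (x ^+ q.*2 * normal_pdf 0 1 x)%:E < +oo)%E.
Proof.
pose s2 : R := Num.sqrt 2.
have s20 : 0 < s2 by rewrite sqrtr_gt0.
have s22 : s2 ^+ 2 = 2 by rewrite sqr_sqrtr.
(* The power comes from x^2/(4q) <= exp(x^2/(4q)), raised to the power q; [s2] compensates the
   normalisation of the wider density. *)
pose c : R := (4 * q%:R) ^+ q * s2.
have bound (x : R) : x ^+ q.*2 * normal_pdf 0 1 x <= c * normal_pdf 0 s2 x.
  have pE : normal_pdf 0 1 x = s2 * normal_pdf 0 s2 x * expR (- (x ^+ 2 / 4)).
    rewrite (normal_pdf_scale _ s20) !normal_pdf01E.
    rewrite [s2 * _]mulrCA divff ?gt_eqF// mulr1 -[RHS]mulrA -expRD expr_div_n s22.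
    by congr (_ * expR _); field.
  rewrite pE /c mulrCA -!mulrA [_ * (s2 * _)]mulrCA ler_pM2l//.
  rewrite [leRHS]mulrC ler_wpM2l ?normal_pdf_ge0//.
  rewrite expRN ler_pdivrMr ?expR_gt0//.
  have [->|q0] := posnP q; first by rewrite /= !expr0 mul1r -expR0 ler_expR mulrA divr_ge0 ?sqr_ge0.
  have q0' : 0 < q%:R :> R by rewrite ltr0n.
  have -> : expR (x * (x / 4)) = expR (x ^+ 2 / (4 * q%:R)) ^+ q.
    by rewrite -expRM_natl; congr expR; field; rewrite gt_eqF.
  rewrite -exprMn -mul2n exprM lerXn2r ?nnegrE ?sqr_ge0 ?mulr_ge0 ?expR_ge0//.
  rewrite mulrC -ler_pdivrMr ?mulr_gt0//.
  by apply: le_trans (expR_ge1Dx _); rewrite lerDr.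
apply: (@le_lt_trans _ _ (\int[mu]_x (c * normal_pdf 0 s2 x)%:E)%E).
  apply: ge0_le_integral => //.
  - by move=> x _; rewrite lee_fin mulr_ge0 ?even_expr_ge0 ?normal_pdf_ge0.
  - apply/measurable_EFinP; apply: measurable_funM; first exact: exprn_measurable.
    exact: measurable_normal_pdf.
  - apply/measurable_EFinP; apply: measurable_funM => //.
    exact: measurable_normal_pdf.
  - by move=> x _; rewrite lee_fin.
under eq_integral do rewrite EFinM.
rewrite integralZl//; last exact: integrable_normal_pdf.
by rewrite integral_normal_pdf mule1 ltry.
Qed.

Lemma ge0_gauss_momentE (q : nat) :
  (\int[mu]_x (x ^+ q.*2 * normal_pdf 0 1 x)%:E = (gauss_moment q)%:E)%E.
Proof.
rewrite /gauss_moment fineK// ge0_fin_numE ?gauss_moment_fin//.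
by apply: integral_ge0 => x _; rewrite lee_fin mulr_ge0 ?even_expr_ge0 ?normal_pdf_ge0.
Qed.

Lemma gauss_moment_ge0 q : 0 <= gauss_moment q.
Proof.
rewrite fine_ge0//; apply: integral_ge0 => x _.
by rewrite lee_fin mulr_ge0 ?even_expr_ge0 ?normal_pdf_ge0.
Qed.

Lemma normal_prob_even_moment (s : R) (q : nat) : 0 < s ->
  (\int[normal_prob 0 s]_x (x ^+ q.*2)%:E = (gauss_moment q * s ^+ q.*2)%:E)%E.
Proof.
move=> s0; rewrite ge0_integral_normal_prob; last 2 first.
  by apply/measurable_EFinP; exact: exprn_measurable.
  by move=> x; rewrite lee_fin even_expr_ge0.
rewrite (@ge0_integral_normal_scale s (fun x => x ^+ q.*2))//; last 2 first.
- exact: even_expr_ge0.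
- exact: exprn_continuous.
under eq_integral do rewrite exprMn -mulrA EFinM.
rewrite ge0_integralZl//; last 3 first.
- apply/measurable_EFinP; apply: measurable_funM; first exact: exprn_measurable.
  exact: measurable_normal_pdf.
- by move=> x _; rewrite lee_fin mulr_ge0 ?even_expr_ge0 ?normal_pdf_ge0.
- by rewrite lee_fin even_expr_ge0.
by rewrite ge0_gauss_momentE -EFinM mulrC.
Qed.

(* Integrate exp(-z^2/2s^2) >= exp(-z^2/2) (1 + (1 - s^-2) z^2/2), with equality
   to first order at s = 1, and let s tend to 1 from both sides. *)
Lemma gauss_moment1 : gauss_moment 1 = 1.
Proof.
set m := gauss_moment 1.
have key (s : R) : 0 < s -> 1 + 2^-1 * (1 - s ^- 2) * m <= s.
  move=> s0; rewrite -lee_fin.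
  have <- : (\int[mu]_x (s * normal_pdf 0 s x)%:E = s%:E)%E.
    under eq_integral do rewrite EFinM.
    rewrite integralZl//; last exact: integrable_normal_pdf.
    by rewrite integral_normal_pdf mule1.
  pose k := 2^-1 * (1 - s ^- 2).
  have im : mu.-integrable setT (fun x : R => (x ^+ 2 * normal_pdf 0 1 x)%:E).
    apply/integrableP; split.
      apply/measurable_EFinP; apply: measurable_funM; first exact: exprn_measurable.
      exact: measurable_normal_pdf.
    under eq_integral do rewrite /= ger0_norm ?(mulr_ge0 (sqr_ge0 _) (normal_pdf_ge0 _ _ _))//.
    exact: (gauss_moment_fin 1).
  have ip := @integrable_normal_pdf R 0 1.
  have is_ := @integrable_normal_pdf R 0 s.
  have -> : ((1 + k * m)%:E = \int[mu]_x (normal_pdf 0 1 x + k * (x ^+ 2 * normal_pdf 0 1 x))%:E)%E.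
    under eq_integral do rewrite EFinD EFinM.
    rewrite integralD//; last exact: integrableZl.
    rewrite integral_normal_pdf integralZl//.
    by rewrite (ge0_gauss_momentE 1) EFinD EFinM.
  apply: le_integral => //.
  - rewrite (_ : (fun _ => _) = (fun x => (normal_pdf 0 1 x)%:E) \+ (fun x => k%:E * (x ^+ 2 * normal_pdf 0 1 x)%:E))%E//.
    by apply: integrableD => //; exact: integrableZl.
  - rewrite (_ : (fun _ => _) = (fun x => s%:E * (normal_pdf 0 s x)%:E))%E//.
    exact: integrableZl.
  - move=> x _; rewrite lee_fin.
    have -> : s * normal_pdf 0 s x = normal_pdf 0 1 (x / s).
      by rewrite (normal_pdf_scale _ s0) mulrCA divff ?gt_eqF ?mulr1.
    rewrite !normal_pdf01E.
    have -> : expR (- ((x / s) ^+ 2 / 2)) = expR (- (x ^+ 2 / 2)) * expR (k * x ^+ 2).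
      by rewrite -expRD; congr expR; rewrite expr_div_n /k; field; rewrite gt_eqF.
    have -> : forall u v w : R, u * v + k * (w * (u * v)) = u * (v * (1 + k * w)).
      by move=> u v w; ring.
    rewrite ler_pM2l ?normal_peak_gt0 ?oner_neq0// ler_pM2l ?expR_gt0//.
    exact: expR_ge1Dx.
(* This is [key] at s = 1 + e after subtracting 1 and dividing by e; the lower bound uses s = 1 -
   e. *)
have ub (e : R) : 0 < e -> e <= 1 -> m <= 1 + 3 * e.
  move=> e0 e1; have /key : 0 < 1 + e by lra.
  have -> : 1 + 2^-1 * (1 - (1 + e) ^- 2) * m =
    1 + e * ((2 + e) * m / (2 * (1 + e) ^+ 2)) by field; lra.
  rewrite lerD2l ger_pMr// ler_pdivrMr ?mul1r; last by nra.
  nra.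
have lb (e : R) : 0 < e -> e <= 2^-1 -> 1 - 3 * e <= m.
  move=> e0 e1; have /key : 0 < 1 - e by lra.
  have -> : 1 + 2^-1 * (1 - (1 - e) ^- 2) * m =
    1 - e * ((2 - e) * m / (2 * (1 - e) ^+ 2)) by field; lra.
  rewrite lerD2l lerN2 ler_pMr// ler_pdivlMr ?mul1r; last by nra.
  nra.
apply/eqP; rewrite eq_le; apply/andP; split; rewrite leNgt; apply/negP => h.
(* If m > 1, taking e at most (m - 1)/4 would give m - 1 <= 3(m - 1)/4. *)
- have := ub (Num.min 1 ((m - 1) / 4)); rewrite lt_min ge_min lexx/=.
  have h4 : 0 < (m - 1) / 4 by lra.
  move=> /(_ _ isT); rewrite ltr01 h4 => /(_ isT).
  have : Num.min 1 ((m - 1) / 4) <= (m - 1) / 4 by rewrite ge_min lexx orbT.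
  lra.
- have := lb (Num.min 2^-1 ((1 - m) / 4)); rewrite lt_min ge_min lexx/=.
  have h4 : 0 < (1 - m) / 4 by lra.
  move=> /(_ _ isT); rewrite invr_gt0 ltr0n h4 => /(_ isT).
  have : Num.min 2^-1 ((1 - m) / 4) <= (1 - m) / 4 by rewrite ge_min lexx orbT.
  lra.
Qed.

End GaussianMoments.

(** * Independence, and variables with moments of all orders *)

Section IndependentProduct.
Context {R : realType} {d : measure_display} {T : measurableType d}.
Variable P : probability T R.

(** Independence says that the joint law agrees with the product law on rectangles. Uniqueness of
    the product measure identifies the two, and Tonelli's theorem separates the integrals. *)
Lemma ge0_integral_indep (U V : T -> R) (f g : R -> R) :
  measurable_fun setT U -> measurable_fun setT V ->
  measurable_fun setT f -> measurable_fun setT g ->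
  (forall x, 0 <= f x) -> (forall x, 0 <= g x) ->
  (forall A B : set R, measurable A -> measurable B ->
     P (U @^-1` A `&` V @^-1` B) = (P (U @^-1` A) * P (V @^-1` B))%E) ->
  (\int[P]_w (f (U w) * g (V w))%:E =
   \int[P]_w (f (U w))%:E * \int[P]_w (g (V w))%:E)%E.
Proof.
move=> mU mV mf mg f0 g0 ind.
pose X : {mfun T >-> R} := HB.pack_for {mfun T >-> R} U (isMeasurableFun.Build _ _ _ _ U mU).
pose Y : {mfun T >-> R} := HB.pack_for {mfun T >-> R} V (isMeasurableFun.Build _ _ _ _ V mV).
have mUV : measurable_fun setT (fun w => (U w, V w)) by exact/measurable_fun_pair.
pose Z : {mfun T >-> (R * R)%type} :=
  HB.pack_for {mfun T >-> (R * R)%type} (fun w => (U w, V w))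
  (isMeasurableFun.Build _ _ _ _ (fun w => (U w, V w)) mUV).
have prodE := product_measure_unique (m1 := distribution P X) (m2 := distribution P Y)
  (m' := distribution P Z) ind.
have mfg : measurable_fun setT (fun z : R * R => (f z.1 * g z.2)%:E).
  apply/measurable_EFinP; apply: measurable_funM.
    by apply: measurableT_comp mf _; exact: measurable_fst.
  by apply: measurableT_comp mg _; exact: measurable_snd.
transitivity (\int[distribution P Z]_z (f z.1 * g z.2)%:E)%E.
  rewrite (ge0_integral_distribution Z)//.
  by move=> z; rewrite lee_fin mulr_ge0.
transitivity (\int[distribution P X \x distribution P Y]_z (f z.1 * g z.2)%:E)%E.
  by apply: eq_measure_integral => A mA _; exact/esym/prodE.
rewrite fubini_tonelli1//; last by move=> z; rewrite lee_fin mulr_ge0.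
rewrite /fubini_F/=.
under eq_integral => x _.
  under eq_integral do rewrite EFinM.
  rewrite ge0_integralZl//; last 3 first.
  - exact/measurable_EFinP.
  - by move=> y _; rewrite lee_fin.
  - by rewrite lee_fin.
  over.
have mfE : measurable_fun setT (EFin \o f) by exact/measurable_EFinP.
have mgE : measurable_fun setT (EFin \o g) by exact/measurable_EFinP.
rewrite ge0_integralZr//; last 2 first.
- by move=> x _; rewrite lee_fin.
- by apply: integral_ge0 => y _; rewrite lee_fin.
congr (_ * _)%E.
- by rewrite (ge0_integral_distribution X (f := fun x => (f x)%:E))// => x; rewrite lee_fin.
- by rewrite (ge0_integral_distribution Y (f := fun x => (g x)%:E))// => x; rewrite lee_fin.
Qed.

Local Notation E f := (Rintegral P setT f).

(** Even powers avoid absolute values. Unlike a single L^p space this class is stable under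
    products, so it serves as the common domain of all expectations below. *)
Definition all_moments (Y : T -> R) : Prop :=
  measurable_fun setT Y /\
  forall q, (\int[P]_w (Y w ^+ q.*2)%:E < +oo)%E.

(** By symmetry z^2 <= y^2, and then (y + z)^2 <= 4 y^2. *)
Lemma even_powD_le (q : nat) (y z : R) :
  (y + z) ^+ q.*2 <= 4 ^+ q * (y ^+ q.*2 + z ^+ q.*2).
Proof.
wlog zy : y z / z ^+ 2 <= y ^+ 2.
  by move=> h; case: (leP (z ^+ 2) (y ^+ 2)) => [/h//|/ltW/h]; rewrite addrC [_ + y ^+ _]addrC.
rewrite -mul2n !exprM; apply: (@le_trans _ _ ((4 * y ^+ 2) ^+ q)).
  have h : (y + z) ^+ 2 <= 4 * y ^+ 2 by have := sqr_ge0 (y - z); nra.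
  by apply: lerXn2r => //; rewrite nnegrE; [exact: sqr_ge0|apply: le_trans h; exact: sqr_ge0].
by rewrite exprMn ler_wpM2l ?exprn_ge0// lerDl exprn_ge0 ?sqr_ge0.
Qed.

Lemma all_moments_dom (Y Z : T -> R) : all_moments Z -> measurable_fun setT Y ->
  (forall w, `|Y w| <= `|Z w|) -> all_moments Y.
Proof.
move=> [mZ hZ] mY YZ; split=> // q; apply: le_lt_trans (hZ q).
apply: ge0_le_integral => //.
- by move=> w _; rewrite lee_fin even_expr_ge0.
- by apply/measurable_EFinP; exact: measurable_funX.
- by apply/measurable_EFinP; exact: measurable_funX.
- move=> w _; rewrite lee_fin -(ger0_norm (even_expr_ge0 q (Y w))).
  by rewrite -(ger0_norm (even_expr_ge0 q (Z w))) !normrX lerXn2r ?nnegrE.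
Qed.

Lemma all_moments_cst (c : R) : all_moments (fun=> c).
Proof.
split=> [|q]; first exact: measurable_cst.
by rewrite integral_cst// [X in (_ * X)%E]probability_setT mule1 ltry.
Qed.

Lemma all_momentsD (Y Z : T -> R) : all_moments Y -> all_moments Z ->
  all_moments (fun w => Y w + Z w).
Proof.
move=> [mY hY] [mZ hZ]; split=> [|q]; first exact: measurable_funD.
apply: (@le_lt_trans _ _
  (\int[P]_w ((4 ^+ q)%:E * ((Y w ^+ q.*2)%:E + (Z w ^+ q.*2)%:E))))%E.
  apply: ge0_le_integral => //.
  - by move=> w _; rewrite lee_fin even_expr_ge0.
  - by apply/measurable_EFinP; apply: measurable_funX; exact: measurable_funD.
  - apply: emeasurable_funM => //; apply: emeasurable_funD;
    by apply/measurable_EFinP; exact: measurable_funX.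
  - by move=> w _; rewrite -EFinD -EFinM lee_fin even_powD_le.
have mp (X : T -> R) : measurable_fun setT X ->
    measurable_fun setT (fun w => (X w ^+ q.*2)%:E).
  by move=> mX; apply/measurable_EFinP; exact: measurable_funX.
rewrite ge0_integralZl ?lee_fin ?exprn_ge0//; last 2 first.
- by apply: emeasurable_funD; exact: mp.
- by move=> w _; rewrite adde_ge0 ?lee_fin ?even_expr_ge0.
rewrite ge0_integralD ?lee_fin//; try exact: mp;
  try by move=> w _; rewrite lee_fin even_expr_ge0.
apply: lte_mul_pinfty; rewrite ?lee_fin ?exprn_ge0//.
exact: lte_add_pinfty.
Qed.

Lemma all_momentsM (Y Z : T -> R) : all_moments Y -> all_moments Z ->
  all_moments (fun w => Y w * Z w).
Proof.
move=> [mY hY] [mZ hZ]; split=> [|q]; first exact: measurable_funM.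
have mp r (X : T -> R) : measurable_fun setT X ->
    measurable_fun setT (fun w => (X w ^+ r.*2)%:E).
  by move=> mX; apply/measurable_EFinP; exact: measurable_funX.
apply: (@le_lt_trans _ _ (\int[P]_w ((Y w ^+ q.*2.*2)%:E + (Z w ^+ q.*2.*2)%:E)))%E.
  apply: ge0_le_integral => //.
  - by move=> w _; rewrite lee_fin even_expr_ge0.
  - by apply/measurable_EFinP; apply: measurable_funX; exact: measurable_funM.
  - by apply: emeasurable_funD; exact: mp.
  - move=> w _; rewrite -EFinD lee_fin exprMn.
    rewrite -[q.*2.*2]muln2 !exprM;
    set a := (Y w ^+ 2) ^+ q; set b := (Z w ^+ 2) ^+ q; have := sqr_ge0 (a - b); nra.
rewrite ge0_integralD ?lee_fin//; try exact: mp;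
  try by move=> w _; rewrite lee_fin even_expr_ge0.
exact: lte_add_pinfty.
Qed.

Lemma all_momentsZ (c : R) (Y : T -> R) : all_moments Y ->
  all_moments (fun w => c * Y w).
Proof. by move=> hY; apply: all_momentsM => //; exact: all_moments_cst. Qed.

Lemma all_momentsN (Y : T -> R) : all_moments Y -> all_moments (fun w => - Y w).
Proof.
by move=> hY; apply: (all_moments_dom hY) => [|w];
  [exact: measurableT_comp hY.1|rewrite normrN].
Qed.

Lemma all_momentsB (Y Z : T -> R) : all_moments Y -> all_moments Z ->
  all_moments (fun w => Y w - Z w).
Proof. by move=> hY hZ; apply: all_momentsD => //; exact: all_momentsN. Qed.

Lemma all_momentsX (k : nat) (Y : T -> R) : all_moments Y ->
  all_moments (fun w => Y w ^+ k).
Proof.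
move=> hY; elim: k => [|k IH]; first exact: all_moments_cst.
by under eq_fun do rewrite exprS; exact: all_momentsM.
Qed.

Lemma all_moments_sum (I : Type) (s : seq I) (Q : pred I) (Y : I -> T -> R) :
  (forall i, Q i -> all_moments (Y i)) ->
  all_moments (fun w => \sum_(i <- s | Q i) Y i w).
Proof.
move=> hY; elim: s => [|i s IH].
  by under eq_fun do rewrite big_nil; exact: all_moments_cst.
under eq_fun do rewrite big_cons.
by have [Qi|_] := boolP (Q i); [apply: all_momentsD => //; exact: hY|].
Qed.

Lemma all_moments_integrable (Y : T -> R) : all_moments Y ->
  P.-integrable setT (EFin \o Y).
Proof.
move=> hY; have [mY _] := hY; apply/integrableP; split; first exact/measurable_EFinP.
apply: (@le_lt_trans _ _ (\int[P]_w ((1 + Y w ^+ 2) ^+ 2)%:E))%E; last first.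
  have [_ /(_ 1%N)] : all_moments (fun w => 1 + Y w ^+ 2).
    by apply: all_momentsD; [exact: all_moments_cst|exact: all_momentsX].
  by [].
apply: ge0_le_integral => //.
- by apply: measurableT_comp => //; exact/measurable_EFinP.
- apply/measurable_EFinP; apply: measurable_funX; apply: measurable_funD => //.
  exact: measurable_funX.
- move=> w _; rewrite /= lee_fin -[Y w ^+ 2]real_normK ?num_real//.
  have := normr_ge0 (Y w); move: `|Y w| => y; nra.
Qed.

Lemma meanD (Y Z : T -> R) : all_moments Y -> all_moments Z ->
  E (fun w => Y w + Z w) = E Y + E Z.
Proof. by move=> hY hZ; rewrite RintegralD//; exact: all_moments_integrable. Qed.

Lemma meanZ (c : R) (Y : T -> R) : all_moments Y -> E (fun w => c * Y w) = c * E Y.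
Proof. by move=> hY; rewrite RintegralZl//; exact: all_moments_integrable. Qed.

Lemma meanB (Y Z : T -> R) : all_moments Y -> all_moments Z ->
  E (fun w => Y w - Z w) = E Y - E Z.
Proof. by move=> hY hZ; rewrite RintegralB//; exact: all_moments_integrable. Qed.

Lemma mean_cst (c : R) : E (fun=> c) = c.
Proof. by rewrite Rintegral_cst// [X in fine X]probability_setT/= mulr1. Qed.

Lemma mean_sum (I : Type) (s : seq I) (Q : pred I) (Y : I -> T -> R) :
  (forall i, Q i -> all_moments (Y i)) ->
  E (fun w => \sum_(i <- s | Q i) Y i w) = \sum_(i <- s | Q i) E (Y i).
Proof.
move=> hY; elim: s => [|i s IH].
  by under eq_Rintegral do rewrite big_nil; rewrite big_nil mean_cst.
under eq_Rintegral do rewrite big_cons; rewrite big_cons.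
have [Qi|_] := boolP (Q i); last exact: IH.
by rewrite -IH meanD//; [exact: hY|exact: all_moments_sum].
Qed.

Lemma mean_le (Y Z : T -> R) : all_moments Y -> all_moments Z ->
  (forall w, Y w <= Z w) -> E Y <= E Z.
Proof.
move=> hY hZ YZ; apply: le_Rintegral => //; try exact: all_moments_integrable.
Qed.

(** Integrates a pointwise bound by a linear combination, with coefficients of any sign, in one go.
    The one-step estimates below have up to nine terms. *)
Lemma mean_le_comb (s : seq (R * (T -> R))) (Y : T -> R) : all_moments Y ->
  foldr (fun p Q => all_moments p.2 /\ Q) True s ->
  (forall w, Y w <= foldr (fun p acc => p.1 * p.2 w + acc) 0 s) ->
  E Y <= foldr (fun p acc => p.1 * E p.2 + acc) 0 s.
Proof.
move=> hY hs h.
have [hf ->] : all_moments (fun w => foldr (fun p acc => p.1 * p.2 w + acc) 0 s) /\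
    foldr (fun p acc => p.1 * E p.2 + acc) 0 s =
    E (fun w => foldr (fun p acc => p.1 * p.2 w + acc) 0 s).
  elim: s hs {h} => [_|p s IH [hp /IH[hf Ef]]] /=.
    by split; [exact: all_moments_cst|rewrite mean_cst].
  have hpZ := all_momentsZ p.1 hp.
  by split; [exact: all_momentsD|rewrite meanD// meanZ// Ef].
exact: mean_le.
Qed.

Lemma mean_ge0 (Y : T -> R) : (forall w, 0 <= Y w) -> 0 <= E Y.
Proof. by move=> Y0; apply: Rintegral_ge0. Qed.

Lemma meanE (Y : T -> R) : all_moments Y -> (\int[P]_w (Y w)%:E = (E Y)%:E)%E.
Proof.
move=> hY; rewrite /Rintegral fineK//; apply: integrable_fin_num => //.
exact: all_moments_integrable.
Qed.

(** Both factors are split into positive and negative parts, which are functions of U and of V, so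
    that the nonnegative case applies to each of the four products. *)
Lemma mean_indep (G H : set (set T)) (U V : T -> R) :
  independent P G H -> rv_measurable G U -> rv_measurable H V ->
  all_moments U -> all_moments V ->
  E (fun w => U w * V w) = E U * E V.
Proof.
move=> GH GU HV hU hV.
pose pos (x : R) := Num.max x 0; pose neg (x : R) := Num.max (- x) 0.
have mpos : measurable_fun setT pos by apply: measurable_maxr.
have mneg : measurable_fun setT neg.
  by apply: measurable_maxr => //; exact: measurableT_comp.
have pos0 x : 0 <= pos x by rewrite le_max lexx orbT.
have neg0 x : 0 <= neg x by rewrite le_max lexx orbT.
have posB x : x = pos x - neg x.
  by rewrite /pos /neg; case: (leP x 0) => x0; case: (leP (- x) 0) => x1; lra.
have posle x : `|pos x| <= `|x|.
  by rewrite ger0_norm// /pos; case: (leP x 0) => // x0; exact: ler_norm.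
have negle x : `|neg x| <= `|x|.
  rewrite ger0_norm// /neg; case: (leP (- x) 0) => // x0.
  by rewrite -normrN; exact: ler_norm.
have hc (h : R -> R) (X : T -> R) : measurable_fun setT h ->
    (forall x, `|h x| <= `|x|) -> all_moments X -> all_moments (h \o X).
  move=> mh hle hX; apply: (all_moments_dom hX) => [|w]; last exact: hle.
  exact: measurableT_comp mh hX.1.
have ind A B : measurable A -> measurable B ->
    P (U @^-1` A `&` V @^-1` B) = (P (U @^-1` A) * P (V @^-1` B))%E.
  move=> mA mB; apply: GH.
    by apply: GU; exists A => //; rewrite setTI.
  by apply: HV; exists B => //; rewrite setTI.
have key (f g : R -> R) : measurable_fun setT f -> measurable_fun setT g ->
    (forall x, 0 <= f x) -> (forall x, 0 <= g x) ->
    (forall x, `|f x| <= `|x|) -> (forall x, `|g x| <= `|x|) ->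
    E (fun w => f (U w) * g (V w)) = E (f \o U) * E (g \o V).
  move=> mf mg f0 g0 fl gl; apply: EFin_inj; rewrite EFinM.
  have hfU := hc f U mf fl hU; have hgV := hc g V mg gl hV.
  rewrite -!meanE//; last exact: all_momentsM hfU hgV.
  exact: ge0_integral_indep hU.1 hV.1 mf mg f0 g0 ind.
have hpU := hc pos U mpos posle hU; have hpV := hc pos V mpos posle hV.
have hnU := hc neg U mneg negle hU; have hnV := hc neg V mneg negle hV.
have EB (X : T -> R) : all_moments (pos \o X) -> all_moments (neg \o X) ->
    E X = E (pos \o X) - E (neg \o X).
  by move=> ? ?; rewrite -meanB//; apply: eq_Rintegral => w _; exact: posB.
rewrite (EB U)// (EB V)//.
transitivity (E (fun w => (pos (U w) * pos (V w) - pos (U w) * neg (V w)) -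
    (neg (U w) * pos (V w) - neg (U w) * neg (V w)))).
  by apply: eq_Rintegral => w _; rewrite {1}(posB (U w)) {1}(posB (V w)); ring.
have M := all_momentsM.
rewrite meanB; last 2 first.
- by apply: all_momentsB; [exact: M hpU hpV|exact: M hpU hnV].
- by apply: all_momentsB; [exact: M hnU hpV|exact: M hnU hnV].
rewrite !meanB; try exact: M hpU hpV; try exact: M hpU hnV;
  try exact: M hnU hpV; try exact: M hnU hnV.
by rewrite !key//; ring.
Qed.

End IndependentProduct.

(** * Measurability through continuous functions and sub-sigma-algebras *)

Section MeasurableComposition.
Context {R : realType}.

(** The vector is known to be measurable only coordinate by coordinate. Since f is continuous, the
    preimage of an open interval is open in R x R^n, hence a countable union of rational boxes, and
    a box is a condition on finitely many coordinates. *)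
Lemma measurable_fun_vector {d : measure_display} {T : measurableType d} {n : nat}
  (f : R * 'rV[R]_n -> R) (t : T -> R) (x : T -> 'rV[R]_n) :
  continuous f -> measurable_fun setT t ->
  (forall i, measurable_fun setT (fun w => x w 0 i)) ->
  measurable_fun setT (fun w => f (t w, x w)).
Proof.
move=> cf mt mx; apply: (measurability _ (RGenOpens.measurableE R)).
move=> _ [_ [a [b ->]] <-]; rewrite setTI; set U : set R := `]a, b[%classic.
pose O : set (R * 'rV[R]_n) := f @^-1` U.
have oO : open O by apply: open_comp => [z _|]; [exact: cf|exact: interval_open].
(* A box is given by a rational centre in time and space and a natural number k; its half-width is
   1/(k + 1). *)
pose box (c : rat * 'rV[rat]_n * nat) : set (R * 'rV[R]_n) :=
  [set z : R * 'rV[R]_n | `|ratr c.1.1 - z.1| < c.2.+1%:R^-1 /\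
           forall i, `|ratr (c.1.2 0 i) - z.2 0 i| < c.2.+1%:R^-1].
have boxP z : O z -> exists2 c, box c z & box c `<=` O.
  move=> Oz; have /nbhs_ballP[e e0 eO] : nbhs z O by rewrite nbhsE; exists O.
  have e20 : 0 < e / 2 by rewrite divr_gt0.
  have [k _ hk] : exists2 k : nat, True & k.+1%:R^-1 < e / 2.
    have := near_infty_natSinv_lt (PosNum e20); case=> k _ hk; exists k => //.
    exact: (hk k (leqnn k)).
  have k0 : 0 < k.+1%:R^-1 :> R by rewrite invr_gt0.
  have approx (y : R) : exists q : rat, `|ratr q - y| < k.+1%:R^-1.
    have /rat_in_itvoo[q] : y < y + k.+1%:R^-1 by rewrite ltrDl.
    rewrite in_itv/= => /andP[h1 h2]; exists q.
    by rewrite ger0_norm ?ltrBlDl// subr_ge0 ltW.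
  have [q0 hq0] := approx z.1.
  have [q hq] := choice (fun i => approx (z.2 0 i)).
  exists (q0, \row_i q i, k); first by split => //= i; rewrite mxE.
  move=> y /= [hy1 hy2]; apply: eO; split => /=.
    rewrite /ball/= -[z.1 - _](subrKA (ratr q0)).
    apply: le_lt_trans (ler_normD _ _) _; rewrite distrC.
    by rewrite [ltRHS](splitr e); apply: ltrD; [exact: lt_trans hq0 hk|exact: lt_trans hy1 hk].
  split => // i0 j0; rewrite (ord1 i0).
    have hy : `|ratr (q j0) - y.2 0 j0| < k.+1%:R^-1 by have := hy2 j0; rewrite /= mxE.
    have := hq j0 => hz.
    rewrite /ball/= -[z.2 0 j0 - _](subrKA (ratr (q j0))).
    apply: le_lt_trans (ler_normD _ _) _; rewrite distrC.
    by rewrite [ltRHS](splitr e); apply: ltrD; [exact: lt_trans hz hk|exact: lt_trans hy hk].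
(* The union runs over codes of boxes; codes of nothing and boxes that leave O contribute the empty
   set. *)
have -> : (fun w => f (t w, x w)) @^-1` U =
    \bigcup_k (if unpickle k is Some c then
      if `[< box c `<=` O >] then [set w | box c (t w, x w)] else set0 else set0).
  apply/seteqP; split => [w Ow|w [k _]].
    have [c bc cO] := boxP (t w, x w) Ow; exists (pickle c); first exact: I.
    by rewrite pickleK; case: asboolP => [_|/(_ cO)[]]; exact: bc.
  case: (unpickle k) => [c|[]]; case: asboolP => [cO /= bc|_ []].
  exact: (cO _ bc).
apply: bigcupT_measurable => k; case: (unpickle k) => [c|]; last exact: measurable0.
case: asboolP => _; last exact: measurable0.
pose A i := [set w | `|ratr (c.1.2 0 i) - x w 0 i| < c.2.+1%:R^-1].
have mlt (y : T -> R) (q : R) : measurable_fun setT y ->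
    measurable [set w | `|q - y w| < c.2.+1%:R^-1].
  move=> my; rewrite -[X in measurable X]setTI.
  have mg : measurable_fun setT (fun w => `|q - y w|).
    by apply: measurableT_comp => //; exact: measurable_funB.
  have := mg measurableT `]-oo, c.2.+1%:R^-1[%classic (measurable_itv _).
  by rewrite (_ : _ `&` _ @^-1` _ = setT `&` [set w | `|q - y w| < c.2.+1%:R^-1]).
have -> : [set w | box c (t w, x w)] =
    [set w | `|ratr c.1.1 - t w| < c.2.+1%:R^-1] `&` \bigcap_(i in [set: 'I_n]) A i.
  apply/seteqP; split => w /= [h1 h2]; split => //.
    by move=> i _; exact: (h2 i).
  by move=> i; exact: (h2 i I).
apply: measurableI; first exact: mlt.
by apply: fin_bigcap_measurable => // i _; exact: mlt.
Qed.

End MeasurableComposition.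

Lemma rv_measurableS {R : realType} {d : measure_display} {T : measurableType d}
  (G H : set (set T)) (Y : T -> R) :
  G `<=` H -> rv_measurable G Y -> rv_measurable H Y.
Proof. by move=> GH GY; exact: subset_trans GY GH. Qed.

Section SubSigmaAlgebraTheory.
Context {R : realType} {d : measure_display} {T : measurableType d}.
Variable G : set (set T).
Hypothesis sG : sigma_algebra setT G.
Implicit Types (Y Z : T -> R).

(** Regarding G as the measurable structure of T transfers the closure properties of measurable
    functions to [rv_measurable G]. *)
Lemma rv_measurableP Y :
  rv_measurable G Y <-> measurable_fun [set: g_sigma_algebraType G] (Y : g_sigma_algebraType G -> R).
Proof.
have GE : @measurable _ (g_sigma_algebraType G) = G by exact: sigma_algebra_id.
split=> [GY _ B mB|mY _ [B mB <-]]; last by rewrite -GE; exact: mY.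
by rewrite GE; apply: GY; exists B.
Qed.

Lemma rv_measurable_cst (c : R) : rv_measurable G (fun _ : T => c).
Proof. by apply/rv_measurableP; exact: measurable_cst. Qed.

Lemma rv_measurableD Y Z : rv_measurable G Y -> rv_measurable G Z ->
  rv_measurable G (fun w => Y w + Z w).
Proof. by rewrite !rv_measurableP; exact: measurable_funD. Qed.

Lemma rv_measurableM Y Z : rv_measurable G Y -> rv_measurable G Z ->
  rv_measurable G (fun w => Y w * Z w).
Proof. by rewrite !rv_measurableP; exact: measurable_funM. Qed.

Lemma rv_measurableB Y Z : rv_measurable G Y -> rv_measurable G Z ->
  rv_measurable G (fun w => Y w - Z w).
Proof. by rewrite !rv_measurableP; exact: measurable_funB. Qed.

Lemma rv_measurableX k Y : rv_measurable G Y -> rv_measurable G (fun w => Y w ^+ k).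
Proof. by rewrite !rv_measurableP; exact: measurable_funX. Qed.

Lemma rv_measurable_sum (I : Type) (s : seq I) (Q : pred I) (Y : I -> T -> R) :
  (forall i, Q i -> rv_measurable G (Y i)) ->
  rv_measurable G (fun w => \sum_(i <- s | Q i) Y i w).
Proof.
move=> hY; elim: s => [|i s IH].
  by under eq_fun do rewrite big_nil; exact: rv_measurable_cst.
under eq_fun do rewrite big_cons.
by have [Qi|_] := boolP (Q i); [apply: rv_measurableD => //; exact: hY|].
Qed.

Lemma rv_measurable_vector n (f : R * 'rV[R]_n -> R) (t : R) (x : T -> 'rV[R]_n) :
  continuous f -> (forall i, rv_measurable G (fun w => x w 0 i)) ->
  rv_measurable G (fun w => f (t, x w)).
Proof.
move=> cf hx; apply/rv_measurableP.
apply: (measurable_fun_vector (T := g_sigma_algebraType G) (t := fun=> t) cf) => // i.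
by have /rv_measurableP := hx i.
Qed.

Lemma rv_measurable_fun Y : G `<=` measurable -> rv_measurable G Y ->
  measurable_fun setT Y.
Proof. by move=> Gm GY _ B mB; apply: Gm; apply: GY; exists B. Qed.

End SubSigmaAlgebraTheory.

(** * Moments of a normal variable *)

Section NormalIncrement.
Context {R : realType} {d : measure_display} {T : measurableType d}.
Variables (P : probability T R) (xi : T -> R) (s : R).
Hypotheses (mxi : measurable_fun setT xi) (s0 : 0 < s).
Hypothesis xi_normal : forall B : set (measurableTypeR R), measurable B ->
  P (xi @^-1` B) = normal_prob 0 s B.
Local Notation E f := (Rintegral P setT f).

Lemma ge0_integral_normal_rv (f : R -> R) :
  measurable_fun setT f -> (forall x, 0 <= f x) ->
  (\int[P]_w (f (xi w))%:E = \int[lebesgue_measure]_x (f x * normal_pdf 0 s x)%:E)%E.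
Proof.
move=> mf f0.
pose X : {mfun T >-> measurableTypeR R} := HB.pack_for {mfun T >-> measurableTypeR R}
  (xi : T -> measurableTypeR R) (isMeasurableFun.Build _ _ T (measurableTypeR R) xi mxi).
have mfE : measurable_fun setT (EFin \o f) by exact/measurable_EFinP.
transitivity (\int[distribution P X]_x (f x)%:E)%E.
  by rewrite (ge0_integral_distribution X)// => x; rewrite lee_fin.
transitivity (\int[normal_prob 0 s]_x (f x)%:E)%E.
  by apply: eq_measure_integral => A mA _; exact: xi_normal.
by rewrite ge0_integral_normal_prob// => x; rewrite lee_fin.
Qed.

Lemma normal_even_moment q :
  (\int[P]_w (xi w ^+ q.*2)%:E = (gauss_moment q * s ^+ q.*2)%:E)%E.
Proof.
rewrite (ge0_integral_normal_rv (f := fun x => x ^+ q.*2))//; last exact: even_expr_ge0.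
rewrite -normal_prob_even_moment// ge0_integral_normal_prob//.
  by apply/measurable_EFinP; exact: exprn_measurable.
by move=> x; rewrite lee_fin even_expr_ge0.
Qed.

Lemma all_moments_normal : all_moments P xi.
Proof. by split => // q; rewrite normal_even_moment ltry. Qed.

Lemma mean_normal_even q : E (fun w => xi w ^+ q.*2) = gauss_moment q * s ^+ q.*2.
Proof. by rewrite /Rintegral normal_even_moment. Qed.

(** An odd power is f(x) - f(-x) with f the power of the positive part; both terms have the same
    mean because the density is even. *)
Lemma mean_normal_odd q : E (fun w => xi w ^+ q.*2.+1) = 0.
Proof.
pose pos (x : R) := Num.max x 0.
have mpos : measurable_fun setT pos by apply: measurable_maxr.
have pos0 x : 0 <= pos x by rewrite le_max lexx orbT.
pose f x := pos x ^+ q.*2.+1.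
have mf : measurable_fun setT f by exact: measurable_funX.
have mf' : measurable_fun setT (fun x : R => f (- x)) by exact: measurableT_comp.
have f0 x : 0 <= f x by rewrite exprn_ge0.
have hxi := all_moments_normal.
have hf : all_moments P (f \o xi).
  apply: (all_moments_dom (Z := fun w => xi w ^+ q.*2.+1)).
  - exact: all_momentsX.
  - exact: measurableT_comp mf mxi.
  - move=> w; rewrite !normrX lerXn2r ?nnegrE// ger0_norm ?pos0//.
    by rewrite ge_max ler_norm normr_ge0.
have hf' : all_moments P (fun w => f (- xi w)).
  apply: (all_moments_dom (Z := fun w => xi w ^+ q.*2.+1)).
  - exact: all_momentsX.
  - exact: measurableT_comp mf' mxi.
  - move=> w; rewrite !normrX lerXn2r ?nnegrE// ger0_norm ?pos0//.
    by rewrite -(normrN (xi w)) ge_max ler_norm normr_ge0.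
have xE w : xi w ^+ q.*2.+1 = f (xi w) - f (- xi w).
  rewrite /f /pos; have [x0|x0] := leP (xi w) 0; have [x1|x1] := leP (- xi w) 0.
  - by have -> : xi w = 0 by [lra]; rewrite subrr expr0n.
  - by rewrite expr0n/= sub0r exprNn -signr_odd/= odd_double/= expr1 mulN1r opprK.
  - by rewrite [X in _ - X]expr0n/= subr0.
  - lra.
transitivity (E (fun w => f (xi w) - f (- xi w))).
  by apply: eq_Rintegral => w _; exact: xE.
rewrite meanB//; apply/eqP; rewrite subr_eq0; apply/eqP.
rewrite /Rintegral; congr fine.
rewrite (ge0_integral_normal_rv mf)//.
rewrite (ge0_integral_normal_rv mf')//.
rewrite -ge0_integral_oppT; last 2 first.
- apply/measurable_EFinP; apply: measurable_funM => //; exact: measurable_normal_pdf.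
- by move=> x; rewrite lee_fin mulr_ge0 ?normal_pdf_ge0.
apply: eq_integral => x _; congr (_ * _)%:E.
by rewrite !normal_pdfE ?gt_eqF// /normal_fun !subr0 sqrrN.
Qed.

End NormalIncrement.

Arguments rv_measurableS {R d T G H Y}.
Arguments rv_measurable_cst {R d T G} sG c.
Arguments rv_measurableD {R d T G} sG {Y Z}.
Arguments rv_measurableM {R d T G} sG {Y Z}.
Arguments rv_measurableB {R d T G} sG {Y Z}.
Arguments rv_measurableX {R d T G} sG k {Y}.
Arguments rv_measurable_sum {R d T G} sG {I s Q Y}.
Arguments rv_measurable_vector {R d T G} sG {n f} t {x}.

(** * Smooth functions of polynomial growth *)

Section DirectionalDerivatives.
Context {R : realType} {E : normedModType R}.
Implicit Types (f g : E -> R) (x y z u v w : E).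

Lemma is_derive_line f z v (s : R) : derivable f (z + s *: v) v ->
  is_derive s 1 (fun s : R => f (z + s *: v)) ('D_v f (z + s *: v)).
Proof.
move=> df.
have e : (fun h : R => h^-1 *: (((fun s : R => f (z + s *: v)) \o shift s) (h *: 1) - f (z + s *: v)))
   = (fun h : R => h^-1 *: ((f \o shift (z + s *: v)) (h *: v) - f (z + s *: v))).
  apply/funext => h /=; congr (_ *: (f _ - _)).
  by rewrite [h%:A]mulr1 scalerDl addrCA.
split; first by rewrite /derivable e.
by rewrite /derive e.
Qed.

Lemma line_continuous f z v : continuous f -> continuous (fun s : R => f (z + s *: v)).
Proof.
move=> cf s; apply: (@continuous_comp _ _ _ (fun s : R => z + s *: v) f); last exact: cf.
by apply: cvgD; [exact: cvg_cst|apply: cvgZr_tmp; exact: cvg_id].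
Qed.

Lemma MVT_line f z v : (forall x, derivable f x v) -> continuous f ->
  exists2 s : R, 0 <= s <= 1 & f (z + v) - f z = 'D_v f (z + s *: v).
Proof.
move=> df cf.
have [|s /[!in_itv]/= s01] := @MVT_segment R (fun s : R => f (z + s *: v))
    (fun s : R => 'D_v f (z + s *: v)) 0 1 ler01 (fun s _ => is_derive_line (df _)).
  by apply: continuous_subspaceT; exact: line_continuous.
by rewrite scale1r scale0r addr0 subr0 mulr1 => e; exists s.
Qed.

Lemma derive_dirZ f v (c : R) z : (forall u x, derivable f x u) ->
  'D_(c *: v) f z = c * 'D_v f z.
Proof.
move=> df.
have h1 := @is_derive_line f z (c *: v) 0 (df _ _).
have h2 := @is_derive_line f z v (c * 0) (df _ _).
have h3 : is_derive (0 : R) 1 ( *%R c : R -> R) c.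
  have := is_deriveM (is_derive_cst c (0 : R) 1) (is_derive_id (0 : R) 1).
  by rewrite scaler0 addr0 /GRing.scale/= mulr1.
have h4 := is_derive1_comp h2 h3.
have e : (fun s : R => f (z + s *: v)) \o *%R c = (fun s : R => f (z + s *: (c *: v))).
  by apply/funext => s /=; rewrite scalerA mulrC.
move: h4; rewrite e => h4.
have := @derive_val _ _ _ _ _ _ _ h1; rewrite (@derive_val _ _ _ _ _ _ _ h4).
by rewrite mulr0 !scale0r !addr0 mulrC.
Qed.

(** The increment along v + w is made in two legs. The first gives D_v f; on the second the mean
    value theorem produces D_w f at a nearby point, and continuity of D_w f concludes. *)
Lemma derive_dirD f v w z : (forall u x, derivable f x u) -> continuous f ->
  continuous (fun x => 'D_w f x) -> 'D_(v + w) f z = 'D_v f z + 'D_w f z.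
Proof.
move=> df cf cw; apply: cvg_lim => //=.
pose q (h : R) := h^-1 *: (f (z + h *: v + h *: w) - f (z + h *: v)).
have -> : (fun h : R => h^-1 *: (f (h *: (v + w) + z) - f z)) =
    (fun h => h^-1 *: (f (h *: v + z) - f z)) \+ q.
  apply/funext => h /=; rewrite /q -scalerDr; congr (_ *: _).
  have -> : h *: (v + w) + z = z + h *: v + h *: w by rewrite scalerDr addrC addrA.
  by rewrite [h *: v + z]addrC; ring.
apply: cvgD; first exact: df.
apply/cvgrPdist_lt => e e0.
have := cw z => /cvgrPdist_lt /(_ e e0) /nbhs_ballP[dl /= dl0 hdl].
near=> h.
have h0 : h != 0 by near: h; exact: nbhs_dnbhs_neq.
have [s /andP[s0 s1] mvt] := @MVT_line f (z + h *: v) (h *: w) (fun x => df _ x) cf.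
have -> : q h = 'D_w f (z + h *: v + s *: (h *: w)).
  by rewrite /q mvt derive_dirZ// /GRing.scale/= mulKf.
apply: hdl; rewrite -ball_normE /ball_ /mkset.
rewrite -addrA opprD addNKr normrN scalerA [s * h]mulrC -scalerA -scalerDr normrZ.
have hs : `|h| * (`|v| + `|w| + 1) < dl.
  rewrite -ltr_pdivlMr; last by rewrite ltr_wpDl ?addr_ge0.
  near: h; apply: dnbhs0_lt; rewrite divr_gt0// ltr_wpDl ?addr_ge0//.
apply: le_lt_trans hs; rewrite ler_wpM2l//.
apply: le_trans (ler_normD _ _) _; rewrite -addrA lerD2l normrZ ger0_norm//.
by apply: le_trans (_ : `|w| <= _); [rewrite ler_piMl|rewrite lerDl].
Unshelve. all: by end_near. Qed.

Lemma derive_dir_sum (I : Type) (s : seq I) (c : I -> R) (v : I -> E) f z :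
  (forall u x, derivable f x u) -> continuous f ->
  (forall u, continuous (fun x => 'D_u f x)) ->
  'D_(\sum_(i <- s) c i *: v i) f z = \sum_(i <- s) c i * 'D_(v i) f z.
Proof.
move=> df cf cD; elim: s => [|i s IH].
  by rewrite !big_nil -[X in 'D_X f z](scale0r (0 : E)) derive_dirZ// mul0r.
by rewrite !big_cons addrC derive_dirD// derive_dirZ// IH addrC.
Qed.

Lemma derive_lin_sum (I : Type) (s : seq I) (c : I -> R) (g : I -> E -> R) v z :
  (forall i x, derivable (g i) x v) ->
  'D_v (fun x => \sum_(i <- s) c i * g i x) z = \sum_(i <- s) c i * 'D_v (g i) z.
Proof.
move=> dg.
suff : is_derive z v (fun x => \sum_(i <- s) c i * g i x) (\sum_(i <- s) c i * 'D_v (g i) z).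
  by move=> h; rewrite derive_val.
elim: s => [|i s IH].
  under eq_fun do rewrite big_nil; rewrite big_nil; exact: is_derive_cst.
under eq_fun do rewrite big_cons; rewrite big_cons.
apply: is_deriveD; apply: is_deriveZ; exact: derivableP.
Qed.

(** Used once per Taylor order: a bound on the last derivative along the segment passes to each
    lower remainder with the same C, the factorials being given up. *)
Lemma increment_bound (phi dphi : R -> R) (C : R) :
  (forall s : R, is_derive s 1 phi (dphi s)) -> phi 0 = 0 ->
  (forall s, 0 <= s <= 1 -> `|dphi s| <= C) ->
  forall s, 0 <= s <= 1 -> `|phi s| <= C.
Proof.
move=> dp p0 bd s /andP[s0 s1].
have [|c /[!in_itv]/= /andP[c0 cs]] := @MVT_segment R phi dphi 0 s s0 (fun (r : R) _ => dp r).
  apply: continuous_subspaceT => x; apply/differentiable_continuous/derivable1_diffP.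
  exact: ex_derive.
rewrite p0 !subr0 => ->; rewrite normrM (ger0_norm s0).
have c1 : 0 <= c <= 1 by rewrite c0 (le_trans cs).
apply: le_trans (bd c c1).
by rewrite ler_piMr.
Qed.

Lemma taylor1 f z v (C : R) : (forall x, derivable f x v) -> continuous f ->
  (forall s : R, 0 <= s <= 1 -> `|'D_v f (z + s *: v)| <= C) ->
  `|f (z + v) - f z| <= C.
Proof. by move=> df cf h; have [s s01 ->] := MVT_line z df cf; exact: h. Qed.

Lemma taylor2 f z v (C : R) :
  (forall x, derivable f x v) -> (forall x, derivable (fun y => 'D_v f y) x v) ->
  (forall s : R, 0 <= s <= 1 -> `|'D_v (fun y => 'D_v f y) (z + s *: v)| <= C) ->
  `|f (z + v) - f z - 'D_v f z| <= C.
Proof.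
move=> df ddf h.
pose phi s := f (z + s *: v) - f z - s * 'D_v f z.
pose dphi s := 'D_v f (z + s *: v) - 'D_v f z.
have b1 := @increment_bound dphi (fun s => 'D_v (fun y => 'D_v f y) (z + s *: v)) C _ _ h.
have {}b1 : forall s, 0 <= s <= 1 -> `|dphi s| <= C.
  apply: b1 => [s|]; last by rewrite /dphi scale0r addr0 subrr.
  by rewrite -[X in is_derive _ _ _ X]subr0; apply: is_deriveB; exact: is_derive_line.
have := @increment_bound phi dphi C _ _ b1 1.
rewrite /phi scale1r mul1r ler01 lexx; apply => //; last by rewrite scale0r addr0 subrr mul0r subr0.
move=> s; apply: is_deriveB.
  by rewrite -[X in is_derive _ _ _ X]subr0; apply: is_deriveB; exact: is_derive_line.
have := is_deriveM (is_derive_id s 1) (is_derive_cst ('D_v f z) s 1).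
by rewrite scaler0 add0r /GRing.scale/= mulr1.
Qed.

Lemma taylor3 f z v (C : R) :
  let Df := fun y => 'D_v f y in let DDf := fun y => 'D_v Df y in
  (forall x, derivable f x v) -> (forall x, derivable Df x v) ->
  (forall x, derivable DDf x v) ->
  (forall s : R, 0 <= s <= 1 -> `|'D_v DDf (z + s *: v)| <= C) ->
  `|f (z + v) - f z - Df z - 2^-1 * DDf z| <= C.
Proof.
move=> Df DDf df ddf dddf h.
pose phi s := f (z + s *: v) - f z - s * Df z - 2^-1 * s ^+ 2 * DDf z.
pose dphi s := Df (z + s *: v) - Df z - s * DDf z.
have b0 : forall r : R, 0 <= r <= 1 -> `|DDf (z + r *: v) - DDf z| <= C.
  apply: (@increment_bound _ (fun s => 'D_v DDf (z + s *: v))) => [r||//].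
  - by rewrite -[X in is_derive _ _ _ X]subr0; apply: is_deriveB; exact: is_derive_line.
  - by rewrite scale0r addr0 subrr.
have b1 : forall r : R, 0 <= r <= 1 -> `|dphi r| <= C.
  apply: (@increment_bound dphi (fun r => DDf (z + r *: v) - DDf z)) => [r||//].
  - apply: is_deriveB.
      by rewrite -[X in is_derive _ _ _ X]subr0; apply: is_deriveB; exact: is_derive_line.
    have := is_deriveM (is_derive_id r 1) (is_derive_cst (DDf z) r 1).
    by rewrite scaler0 add0r /GRing.scale/= mulr1.
  - by rewrite /dphi scale0r addr0 subrr mul0r subr0.
have := @increment_bound phi dphi C _ _ b1 1.
rewrite /phi scale1r mul1r expr1n mulr1 ler01 lexx; apply => //; last first.
  by rewrite scale0r addr0 subrr mul0r expr0n mulr0 mul0r !subr0.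
move=> s; apply: is_deriveB.
  apply: is_deriveB.
    by rewrite -[X in is_derive _ _ _ X]subr0; apply: is_deriveB; exact: is_derive_line.
  have := is_deriveM (is_derive_id s 1) (is_derive_cst (Df z) s 1).
  by rewrite scaler0 add0r /GRing.scale/= mulr1.
have := is_deriveM (is_deriveM (is_derive_id s 1) (is_derive_id s 1)) (is_derive_cst (2^-1 * DDf z) s 1).
rewrite scaler0 add0r /GRing.scale/= => hh.
have e : (fun x : R => 2^-1 * x ^+ 2 * DDf z) = (id * id * cst (2^-1 * DDf z)).
  by apply/funext => x; rewrite !fctE; ring.
rewrite e; move: hh; rewrite (_ : _ * (_ + _) = s * DDf z)//.
by rewrite !mulr1; field.
Qed.

End DirectionalDerivatives.

Section VectorNorms.
Context {R : realType} {n : nat}.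
Implicit Types (x : 'rV[R]_n) (v w : R * 'rV[R]_n).

Lemma coord_norm_le x i : `|x 0 i| <= `|x|.
Proof. by rewrite [leRHS]mx_normrE; exact: (le_bigmax _ _ (ord0, i)). Qed.

Lemma norm_le_sum x : `|x| <= \sum_i `|x 0 i|.
Proof.
have [x0|x0] := eqVneq `|x| 0; first by rewrite x0 sumr_ge0.
have [[i j] ->] : exists i, `|x| = `|x i.1 i.2| := mx_norm_neq0 x0.
by rewrite (ord1 i) (bigD1 j)//= lerDl sumr_ge0.
Qed.

Lemma pair_normE v : `|v| = Num.max `|v.1| `|v.2|. Proof. by []. Qed.

Lemma pair_norm_le v : `|v| <= `|v.1| + `|v.2|.
Proof. by rewrite pair_normE ge_max lerDl normr_ge0 lerDr normr_ge0. Qed.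

Lemma norm_pair_norm v : `| `|v| | = `|v|.
Proof. by rewrite pair_normE ger0_norm// le_max normr_ge0. Qed.

Lemma pair_normD v w : `|v + w| <= `|v| + `|w|. Proof. exact: ler_normD. Qed.

Lemma pair_normZ (c : R) v : `|c *: v| = `|c| * `|v|.
Proof. by rewrite !pair_normE !normrZ maxr_pMr. Qed.

Definition basis_dir (o : option 'I_n) : R * 'rV[R]_n :=
  if o is Some j then (0, delta_mx 0 j) else (1, 0).

Definition coord_dir v (o : option 'I_n) : R :=
  if o is Some j then v.2 0 j else v.1.

Lemma coord_dir_le v o : `|coord_dir v o| <= `|v|.
Proof.
rewrite pair_normE; case: o => [j|] /=; rewrite le_max ?lexx//.
by rewrite coord_norm_le orbT.
Qed.

Lemma dir_sumE v : v = \sum_o coord_dir v o *: basis_dir o.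
Proof.
have -> : \sum_o coord_dir v o *: basis_dir o =
    (v.1, 0) + \sum_(j < n) v.2 0 j *: basis_dir (Some j).
  rewrite (bigD1 None)//=; congr (_ + _).
    by apply/pair_equal_spec; split; rewrite /= ?scaler0// /GRing.scale/= mulr1.
  by rewrite (reindex_omap Some id) /=; [apply: eq_bigl => j; rewrite eqxx|case].
case: v => s y /=; apply/pair_equal_spec; split => /=.
  rewrite (big_morph fst (id1 := 0) (op1 := +%R))// big1 ?addr0// => j _ /=.
  by rewrite scaler0.
rewrite (big_morph snd (id1 := 0) (op1 := +%R))// add0r.
by rewrite [LHS]row_sum_delta; apply: eq_bigr.
Qed.
End VectorNorms.

(* Bounds of the form C g^p rho^k, uniform over a parameter set [dom]: here [g]
   controls the size of the state and of the noise, [rho] is the square root of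
   the time step. *)
Section BigO.
Context {R : realType} {W : Type}.
Variables (dom : W -> Prop) (g rho : W -> R).
Hypothesis g1 : forall w, dom w -> 1 <= g w.
Hypothesis rho0 : forall w, dom w -> 0 <= rho w.
Hypothesis rho1 : forall w, dom w -> rho w <= 1.

Definition big_O (k : nat) (phi : W -> R) : Prop :=
  exists (C : R) (p : nat), 0 <= C /\
    forall w, dom w -> `|phi w| <= C * g w ^+ p * rho w ^+ k.

Lemma big_O_le k (phi psi : W -> R) :
  (forall w, dom w -> `|phi w| <= `|psi w|) -> big_O k psi -> big_O k phi.
Proof.
move=> h [C [p [C0 hC]]]; exists C, p; split => // w dw.
exact: le_trans (h w dw) (hC w dw).
Qed.

Lemma eq_big_O k (phi psi : W -> R) : (forall w, dom w -> phi w = psi w) ->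
  big_O k psi -> big_O k phi.
Proof. by move=> h; apply: big_O_le => w dw; rewrite h. Qed.

Lemma g_powM w (p q : nat) : dom w -> (p <= q)%N -> g w ^+ p <= g w ^+ q.
Proof. by move=> dw pq; apply: ler_weXn2l => //; exact: g1. Qed.

Lemma big_OW k l (phi : W -> R) : (l <= k)%N -> big_O k phi -> big_O l phi.
Proof.
move=> lk [C [p [C0 hC]]]; exists C, p; split => // w dw.
apply: le_trans (hC w dw) _; rewrite ler_wpM2l ?mulr_ge0 ?exprn_ge0//.
  exact: le_trans (g1 dw).
by apply: ler_wiXn2l => //; [exact: rho0|exact: rho1].
Qed.

Lemma big_OD k (phi psi : W -> R) : big_O k phi -> big_O k psi ->
  big_O k (fun w => phi w + psi w).
Proof.
move=> [C [p [C0 hC]]] [C' [p' [C'0 hC']]]; exists (C + C'), (maxn p p').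
split => [|w dw]; first exact: addr_ge0.
apply: le_trans (ler_normD _ _) _; rewrite !mulrDl; apply: lerD.
  apply: le_trans (hC w dw) _; rewrite ler_wpM2r ?exprn_ge0 ?rho0//.
  by rewrite ler_wpM2l// g_powM// leq_maxl.
apply: le_trans (hC' w dw) _; rewrite ler_wpM2r ?exprn_ge0 ?rho0//.
by rewrite ler_wpM2l// g_powM// leq_maxr.
Qed.

Lemma big_OM k l (phi psi : W -> R) : big_O k phi -> big_O l psi ->
  big_O (k + l) (fun w => phi w * psi w).
Proof.
move=> [C [p [C0 hC]]] [C' [p' [C'0 hC']]]; exists (C * C'), (p + p')%N.
split => [|w dw]; first exact: mulr_ge0.
rewrite normrM !exprD.
have -> : C * C' * (g w ^+ p * g w ^+ p') * (rho w ^+ k * rho w ^+ l) =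
  (C * g w ^+ p * rho w ^+ k) * (C' * g w ^+ p' * rho w ^+ l) by ring.
by apply: ler_pM => //; [exact: hC|exact: hC'].
Qed.

Lemma big_O_cst (c : R) : big_O 0 (fun=> c).
Proof. by exists `|c|, 0%N; split => // w dw; rewrite !expr0 !mulr1. Qed.

Lemma big_O0 k : big_O k (fun=> 0).
Proof. by exists 0, 0%N; split => // w dw; rewrite normr0 !mul0r. Qed.

Lemma big_O_rho : big_O 1 rho.
Proof. by exists 1, 0%N; split => // w dw; rewrite expr0 !mul1r expr1 ger0_norm ?rho0. Qed.

Lemma big_O_g : big_O 0 g.
Proof.
exists 1, 1%N; split => // w dw; rewrite expr0 mul1r mulr1 ger0_norm//.
exact: le_trans (g1 dw).
Qed.

Lemma big_OZ k (c : R) (phi : W -> R) : big_O k phi -> big_O k (fun w => c * phi w).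
Proof. by move=> h; apply: (@big_OM 0 k) => //; exact: big_O_cst. Qed.

Lemma big_ON k (phi : W -> R) : big_O k phi -> big_O k (fun w => - phi w).
Proof. by apply: big_O_le => w _; rewrite normrN. Qed.

Lemma big_OB k (phi psi : W -> R) : big_O k phi -> big_O k psi ->
  big_O k (fun w => phi w - psi w).
Proof. by move=> h1 h2; apply: big_OD => //; exact: big_ON. Qed.

Lemma big_OX k m (phi : W -> R) : big_O k phi -> big_O (k * m) (fun w => phi w ^+ m).
Proof.
move=> h; elim: m => [|m IH].
  by rewrite muln0; under eq_fun do rewrite expr0; exact: big_O_cst.
by rewrite mulnS; under eq_fun do rewrite exprS; exact: big_OM.
Qed.

Lemma big_O_sum k (I : Type) (s : seq I) (phi : I -> W -> R) :
  (forall i, big_O k (phi i)) -> big_O k (fun w => \sum_(i <- s) phi i w).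
Proof.
move=> h; elim: s => [|i s IH].
  by under eq_fun do rewrite big_nil; exact: big_O0.
by under eq_fun do rewrite big_cons; exact: big_OD.
Qed.

Lemma big_O_norm k (phi : W -> R) : big_O k phi -> big_O k (fun w => `|phi w|).
Proof. by apply: big_O_le => w _; rewrite normr_id. Qed.

End BigO.

(** * Growth of iterated derivatives and Taylor remainders *)

Section SmoothFunctions.
Context {R : realType} {n : nat}.
Local Notation E := (R * 'rV[R]_n)%type.
Implicit Types (f : E -> R) (z u v w : E).
Variables t0 tm : R.
Local Notation smooth := (fun N f => smooth N t0 tm f).

Lemma smoothW N f : smooth N.+1 f -> smooth N f.
Proof.
elim: N f => [|N IH] f [cf pf df]; split => //.
by move=> v; have [dfv sv] := df v; split => //; exact: IH.
Qed.

Lemma smooth_continuous N f : smooth N f -> continuous f.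
Proof. by case: N => [|N] []. Qed.

Lemma smooth_poly_growth N f : smooth N f -> poly_growth t0 tm f.
Proof. by case: N => [|N] []. Qed.

Lemma smooth_derivable N f : smooth N.+1 f -> forall u x, derivable f x u.
Proof. by move=> [_ _ df] u x; have [] := df u. Qed.

Lemma smooth_derive N f v : smooth N.+1 f -> smooth N (fun x => 'D_v f x).
Proof. by move=> [_ _ df]; have [] := df v. Qed.

Lemma smooth_leq M N f : (M <= N)%N -> smooth N f -> smooth M f.
Proof.
elim: N f => [|N IH] f; first by rewrite leqn0 => /eqP ->.
rewrite leq_eqVlt => /orP[/eqP -> //|]; rewrite ltnS => MN /smoothW; exact: IH.
Qed.

Lemma smooth_derive_sumE N f v : smooth N.+1 f ->
  (fun x => 'D_v f x) = (fun x => \sum_o coord_dir v o * 'D_(basis_dir o) f x).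
Proof.
move=> sf; apply/funext => x; rewrite {1}(dir_sumE v) derive_dir_sum//.
- exact: smooth_derivable sf.
- exact: smooth_continuous sf.
- by move=> u; apply: smooth_continuous (smooth_derive u sf).
Qed.

Fixpoint derive_seq (vs : seq E) f : E -> R :=
  if vs is v :: vs' then derive_seq vs' (fun x => 'D_v f x) else f.

Lemma derive_seq_sum vs (I : Type) (s : seq I) (c : I -> R) (F : I -> E -> R) x :
  (forall i, smooth (size vs) (F i)) ->
  derive_seq vs (fun x => \sum_(i <- s) c i * F i x) x =
  \sum_(i <- s) c i * derive_seq vs (F i) x.
Proof.
elim: vs F x => [|v vs IH] F x sF //=.
rewrite -IH => [|i]; last exact: smooth_derive (sF i).
congr (derive_seq vs _ x); apply/funext => y.
by rewrite derive_lin_sum// => i z; exact: smooth_derivable (sF i) _ _.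
Qed.

(** [smooth] provides constants for each fixed direction separately. Expanding every direction in
    the finite basis makes them uniform, with the product of the norms of the directions as a
    factor. *)
Lemma derive_seq_bound N f : smooth N f ->
  exists (K : R) (p : nat), 0 <= K /\
    forall (vs : seq E) t x, size vs = N -> t0 <= t <= tm ->
      `|derive_seq vs f (t, x)| <= K * (1 + `|x|) ^+ p * \prod_(v <- vs) `|v|.
Proof.
elim: N f => [|N IH] f sf.
  have [K [p hK]] := smooth_poly_growth sf.
  exists (`|K| * 2), p; split => [|[]// t x _ tI]; first by rewrite mulr_ge0.
  rewrite big_nil mulr1 /=; apply: le_trans (hK t x tI) _.
  apply: le_trans (ler_wpM2r _ (ler_norm K)) _; first by rewrite addr_ge0.
  rewrite -mulrA ler_wpM2l//.
  have x1 : 1 <= 1 + `|x| by rewrite lerDl.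
  have h1 : 1 <= (1 + `|x|) ^+ p by rewrite exprn_ege1.
  have h2 : `|x| ^+ p <= (1 + `|x|) ^+ p by rewrite lerXn2r ?nnegrE ?addr_ge0 ?lerDr.
  lra.
have /choice[K /choice[p hK]] : forall o : option 'I_n, exists (K : R) (p : nat), 0 <= K /\
    forall (vs : seq E) t x, size vs = N -> t0 <= t <= tm ->
      `|derive_seq vs (fun x => 'D_(basis_dir o) f x) (t, x)| <= K * (1 + `|x|) ^+ p * \prod_(v <- vs) `|v|.
  by move=> o; apply: IH; exact: smooth_derive sf.
exists (\sum_o K o), (\max_o p o); split => [|[//|v vs] t x [sz] tI].
  by apply: sumr_ge0 => o _; have [] := hK o.
rewrite /= (smooth_derive_sumE v sf) derive_seq_sum; last first.
  by move=> o; rewrite sz; exact: smooth_derive sf.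
apply: le_trans (ler_norm_sum _ _ _) _; rewrite !mulr_suml; apply: ler_sum => o _.
have [K0 /(_ vs t x sz tI) hKo] := hK o.
rewrite normrM big_cons mulrCA; apply: ler_pM => //; first exact: coord_dir_le.
apply: le_trans hKo _; rewrite ler_wpM2r ?prodr_ge0// ler_wpM2l//.
by apply: ler_weXn2l; [rewrite lerDl|exact: leq_bigmax].
Qed.

End SmoothFunctions.

Section TaylorBigO.
Context {R : realType} {n : nat} {W : Type}.
Local Notation E := (R * 'rV[R]_n)%type.
Variables (dom : W -> Prop) (g rho : W -> R).
Hypothesis g1 : forall w, dom w -> 1 <= g w.
Hypothesis rho0 : forall w, dom w -> 0 <= rho w.
Hypothesis rho1 : forall w, dom w -> rho w <= 1.
Variables t0 tm : R.
Implicit Types (f : E -> R) (z v u : W -> E).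
Local Notation O := (big_O dom g rho).

Let O_powD k (c : R) (p : nat) (y : W -> R) (m : W -> R) :
  O 0%N y -> O k m -> O k (fun w => c * (1 + y w) ^+ p * m w).
Proof.
move=> hy hm; apply: (@big_OM _ _ _ _ _ 0 k) => //.
apply: (@big_OM _ _ _ _ _ 0 0); first exact: big_O_cst.
rewrite -[0%N]/(0 * p)%N; apply: big_OX.
by apply: big_OD => //; exact: big_O_cst.
Qed.

Lemma big_O_smooth N f z : smooth N t0 tm f ->
  (forall w, dom w -> t0 <= (z w).1 <= tm) -> O 0 (fun w => `|(z w).2|) ->
  O 0 (fun w => f (z w)).
Proof.
move=> /(smooth_leq (leq0n N))/derive_seq_bound[K [p [K0 h]]] zI hz.
apply: (big_O_le (psi := fun w => K * (1 + `|(z w).2|) ^+ p * 1)).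
  move=> w dw; have := h [::] (z w).1 (z w).2 erefl (zI w dw).
  rewrite big_nil /= -surjective_pairing => h1.
  by apply: le_trans h1 _; exact: ler_norm.
by apply: O_powD => //; exact: big_O_cst.
Qed.

Lemma big_O_derive1 k f z v : smooth 1 t0 tm f ->
  (forall w, dom w -> t0 <= (z w).1 <= tm) -> O 0 (fun w => `|(z w).2|) ->
  O k (fun w => `|v w|) -> O k (fun w => 'D_(v w) f (z w)).
Proof.
move=> /derive_seq_bound[K [p [K0 h]]] zI hz hv.
apply: (big_O_le (psi := fun w => K * (1 + `|(z w).2|) ^+ p * `|v w|)).
  move=> w dw; have := h [:: v w] (z w).1 (z w).2 erefl (zI w dw).
  rewrite big_seq1 /= -surjective_pairing => h1.
  by apply: le_trans h1 _; exact: ler_norm.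
exact: O_powD.
Qed.

Lemma big_O_derive2 k l f z v u : smooth 2 t0 tm f ->
  (forall w, dom w -> t0 <= (z w).1 <= tm) -> O 0 (fun w => `|(z w).2|) ->
  O k (fun w => `|v w|) -> O l (fun w => `|u w|) ->
  O (k + l) (fun w => 'D_(u w) (fun x => 'D_(v w) f x) (z w)).
Proof.
move=> /derive_seq_bound[K [p [K0 h]]] zI hz hv hu.
apply: (big_O_le (psi := fun w => K * (1 + `|(z w).2|) ^+ p * (`|v w| * `|u w|))).
  move=> w dw; have := h [:: v w; u w] (z w).1 (z w).2 erefl (zI w dw).
  rewrite big_cons big_seq1 /= -surjective_pairing => h1.
  by apply: le_trans h1 _; exact: ler_norm.
by apply: O_powD => //; exact: big_OM.
Qed.

(** The growth bounds hold only for times in [t0, tm]; since the interval is convex, the whole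
    Taylor segment stays inside. *)
Let segment_time (y v : E) (s : R) : t0 <= y.1 <= tm -> t0 <= (y + v).1 <= tm ->
  0 <= s <= 1 -> t0 <= (y + s *: v).1 <= tm.
Proof.
move=> /andP[h1 h2] /andP[h3 h4] /andP[s0 s1]; move: h3 h4 => /=.
change (s *: v.1) with (s * v.1) => h3 h4; apply/andP; split; nra.
Qed.

Let segment_norm (y v : E) (s : R) : 0 <= s <= 1 ->
  1 + `|(y + s *: v).2| <= 1 + (`|y.2| + `|v|).
Proof.
move=> /andP[s0 s1]; rewrite lerD2l /=; apply: le_trans (ler_normD _ _) _.
rewrite lerD2l; apply: (@le_trans _ _ `|v.2|).
  by rewrite normrZ ger0_norm// ler_piMl.
by rewrite pair_normE le_max lexx orbT.
Qed.

Let segment_bound N f (K : R) (p : nat) (m : R) (y v : E) (s : R) (vs : seq E) :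
  0 <= K ->
  (forall (vs : seq E) t x, size vs = N -> t0 <= t <= tm ->
      `|derive_seq vs f (t, x)| <= K * (1 + `|x|) ^+ p * \prod_(v <- vs) `|v|) ->
  size vs = N -> \prod_(v <- vs) `|v| = m ->
  t0 <= y.1 <= tm -> t0 <= (y + v).1 <= tm -> 0 <= s <= 1 ->
  `|derive_seq vs f (y + s *: v)| <= `|K * (1 + (`|y.2| + `|v|)) ^+ p * m|.
Proof.
move=> K0 h sz <- yI vI s01; rewrite [y + s *: v]surjective_pairing.
apply: le_trans (h vs _ _ sz (segment_time yI vI s01)) _.
apply: le_trans (ler_norm _); rewrite ler_wpM2r ?prodr_ge0// ler_wpM2l//.
by rewrite lerXn2r ?nnegrE ?addr_ge0//; exact: segment_norm.
Qed.

Lemma big_O_taylor1 k f z v : smooth 1 t0 tm f ->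
  (forall w, dom w -> t0 <= (z w).1 <= tm) ->
  (forall w, dom w -> t0 <= (z w + v w).1 <= tm) ->
  O 0 (fun w => `|(z w).2|) -> O k (fun w => `|v w|) ->
  O k (fun w => f (z w + v w) - f (z w)).
Proof.
move=> sf zI vI hz hv; have [K [p [K0 h]]] := derive_seq_bound sf.
apply: (big_O_le (psi := fun w => K * (1 + (`|(z w).2| + `|v w|)) ^+ p * `|v w|)).
  move=> w dw; apply: taylor1.
  - by move=> x; exact: smooth_derivable sf _ _.
  - exact: smooth_continuous sf.
  - move=> s s01; apply: (segment_bound (vs := [:: v w]) K0 h) => //.
    + by rewrite big_seq1.
    + exact: zI.
    + exact: vI.
by apply: O_powD => //; apply: big_OD => //; exact: big_OW hv.
Qed.

Lemma big_O_taylor2 k f z v : smooth 2 t0 tm f ->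
  (forall w, dom w -> t0 <= (z w).1 <= tm) ->
  (forall w, dom w -> t0 <= (z w + v w).1 <= tm) ->
  O 0 (fun w => `|(z w).2|) -> O k (fun w => `|v w|) ->
  O (k * 2) (fun w => f (z w + v w) - f (z w) - 'D_(v w) f (z w)).
Proof.
move=> sf zI vI hz hv; have [K [p [K0 h]]] := derive_seq_bound sf.
apply: (big_O_le (psi := fun w => K * (1 + (`|(z w).2| + `|v w|)) ^+ p * `|v w| ^+ 2)).
  move=> w dw; apply: taylor2.
  - by move=> x; exact: smooth_derivable sf _ _.
  - by move=> x; apply: smooth_derivable (smooth_derive (v w) sf) _ _.
  - move=> s s01; apply: (segment_bound (vs := [:: v w; v w]) K0 h) => //.
    + by rewrite big_cons big_seq1 expr2.
    + exact: zI.
    + exact: vI.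
by apply: O_powD; [apply: big_OD => //; exact: big_OW hv|exact: big_OX].
Qed.

Lemma big_O_taylor3 k f z v : smooth 3 t0 tm f ->
  (forall w, dom w -> t0 <= (z w).1 <= tm) ->
  (forall w, dom w -> t0 <= (z w + v w).1 <= tm) ->
  O 0 (fun w => `|(z w).2|) -> O k (fun w => `|v w|) ->
  O (k * 3) (fun w => f (z w + v w) - f (z w) - 'D_(v w) f (z w)
    - 2^-1 * 'D_(v w) (fun x => 'D_(v w) f x) (z w)).
Proof.
move=> sf zI vI hz hv; have [K [p [K0 h]]] := derive_seq_bound sf.
apply: (big_O_le (psi := fun w => K * (1 + (`|(z w).2| + `|v w|)) ^+ p * `|v w| ^+ 3)).
  move=> w dw; apply: taylor3.
  - by move=> x; exact: smooth_derivable sf _ _.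
  - by move=> x; apply: smooth_derivable (smooth_derive (v w) sf) _ _.
  - by move=> x; apply: smooth_derivable (smooth_derive (v w) (smooth_derive (v w) sf)) _ _.
  - move=> s s01; apply: (segment_bound (vs := [:: v w; v w; v w]) K0 h) => //.
    + by rewrite !big_cons big_nil mulr1 !exprS expr0 mulr1.
    + exact: zI.
    + exact: vI.
by apply: O_powD; [apply: big_OD => //; exact: big_OW hv|exact: big_OX].
Qed.

Lemma big_O_pair k (t : W -> R) (x : W -> 'rV[R]_n) :
  O k t -> (forall i, O k (fun w => x w 0 i)) -> O k (fun w => `|(t w, x w)|).
Proof.
move=> ht hx; apply: (big_O_le (psi := fun w => `|t w| + \sum_i `|x w 0 i|)).
  move=> w dw; rewrite normr_id; apply: le_trans (ler_norm _).
  by apply: le_trans (pair_norm_le _) _; rewrite lerD2l norm_le_sum.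
apply: big_OD => //; first exact: big_O_norm.
by apply: big_O_sum => // i; exact: big_O_norm.
Qed.

End TaylorBigO.

Section SmoothLinearity.
Context {R : realType} {n : nat}.
Local Notation E := (R * 'rV[R]_n)%type.
Variables (t0 tm : R).
Implicit Types (f : E -> R) (z u v w : E).

Lemma smooth_derive_dirD f u v z : smooth 1 t0 tm f ->
  'D_(u + v) f z = 'D_u f z + 'D_v f z.
Proof.
move=> sf; apply: derive_dirD.
- exact: smooth_derivable sf.
- exact: smooth_continuous sf.
- exact: smooth_continuous (smooth_derive v sf).
Qed.

Lemma smooth_derive_dirZ f (c : R) v z : smooth 1 t0 tm f ->
  'D_(c *: v) f z = c * 'D_v f z.
Proof. by move=> sf; apply: derive_dirZ; exact: smooth_derivable sf. Qed.

(** Only the e^2 term matters later. With c = rho^2 and e = O(rho) everything multiplied by c is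
    O(rho^3), so it is left unexpanded. *)
Lemma smooth_derive2_dir f (c e : R) u v z : smooth 2 t0 tm f ->
  'D_(c *: u + e *: v) (fun x => 'D_(c *: u + e *: v) f x) z =
  e ^+ 2 * 'D_v (fun x => 'D_v f x) z + c * ('D_u (fun x => 'D_(c *: u + e *: v) f x) z
    + e * 'D_v (fun x => 'D_u f x) z).
Proof.
move=> sf; have sD w := smooth_derive w sf.
have alg (X Y A B C : R) : X = c * A + e * Y -> Y = c * B + e * C ->
    X = e ^+ 2 * C + c * (A + e * B) by move=> -> ->; ring.
pose F := fun x => 'D_(c *: u + e *: v) f x.
have FE : F = (fun x => \sum_(i <- [:: (c, u); (e, v)]) i.1 * 'D_(i.2) f x).
  apply/funext => x; rewrite /F (smooth_derive_dirD _ _ _ (smoothW sf)).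
  by rewrite !(smooth_derive_dirZ _ _ _ (smoothW sf)) big_cons big_seq1.
have vE : 'D_v F z = c * 'D_v (fun x => 'D_u f x) z + e * 'D_v (fun x => 'D_v f x) z.
  rewrite FE (@derive_lin_sum _ _ _ _ (fun i => i.1) (fun i x => 'D_(i.2) f x)).
    by rewrite big_cons big_seq1.
  by move=> i x; exact: smooth_derivable (sD i.2) v x.
have sF : smooth 1 t0 tm F by exact: sD.
have e1 : 'D_(c *: u + e *: v) F z = c * 'D_u F z + e * 'D_v F z.
  apply: etrans (smooth_derive_dirD (c *: u) (e *: v) z sF) _.
  by congr (_ + _); exact: smooth_derive_dirZ sF.
exact: alg e1 vE.
Qed.

Lemma smooth_derive_dir0E f (c : 'rV[R]_n) z : smooth 1 t0 tm f ->
  'D_(0, c) f z = \sum_j c 0 j * 'D_(0, delta_mx 0 j) f z.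
Proof.
move=> sf; have := congr1 (@^~ z) (smooth_derive_sumE (0, c) sf) => /= ->.
rewrite (bigD1 None)//= mul0r add0r (reindex_omap Some id) /=; last by case.
by apply: eq_bigl => j; rewrite eqxx.
Qed.

End SmoothLinearity.

(** * Local expansion of the schemes *)

Section MilsteinStep.
Context {R : realType} {n : nat}.
Implicit Types a b : R -> 'rV[R]_n -> 'rV[R]_n.

(** Difference quotient of b along b. As r tends to 0 it approaches the derivative of b in direction
    b, which is the coefficient of the classical Milstein correction; r will be the square root of
    the time step. *)
Definition milstein_corr b (r t : R) (x : 'rV[R]_n) : 'rV[R]_n :=
  r^-1 *: (b t (x + r *: b t x) - b t x).

(* The derivative-free Milstein step.  Unlike the scheme under study and unlike
   the classical Milstein step, it depends on [x] in a globally Lipschitz way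
   as soon as [a] and [b] do. *)
Definition milstein_step a b (h t dW : R) (x : 'rV[R]_n) : 'rV[R]_n :=
  x + (h *: a t x + dW *: b t x + ((dW ^+ 2 - h) / 2) *: milstein_corr b (Num.sqrt h) t x).

Lemma milstein_stepE a b (h t dW : R) (x : 'rV[R]_n) i :
  milstein_step a b h t dW x 0 i = x 0 i + (h * a t x 0 i + dW * b t x 0 i
    + (dW ^+ 2 - h) / 2 * milstein_corr b (Num.sqrt h) t x 0 i).
Proof.
by rewrite /milstein_step; move: (milstein_corr _ _ _ _) => c; rewrite !mxE.
Qed.

End MilsteinStep.

Section LocalExpansion.
Context {R : realType} {n : nat}.
Local Notation E := (R * 'rV[R]_n)%type.
Variables (a b : R -> 'rV[R]_n -> 'rV[R]_n) (t0 tm : R).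
Let fa i (z : E) := a z.1 z.2 0 i.
Let fb i (z : E) := b z.1 z.2 0 i.
Hypothesis sa : forall i, smooth 3 t0 tm (fa i).
Hypothesis sb : forall i, smooth 3 t0 tm (fb i).

Let sa1 i : smooth 1 t0 tm (fa i). Proof. exact: smooth_leq (sa i). Qed.
Let sa2 i : smooth 2 t0 tm (fa i). Proof. exact: smooth_leq (sa i). Qed.
Let sb1 i : smooth 1 t0 tm (fb i). Proof. exact: smooth_leq (sb i). Qed.
Let sb2 i : smooth 2 t0 tm (fb i). Proof. exact: smooth_leq (sb i). Qed.

Definition bDb (i : 'I_n) (z : E) : R := 'D_(0, b z.1 z.2) (fun z => b z.1 z.2 0 i) z.
Definition bDa (i : 'I_n) (z : E) : R := 'D_(0, b z.1 z.2) (fun z => a z.1 z.2 0 i) z.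
Definition dtb (i : 'I_n) (z : E) : R := 'D_(1, a z.1 z.2) (fun z => b z.1 z.2 0 i) z.
(** Both derivatives are taken in the direction frozen at z, so this is the second derivative of b
    applied to the pair (b, b), not b.grad applied twice. *)
Definition bbDDb (i : 'I_n) (z : E) : R :=
  'D_(0, b z.1 z.2) (fun y => 'D_(0, b z.1 z.2) (fun z => b z.1 z.2 0 i) y) z.

Context {W : Type}.
Variables (dom : W -> Prop) (g rho : W -> R).
Hypothesis g1 : forall w, dom w -> 1 <= g w.
Hypothesis rho0 : forall w, dom w -> 0 < rho w.
Hypothesis rho1 : forall w, dom w -> rho w <= 1.
Local Notation O := (big_O dom g rho).
Let rho0' w : dom w -> 0 <= rho w. Proof. by move/rho0/ltW. Qed.
Let OM := @big_OM _ _ dom g rho.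
Let OD := @big_OD _ _ dom g rho g1 rho0'.
Let OW := @big_OW _ _ dom g rho g1 rho0' rho1.
Let Orho := @big_O_rho _ _ dom g rho rho0'.
Let O2 := @big_OX _ _ dom g rho 1 2 rho Orho.
Let OZ := @big_OZ _ _ dom g rho.

Lemma big_O_div (k : nat) (c : R) (phi : W -> R) : 0 < c -> O k.+1 phi ->
  O k (fun w => (c * rho w)^-1 * phi w).
Proof.
move=> c0 [C [p [C0 h]]]; exists (c^-1 * C), p; split => [|w dw].
  by rewrite mulr_ge0// invr_ge0 ltW.
have r0 := rho0 dw.
rewrite normrM [`|_^-1|]ger0_norm ?invr_ge0 ?mulr_ge0 ?(ltW c0) ?(rho0' dw)// invfM.
rewrite -[leRHS]mulrA -[leLHS]mulrA -[leRHS]mulrA ler_pM2l ?invr_gt0// ler_pdivrMl//.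
by apply: le_trans (h w dw) _; rewrite exprS le_eqVlt; apply/orP; left; apply/eqP; ring.
Qed.

Section AtPoint.
Variables (t : W -> R) (x : W -> 'rV[R]_n).
Hypothesis tI : forall w, dom w -> t0 <= t w <= tm.
Hypothesis Ox : O 0 (fun w => `|x w|).
Let z w : E := (t w, x w).

Lemma big_O_a i : O 0 (fun w => a (t w) (x w) 0 i).
Proof. exact: (big_O_smooth g1 rho0' (z := z) (sa i) tI Ox). Qed.

Lemma big_O_b i : O 0 (fun w => b (t w) (x w) 0 i).
Proof. exact: (big_O_smooth g1 rho0' (z := z) (sb i) tI Ox). Qed.

Lemma big_O_dirb : O 0 (fun w => `|(0 : R, b (t w) (x w))|).
Proof. by apply: (big_O_pair g1 rho0') => //; [exact: big_O0|exact: big_O_b]. Qed.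

Lemma big_O_dira : O 0 (fun w => `|(1 : R, a (t w) (x w))|).
Proof. by apply: (big_O_pair g1 rho0') => //; [exact: big_O_cst|exact: big_O_a]. Qed.

Lemma big_O_bDb i : O 0 (fun w => bDb i (z w)).
Proof. exact: (big_O_derive1 g1 rho0' (z := z) (sb1 i) tI Ox big_O_dirb). Qed.

Lemma big_O_bDa i : O 0 (fun w => bDa i (z w)).
Proof. exact: (big_O_derive1 g1 rho0' (z := z) (sa1 i) tI Ox big_O_dirb). Qed.

Lemma big_O_dtb i : O 0 (fun w => dtb i (z w)).
Proof. exact: (big_O_derive1 g1 rho0' (z := z) (sb1 i) tI Ox big_O_dira). Qed.

Lemma big_O_bbDDb i : O 0 (fun w => bbDDb i (z w)).
Proof.
exact: (big_O_derive2 g1 rho0' (z := z) (sb2 i) tI Ox big_O_dirb big_O_dirb).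
Qed.

(** The second-order Taylor remainder O(rho^2) loses one order by the division. The factor c is
    there because the doubled step 2 rho^2 has root sqrt 2 rho. *)
Lemma big_O_milstein_corr (c : R) i : 0 < c ->
  O 1 (fun w => milstein_corr b (c * rho w) (t w) (x w) 0 i - bDb i (z w)).
Proof.
move=> c0.
pose v w : E := (c * rho w) *: (0, b (t w) (x w)).
have Ov : O 1 (fun w => `|v w|).
  apply: (big_O_le (psi := fun w => (c * rho w) * `|(0 : R, b (t w) (x w))|)).
    by move=> w dw; rewrite norm_pair_norm pair_normZ [leRHS]normrM norm_pair_norm.
  by apply: (OM (k := 1) (l := 0)) big_O_dirb; exact: OZ.
have vI w : dom w -> t0 <= (z w + v w).1 <= tm.
  move=> dw; have -> : (z w + v w).1 = t w by rewrite /= scaler0 addr0.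
  exact: tI.
have := big_O_taylor2 g1 rho0' rho1 (sb2 i) (z := z) tI vI Ox Ov.
move=> /(big_O_div (k := 1) c0); apply: eq_big_O => w dw.
have -> : 'D_(v w) (fb i) (z w) = (c * rho w) * bDb i (z w).
  exact: smooth_derive_dirZ (sb1 i).
rewrite mulrBr mulKf; last by rewrite mulf_neq0 ?gt_eqF ?rho0.
by rewrite /milstein_corr !mxE /fb /v /= scaler0 addr0.
Qed.

End AtPoint.

Section RungeKutta.
Variables (t : W -> R) (x : W -> 'rV[R]_n) (zeta s : W -> R).
Hypothesis tI : forall w, dom w -> t0 <= t w <= tm.
Hypothesis tI' : forall w, dom w -> t0 <= t w + rho w ^+ 2 <= tm.
Hypothesis Ox : O 0 (fun w => `|x w|).
Hypothesis Ozeta : O 0 zeta.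
Hypothesis s1 : forall w, dom w -> s w ^+ 2 = 1.
Let z w : E := (t w, x w).

(** K1 moves the state by the noise rho(zeta - s), K2 multiplies by rho(zeta + s), and (zeta -
    s)(zeta + s) = zeta^2 - 1; the first three terms are what this leaves at order rho^3. The last
    one replaces the exact derivative [bDb] by the difference quotient of the Milstein step. *)
Definition rk_martingale i w : R :=
  rho w ^+ 3 * (2^-1 * (zeta w - s w) * bDa i (z w) + 2^-1 * (zeta w + s w) * dtb i (z w)
    + 4^-1 * (zeta w ^+ 2 - 1) * (zeta w - s w) * bbDDb i (z w))
  - 2^-1 * rho w ^+ 2 * (zeta w ^+ 2 - 1) *
    (milstein_corr b (rho w) (t w) (x w) 0 i - bDb i (z w)).

Let Os : O 0 s.
Proof.
apply: (big_O_le (psi := fun=> 1)); last exact: big_O_cst.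
move=> w /s1 /(congr1 (fun y => `|y|)); rewrite normrX normr1 => /eqP.
by rewrite sqrp_eq1// => /eqP ->.
Qed.

Let Om : O 0 (fun w => zeta w - s w). Proof. exact: big_OB. Qed.
Let Op : O 0 (fun w => zeta w + s w). Proof. exact: OD. Qed.
Let O3 : O 3 (fun w => rho w ^+ 3). Proof. exact: (big_OX (k := 1) 3). Qed.
Let Oq : O 0 (fun w => zeta w ^+ 2 - 1).
Proof. by apply: big_OB => //; [exact: (big_OX (k := 0) 2)|exact: big_O_cst]. Qed.

Lemma big_O_rk_martingale i : O 3 (rk_martingale i).
Proof.
apply: big_OB => //.
  apply: (OM (k := 3) (l := 0)) => //; apply: OD; first apply: OD.
  - by apply: (OM (k := 0) (l := 0)); [exact: OZ|exact: big_O_bDa].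
  - by apply: (OM (k := 0) (l := 0)); [exact: OZ|exact: big_O_dtb].
  - apply: (OM (k := 0) (l := 0)); last exact: big_O_bbDDb.
    by apply: (OM (k := 0) (l := 0)) => //; exact: OZ.
apply: (OM (k := 2) (l := 1)).
  by apply: (OM (k := 2) (l := 0)) => //; exact: OZ.
have := big_O_milstein_corr tI Ox i ltr01; apply: eq_big_O => w dw.
by rewrite mul1r.
Qed.

Lemma rk_local_expansion i :
  O 4 (fun w =>
    rk_step a b (rho w ^+ 2) (t w) (t w + rho w ^+ 2) (rho w * zeta w) (s w) (x w) 0 i
    - milstein_step a b (rho w ^+ 2) (t w) (rho w * zeta w) (x w) 0 i
    - rk_martingale i w).
Proof.
pose u w : E := (1, a (t w) (x w)).
pose v' w : E := (0, b (t w) (x w)).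
pose e w := rho w * (zeta w - s w).
(* The Taylor increment (h, K1), split into its deterministic part of size rho^2 and its noise part
   of size rho. *)
pose v w : E := rho w ^+ 2 *: u w + e w *: v' w.
have Oe : O 1 e by apply: (OM (k := 1) (l := 0)).
have Ou : O 0 (fun w => `|u w|) := big_O_dira tI Ox.
have Ov' : O 0 (fun w => `|v' w|) := big_O_dirb tI Ox.
have Ov : O 1 (fun w => `|v w|).
  apply: (big_O_le (psi := fun w => rho w ^+ 2 * `|u w| + `|e w| * `|v' w|)).
    move=> w dw; rewrite norm_pair_norm; apply: le_trans (ler_norm _).
    apply: le_trans (pair_normD _ _) _; rewrite !pair_normZ.
    by rewrite (ger0_norm (exprn_ge0 _ (rho0' dw))).
  apply: OD; last by apply: (OM (k := 1) (l := 0)) => //; exact: big_O_norm.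
  by apply: (@OW 2) => //; apply: (OM (k := 2) (l := 0)).
have v1 w : (z w + v w).1 = t w + rho w ^+ 2.
  rewrite /= -[_ *: 1]/(rho w ^+ 2 * 1) -[_ *: 0]/(e w * 0).
  by rewrite mulr1 mulr0 addr0.
have vI w : dom w -> t0 <= (z w + v w).1 <= tm by move=> dw; rewrite v1; exact: tI'.
(* In K2 the drift is multiplied by rho^2 and the volatility by rho. Hence first order suffices for
   a and second order for b to make both contributions O(rho^4). *)
pose Ea w := fa i (z w + v w) - fa i (z w) - e w * bDa i (z w).
pose Eb w := fb i (z w + v w) - fb i (z w) - rho w ^+ 2 * dtb i (z w) - e w * bDb i (z w)
  - 2^-1 * e w ^+ 2 * bbDDb i (z w).
have OEa : O 2 Ea.
  pose E1 w := 'D_(u w) (fa i) (z w).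
  have h1 := big_O_taylor2 g1 rho0' rho1 (sa2 i) (z := z) tI vI Ox Ov.
  have h2 : O 0 E1 := big_O_derive1 g1 rho0' (sa1 i) (z := z) tI Ox Ou.
  have := OD h1 (OM O2 h2); apply: eq_big_O => w dw; rewrite /Ea.
  have -> : 'D_(v w) (fa i) (z w) = rho w ^+ 2 * E1 w + e w * bDa i (z w).
    apply: etrans (smooth_derive_dirD _ _ _ (sa1 i)) _.
    by congr (_ + _); exact: smooth_derive_dirZ (sa1 i).
  by ring.
have OEb : O 3 Eb.
  pose D1 w := 'D_(u w) (fun y => 'D_(v w) (fb i) y) (z w).
  pose D2 w := 'D_(v' w) (fun y => 'D_(u w) (fb i) y) (z w).
  have h1 := big_O_taylor3 g1 rho0' rho1 (sb i) (z := z) tI vI Ox Ov.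
  have h2 : O 1 D1 := big_O_derive2 g1 rho0' (sb2 i) (z := z) tI Ox Ov Ou.
  have h3 : O 0 D2 := big_O_derive2 g1 rho0' (sb2 i) (z := z) tI Ox Ou Ov'.
  have := OD h1 (OZ 2^-1 (OM O2 (OD h2 (OM Oe h3)))); apply: eq_big_O => w dw; rewrite /Eb.
  have dE : 'D_(v w) (fb i) (z w) = rho w ^+ 2 * dtb i (z w) + e w * bDb i (z w).
    apply: etrans (smooth_derive_dirD _ _ _ (sb1 i)) _.
    by congr (_ + _); exact: smooth_derive_dirZ (sb1 i).
  have ddE : 'D_(v w) (fun y => 'D_(v w) (fb i) y) (z w) =
    e w ^+ 2 * bbDDb i (z w) + rho w ^+ 2 * (D1 w + e w * D2 w).
    exact: smooth_derive2_dir (sb2 i).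
  by rewrite dE ddE; ring.
have OR : O 4 (fun w => 2^-1 * rho w ^+ 2 * Ea w + 2^-1 * (rho w * (zeta w + s w)) * Eb w).
  apply: OD.
    by apply: (OM (k := 2) (l := 2)) => //; exact: OZ.
  apply: (OM (k := 1) (l := 3)) => //; apply: OZ.
  by apply: (OM (k := 1) (l := 0)).
apply: eq_big_O OR => w dw.
have sq : Num.sqrt (rho w ^+ 2) = rho w by rewrite sqrtr_sqr ger0_norm// rho0'.
have zv : z w + v w = (t w + rho w ^+ 2, x w + (rho w ^+ 2 *: a (t w) (x w) +
    (rho w * zeta w - s w * rho w) *: b (t w) (x w))).
  rewrite [LHS]surjective_pairing v1 /=; congr (_, _ + (_ + _ *: _)).
  by rewrite /e; ring.
rewrite /Ea /Eb zv /fa /fb /= /rk_step /milstein_step /rk_martingale sq !mxE.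
rewrite /e; have := s1 dw; move: (s w) (rho w)^-1 => s' r s'1.
move: (bDb _ _) (bDa _ _) (dtb _ _) (bbDDb _ _) => B1 B2 B3 B4.
move: (a (t w + _) _ 0 i) (b (t w + _) _ 0 i) => a1 b1.
move: (b (t w) (x w + _) 0 i) (a (t w) _ 0 i) (b (t w) _ 0 i) => c1 a2 b2.
(* The identity uses s^2 = 1, which is not an identity of fields; it is checked at the two values of
   s. *)
by have /orP[/eqP ->|/eqP ->] : (s' == 1) || (s' == -1) by [rewrite -sqrf_eq1 s'1]; field.
Qed.

End RungeKutta.

Section TwoSteps.
Variables (t : W -> R) (x : W -> 'rV[R]_n) (zeta1 zeta2 : W -> R).
Hypothesis tI : forall w, dom w -> t0 <= t w <= tm.
Hypothesis tI' : forall w, dom w -> t0 <= t w + rho w ^+ 2 <= tm.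
Hypothesis Ox : O 0 (fun w => `|x w|).
Hypothesis Ozeta1 : O 0 zeta1.
Hypothesis Ozeta2 : O 0 zeta2.
Let z w : E := (t w, x w).
Let x1 w := milstein_step a b (rho w ^+ 2) (t w) (rho w * zeta1 w) (x w).
Let t1 w := t w + rho w ^+ 2.
Let z1 w : E := (t1 w, x1 w).
Let c i w := milstein_corr b (rho w) (t w) (x w) 0 i.
Let c1 i w := milstein_corr b (rho w) (t1 w) (x1 w) 0 i.
Let c2 i w := milstein_corr b (Num.sqrt 2 * rho w) (t w) (x w) 0 i.

Let sqrt_rho w : dom w -> Num.sqrt (rho w ^+ 2) = rho w.
Proof. by move=> dw; rewrite sqrtr_sqr ger0_norm// rho0'. Qed.

Let Oq (zeta : W -> R) (k : R) : O 0 zeta -> O 0 (fun w => zeta w ^+ 2 - k).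
Proof. by move=> h; apply: big_OB => //; [exact: (big_OX (k := 0) 2)|exact: big_O_cst]. Qed.

Let Oc i : O 1 (fun w => c i w - bDb i (z w)).
Proof.
have := big_O_milstein_corr tI Ox i ltr01; apply: eq_big_O => w dw.
by rewrite mul1r.
Qed.

Let Oc2 i : O 1 (fun w => c2 i w - bDb i (z w)).
Proof. by apply: big_O_milstein_corr; rewrite ?sqrtr_gt0. Qed.

Let Oc0 i : O 0 (c i).
Proof.
have := OD (OW (leq0n 1) (Oc i)) (big_O_bDb tI Ox i).
by apply: eq_big_O => w dw; rewrite subrK.
Qed.

Let e w := rho w * zeta1 w.
(** The first Milstein step is the displacement v, whose part of size rho^2, including the Milstein
    correction, is collected in u. *)
Let u w : E := (1, a (t w) (x w) + (2^-1 * (zeta1 w ^+ 2 - 1)) *: milstein_corr b (rho w) (t w) (x w)).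
Let v' w : E := (0, b (t w) (x w)).
Let v w : E := rho w ^+ 2 *: u w + e w *: v' w.

Let Oe : O 1 e. Proof. exact: (OM (k := 1) (l := 0)). Qed.

Let Ou : O 0 (fun w => `|u w|).
Proof.
apply: (big_O_pair g1 rho0'); first exact: big_O_cst.
move=> i; have := OD (big_O_a tI Ox i) (OM (k := 0) (l := 0) (OZ 2^-1 (Oq 1 Ozeta1)) (Oc0 i)).
by apply: eq_big_O => w dw; rewrite mxE; congr (_ + _); rewrite mxE.
Qed.

Let Ov : O 1 (fun w => `|v w|).
Proof.
apply: (big_O_le (psi := fun w => rho w ^+ 2 * `|u w| + `|e w| * `|v' w|)).
  move=> w dw; rewrite norm_pair_norm; apply: le_trans (ler_norm _).
  apply: le_trans (pair_normD _ _) _; rewrite !pair_normZ.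
  by rewrite (ger0_norm (exprn_ge0 _ (rho0' dw))).
apply: OD.
  by apply: (@OW 2) => //; apply: (OM (k := 2) (l := 0)).
apply: (OM (k := 1) (l := 0)); first exact: big_O_norm.
exact: big_O_dirb.
Qed.

Let z1E w : dom w -> z w + v w = z1 w.
Proof.
move=> dw; rewrite /z /v /z1 /x1 /t1 /milstein_step sqrt_rho//.
apply/pair_equal_spec; split => /=.
  by rewrite -[_ *: 1]/(rho w ^+ 2 * 1) -[_ *: 0]/(e w * 0) mulr1 mulr0 addr0.
congr (_ + _); rewrite scalerDr scalerA addrAC; congr (_ + _ + _ *: _).
by field.
Qed.

Let vI w : dom w -> t0 <= (z w + v w).1 <= tm.
Proof. by move=> dw; rewrite z1E//; exact: tI'. Qed.

Let Ox1 : O 0 (fun w => `|x1 w|).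
Proof.
apply: (big_O_le (psi := fun w => `|x w| + `|v w|)).
  move=> w dw; rewrite normr_id; apply: le_trans (ler_norm _).
  have -> : x1 w = x w + (v w).2 by rewrite -[LHS]/((z1 w).2) -z1E.
  apply: le_trans (ler_normD _ _) _; rewrite lerD2l.
  by rewrite [leRHS]pair_normE le_max lexx orbT.
by apply: OD => //; exact: OW Ov.
Qed.

Let step_first (f : E -> R) : smooth 1 t0 tm f -> O 1 (fun w => f (z1 w) - f (z w)).
Proof.
move=> sf; have := big_O_taylor1 g1 rho0' rho1 sf (z := z) tI vI Ox Ov.
by apply: eq_big_O => w dw; rewrite z1E.
Qed.

Let step_second (f : E -> R) : smooth 2 t0 tm f ->
  O 2 (fun w => f (z1 w) - f (z w) - e w * 'D_(v' w) f (z w)).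
Proof.
move=> sf; pose E1 w := 'D_(u w) f (z w).
have h1 := big_O_taylor2 g1 rho0' rho1 sf (z := z) tI vI Ox Ov.
have h2 : O 0 E1 := big_O_derive1 g1 rho0' (smooth_leq (isT : (1 <= 2)%N) sf) (z := z) tI Ox Ou.
have := OD h1 (OM O2 h2); apply: eq_big_O => w dw.
have -> : 'D_(v w) f (z w) = rho w ^+ 2 * E1 w + e w * 'D_(v' w) f (z w).
  apply: etrans (smooth_derive_dirD _ _ _ (smoothW sf)) _.
  by congr (_ + _); exact: smooth_derive_dirZ (smoothW sf).
by rewrite z1E//; ring.
Qed.

Let tI1 w : dom w -> t0 <= t1 w <= tm. Proof. exact: tI'. Qed.

(** Function and direction both change with the point. In coordinates [bDb] is a sum of products b_j
    D_j b_i, and each factor moves by O(rho). *)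
Let step_bDb i : O 1 (fun w => bDb i (z1 w) - bDb i (z w)).
Proof.
pose D j y := 'D_(0, delta_mx 0 j) (fb i) y.
have h : O 1 (fun w => \sum_j ((fb j (z1 w) - fb j (z w)) * D j (z1 w) +
    fb j (z w) * (D j (z1 w) - D j (z w)))).
  apply: big_O_sum => // j; apply: OD.
    apply: (OM (k := 1) (l := 0)); first exact: step_first.
    by apply: (big_O_smooth g1 rho0' (z := z1) (smooth_derive _ (sb1 i))).
  apply: (OM (k := 0) (l := 1)); first exact: big_O_b.
  by apply: step_first; exact: smooth_derive (sb2 i).
apply: eq_big_O h => w dw.
rewrite /bDb !(smooth_derive_dir0E _ _ (sb1 i)) -sumrB; apply: eq_bigr => j _.
by rewrite /D /fb; ring.
Qed.

Let Oc1 i : O 1 (fun w => c1 i w - bDb i (z w)).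
Proof.
have h : O 1 (fun w => c1 i w - bDb i (z1 w)).
  have := big_O_milstein_corr tI1 Ox1 i ltr01; apply: eq_big_O => w dw.
  by rewrite mul1r.
by have := OD h (step_bDb i); apply: eq_big_O => w dw; rewrite subrKA.
Qed.

(** Subtracting the long step from the two short ones, the products of [bDb] with the noises cancel
    because (zeta1 + zeta2)^2 - 2 = (zeta1^2 - 1) + (zeta2^2 - 1) + 2 zeta1 zeta2. What is left are
    the increments of the coefficients and the errors of the three difference quotients. *)
Definition two_step_martingale i w : R :=
  rho w ^+ 3 * zeta1 w * bDa i (z w)
  + rho w * zeta2 w * (b (t1 w) (x1 w) 0 i - b (t w) (x w) 0 i - e w * bDb i (z w))
  + 2^-1 * rho w ^+ 2 * (zeta1 w ^+ 2 - 1) * (c i w - bDb i (z w))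
  + 2^-1 * rho w ^+ 2 * (zeta2 w ^+ 2 - 1) * (c1 i w - bDb i (z w))
  - 2^-1 * rho w ^+ 2 * ((zeta1 w + zeta2 w) ^+ 2 - 2) * (c2 i w - bDb i (z w)).

Lemma big_O_two_step_martingale i : O 3 (two_step_martingale i).
Proof.
have O12 : O 0 (fun w => (zeta1 w + zeta2 w) ^+ 2 - 2) by apply: Oq; exact: OD.
have Oh2 : O 2 (fun w => 2^-1 * rho w ^+ 2) by exact: OZ.
apply: big_OB => //; last first.
  by apply: (OM (k := 2) (l := 1)) => //; apply: (OM (k := 2) (l := 0)).
apply: OD; last first.
  by apply: (OM (k := 2) (l := 1)) => //; apply: (OM (k := 2) (l := 0)) => //; exact: Oq.
apply: OD; last first.
  by apply: (OM (k := 2) (l := 1)) => //; apply: (OM (k := 2) (l := 0)) => //; exact: Oq.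
apply: OD.
  apply: (OM (k := 3) (l := 0)); last exact: big_O_bDa.
  by apply: (OM (k := 3) (l := 0)) => //; exact: (big_OX (k := 1) 3).
apply: (OM (k := 1) (l := 2)); first exact: (OM (k := 1) (l := 0)).
exact: (step_second (sb2 i)).
Qed.

Lemma two_step_expansion i :
  O 4 (fun w => milstein_step a b (rho w ^+ 2) (t1 w) (rho w * zeta2 w) (x1 w) 0 i
    - milstein_step a b (2 * rho w ^+ 2) (t w) (rho w * zeta1 w + rho w * zeta2 w) (x w) 0 i
    - two_step_martingale i w).
Proof.
(* The whole remainder is rho^2 times the second-order increment of the drift. *)
have h := OM (k := 2) (l := 2) O2 (step_second (sa2 i)).
apply: eq_big_O h => w dw.
have sq2 : Num.sqrt (2 * rho w ^+ 2) = Num.sqrt 2 * rho w.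
  by rewrite sqrtrM// sqrt_rho.
have x1E : x1 w 0 i = x w 0 i + (rho w ^+ 2 * a (t w) (x w) 0 i
    + rho w * zeta1 w * b (t w) (x w) 0 i
    + ((rho w * zeta1 w) ^+ 2 - rho w ^+ 2) / 2 * c i w).
  by rewrite [LHS]milstein_stepE sqrt_rho.
rewrite [X in X - _ - _]milstein_stepE [X in _ - X - _]milstein_stepE sqrt_rho// sq2 x1E.
rewrite /two_step_martingale -/(c1 i w) -/(c2 i w) /fa /e -/(bDa i (z w)) /z1 /z /=.
move: (c i w) (c1 i w) (c2 i w) (bDa _ _) (bDb _ _) => C C1 C2 B1 B2.
move: (a _ _ 0 i) (a _ _ 0 i) (b _ _ 0 i) (b _ _ 0 i) => a1 a2 b1 b2.
by field.
Qed.

End TwoSteps.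
End LocalExpansion.

(** * Moment stability of one step *)

Section LyapunovStep.
Context {R : realType} {n : nat} {W : Type}.
Implicit Types (x : 'rV[R]_n).

(** The norm of row vectors is the maximum norm. The Euclidean square is polynomial in the
    coordinates, so the effect of a step on its powers can be expanded. *)
Definition lyap x : R := 1 + \sum_i x 0 i ^+ 2.

Lemma lyap_ge1 x : 1 <= lyap x.
Proof. by rewrite lerDl sumr_ge0// => i _; exact: sqr_ge0. Qed.

Lemma lyap_gt0 x : 0 < lyap x. Proof. exact: lt_le_trans (lyap_ge1 x). Qed.

Lemma norm_sqr_le_lyap x : `|x| ^+ 2 <= lyap x - 1.
Proof.
have [x0|x0] := eqVneq `|x| 0; first by rewrite x0 expr0n subr_ge0 lyap_ge1.
have [[i j] ->] : exists i, `|x| = `|x i.1 i.2| := mx_norm_neq0 x0.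
rewrite (ord1 i) /lyap addrC addKr (bigD1 j)//= real_normK ?num_real//.
by rewrite lerDl sumr_ge0// => k _; exact: sqr_ge0.
Qed.

Lemma norm_le_sqrt_lyap x : 1 + `|x| <= 2 * Num.sqrt (lyap x).
Proof.
have h1 : 1 <= Num.sqrt (lyap x) by rewrite -[leLHS]sqrtr1; apply: ler_wsqrtr; exact: lyap_ge1.
have h2 : `|x| <= Num.sqrt (lyap x).
  rewrite -(ger0_norm (normr_ge0 x)) -sqrtr_sqr; apply: ler_wsqrtr.
  by have := norm_sqr_le_lyap x; lra.
lra.
Qed.

Lemma norm_le_lyap x : `|x| <= lyap x.
Proof. have := norm_sqr_le_lyap x; have := sqr_ge0 (`|x| - 1); nra. Qed.

Variables (dom : W -> Prop) (rho zeta s : W -> R) (x : W -> 'rV[R]_n).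
Variables (A B Rm : 'I_n -> W -> R).
Let g w := 1 + zeta w ^+ 2.
Let g1 w : dom w -> 1 <= g w. Proof. by move=> _; rewrite lerDl sqr_ge0. Qed.
Hypothesis rho0 : forall w, dom w -> 0 < rho w.
Hypothesis rho1 : forall w, dom w -> rho w <= 1.
Hypothesis s1 : forall w, dom w -> s w ^+ 2 = 1.
Let rho0' w : dom w -> 0 <= rho w. Proof. by move/rho0/ltW. Qed.
Local Notation O := (big_O dom g rho).

Lemma big_O_zeta : O 0 zeta.
Proof.
apply: (big_O_le (psi := g)); last exact: big_O_g.
move=> w dw; rewrite (ger0_norm (le_trans ler01 (g1 dw))) /g.
rewrite -[zeta w ^+ 2]real_normK ?num_real//; have := sqr_ge0 (`|zeta w| - 1).
by have := normr_ge0 (zeta w); move: `|zeta w| => r; nra.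
Qed.

Lemma big_O_sign : O 0 s.
Proof.
apply: (big_O_le (psi := fun=> 1)); last exact: big_O_cst.
move=> w /s1 /(congr1 (fun y => `|y|)); rewrite normrX normr1 => /eqP.
by rewrite sqrp_eq1// => /eqP ->.
Qed.

Lemma big_O_pow1p (y : W -> R) (p : nat) : O 1 y ->
  O 2 (fun w => (1 + y w) ^+ p - 1 - p%:R * y w).
Proof.
move=> hy; elim: p => [|p IH].
  by apply: eq_big_O (big_O0 _ _ _ 2) => w dw; rewrite expr0 subrr mul0r subr0.
have h1 : O 0 (fun w => 1 + y w).
  apply: (big_OD g1 rho0'); first exact: big_O_cst.
  exact: big_OW hy.
have h := big_OD g1 rho0' (big_OM (k := 2) (l := 0) IH h1)
   (big_OZ p%:R (big_OX (k := 1) 2 hy)).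
apply: eq_big_O h => w dw; rewrite exprS -[p.+1]addn1 natrD; ring.
Qed.

Hypothesis OA : forall i, O 0 (fun w => A i w / (1 + `|x w|)).
Hypothesis OB : forall i, O 0 (fun w => B i w / (1 + `|x w|)).
Hypothesis ORm : forall i, O 0 (fun w => Rm i w / (1 + `|x w|)).

(** All quantities are divided by the root of [lyap x]. The relative change of [lyap] is then O(rho)
    with constants depending on the noise alone, and (1 + y)^p is expanded to first order. The terms
    of order rho are kept exactly, since they will vanish in the mean; the rest is O(rho^2) times
    [lyap x ^+ p]. *)
Lemma lyap_step (p : nat) : exists (C : R) (q : nat), 0 <= C /\
  forall w (y : 'rV[R]_n), dom w ->
    (forall i, y 0 i = x w 0 i + (rho w * (zeta w * A i w + s w * B i w) + rho w ^+ 2 * Rm i w)) ->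
    lyap y ^+ p <= lyap (x w) ^+ p
      + p%:R * (2 * rho w * (zeta w * (lyap (x w) ^+ p.-1 * \sum_i x w 0 i * A i w)
        + s w * (lyap (x w) ^+ p.-1 * \sum_i x w 0 i * B i w)))
      + C * rho w ^+ 2 * (lyap (x w) ^+ p * (1 + zeta w ^+ 2) ^+ q).
Proof.
pose v w := Num.sqrt (lyap (x w)).
have v0 w : 0 < v w by rewrite sqrtr_gt0 lyap_gt0.
have vv w : v w * v w = lyap (x w) by rewrite -expr2 sqr_sqrtr ?(ltW (lyap_gt0 _)).
have Ov (f : W -> R) : O 0 (fun w => f w / (1 + `|x w|)) -> O 0 (fun w => f w / v w).
  move=> h; apply: (big_O_le (psi := fun w => 2 * (f w / (1 + `|x w|)))); last exact: big_OZ.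
  move=> w dw; rewrite !normrM mulrCA ler_wpM2l//.
  have nx : 0 < 1 + `|x w| by rewrite ltr_wpDr.
  rewrite (ger0_norm (ler0n _ 2)) !ger0_norm ?invr_ge0 ?(ltW (v0 w)) ?(ltW nx)//.
  by rewrite -[leLHS]mul1r ler_pdivrMr// mulrAC ler_pdivlMr// mul1r norm_le_sqrt_lyap.
have Ox i : O 0 (fun w => x w 0 i / v w).
  apply: Ov; apply: (big_O_le (psi := fun=> 1)); last exact: big_O_cst.
  move=> w dw; have nx : 0 < 1 + `|x w| by rewrite ltr_wpDr.
  rewrite normr1 normrM normfV (ger0_norm (ltW nx)) ler_pdivrMr// mul1r.
  by apply: le_trans (coord_norm_le _ i) _; rewrite lerDr.
pose m w := \sum_i (x w 0 i / v w) * (2 * (zeta w * (A i w / v w) + s w * (B i w / v w))).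
pose ph i w := rho w * (zeta w * (A i w / v w) + s w * (B i w / v w)) + rho w ^+ 2 * (Rm i w / v w).
(* The relative change of [lyap] is rho m + r, with m linear in the noise and the sign and r =
   O(rho^2). *)
pose r w := \sum_i 2 * (x w 0 i / v w) * (rho w ^+ 2 * (Rm i w / v w)) + \sum_i ph i w ^+ 2.
have Orho : O 1 rho by exact: big_O_rho.
have Orho2 : O 2 (fun w => rho w ^+ 2) by exact: (big_OX (k := 1) 2).
have OAB i : O 0 (fun w => zeta w * (A i w / v w) + s w * (B i w / v w)).
  apply: (big_OD g1 rho0').
    by apply: (big_OM (k := 0) (l := 0)); [exact: big_O_zeta|exact: Ov].
  by apply: (big_OM (k := 0) (l := 0)); [exact: big_O_sign|exact: Ov].
have Om : O 0 m.
  apply: (big_O_sum g1 rho0') => // i; apply: (big_OM (k := 0) (l := 0)) => //.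
  exact: big_OZ.
have Oph i : O 1 (ph i).
  apply: (big_OD g1 rho0'); first exact: (big_OM (k := 1) (l := 0)).
  apply: (big_OW g1 rho0' rho1 (k := 2)) => //.
  by apply: (big_OM (k := 2) (l := 0)) => //; exact: Ov.
have Or : O 2 r.
  apply: (big_OD g1 rho0'); apply: (big_O_sum g1 rho0') => i; last exact: (big_OX (k := 1) 2).
  apply: (big_OM (k := 0) (l := 2)); first exact: big_OZ.
  by apply: (big_OM (k := 2) (l := 0)) => //; exact: Ov.
have Oy : O 1 (fun w => rho w * m w + r w).
  apply: (big_OD g1 rho0'); first exact: (big_OM (k := 1) (l := 0)).
  exact: big_OW Or.
have Orem := big_OD g1 rho0' (big_O_pow1p p Oy) (big_OZ p%:R Or).
have [C [q [C0 hC]]] := Orem.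
exists C, q; split => // w y dw yE.
have yl : lyap y = lyap (x w) * (1 + (rho w * m w + r w)).
  rewrite -vv /lyap.
  have -> : \sum_i y 0 i ^+ 2 = \sum_i (x w 0 i ^+ 2 + v w * v w *
     (rho w * ((x w 0 i / v w) * (2 * (zeta w * (A i w / v w) + s w * (B i w / v w))))
      + (2 * (x w 0 i / v w) * (rho w ^+ 2 * (Rm i w / v w)) + ph i w ^+ 2))).
    apply: eq_bigr => i _; rewrite yE /ph; field; rewrite gt_eqF//.
  rewrite big_split/= -mulr_sumr big_split/= -mulr_sumr big_split/= -/(m w) -/(r w).
  by rewrite [RHS]mulrDr mulr1 addrA; congr (_ + _); rewrite vv.
have mE : lyap (x w) ^+ p * (p%:R * (rho w * m w)) =
  p%:R * (2 * rho w * (zeta w * (lyap (x w) ^+ p.-1 * \sum_i x w 0 i * A i w)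
        + s w * (lyap (x w) ^+ p.-1 * \sum_i x w 0 i * B i w))).
  (* At p = 0 the exponent [p.-1] is a default value, harmless because of the factor p. *)
  case: p {Orem hC} => [|p /=]; first by rewrite mul0r mulr0 mul0r.
  have -> : m w = 2 * (zeta w * (\sum_i x w 0 i * A i w) + s w * (\sum_i x w 0 i * B i w)) / lyap (x w).
    rewrite -vv !mulr_sumr -big_split/= mulr_sumr mulr_suml; apply: eq_bigr => i _.
    by field; rewrite gt_eqF.
  by rewrite exprS; field; rewrite gt_eqF ?lyap_gt0.
rewrite yl exprMn -mE.
have := hC w dw; rewrite ler_norml => /andP[_ h].
have V0 : 0 <= lyap (x w) ^+ p by rewrite exprn_ge0 ?(ltW (lyap_gt0 _)).
have -> : lyap (x w) ^+ p + lyap (x w) ^+ p * (p%:R * (rho w * m w)) +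
    C * rho w ^+ 2 * (lyap (x w) ^+ p * (1 + zeta w ^+ 2) ^+ q) =
    lyap (x w) ^+ p * (1 + p%:R * (rho w * m w) + C * (1 + zeta w ^+ 2) ^+ q * rho w ^+ 2) by ring.
by rewrite ler_wpM2l//; move: h; rewrite -/(g w); lra.
Qed.

End LyapunovStep.

(** At x = 0 the polynomial bound is uniform in t, and the Lipschitz bound carries it to all x. *)
Lemma linear_growth {R : realType} {n : nat} (a : R -> 'rV[R]_n -> 'rV[R]_n) (t0 tm : R) :
  lipschitz_in_space t0 tm a -> (forall i, poly_growth t0 tm (fun z => a z.1 z.2 0 i)) ->
  exists L : R, 1 <= L /\ forall t, t0 <= t <= tm ->
    (forall x y, `|a t x - a t y| <= L * `|x - y|) /\
    (forall x, `|a t x| <= L * (1 + `|x|)).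
Proof.
move=> [L hL] /choice[K /choice[p hK]].
pose M := \sum_i (`|K i| * 2); pose L' := 1 + `|L| + M.
have M0 : 0 <= M by apply: sumr_ge0 => i _; exact: mulr_ge0.
have LL' : `|L| <= L' by rewrite /L'; lra.
exists L'; split => [|t tI]; first by rewrite /L' -addrA lerDl addr_ge0.
have lip x y : `|a t x - a t y| <= L' * `|x - y|.
  apply: le_trans (hL t x y tI) _; rewrite ler_wpM2r//.
  exact: le_trans (ler_norm _) LL'.
have a0 : `|a t 0| <= M.
  apply: le_trans (norm_le_sum _) _; apply: ler_sum => i _.
  apply: le_trans (hK i t 0 tI) _; apply: le_trans (ler_wpM2r _ (ler_norm _)) _.
    by rewrite addr_ge0// exprn_ge0.
  rewrite ler_wpM2l// normr0 -[leRHS]/(1 + 1) lerD2l.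
  by case: (p i) => [|q]; rewrite ?expr0// expr0n.
split=> // x; rewrite -[a t x](subrK (a t 0)).
apply: le_trans (ler_normD _ _) _; have := lip x 0; rewrite subr0 => h.
have ML' : M <= L' by rewrite /L' lerDr addr_ge0.
by rewrite mulrDr mulr1 addrC; apply: lerD => //; exact: le_trans a0 ML'.
Qed.

Section StepStability.
Context {R : realType} {n : nat}.
Variables (a b : R -> 'rV[R]_n -> 'rV[R]_n) (t0 tm L : R).
Hypothesis L1 : 1 <= L.
Hypothesis lipb : forall t x y, t0 <= t <= tm -> `|b t x - b t y| <= L * `|x - y|.
Hypothesis groa : forall t x, t0 <= t <= tm -> `|a t x| <= L * (1 + `|x|).
Hypothesis grob : forall t x, t0 <= t <= tm -> `|b t x| <= L * (1 + `|x|).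
Let L0 : 0 <= L. Proof. exact: le_trans L1. Qed.

(** The Lipschitz constant is of order 1/r. This is affordable because the step multiplies the
    correction by (dW^2 - h)/2, which is of size r^2. *)
Lemma milstein_corr_lip t x y (r : R) : t0 <= t <= tm -> 0 < r -> r <= 1 ->
  `|milstein_corr b r t x - milstein_corr b r t y| <= r^-1 * (L * (2 + L) * `|x - y|).
Proof.
move=> tI r0 r1; rewrite /milstein_corr -scalerBr normrZ ger0_norm ?invr_ge0 ?(ltW r0)//.
rewrite ler_pM2l ?invr_gt0//.
rewrite [X in `|X|](_ : _ = (b t (x + r *: b t x) - b t (y + r *: b t y)) - (b t x - b t y)); last first.
  by rewrite !opprB addrACA [RHS]addrACA; congr (_ + _); rewrite addrC.
apply: le_trans (ler_normB _ _) _.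
have h1 := lipb (x + r *: b t x) (y + r *: b t y) tI.
have h2 := lipb x y tI.
have h3 : `|x + r *: b t x - (y + r *: b t y)| <= `|x - y| + L * `|x - y|.
  rewrite opprD addrACA -scalerBr; apply: le_trans (ler_normD _ _) _.
  rewrite lerD2l normrZ ger0_norm ?(ltW r0)//; apply: le_trans h2.
  by rewrite ler_piMl.
have := ler_wpM2l L0 h3; have := normr_ge0 (x - y); lra.
Qed.

Lemma milstein_corr_growth t x (r : R) : t0 <= t <= tm -> 0 < r -> r <= 1 ->
  `|milstein_corr b r t x| <= L ^+ 2 * (1 + `|x|).
Proof.
move=> tI r0 r1; rewrite /milstein_corr normrZ ger0_norm ?invr_ge0 ?(ltW r0)//.
rewrite ler_pdivrMl//; apply: le_trans (lipb _ _ tI) _.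
rewrite addrC addKr normrZ ger0_norm ?(ltW r0)// mulrCA ler_pM2l//.
by rewrite expr2 -mulrA ler_wpM2l// grob.
Qed.

(** The parameter set over which the constants of the moment estimates are uniform; [pt_root] is the
    square root of the step. *)
Record step_point := StepPoint {
  pt_time : R ; pt_state : 'rV[R]_n ; pt_noise : R ; pt_sign : R ; pt_root : R }.

Definition step_dom (w : step_point) : Prop :=
  [/\ t0 <= pt_time w <= tm, t0 <= pt_time w + pt_root w ^+ 2 <= tm,
      0 < pt_root w, pt_root w <= 1 & pt_sign w ^+ 2 = 1].

Let rho0 w : step_dom w -> 0 < pt_root w. Proof. by case. Qed.
Let rho1 w : step_dom w -> pt_root w <= 1. Proof. by case. Qed.
Let rho0' w : step_dom w -> 0 <= pt_root w. Proof. by move/rho0/ltW. Qed.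
Let s1 w : step_dom w -> pt_sign w ^+ 2 = 1. Proof. by case. Qed.
Let g w := 1 + pt_noise w ^+ 2.
Let g1 w : step_dom w -> 1 <= g w. Proof. by move=> _; rewrite lerDl sqr_ge0. Qed.
Local Notation O := (big_O step_dom g pt_root).
Let nx w : 0 < 1 + `|pt_state w|. Proof. by rewrite ltr_wpDr. Qed.

Let O_rel (y : step_point -> 'rV[R]_n) (C : step_point -> R) i : O 0 C ->
  (forall w, step_dom w -> `|y w| <= C w * (1 + `|pt_state w|)) ->
  O 0 (fun w => y w 0 i / (1 + `|pt_state w|)).
Proof.
move=> hC h; apply: big_O_le hC => w dw.
rewrite normrM normfV (ger0_norm (ltW (nx w))) ler_pdivrMr//.
apply: le_trans (coord_norm_le _ _) _; apply: le_trans (h w dw) _.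
by rewrite ler_wpM2r ?(ltW (nx w))// ler_norm.
Qed.

Lemma milstein_lyap_step (p : nat) : exists (C : R) (q : nat), 0 <= C /\
  forall (t rho zeta : R) (x : 'rV[R]_n), t0 <= t <= tm -> t0 <= t + rho ^+ 2 <= tm ->
    0 < rho -> rho <= 1 ->
    lyap (milstein_step a b (rho ^+ 2) t (rho * zeta) x) ^+ p <= lyap x ^+ p
      + p%:R * (2 * rho * (zeta * (lyap x ^+ p.-1 * \sum_i x 0 i * b t x 0 i)))
      + C * rho ^+ 2 * (lyap x ^+ p * (1 + zeta ^+ 2) ^+ q).
Proof.
pose c w := milstein_corr b (pt_root w) (pt_time w) (pt_state w).
pose Rm i w := a (pt_time w) (pt_state w) 0 i + 2^-1 * (pt_noise w ^+ 2 - 1) * c w 0 i.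
have OA i : O 0 (fun w => b (pt_time w) (pt_state w) 0 i / (1 + `|pt_state w|)).
  apply: (O_rel (C := fun=> L)); first exact: big_O_cst.
  by move=> w [tI _ _ _ _]; exact: grob.
(* The Milstein step contains no sign: B = 0, and the sign of the point is set to 1 below. *)
have OB (i : 'I_n) : O 0 (fun w => 0 / (1 + `|pt_state w|)).
  by apply: eq_big_O (big_O0 _ _ _ 0) => w _; rewrite mul0r.
have Oz : O 0 pt_noise by exact: big_O_zeta.
have ORm i : O 0 (fun w => Rm i w / (1 + `|pt_state w|)).
  have h1 : O 0 (fun w => a (pt_time w) (pt_state w) 0 i / (1 + `|pt_state w|)).
    apply: (O_rel (C := fun=> L)); first exact: big_O_cst.
    by move=> w [tI _ _ _ _]; exact: groa.
  have h2 : O 0 (fun w => c w 0 i / (1 + `|pt_state w|)).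
    apply: (O_rel (C := fun=> L ^+ 2)); first exact: big_O_cst.
    by move=> w [tI _ r0 r1 _]; exact: milstein_corr_growth.
  have h3 : O 0 (fun w => 2^-1 * (pt_noise w ^+ 2 - 1)).
    apply: big_OZ; apply: big_OB => //; first exact: (big_OX (k := 0) 2).
    exact: big_O_cst.
  apply: eq_big_O (big_OD g1 rho0' h1 (big_OM (k := 0) (l := 0) h3 h2)) => w dw.
  by rewrite /Rm mulrDl mulrA.
have [C [q [C0 h]]] := lyap_step rho0 rho1 s1 OA OB ORm p.
exists C, q; split => // t rho zeta x tI tI' r0 r1.
have dw : step_dom (StepPoint t x zeta 1 rho) by split => //; rewrite expr1n.
have := h _ (milstein_step a b (rho ^+ 2) t (rho * zeta) x) dw.
have e0 : \sum_i x 0 i * (0 : R) = 0 by rewrite big1// => i _; rewrite mulr0.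
rewrite /= e0 !mulr0 addr0; apply => i; rewrite milstein_stepE /Rm /c /=.
rewrite sqrtr_sqr (ger0_norm (ltW r0)).
by field.
Qed.

(** In K2 the shift of the state by K1 costs only O(rho) by the Lipschitz bound, relative to 1 +
    |x|, and goes to the remainder. The shift of the time stays in the leading part: a time
    derivative of b may grow faster than linearly in x. This is the origin of the term with the
    sign. *)
Lemma rk_lyap_step (p : nat) : exists (C : R) (q : nat), 0 <= C /\
  forall (t rho zeta s : R) (x : 'rV[R]_n), t0 <= t <= tm -> t0 <= t + rho ^+ 2 <= tm ->
    0 < rho -> rho <= 1 -> s ^+ 2 = 1 ->
    lyap (rk_step a b (rho ^+ 2) t (t + rho ^+ 2) (rho * zeta) s x) ^+ p <= lyap x ^+ p
      + p%:R * (2 * rho * (zeta * (lyap x ^+ p.-1 * \sum_i x 0 i *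
            (2^-1 * (b t x 0 i + b (t + rho ^+ 2) x 0 i)))
        + s * (lyap x ^+ p.-1 * \sum_i x 0 i *
            (2^-1 * (b (t + rho ^+ 2) x 0 i - b t x 0 i)))))
      + C * rho ^+ 2 * (lyap x ^+ p * (1 + zeta ^+ 2) ^+ q).
Proof.
pose T w := pt_time w; pose T' w := T w + pt_root w ^+ 2; pose X w := pt_state w.
pose K1 w := pt_root w ^+ 2 *: a (T w) (X w)
  + (pt_root w * (pt_noise w - pt_sign w)) *: b (T w) (X w).
pose A i w := 2^-1 * (b (T w) (X w) 0 i + b (T' w) (X w) 0 i).
pose B i w := 2^-1 * (b (T' w) (X w) 0 i - b (T w) (X w) 0 i).
(* Here b(t', x + K1) = b(t', x) + rho y, with y of linear growth. *)
pose y w := (pt_root w)^-1 *: (b (T' w) (X w + K1 w) - b (T' w) (X w)).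
pose Rm i w := 2^-1 * (a (T w) (X w) 0 i + a (T' w) (X w + K1 w) 0 i)
  + 2^-1 * (pt_noise w + pt_sign w) * y w 0 i.
have Oz : O 0 pt_noise by exact: big_O_zeta.
have Os : O 0 pt_sign by exact: big_O_sign.
pose k w := L * (1 + `|pt_noise w - pt_sign w|).
have k0 w : 0 <= k w by rewrite mulr_ge0 ?addr_ge0.
have Ok : O 0 k.
  apply: big_OZ; apply: (big_OD g1 rho0'); first exact: big_O_cst.
  by apply: big_O_norm; exact: big_OB.
have K1le w : step_dom w -> `|K1 w| <= pt_root w * (k w * (1 + `|X w|)).
  move=> [tI tI' r0 r1 _]; apply: le_trans (ler_normD _ _) _; rewrite !normrZ.
  rewrite (gtr0_norm r0) -!mulrA -mulrDr ler_pM2l//.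
  have ha := groa (X w) tI.
  have hb := ler_wpM2l (normr_ge0 (pt_noise w - pt_sign w)) (grob (X w) tI).
  by have := ler_wpM2r (normr_ge0 (a (T w) (X w))) r1; rewrite /k; lra.
have Ob i : O 0 (fun w => b (T w) (X w) 0 i / (1 + `|pt_state w|)).
  apply: (O_rel (C := fun=> L)); first exact: big_O_cst.
  by move=> w [tI _ _ _ _]; exact: grob.
have Ob' i : O 0 (fun w => b (T' w) (X w) 0 i / (1 + `|pt_state w|)).
  apply: (O_rel (C := fun=> L)); first exact: big_O_cst.
  by move=> w [_ tI _ _ _]; exact: grob.
have OA i : O 0 (fun w => A i w / (1 + `|pt_state w|)).
  apply: eq_big_O (big_OZ 2^-1 (big_OD g1 rho0' (Ob i) (Ob' i))) => w dw.
  by rewrite /A -mulrA mulrDl.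
have OB i : O 0 (fun w => B i w / (1 + `|pt_state w|)).
  apply: eq_big_O (big_OZ 2^-1 (big_OB g1 rho0' (Ob' i) (Ob i))) => w dw.
  by rewrite /B -mulrA mulrBl.
have ORm i : O 0 (fun w => Rm i w / (1 + `|pt_state w|)).
  have h1 : O 0 (fun w => a (T w) (X w) 0 i / (1 + `|pt_state w|)).
    apply: (O_rel (C := fun=> L)); first exact: big_O_cst.
    by move=> w [tI _ _ _ _]; exact: groa.
  have h2 : O 0 (fun w => a (T' w) (X w + K1 w) 0 i / (1 + `|pt_state w|)).
    apply: (O_rel (y := fun w => a (T' w) (X w + K1 w)) (C := fun w => L * (1 + k w))).
      by apply: big_OZ; apply: (big_OD g1 rho0') => //; exact: big_O_cst.
    move=> w dw; have [_ tI' r0 r1 _] := dw.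
    apply: le_trans (groa _ tI') _; rewrite -mulrA ler_wpM2l//.
    apply: (@le_trans _ _ (1 + `|X w| + `|K1 w|)).
      by rewrite -addrA lerD2l ler_normD.
    rewrite mulrDl mul1r lerD2l; apply: le_trans (K1le w dw) _.
    by rewrite ler_piMl ?mulr_ge0 ?(ltW (nx w)).
  have h3 : O 0 (fun w => y w 0 i / (1 + `|pt_state w|)).
    apply: (O_rel (C := fun w => L * k w)); first exact: big_OZ.
    move=> w dw; have [_ tI' r0 r1 _] := dw.
    rewrite normrZ ger0_norm ?invr_ge0 ?(ltW r0)// ler_pdivrMl//.
    apply: le_trans (lipb _ _ tI') _; rewrite addrC addKr.
    by have := ler_wpM2l L0 (K1le w dw); rewrite !mulrA [L * pt_root w]mulrC.
  have h4 : O 0 (fun w => 2^-1 * (pt_noise w + pt_sign w)).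
    by apply: big_OZ; exact: (big_OD g1 rho0').
  have h5 := big_OD g1 rho0' (big_OZ 2^-1 (big_OD g1 rho0' h1 h2)) (big_OM (k := 0) (l := 0) h4 h3).
  apply: eq_big_O h5 => w dw.
  by rewrite /Rm; ring.
have [C [q [C0 h]]] := lyap_step rho0 rho1 s1 OA OB ORm p.
exists C, q; split => // t rho zeta s x tI tI' r0 r1 ss.
have dw : step_dom (StepPoint t x zeta s rho) by split.
apply: (h _ (rk_step a b (rho ^+ 2) t (t + rho ^+ 2) (rho * zeta) s x) dw) => i.
rewrite /A /B /Rm /y /rk_step /T' /T /X /K1 /= sqrtr_sqr (ger0_norm (ltW r0)).
have -> : (rho * (zeta - s)) = rho * zeta - s * rho by ring.
rewrite !mxE; move: (a (t + _) _ 0 i) (b (t + _) (x + _) 0 i) => a1 b1.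
by field; rewrite gt_eqF.
Qed.

End StepStability.

(** * One-step errors in mean square *)

Section AdaptedMoments.
Context {R : realType} {d : measure_display} {T : measurableType d}.
Variables (P : probability T R) (F : R -> set (set T)) (W : R -> T -> R).
Hypothesis fF : filtration F.
Hypothesis wW : wiener P F W.
Local Notation E f := (Rintegral P setT f).

(** The multipliers against which a conditional mean zero is tested. *)
Definition adapted_mom (t : R) (Y : T -> R) : Prop :=
  rv_measurable (F t) Y /\ all_moments P Y.

Let sF t : 0 <= t -> sigma_algebra setT (F t). Proof. exact: filtration_sigma fF t. Qed.

Section FixedTime.
Variable t : R.
Hypothesis t0 : 0 <= t.
Local Notation A := (adapted_mom t).

Lemma adapted_mom_cst (c : R) : A (fun=> c).
Proof. by split; [exact (rv_measurable_cst (sF t0) c)|exact: all_moments_cst]. Qed.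

Lemma adapted_momD Y Z : A Y -> A Z -> A (fun w => Y w + Z w).
Proof.
by move=> [m1 h1] [m2 h2]; split; [exact (rv_measurableD (sF t0) m1 m2)|exact: all_momentsD].
Qed.

Lemma adapted_momB Y Z : A Y -> A Z -> A (fun w => Y w - Z w).
Proof.
by move=> [m1 h1] [m2 h2]; split; [exact (rv_measurableB (sF t0) m1 m2)|exact: all_momentsB].
Qed.

Lemma adapted_momM Y Z : A Y -> A Z -> A (fun w => Y w * Z w).
Proof.
by move=> [m1 h1] [m2 h2]; split; [exact (rv_measurableM (sF t0) m1 m2)|exact: all_momentsM].
Qed.

Lemma adapted_momZ (c : R) Y : A Y -> A (fun w => c * Y w).
Proof. by apply: adapted_momM; exact: adapted_mom_cst. Qed.

Lemma adapted_momX k Y : A Y -> A (fun w => Y w ^+ k).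
Proof.
by move=> [m1 h1]; split; [exact (rv_measurableX (sF t0) k m1)|exact: all_momentsX].
Qed.

Lemma adapted_mom_sum (I : Type) (s : seq I) (Q : pred I) (Y : I -> T -> R) :
  (forall i, Q i -> A (Y i)) -> A (fun w => \sum_(i <- s | Q i) Y i w).
Proof.
move=> h; split; first by refine (rv_measurable_sum (sF t0) _) => i /h[].
by apply: all_moments_sum => i /h[].
Qed.

Lemma adapted_mom_lyap n (x : T -> 'rV[R]_n) : (forall i, A (fun w => x w 0 i)) ->
  A (fun w => lyap (x w)).
Proof.
move=> hx; apply: adapted_momD; first exact: adapted_mom_cst.
by apply: adapted_mom_sum => i _; exact: adapted_momX.
Qed.

Lemma adapted_mom_poly n (lo hi s : R) (f : R * 'rV[R]_n -> R) (x : T -> 'rV[R]_n) :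
  continuous f -> poly_growth lo hi f -> lo <= s <= hi ->
  (forall i, A (fun w => x w 0 i)) -> A (fun w => f (s, x w)).
Proof.
move=> cf [K [p hK]] sI hx.
have mf : rv_measurable (F t) (fun w => f (s, x w)).
  by refine (rv_measurable_vector (sF t0) s cf _) => i; have [] := hx i.
split => //; apply: (all_moments_dom (Z := fun w => `|K| * (1 + lyap (x w) ^+ p))).
- apply: all_momentsZ; apply: all_momentsD; first exact: all_moments_cst.
  by apply: all_momentsX; have [] := adapted_mom_lyap hx.
- apply: rv_measurable_fun mf; exact: (filtration_sub fF t0).
- move=> w; apply: le_trans (hK s (x w) sI) _; apply: le_trans (ler_norm _) _.
  have l0 := ltW (lyap_gt0 (x w)).
  rewrite !normrM normr_id ler_wpM2l// !ger0_norm ?addr_ge0 ?exprn_ge0//.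
  by rewrite lerD2l lerXn2r ?nnegrE ?norm_le_lyap.
Qed.

Lemma adapted_mom_smooth n N (lo hi s : R) (f : R * 'rV[R]_n -> R) (x : T -> 'rV[R]_n) :
  smooth N lo hi f -> lo <= s <= hi ->
  (forall i, A (fun w => x w 0 i)) -> A (fun w => f (s, x w)).
Proof.
by move=> sf; apply: adapted_mom_poly; [exact: smooth_continuous sf|exact: smooth_poly_growth sf].
Qed.

End FixedTime.

Lemma adapted_momS s t Y : 0 <= s -> s <= t -> adapted_mom s Y -> adapted_mom t Y.
Proof.
by move=> s0 st [m1 h1]; split => //; apply: rv_measurableS m1; exact: filtration_mono fF _ _ s0 st.
Qed.

Definition unit_noise (s t : R) (w : T) : R := (W t w - W s w) / Num.sqrt (t - s).

(** The moment E (1 + Z^2)^q of a standard normal Z, expanded binomially. *)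
Definition gauss_sum (q : nat) : R := \sum_(j < q.+1) gauss_moment j *+ 'C(q, j).

Lemma gauss_sum_ge0 q : 0 <= gauss_sum q.
Proof. by apply: sumr_ge0 => j _; rewrite mulrn_wge0// gauss_moment_ge0. Qed.

Section UnitNoise.
Variables s t : R.
Hypotheses (s0 : 0 <= s) (st : s < t).
Let t0 : 0 <= t. Proof. exact: le_trans s0 (ltW st). Qed.
Let r := Num.sqrt (t - s).
Let r0 : 0 < r. Proof. by rewrite sqrtr_gt0 subr_gt0. Qed.
Let xi w := W t w - W s w.
Local Notation zeta := (unit_noise s t).

Let rvxi : rv_measurable (F t) xi.
Proof.
refine (rv_measurableB (sF t0) _ _); first exact: wiener_adapted wW _ t0.
apply: rv_measurableS (wiener_adapted wW s0).
exact: filtration_mono fF _ _ s0 (ltW st).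
Qed.

Let mxi : measurable_fun setT xi.
Proof. apply: rv_measurable_fun rvxi; exact: filtration_sub fF _ t0. Qed.

Let normal := wiener_increment wW s0 st.

Lemma increment_scale w : W t w - W s w = r * zeta w.
Proof. by rewrite /unit_noise mulrCA divff ?mulr1// gt_eqF. Qed.

Lemma adapted_noise : adapted_mom t zeta.
Proof.
have h : adapted_mom t xi by split; [exact: rvxi|exact: all_moments_normal mxi r0 normal].
have -> : zeta = (fun w => r^-1 * xi w) by apply/funext => w; rewrite mulrC.
exact: adapted_momZ.
Qed.

Lemma mean_noise_fun (phi : R -> R) U : measurable_fun setT phi ->
  all_moments P (phi \o zeta) -> adapted_mom s U ->
  E (fun w => U w * phi (zeta w)) = E U * E (phi \o zeta).
Proof.
move=> mphi hphi [mU hU].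
apply: (mean_indep (wiener_indep wW s0 st) mU _ hU hphi).
have mg : measurable_fun setT (fun y : R => phi (y / r)).
  by apply: measurableT_comp mphi _; exact: measurable_funM.
move=> _ [B mB <-]; exists ((fun y : R => phi (y / r)) @^-1` B) => //.
by rewrite -[X in measurable X]setTI; exact: mg.
Qed.

Lemma mean_noise_even U q : adapted_mom s U ->
  E (fun w => U w * zeta w ^+ q.*2) = E U * gauss_moment q.
Proof.
move=> hU; apply: etrans (mean_noise_fun (phi := fun y => y ^+ q.*2) _ _ hU) _.
- exact: exprn_measurable.
- by apply: all_momentsX; have [] := adapted_noise.
congr (_ * _).
transitivity (E (fun w => r^-1 ^+ q.*2 * xi w ^+ q.*2)).
  by apply: eq_Rintegral => w _; rewrite /unit_noise -exprMn mulrC.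
have hxi := all_moments_normal mxi r0 normal.
rewrite meanZ; last exact: all_momentsX.
rewrite (mean_normal_even mxi r0 normal) mulrCA -exprMn mulVf ?gt_eqF//.
by rewrite expr1n mulr1.
Qed.

Lemma mean_noise_odd U q : adapted_mom s U ->
  E (fun w => U w * zeta w ^+ q.*2.+1) = 0.
Proof.
move=> hU; apply: etrans (mean_noise_fun (phi := fun y => y ^+ q.*2.+1) _ _ hU) _.
- exact: exprn_measurable.
- by apply: all_momentsX; have [] := adapted_noise.
suff -> : E ((fun y : R => y ^+ q.*2.+1) \o zeta) = 0 by rewrite mulr0.
transitivity (E (fun w => r^-1 ^+ q.*2.+1 * xi w ^+ q.*2.+1)).
  by apply: eq_Rintegral => w _; rewrite /unit_noise -exprMn mulrC.
have hxi := all_moments_normal mxi r0 normal.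
rewrite meanZ; last exact: all_momentsX.
by rewrite (mean_normal_odd mxi r0 normal) mulr0.
Qed.

Let noise_pow U k : adapted_mom s U -> all_moments P (fun w => U w * zeta w ^+ k).
Proof.
move=> [_ hU]; apply: all_momentsM => //; apply: all_momentsX.
by have [] := adapted_noise.
Qed.

Lemma mean_noise1 U : adapted_mom s U -> E (fun w => U w * zeta w) = 0.
Proof. exact: (mean_noise_odd 0). Qed.

Lemma mean_noise3 U : adapted_mom s U -> E (fun w => U w * zeta w ^+ 3) = 0.
Proof. exact: (mean_noise_odd 1). Qed.

Lemma mean_noise2 U : adapted_mom s U -> E (fun w => U w * zeta w ^+ 2) = E U.
Proof. by move=> hU; rewrite (mean_noise_even 1 hU) gauss_moment1 mulr1. Qed.

Lemma mean_noise_gauss_sum U q : adapted_mom s U ->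
  E (fun w => U w * (1 + zeta w ^+ 2) ^+ q) = E U * gauss_sum q.
Proof.
move=> hU.
transitivity (E (fun w => \sum_(j < q.+1) 'C(q, j)%:R * (U w * zeta w ^+ j.*2))).
  apply: eq_Rintegral => w _; rewrite exprDn mulr_sumr; apply: eq_bigr => j _.
  by rewrite expr1n mul1r -exprM mul2n mulrnAr mulr_natl.
rewrite mean_sum => [|j _]; last by apply: all_momentsZ; exact: noise_pow.
rewrite /gauss_sum mulr_sumr; apply: eq_bigr => j _.
by rewrite meanZ ?mean_noise_even// ?mulr_natl ?mulrnAr//; exact: noise_pow.
Qed.

End UnitNoise.
End AdaptedMoments.

Section MilsteinScheme.
Context {R : realType} {n : nat}.

Fixpoint milstein_scheme (a b : R -> 'rV[R]_n -> 'rV[R]_n) (t0 h : R) (W : R -> R)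
    (x0 : 'rV[R]_n) (k : nat) : 'rV[R]_n :=
  if k is k'.+1 then
    milstein_step a b h (grid t0 h k') (W (grid t0 h k) - W (grid t0 h k'))
      (milstein_scheme a b t0 h W x0 k')
  else x0.

Lemma gridS (t0 h : R) k : grid t0 h k.+1 = grid t0 h k + h.
Proof. by rewrite /grid -addn1 natrD mulrDl mul1r addrA. Qed.

End MilsteinScheme.

Section SchemeMoments.
Context {R : realType} {d : measure_display} {T : measurableType d}.
Variables (P : probability T R) (F : R -> set (set T)) (W : R -> T -> R).
Hypothesis fF : filtration F.
Hypothesis wW : wiener P F W.
Local Notation E f := (Rintegral P setT f).
Context {n : nat}.
Variables (a b : R -> 'rV[R]_n -> 'rV[R]_n) (t0 tm L : R).
Hypothesis t00 : 0 <= t0.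
Hypothesis sa : forall i, smooth 3 t0 tm (fun z => a z.1 z.2 0 i).
Hypothesis sb : forall i, smooth 3 t0 tm (fun z => b z.1 z.2 0 i).
Hypothesis L1 : 1 <= L.
Hypothesis lipa : forall t x y, t0 <= t <= tm -> `|a t x - a t y| <= L * `|x - y|.
Hypothesis lipb : forall t x y, t0 <= t <= tm -> `|b t x - b t y| <= L * `|x - y|.
Hypothesis groa : forall t x, t0 <= t <= tm -> `|a t x| <= L * (1 + `|x|).
Hypothesis grob : forall t x, t0 <= t <= tm -> `|b t x| <= L * (1 + `|x|).
Let L0 : 0 <= L. Proof. exact: le_trans L1. Qed.
Local Notation A := (adapted_mom P F).

Definition adapted_vec (t : R) (x : T -> 'rV[R]_n) : Prop :=
  forall i, A t (fun w => x w 0 i).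

Lemma adapted_vecS s t x : 0 <= s -> s <= t -> adapted_vec s x -> adapted_vec t x.
Proof. by move=> s0 st hx i; exact: adapted_momS fF _ _ _ s0 st (hx i). Qed.

Lemma adapted_vecD t x y : 0 <= t -> adapted_vec t x -> adapted_vec t y ->
  adapted_vec t (fun w => x w + y w).
Proof.
by move=> tge hx hy i; under eq_fun do rewrite mxE; exact: adapted_momD.
Qed.

Lemma adapted_vecZ t (c : T -> R) x : 0 <= t -> A t c -> adapted_vec t x ->
  adapted_vec t (fun w => c w *: x w).
Proof.
by move=> tge hc hx i; under eq_fun do rewrite mxE; exact: adapted_momM.
Qed.

Lemma adapted_vec_a s t x : 0 <= t -> t0 <= s <= tm -> adapted_vec t x ->
  adapted_vec t (fun w => a s (x w)).
Proof. by move=> tge sI hx i; exact: (adapted_mom_smooth fF tge (sa i) sI hx). Qed.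

Lemma adapted_vec_b s t x : 0 <= t -> t0 <= s <= tm -> adapted_vec t x ->
  adapted_vec t (fun w => b s (x w)).
Proof. by move=> tge sI hx i; exact: (adapted_mom_smooth fF tge (sb i) sI hx). Qed.

Lemma adapted_vec_corr (r : R) s t x : 0 <= t -> t0 <= s <= tm -> adapted_vec t x ->
  adapted_vec t (fun w => milstein_corr b r s (x w)).
Proof.
move=> tge sI hx; have cst c : A t (fun=> c) by exact: adapted_mom_cst.
rewrite /milstein_corr; apply: adapted_vecZ => //; apply: adapted_vecD => //.
  apply: adapted_vec_b => //; apply: adapted_vecD => //; apply: adapted_vecZ => //.
  exact: adapted_vec_b.
have -> : (fun w => - b s (x w)) = (fun w => (-1) *: b s (x w)).
  by apply/funext => w; rewrite scaleN1r.
by apply: adapted_vecZ => //; exact: adapted_vec_b.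
Qed.

Lemma adapted_vec_milstein (h s t : R) (dW : T -> R) x : 0 <= t -> t0 <= s <= tm ->
  A t dW -> adapted_vec t x ->
  adapted_vec t (fun w => milstein_step a b h s (dW w) (x w)).
Proof.
move=> tge sI hW hx; have cst c : A t (fun=> c) by exact: adapted_mom_cst.
rewrite /milstein_step; apply: adapted_vecD => //; apply: adapted_vecD => //.
  by apply: adapted_vecD => //; apply: adapted_vecZ => //;
    [exact: adapted_vec_a|exact: adapted_vec_b].
apply: adapted_vecZ => //; last exact: adapted_vec_corr.
by apply: adapted_momM => //; apply: adapted_momB => //; exact: adapted_momX.
Qed.

Lemma adapted_vec_rk (h s s' t sgn : R) (dW : T -> R) x : 0 <= t ->
  t0 <= s <= tm -> t0 <= s' <= tm -> A t dW -> adapted_vec t x ->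
  adapted_vec t (fun w => rk_step a b h s s' (dW w) sgn (x w)).
Proof.
move=> tge sI sI' hW hx; have cst c : A t (fun=> c) by exact: adapted_mom_cst.
have K1 : adapted_vec t (fun w => h *: a s (x w) + (dW w - sgn * Num.sqrt h) *: b s (x w)).
  apply: adapted_vecD => //; apply: adapted_vecZ => //; first exact: adapted_vec_a.
    exact: adapted_momB.
  exact: adapted_vec_b.
rewrite /rk_step; apply: adapted_vecD => //; apply: adapted_vecZ => //.
apply: adapted_vecD => //; apply: adapted_vecD => //; apply: adapted_vecZ => //.
- by apply: adapted_vec_a => //; exact: adapted_vecD.
- exact: adapted_momD.
- by apply: adapted_vec_b => //; exact: adapted_vecD.
Qed.

Definition step_ok (s rho : R) : Prop :=
  [/\ t0 <= s, s + rho ^+ 2 <= tm, 0 < rho & rho <= 1].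

Local Notation noise s rho := (unit_noise W s (s + rho ^+ 2)).

Section StepFacts.
Variables (s rho : R).
Hypothesis ok : step_ok s rho.

Lemma step_ge0 : 0 <= s. Proof. by case: ok => h _ _ _; exact: le_trans h. Qed.
Lemma step_lt : s < s + rho ^+ 2.
Proof. by case: ok => _ _ h _; rewrite ltrDl exprn_gt0. Qed.
Lemma step_end_ge0 : 0 <= s + rho ^+ 2.
Proof. exact: le_trans step_ge0 (ltW step_lt). Qed.
Lemma step_I : t0 <= s <= tm.
Proof. by case: ok => -> h _ _; rewrite (le_trans (ltW step_lt)). Qed.
Lemma step_I' : t0 <= s + rho ^+ 2 <= tm.
Proof. by case: ok => h -> _ _; rewrite (le_trans h (ltW step_lt)). Qed.
Lemma step_increment w : W (s + rho ^+ 2) w - W s w = rho * noise s rho w.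
Proof.
rewrite (increment_scale W step_lt) addrC addKr sqrtr_sqr ger0_norm//.
by case: ok => _ _ /ltW.
Qed.
Lemma adapted_step_noise : A (s + rho ^+ 2) (noise s rho).
Proof. exact: (adapted_noise fF wW step_ge0 step_lt). Qed.
Lemma adapted_step_increment : A (s + rho ^+ 2) (fun w => W (s + rho ^+ 2) w - W s w).
Proof.
under eq_fun do rewrite step_increment.
apply: (adapted_momZ fF); [exact: step_end_ge0|exact: adapted_step_noise].
Qed.
End StepFacts.

Lemma mean_lyap_milstein (p : nat) : exists C : R, 0 <= C /\
  forall s rho x, step_ok s rho -> adapted_vec s x ->
    E (fun w => lyap (milstein_step a b (rho ^+ 2) s (W (s + rho ^+ 2) w - W s w) (x w)) ^+ p)
    <= (1 + C * rho ^+ 2) * E (fun w => lyap (x w) ^+ p).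
Proof.
have [C [q [C0 h]]] := milstein_lyap_step L1 lipb groa grob p.
exists (C * gauss_sum q); split => [|s rho x ok hx].
  by rewrite mulr_ge0// gauss_sum_ge0.
have s0 := step_ge0 ok; have st := step_lt ok; have t0' := step_end_ge0 ok.
have [_ _ r0 r1] := ok.
have zA := adapted_step_noise ok; have [_ zM] := zA.
pose U w := lyap (x w) ^+ p.-1 * \sum_i x w 0 i * b s (x w) 0 i.
pose V w := lyap (x w) ^+ p.
have hV : A s V by apply: (adapted_momX fF) => //; exact: adapted_mom_lyap.
have hU : A s U.
  apply: (adapted_momM fF) => //.
    by apply: (adapted_momX fF) => //; exact: adapted_mom_lyap.
  apply: (adapted_mom_sum fF) => // i _; apply: (adapted_momM fF) => //.
  exact: (adapted_vec_b s0 (step_I ok) hx).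
have [_ mV] := hV; have [_ mU] := hU.
pose z := noise s rho.
have key w : lyap (milstein_step a b (rho ^+ 2) s (W (s + rho ^+ 2) w - W s w) (x w)) ^+ p <=
    V w + p%:R * (2 * rho) * (U w * z w) + C * rho ^+ 2 * (V w * (1 + z w ^+ 2) ^+ q).
  rewrite step_increment//.
  apply: le_trans (h s rho (z w) (x w) (step_I ok) (step_I' ok) r0 r1) _.
  by rewrite lerD2r lerD2l [U w * _]mulrC !mulrA.
have hS := adapted_vec_milstein (rho ^+ 2) t0' (step_I ok)
  (adapted_step_increment ok) (adapted_vecS s0 (ltW st) hx).
have [_ mS] := adapted_momX fF t0' p (adapted_mom_lyap fF t0' hS).
have mz : all_moments P z by [].
have := mean_le_comb (s := [:: (1, V); (p%:R * (2 * rho), fun w => U w * z w);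
  (C * rho ^+ 2, fun w => V w * (1 + z w ^+ 2) ^+ q)]) mS.
rewrite /= (mean_noise1 fF wW s0 st hU) (mean_noise_gauss_sum fF wW s0 st q hV) -/V.
move=> h1; apply: le_trans (h1 _ _) _.
- have mz1 : all_moments P (fun w => 1 + z w ^+ 2).
    by apply: all_momentsD; [exact: all_moments_cst|exact: all_momentsX].
  split; first exact: mV.
  split; first exact: all_momentsM.
  by split => //; apply: all_momentsM => //; exact: all_momentsX.
- by move=> w; apply: le_trans (key w) _; rewrite mul1r addr0 !addrA.
- by rewrite le_eqVlt; apply/orP; left; apply/eqP; ring.
Qed.

(** The term linear in the sign survives the expectation over the noise and cancels only in the
    average over the two signs. *)
Lemma mean_lyap_rk (p : nat) : exists C : R, 0 <= C /\
  forall s rho x, step_ok s rho -> adapted_vec s x ->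
    2^-1 * (\sum_(sg <- [:: 1; -1])
      E (fun w => lyap (rk_step a b (rho ^+ 2) s (s + rho ^+ 2)
          (W (s + rho ^+ 2) w - W s w) sg (x w)) ^+ p))
    <= (1 + C * rho ^+ 2) * E (fun w => lyap (x w) ^+ p).
Proof.
have avg (X1 X2 v u c k : R) : X1 <= v + c * 1 * u + k -> X2 <= v + c * -1 * u + k ->
    2^-1 * (X1 + X2) <= v + k by lra.
have [C [q [C0 h]]] := rk_lyap_step L1 lipb groa grob p.
exists (C * gauss_sum q); split => [|s rho x ok hx].
  by rewrite mulr_ge0// gauss_sum_ge0.
have s0 := step_ge0 ok; have st := step_lt ok; have t0' := step_end_ge0 ok.
have [_ _ r0 r1] := ok.
have zA := adapted_step_noise ok; have [_ zM] := zA.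
pose U1 w := lyap (x w) ^+ p.-1 * \sum_i x w 0 i *
  (2^-1 * (b s (x w) 0 i + b (s + rho ^+ 2) (x w) 0 i)).
pose U2 w := lyap (x w) ^+ p.-1 * \sum_i x w 0 i *
  (2^-1 * (b (s + rho ^+ 2) (x w) 0 i - b s (x w) 0 i)).
pose V w := lyap (x w) ^+ p.
have hl : A s (fun w => lyap (x w)) by exact: adapted_mom_lyap.
have hV : A s V by exact: (adapted_momX fF).
have hU1 : A s U1.
  apply: (adapted_momM fF) => //; first exact: (adapted_momX fF).
  apply: (adapted_mom_sum fF) => // i _; apply: (adapted_momM fF) => //.
  apply: (adapted_momZ fF) => //; apply: (adapted_momD fF) => //.
    exact: (adapted_vec_b s0 (step_I ok) hx).
  exact: (adapted_vec_b s0 (step_I' ok) hx).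
have hU2 : A s U2.
  apply: (adapted_momM fF) => //; first exact: (adapted_momX fF).
  apply: (adapted_mom_sum fF) => // i _; apply: (adapted_momM fF) => //.
  apply: (adapted_momZ fF) => //; apply: (adapted_momB fF) => //.
    exact: (adapted_vec_b s0 (step_I' ok) hx).
  exact: (adapted_vec_b s0 (step_I ok) hx).
have [_ mV] := hV; have [_ mU1] := hU1; have [_ mU2] := hU2.
pose z := noise s rho.
have key sg w : sg ^+ 2 = 1 -> lyap (rk_step a b (rho ^+ 2) s (s + rho ^+ 2)
      (W (s + rho ^+ 2) w - W s w) sg (x w)) ^+ p <=
    V w + p%:R * (2 * rho) * (U1 w * z w) + p%:R * (2 * rho) * sg * U2 w
      + C * rho ^+ 2 * (V w * (1 + z w ^+ 2) ^+ q).
  move=> sg1; rewrite step_increment//.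
  apply: le_trans (h s rho (z w) sg (x w) (step_I ok) (step_I' ok) r0 r1 sg1) _.
  by rewrite lerD2r -addrA lerD2l /U1 /U2 le_eqVlt; apply/orP; left; apply/eqP; ring.
have mz : all_moments P z by [].
have bound sg : sg ^+ 2 = 1 -> E (fun w => lyap (rk_step a b (rho ^+ 2) s (s + rho ^+ 2)
      (W (s + rho ^+ 2) w - W s w) sg (x w)) ^+ p) <=
    E V + p%:R * (2 * rho) * sg * E U2 + C * rho ^+ 2 * (E V * gauss_sum q).
  move=> sg1.
  have hS := adapted_vec_rk (rho ^+ 2) sg t0' (step_I ok) (step_I' ok)
    (adapted_step_increment ok) (adapted_vecS s0 (ltW st) hx).
  have [_ mS] := adapted_momX fF t0' p (adapted_mom_lyap fF t0' hS).
  have := mean_le_comb (s := [:: (1, V); (p%:R * (2 * rho), fun w => U1 w * z w);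
    (p%:R * (2 * rho) * sg, U2); (C * rho ^+ 2, fun w => V w * (1 + z w ^+ 2) ^+ q)]) mS.
  rewrite /= (mean_noise1 fF wW s0 st hU1) (mean_noise_gauss_sum fF wW s0 st q hV).
  move=> h1; apply: le_trans (h1 _ _) _.
  - have mz1 : all_moments P (fun w => 1 + z w ^+ 2).
      by apply: all_momentsD; [exact: all_moments_cst|exact: all_momentsX].
    split; first exact: mV.
    split; first exact: all_momentsM.
    split; first exact: mU2.
    by split => //; apply: all_momentsM => //; exact: all_momentsX.
  - by move=> w; apply: le_trans (key sg w sg1) _; rewrite mul1r addr0 !addrA.
  - by rewrite mul1r mulr0 add0r addr0 addrA.
rewrite big_cons big_seq1.
have n1 : (-1 : R) ^+ 2 = 1 by rewrite sqrrN expr1n.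
have h1 := bound 1 (expr1n _ _); have h2 := bound (-1) n1.
apply: le_trans (avg _ _ _ _ _ _ h1 h2) _.
rewrite -/V le_eqVlt; apply/orP; left; apply/eqP.
by move: (E V) (gauss_sum q) => v k; ring.
Qed.

End SchemeMoments.

(** * Propagation of the mean-square error over one step *)

Section ErrorStep.
Context {R : realType} {d : measure_display} {T : measurableType d}.
Variables (P : probability T R) (F : R -> set (set T)) (W : R -> T -> R).
Hypothesis fF : filtration F.
Hypothesis wW : wiener P F W.
Local Notation E f := (Rintegral P setT f).
Context {n : nat}.
Variables (a b : R -> 'rV[R]_n -> 'rV[R]_n) (t0 tm L : R).
Hypothesis t00 : 0 <= t0.
Hypothesis sa : forall i, smooth 3 t0 tm (fun z => a z.1 z.2 0 i).
Hypothesis sb : forall i, smooth 3 t0 tm (fun z => b z.1 z.2 0 i).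
Hypothesis L1 : 1 <= L.
Hypothesis lipa : forall t x y, t0 <= t <= tm -> `|a t x - a t y| <= L * `|x - y|.
Hypothesis lipb : forall t x y, t0 <= t <= tm -> `|b t x - b t y| <= L * `|x - y|.
Hypothesis groa : forall t x, t0 <= t <= tm -> `|a t x| <= L * (1 + `|x|).
Hypothesis grob : forall t x, t0 <= t <= tm -> `|b t x| <= L * (1 + `|x|).
Let L0 : 0 <= L. Proof. exact: le_trans L1. Qed.
Local Notation A := (adapted_mom P F).

Local Notation noise s rho := (unit_noise W s (s + rho ^+ 2)).
Local Notation adapted_vec := (adapted_vec P F).
Local Notation step_ok := (step_ok t0 tm).
(** A step from x, disturbed by M + Q, is compared with a Milstein step from y. With D = x - y, the
    cross term D M vanishes after summation over the index e, the cross term D Q is split by Young's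
    inequality with weight rho^2, and the terms of the step difference of order rho have mean zero
    against D. The index e is the sign in the Runge-Kutta case and a dummy in the comparison of one
    step with two. *)
Lemma error_step : exists C : R, 0 <= C /\
  forall s rho (x y : T -> 'rV[R]_n) (M Q : bool -> 'I_n -> T -> R) (B : R),
    step_ok s rho -> adapted_vec s x -> adapted_vec s y -> 0 <= B ->
    (forall e i, all_moments P (M e i)) -> (forall e i, all_moments P (Q e i)) ->
    (forall i U, A s U -> E (fun w => U w * M true i w) + E (fun w => U w * M false i w) = 0) ->
    (forall e i, E (fun w => M e i w ^+ 2) <= B * rho ^+ 6) ->
    (forall e i, E (fun w => Q e i w ^+ 2) <= B * rho ^+ 8) ->
    let step z w := milstein_step a b (rho ^+ 2) s (W (s + rho ^+ 2) w - W s w) z in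
    2^-1 * (\sum_i (E (fun w => (step (x w) w 0 i + M true i w + Q true i w - step (y w) w 0 i) ^+ 2)
       + E (fun w => (step (x w) w 0 i + M false i w + Q false i w - step (y w) w 0 i) ^+ 2)))
    <= (1 + C * rho ^+ 2) * \sum_i E (fun w => (x w 0 i - y w 0 i) ^+ 2) + C * B * rho ^+ 6.
Proof.
(* These purely real inequalities are separated from the proof, where their letters stand for large
   expressions. *)
have alg0 (v : R) : v <= 1 -> 3 * v + 1 <= 4 by move=> *; lra.
have alg1 (r r2 D2 l dl G c1 e1 e2 e2' e3 e4 m q qc B r6 : R) : e1 = 0 -> e2 = e2' ->
  e3 = dl * G -> m <= B * r6 -> qc * q <= 4 * B * r6 ->
  (1 + r2) * D2 + (2 * l * r2 * dl + (2 * r * e1 + (r2 * e2 + (- r2 * e2' +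
    (c1 * r2 * e3 + (2 * e4 + (3 * m + (qc * q + 0)))))))) <=
  (1 + r2) * D2 + (2 * l + c1 * G) * r2 * dl + 2 * e4 + 7 * B * r6.
  by move=> -> -> -> *; lra.
have alg2 (X1 X2 D2 r2 u v m1 m2 : R) : X1 <= (1 + r2) * D2 + u + 2 * m1 + v ->
  X2 <= (1 + r2) * D2 + u + 2 * m2 + v -> m1 + m2 = 0 ->
  X1 + X2 <= 2 * ((1 + r2) * D2 + (u + v)) by move=> *; lra.
have alg4 (D2 da dla r2 zb g1 g2 dm dq GMQ g m q qq Gb : R) :
  da <= 2 * r2 * dla -> 2 * dq <= r2 * D2 + qq -> GMQ <= 3 * g + 3 * m + 3 * q -> 3 * g <= Gb ->
  D2 + (da + zb + g1 - g2) + 2 * dm + 2 * dq + GMQ <=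
  (1 + r2) * D2 + 2 * r2 * dla + zb + g1 - g2 + Gb + 2 * dm + 3 * m + (3 * q + qq).
  by move=> *; lra.
have alg3 (nn r2 dl l c1 G B r6 : R) : 0 <= nn * (7 * (r2 * dl)) ->
  0 <= (1 + nn * (2 * l + c1 * G)) * (B * r6) ->
  (1 + r2) * dl + nn * ((2 * l + c1 * G) * r2 * dl + 7 * B * r6) <=
  (1 + (1 + nn * (2 * l + c1 * G + 7)) * r2) * dl +
  (1 + nn * (2 * l + c1 * G + 7)) * B * r6 by move=> *; lra.
(* The 18 is 9 times 2: the 9 comes from 3(u + v + t)^2 <= 9(u^2 + v^2 + t^2), the 2 from bounding
   the resulting polynomial in the noise by 2(2 + L)^2 (1 + z^2)^2. *)
pose C1 := 18 * L ^+ 2 * (2 + L) ^+ 2.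
have C10 : 0 <= C1 by rewrite !mulr_ge0 ?exprn_ge0 ?addr_ge0.
have G0 := gauss_sum_ge0 (R := R) 2.
pose C := 1 + n%:R * (2 * L + C1 * gauss_sum 2 + 7).
have S0 : 0 <= 2 * L + C1 * gauss_sum 2 by apply: addr_ge0; exact: mulr_ge0.
have S7 : 0 <= 2 * L + C1 * gauss_sum 2 + 7 by exact: addr_ge0.
exists C; split.
  by rewrite /C addr_ge0// mulr_ge0.
move=> s rho x y M Q B ok hx hy B0 mM mQ orth EM EQ /=.
pose step z w := milstein_step a b (rho ^+ 2) s (W (s + rho ^+ 2) w - W s w) z.
have s0 := step_ge0 t00 ok; have st := step_lt ok; have t0' := step_end_ge0 t00 ok.
have [_ _ r0 r1] := ok.
have zA := adapted_step_noise fF wW t00 ok; have [_ zM] := zA.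
pose z := noise s rho.
pose D i w := x w 0 i - y w 0 i.
pose Dl w := \sum_i D i w ^+ 2.
pose al i w := a s (x w) 0 i - a s (y w) 0 i.
pose be i w := b s (x w) 0 i - b s (y w) 0 i.
pose ga i w := milstein_corr b rho s (x w) 0 i - milstein_corr b rho s (y w) 0 i.
have hD i : A s (D i) by apply: (adapted_momB fF).
have hDl : A s Dl by apply: (adapted_mom_sum fF) => // i _; exact: (adapted_momX fF).
have hbe i : A s (be i).
  by apply: (adapted_momB fF) => //; exact: (adapted_vec_b fF sb s0 (step_I ok)).
have hga i : A s (ga i).
  by apply: (adapted_momB fF) => //; exact: (adapted_vec_corr fF sb rho s0 (step_I ok)).
have nDl w : `|x w - y w| ^+ 2 <= Dl w.
  have -> : Dl w = lyap (x w - y w) - 1.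
    by rewrite /lyap addrC addKr; apply: eq_bigr => i _; rewrite /D !mxE.
  exact: norm_sqr_le_lyap.
have nDl0 w : 0 <= Dl w by apply: sumr_ge0 => i _; exact: sqr_ge0.
have crd (u v : 'rV[R]_n) i : `|u 0 i - v 0 i| <= `|u - v|.
  by have := coord_norm_le (u - v) i; rewrite !mxE.
have sqle (u c e : R) : `|u| <= c * e -> 0 <= c -> 0 <= e -> u ^+ 2 <= c ^+ 2 * e ^+ 2.
  move=> h c0 e0; rewrite -[u ^+ 2]real_normK ?num_real// -exprMn.
  by rewrite lerXn2r ?nnegrE ?mulr_ge0.
have alb i w : al i w ^+ 2 <= L ^+ 2 * Dl w.
  apply: le_trans (_ : L ^+ 2 * `|x w - y w| ^+ 2 <= _); last by rewrite ler_wpM2l ?exprn_ge0.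
  by apply: sqle => //; apply: le_trans (crd _ _ _) (lipa _ _ (step_I ok)).
have beb i w : be i w ^+ 2 <= L ^+ 2 * Dl w.
  apply: le_trans (_ : L ^+ 2 * `|x w - y w| ^+ 2 <= _); last by rewrite ler_wpM2l ?exprn_ge0.
  by apply: sqle => //; apply: le_trans (crd _ _ _) (lipb _ _ (step_I ok)).
have gab i w : rho ^+ 2 * ga i w ^+ 2 <= (L * (2 + L)) ^+ 2 * Dl w.
  apply: le_trans (_ : (L * (2 + L)) ^+ 2 * `|x w - y w| ^+ 2 <= _); last first.
    by rewrite ler_wpM2l ?exprn_ge0 ?mulr_ge0 ?addr_ge0.
  rewrite -exprMn; apply: sqle; rewrite ?mulr_ge0 ?addr_ge0//.
  rewrite normrM gtr0_norm// -ler_pdivlMl//.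
  exact: le_trans (crd _ _ _) (milstein_corr_lip L1 lipb _ _ (step_I ok) r0 r1).
have Dal i w : D i w * al i w <= L * Dl w.
  apply: le_trans (ler_norm _) _; rewrite normrM.
  have h1 : `|D i w| <= `|x w - y w| by exact: crd.
  have h2 : `|al i w| <= L * `|x w - y w|.
    by apply: le_trans (crd _ _ _) (lipa _ _ (step_I ok)).
  apply: le_trans (ler_pM _ _ h1 h2) _ => //.
  by rewrite mulrCA -expr2 ler_wpM2l.
(* The difference of the two Milstein steps is D + G; G has mean square O(rho^2) relative to D. *)
pose G i w := rho ^+ 2 * al i w + rho * z w * be i w + rho ^+ 2 * (z w ^+ 2 - 1) / 2 * ga i w.
have stepE e i w : step (x w) w 0 i + M e i w + Q e i w - step (y w) w 0 i
    = D i w + G i w + M e i w + Q e i w.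
  rewrite /step (step_increment W ok) !milstein_stepE sqrtr_sqr gtr0_norm//.
  by rewrite /G /D /al /be /ga -/z; field.
have Gb i w : 3 * G i w ^+ 2 <= C1 * rho ^+ 2 * (Dl w * (1 + z w ^+ 2) ^+ 2).
  have q3 (u v t : R) : 3 * (u + v + t) ^+ 2 <= 9 * (u ^+ 2 + v ^+ 2 + t ^+ 2).
    by have := sqr_ge0 (u - v); have := sqr_ge0 (u - t); have := sqr_ge0 (v - t); nra.
  apply: le_trans (q3 _ _ _) _.
  have e1 : (rho ^+ 2 * al i w) ^+ 2 <= rho ^+ 2 * (L ^+ 2 * Dl w).
    rewrite exprMn expr2 -mulrA ler_wpM2l ?exprn_ge0 ?(ltW r0)//.
    apply: le_trans (alb i w); rewrite ler_piMl ?sqr_ge0//.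
    by rewrite expr_le1// ltW.
  have e2 : (rho * z w * be i w) ^+ 2 <= rho ^+ 2 * (z w ^+ 2 * (L ^+ 2 * Dl w)).
    have -> : (rho * z w * be i w) ^+ 2 = rho ^+ 2 * (z w ^+ 2 * be i w ^+ 2) by ring.
    by do 2 (apply: ler_wpM2l; first exact: sqr_ge0); exact: beb.
  have e3 : (rho ^+ 2 * (z w ^+ 2 - 1) / 2 * ga i w) ^+ 2 <=
      rho ^+ 2 * ((z w ^+ 2 - 1) ^+ 2 / 4 * ((L * (2 + L)) ^+ 2 * Dl w)).
    have -> : (rho ^+ 2 * (z w ^+ 2 - 1) / 2 * ga i w) ^+ 2 =
      rho ^+ 2 * ((z w ^+ 2 - 1) ^+ 2 / 4 * (rho ^+ 2 * ga i w ^+ 2)) by field.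
    apply: ler_wpM2l; first exact: sqr_ge0.
    by apply: ler_wpM2l; [rewrite divr_ge0 ?sqr_ge0|exact: gab].
  apply: le_trans (ler_wpM2l _ (lerD (lerD e1 e2) e3)) _ => //.
  rewrite -!mulrDr [C1 * _]mulrC [leLHS]mulrCA -[leRHS]mulrA ler_wpM2l ?sqr_ge0//.
  have -> : 9 * (L ^+ 2 * Dl w + z w ^+ 2 * (L ^+ 2 * Dl w) +
    (z w ^+ 2 - 1) ^+ 2 / 4 * ((L * (2 + L)) ^+ 2 * Dl w)) =
    9 * (L ^+ 2 * Dl w) * (1 + z w ^+ 2 + (z w ^+ 2 - 1) ^+ 2 / 4 * (2 + L) ^+ 2) by field.
  have -> : C1 * (Dl w * (1 + z w ^+ 2) ^+ 2) =
    9 * (L ^+ 2 * Dl w) * (2 * (2 + L) ^+ 2 * (1 + z w ^+ 2) ^+ 2) by rewrite /C1; ring.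
  rewrite ler_wpM2l ?mulr_ge0 ?sqr_ge0//.
  have k1 : 1 <= (2 + L) ^+ 2 by apply: exprn_ege1; rewrite -[leLHS]add0r lerD.
  have k2 := sqr_ge0 (z w); move: (z w ^+ 2) ((2 + L) ^+ 2) k1 k2 => Z K k1 k2.
  have h1 : 1 + Z <= (1 + Z) ^+ 2 by nra.
  have h2 : (Z - 1) ^+ 2 / 4 * K <= (1 + Z) ^+ 2 * K.
    by rewrite ler_wpM2r//; [lra|nra].
  have h3 : (1 + Z) ^+ 2 <= K * (1 + Z) ^+ 2 by rewrite ler_peMl ?sqr_ge0.
  by lra.
have key e i w : (step (x w) w 0 i + M e i w + Q e i w - step (y w) w 0 i) ^+ 2 <=
    (1 + rho ^+ 2) * D i w ^+ 2 + 2 * rho ^+ 2 * (L * Dl w)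
    + 2 * rho * (D i w * be i w * z w)
    + rho ^+ 2 * (D i w * ga i w * z w ^+ 2) - rho ^+ 2 * (D i w * ga i w)
    + C1 * rho ^+ 2 * (Dl w * (1 + z w ^+ 2) ^+ 2)
    + 2 * (D i w * M e i w) + 3 * M e i w ^+ 2
    + (3 * Q e i w ^+ 2 + rho ^- 2 * Q e i w ^+ 2).
  rewrite stepE; have hG := Gb i w; have hDa := Dal i w.
  have rho20 : 0 < rho ^+ 2 by rewrite exprn_gt0.
  (* Young's inequality with weight rho^2: the price rho^-2 Q^2 is acceptable since Q^2 is of order
     rho^8. *)
  have hR : 2 * (D i w * Q e i w) <= rho ^+ 2 * D i w ^+ 2 + rho ^- 2 * Q e i w ^+ 2.
    have := sqr_ge0 (rho * D i w - rho^-1 * Q e i w); rewrite sqrrB !exprMn exprVn.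
    have -> : rho * D i w * (rho^-1 * Q e i w) = D i w * Q e i w.
      by field; rewrite gt_eqF.
    by rewrite mulr2n; lra.
  have hDa2 : 2 * rho ^+ 2 * (D i w * al i w) <= 2 * rho ^+ 2 * (L * Dl w).
    by apply: ler_wpM2l => //; rewrite mulr_ge0 ?sqr_ge0.
  have q3 : (G i w + M e i w + Q e i w) ^+ 2 <= 3 * G i w ^+ 2 + 3 * M e i w ^+ 2 + 3 * Q e i w ^+ 2.
    have := sqr_ge0 (G i w - M e i w); have := sqr_ge0 (G i w - Q e i w).
    by have := sqr_ge0 (M e i w - Q e i w); lra.
  have -> : (D i w + G i w + M e i w + Q e i w) ^+ 2 = D i w ^+ 2
     + (2 * rho ^+ 2 * (D i w * al i w) + 2 * rho * (D i w * be i w * z w)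
       + rho ^+ 2 * (D i w * ga i w * z w ^+ 2) - rho ^+ 2 * (D i w * ga i w))
     + 2 * (D i w * M e i w) + 2 * (D i w * Q e i w) + (G i w + M e i w + Q e i w) ^+ 2.
    have -> : 2 * rho ^+ 2 * (D i w * al i w) + 2 * rho * (D i w * be i w * z w)
       + rho ^+ 2 * (D i w * ga i w * z w ^+ 2) - rho ^+ 2 * (D i w * ga i w) = 2 * (D i w * G i w).
      by rewrite /G; field.
    by move: (D i w) (G i w) (M e i w) (Q e i w) => *; ring.
  exact: alg4 hDa2 hR q3 (hG).
have [_ mDl] := hDl; have mz : all_moments P z by [].
have bound e i : E (fun w => (step (x w) w 0 i + M e i w + Q e i w - step (y w) w 0 i) ^+ 2) <=
    (1 + rho ^+ 2) * E (fun w => D i w ^+ 2) + (2 * L + C1 * gauss_sum 2) * rho ^+ 2 * E Dl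
    + 2 * E (fun w => D i w * M e i w) + 7 * B * rho ^+ 6.
  have [_ mD] := hD i; have hDbe := adapted_momM fF s0 (hD i) (hbe i).
  have hDga := adapted_momM fF s0 (hD i) (hga i).
  have mMe := mM e i; have mQe := mQ e i.
  have ok' := adapted_step_increment fF wW t00 ok.
  have [_ msx] := adapted_vec_milstein fF sa sb (rho ^+ 2) t0' (step_I ok) ok' (adapted_vecS fF s0 (ltW st) hx) i.
  have [_ msy] := adapted_vec_milstein fF sa sb (rho ^+ 2) t0' (step_I ok) ok' (adapted_vecS fF s0 (ltW st) hy) i.
  have mY : all_moments P (fun w => (step (x w) w 0 i + M e i w + Q e i w - step (y w) w 0 i) ^+ 2).
    apply: all_momentsX; apply: all_momentsB; last exact: msy.
    by apply: all_momentsD; [apply: all_momentsD; [exact: msx|exact: mMe]|exact: mQe].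
  pose Y1 w := D i w ^+ 2; pose Y2 w := D i w * be i w * z w.
  pose Y3 w := D i w * ga i w * z w ^+ 2; pose Y4 w := D i w * ga i w.
  pose Y5 w := Dl w * (1 + z w ^+ 2) ^+ 2; pose Y6 w := D i w * M e i w.
  pose Y7 w := M e i w ^+ 2; pose Y8 w := Q e i w ^+ 2.
  pose Ls : seq (R * (T -> R)) := [:: (1 + rho ^+ 2, Y1); (2 * L * rho ^+ 2, Dl); (2 * rho, Y2);
    (rho ^+ 2, Y3); (- rho ^+ 2, Y4); (C1 * rho ^+ 2, Y5); (2, Y6); (3, Y7); (3 + rho ^- 2, Y8)].
  have h1 := mean_le_comb (s := Ls) mY.
  apply: le_trans (h1 _ _) _.
  - have mz1 : all_moments P (fun w => 1 + z w ^+ 2).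
      by apply: all_momentsD; [exact: all_moments_cst|exact: all_momentsX].
    split; first exact: all_momentsX.
    split; first exact: mDl.
    split; first by apply: all_momentsM => //; case: hDbe.
    split; first by apply: all_momentsM; [case: hDga|exact: all_momentsX].
    split; first by case: hDga.
    split; first by apply: all_momentsM => //; exact: all_momentsX.
    split; first exact: all_momentsM.
    split; first exact: all_momentsX.
    by split => //; exact: all_momentsX.
  - by move=> w; apply: le_trans (key e i w) _; rewrite /Ls /= /Y1 /Y2 /Y3 /Y4 /Y5 /Y6 /Y7 /Y8;
      rewrite le_eqVlt; apply/orP; left; apply/eqP; ring.
  have hM := EM e i; have hQ := EQ e i.
  (* The remainder enters with rho^-2 and still contributes only rho^6, like the square of M. *)
  have hQ2 : (3 + rho ^- 2) * E (fun w => Q e i w ^+ 2) <= 4 * B * rho ^+ 6.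
    apply: le_trans (ler_wpM2l _ hQ) _; first by rewrite addr_ge0// invr_ge0 sqr_ge0.
    have -> : (3 + rho ^- 2) * (B * rho ^+ 8) = B * rho ^+ 6 * (3 * rho ^+ 2 + 1).
      by field; rewrite gt_eqF.
    have -> : 4 * B * rho ^+ 6 = B * rho ^+ 6 * 4 by ring.
    apply: ler_wpM2l; first by rewrite mulr_ge0 ?exprn_ge0 ?(ltW r0).
    by apply: alg0; rewrite expr_le1 ?(ltW r0).
  exact: (alg1 _ _ _ _ _ _ _ _ _ _ _ _ _ _ _ _ _ (mean_noise1 fF wW s0 st hDbe)
    (mean_noise2 fF wW s0 st hDga) (mean_noise_gauss_sum fF wW s0 st 2 hDl) hM hQ2).
have EDl : E Dl = \sum_i E (fun w => D i w ^+ 2).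
  by rewrite mean_sum// => i _; apply: all_momentsX; case: (hD i).
have sumb i : E (fun w => (step (x w) w 0 i + M true i w + Q true i w - step (y w) w 0 i) ^+ 2)
    + E (fun w => (step (x w) w 0 i + M false i w + Q false i w - step (y w) w 0 i) ^+ 2) <=
    2 * ((1 + rho ^+ 2) * E (fun w => D i w ^+ 2)
      + ((2 * L + C1 * gauss_sum 2) * rho ^+ 2 * E Dl + 7 * B * rho ^+ 6)).
  have h1 := bound true i; have h2 := bound false i; have h3 := orth i (D i) (hD i).
  exact: alg2 h1 h2 h3.
apply: le_trans (ler_wpM2l _ (ler_sum _ (fun i _ => sumb i))) _; first by rewrite invr_ge0.
rewrite -mulr_sumr mulrA mulVf// mul1r big_split/= -mulr_sumr -EDl.
rewrite sumr_const card_ord -[_ *+ n]mulr_natl.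
have EDl0 : 0 <= E Dl by exact: mean_ge0.
have n0 : 0 <= n%:R :> R by [].
have r60 : 0 <= rho ^+ 6 by rewrite exprn_ge0 ?(ltW r0).
have k1 : 0 <= n%:R * (7 * (rho ^+ 2 * E Dl)).
  by apply: mulr_ge0 => //; apply: mulr_ge0 => //; apply: mulr_ge0 => //; exact: sqr_ge0.
have k2 : 0 <= (1 + n%:R * (2 * L + C1 * gauss_sum 2)) * (B * rho ^+ 6).
  apply: mulr_ge0; last exact: mulr_ge0.
  by apply: addr_ge0 => //; exact: mulr_ge0.
exact: alg3 k1 k2.
Qed.

End ErrorStep.

(** * Local errors: orthogonal part and remainder in mean square *)

Section LocalBounds.
Context {R : realType} {n : nat}.
Variables (a b : R -> 'rV[R]_n -> 'rV[R]_n) (t0 tm : R).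
Hypothesis sa : forall i, smooth 3 t0 tm (fun z => a z.1 z.2 0 i).
Hypothesis sb : forall i, smooth 3 t0 tm (fun z => b z.1 z.2 0 i).

Let I := ((R * R) * (R * R) * 'rV[R]_n)%type.
Let dom (w : I) := step_ok t0 tm w.1.1.1 w.1.1.2.
(** The weight is a product of one factor per variable, so that its mean factors over the state and
    the independent noises. *)
Let g (w : I) := lyap w.2 * (1 + w.1.2.1 ^+ 2) * (1 + w.1.2.2 ^+ 2).

Let g1 w : dom w -> 1 <= g w.
Proof.
have h (u : R) : 1 <= 1 + u ^+ 2 by rewrite lerDl sqr_ge0.
by move=> _; rewrite !mulr_ege1 ?lyap_ge1.
Qed.

Let rho0 w : dom w -> 0 < w.1.1.2. Proof. by case. Qed.
Let rho1 w : dom w -> w.1.1.2 <= 1. Proof. by case. Qed.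
Let rho0' w : dom w -> 0 <= w.1.1.2. Proof. by move/rho0/ltW. Qed.
Let tI w : dom w -> t0 <= w.1.1.1 <= tm. Proof. exact: step_I. Qed.
Let tI' w : dom w -> t0 <= w.1.1.1 + w.1.1.2 ^+ 2 <= tm. Proof. exact: step_I'. Qed.

Let Og (phi : I -> R) : (forall w, `|phi w| <= g w) -> big_O dom g (fun w => w.1.1.2) 0 phi.
Proof.
move=> h; apply: (big_O_le (psi := g)); last exact: big_O_g.
by move=> w dw; rewrite (ger0_norm (le_trans ler01 (g1 dw))).
Qed.

Let sq_bound (u : R) : `|u| <= 1 + u ^+ 2.
Proof.
rewrite -[u ^+ 2]real_normK ?num_real//; have := sqr_ge0 (`|u| - 1).
by have := normr_ge0 u; move: `|u| => r; nra.
Qed.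

Let Ox : big_O dom g (fun w => w.1.1.2) 0 (fun w => `|w.2|).
Proof.
apply: Og => w; rewrite normr_id /g -mulrA; apply: le_trans (norm_le_lyap _) _.
by rewrite ler_peMr ?(ltW (lyap_gt0 _))// mulr_ege1// lerDl sqr_ge0.
Qed.

Let Oz1 : big_O dom g (fun w => w.1.1.2) 0 (fun w => w.1.2.1).
Proof.
apply: Og => w; rewrite /g mulrAC mulrC; apply: le_trans (sq_bound _) _.
by rewrite ler_peMr ?addr_ge0 ?sqr_ge0// mulr_ege1 ?lyap_ge1// lerDl sqr_ge0.
Qed.

Let Oz2 : big_O dom g (fun w => w.1.1.2) 0 (fun w => w.1.2.2).
Proof.
apply: Og => w; rewrite /g mulrC; apply: le_trans (sq_bound _) _.
by rewrite ler_peMr ?addr_ge0 ?sqr_ge0// mulr_ege1 ?lyap_ge1// lerDl sqr_ge0.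
Qed.

Let uniform (k : nat) (phi : 'I_n -> I -> R) :
  (forall i, big_O dom g (fun w => w.1.1.2) k (phi i)) ->
  exists (C : R) (p : nat), 0 <= C /\
    forall i w, dom w -> `|phi i w| <= C * g w ^+ p * w.1.1.2 ^+ k.
Proof.
move=> h; have [C [p [C0 hC]]] : big_O dom g (fun w => w.1.1.2) k (fun w => \sum_i `|phi i w|).
  by apply: (big_O_sum g1 rho0') => i; exact: big_O_norm.
exists C, p; split => // i w dw; apply: le_trans (hC w dw); apply: le_trans (ler_norm _).
by rewrite (bigD1 i)//= lerDl sumr_ge0.
Qed.

Let mono (q : nat) (C C' : R) (p k : nat) w y : 0 <= C' -> 0 <= C -> dom w ->
  y <= C * g w ^+ p * w.1.1.2 ^+ k -> y <= (C + C') * g w ^+ (p + q) * w.1.1.2 ^+ k.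
Proof.
move=> C'0 C0 dw h; apply: le_trans h _; have gw := g1 dw.
apply: ler_wpM2r; first by rewrite exprn_ge0 ?rho0'.
apply: ler_pM => //; rewrite ?exprn_ge0 ?(le_trans ler01 gw) ?lerDl//.
by rewrite ler_weXn2l ?leq_addr.
Qed.

Lemma two_step_bound : exists (C : R) (p : nat), 0 <= C /\
  forall i t rho z1 z2 x, step_ok t0 tm t rho ->
  let M := two_step_martingale a b (fun=> rho) (fun=> t) (fun=> x) (fun=> z1) (fun=> z2) i tt in
  let G := (lyap x * (1 + z1 ^+ 2) * (1 + z2 ^+ 2)) ^+ p in
  `|M| <= C * G * rho ^+ 3 /\
  `|milstein_step a b (rho ^+ 2) (t + rho ^+ 2) (rho * z2)
      (milstein_step a b (rho ^+ 2) t (rho * z1) x) 0 i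
    - milstein_step a b (2 * rho ^+ 2) t (rho * z1 + rho * z2) x 0 i - M| <= C * G * rho ^+ 4.
Proof.
have [C1 [p1 [C10 h1]]] := uniform (big_O_two_step_martingale sa sb g1 rho0 rho1 tI tI' Ox Oz1 Oz2).
have [C2 [p2 [C20 h2]]] := uniform (two_step_expansion sa sb g1 rho0 rho1
  (fun w => w.1.2.2) tI tI' Ox Oz1).
exists (C1 + C2), (p1 + p2)%N; split=> [|i t rho z1 z2 x ok M G]; first exact: addr_ge0.
pose w : I := ((t, rho), (z1, z2), x).
by split; [exact: (@mono p2 _ _ _ _ w _ C20 C10 ok (h1 i w ok))|
  rewrite [C1 + _]addrC /G addnC; exact: (@mono p1 _ _ _ _ w _ C10 C20 ok (h2 i w ok))].
Qed.

Lemma rk_bound : exists (C : R) (p : nat), 0 <= C /\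
  forall i t rho z s x, step_ok t0 tm t rho -> s = 1 \/ s = -1 ->
  let M := rk_martingale a b (fun=> rho) (fun=> t) (fun=> x) (fun=> z) (fun=> s) i tt in
  let G := (lyap x * (1 + z ^+ 2) * (1 + s ^+ 2)) ^+ p in
  `|M| <= C * G * rho ^+ 3 /\
  `|rk_step a b (rho ^+ 2) t (t + rho ^+ 2) (rho * z) s x 0 i
    - milstein_step a b (rho ^+ 2) t (rho * z) x 0 i - M| <= C * G * rho ^+ 4.
Proof.
(* The second noise slot is an arbitrary real number. Reading a sign off it makes s^2 = 1 hold on
   the whole domain and gives back s when s = 1 or s = -1. *)
pose sgn (w : I) : R := if 0 <= w.1.2.2 then 1 else -1.
have sgn2 w : dom w -> sgn w ^+ 2 = 1.
  by move=> _; rewrite /sgn; case: ifP => _; rewrite ?sqrrN expr1n.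
have [C1 [p1 [C10 h1]]] := uniform (big_O_rk_martingale sa sb g1 rho0 rho1 tI Ox Oz1 sgn2).
have [C2 [p2 [C20 h2]]] := uniform (rk_local_expansion sa sb g1 rho0 rho1 tI tI' Ox Oz1 sgn2).
exists (C1 + C2), (p1 + p2)%N; split=> [|i t rho z s x ok s1 M G]; first exact: addr_ge0.
pose w : I := ((t, rho), (z, s), x).
have sE : sgn w = s.
  by case: s1 => sE; rewrite /sgn /= sE ?ler01// oppr_ge0 ler10.
have H1 := @mono p2 _ _ _ _ w _ C20 C10 ok (h1 i w ok).
have H2 := @mono p1 _ _ _ _ w _ C10 C20 ok (h2 i w ok).
move: H1 H2; rewrite /rk_martingale /= sE => H1 H2.
by split; [exact: H1|rewrite [C1 + _]addrC /G addnC; exact: H2].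
Qed.

End LocalBounds.

Section LocalError.
Context {R : realType} {d : measure_display} {T : measurableType d}.
Variables (P : probability T R) (F : R -> set (set T)) (W : R -> T -> R).
Hypothesis fF : filtration F.
Hypothesis wW : wiener P F W.
Local Notation E f := (Rintegral P setT f).
Context {n : nat}.
Variables (a b : R -> 'rV[R]_n -> 'rV[R]_n) (t0 tm L : R).
Hypothesis t00 : 0 <= t0.
Hypothesis sa : forall i, smooth 3 t0 tm (fun z => a z.1 z.2 0 i).
Hypothesis sb : forall i, smooth 3 t0 tm (fun z => b z.1 z.2 0 i).
Local Notation A := (adapted_mom P F).

Local Notation adapted_vec := (adapted_vec P F).
Local Notation step_ok := (step_ok t0 tm).

Section Coefficients.
Variables (t s : R) (x : T -> 'rV[R]_n).
Hypotheses (tge : 0 <= t) (sI : t0 <= s <= tm) (hx : adapted_vec t x).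

(** The direction is random. In coordinates it becomes a factor, and only derivatives in fixed
    directions remain. *)
Lemma adapted_derive1 (f : R * 'rV[R]_n -> R) (v : T -> 'rV[R]_n) : smooth 1 t0 tm f ->
  adapted_vec t v -> A t (fun w => 'D_(0, v w) f (s, x w)).
Proof.
move=> sf hv; under eq_fun do rewrite (smooth_derive_dir0E _ _ sf).
apply: (adapted_mom_sum fF) => // j _; apply: (adapted_momM fF) => //.
exact: (adapted_mom_smooth fF tge (smooth_derive _ sf) sI hx).
Qed.

Lemma adapted_derive2 (f : R * 'rV[R]_n -> R) (v : T -> 'rV[R]_n) : smooth 2 t0 tm f ->
  adapted_vec t v -> A t (fun w => 'D_(0, v w) (fun y => 'D_(0, v w) f y) (s, x w)).
Proof.
move=> sf hv; have sf1 := smooth_leq (isT : (1 <= 2)%N) sf.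
have -> : (fun w => 'D_(0, v w) (fun y => 'D_(0, v w) f y) (s, x w)) =
    (fun w => \sum_j v w 0 j * 'D_(0, v w) (fun y => 'D_(0, delta_mx 0 j) f y) (s, x w)).
  apply/funext => w.
  have -> : (fun y => 'D_(0, v w) f y) =
      (fun y => \sum_j v w 0 j * 'D_(0, delta_mx 0 j) f y).
    by apply/funext => y; exact: smooth_derive_dir0E sf1.
  apply: derive_lin_sum => j y.
  have [_ _ /(_ (0, v w))[dd _]] := smooth_derive (0, delta_mx 0 j) sf; exact: dd.
apply: (adapted_mom_sum fF) => // j _; apply: (adapted_momM fF) => //.
apply: adapted_derive1 => //; exact: smooth_derive sf.
Qed.

Let sa1 i := smooth_leq (isT : (1 <= 3)%N) (sa i).
Let sb1 i := smooth_leq (isT : (1 <= 3)%N) (sb i).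
Let sb2 i := smooth_leq (isT : (2 <= 3)%N) (sb i).
Let ha : adapted_vec t (fun w => a s (x w)) := adapted_vec_a fF sa tge sI hx.
Let hb : adapted_vec t (fun w => b s (x w)) := adapted_vec_b fF sb tge sI hx.

Lemma adapted_bDa i : A t (fun w => bDa a b i (s, x w)).
Proof. exact: adapted_derive1 (sa1 i) hb. Qed.

Lemma adapted_bDb i : A t (fun w => bDb b i (s, x w)).
Proof. exact: adapted_derive1 (sb1 i) hb. Qed.

Lemma adapted_bbDDb i : A t (fun w => bbDDb b i (s, x w)).
Proof. exact: adapted_derive2 (sb2 i) hb. Qed.

Lemma adapted_dtb i : A t (fun w => dtb a b i (s, x w)).
Proof.
have -> : (fun w => dtb a b i (s, x w)) = (fun w => 'D_(1, 0) (fun z => b z.1 z.2 0 i) (s, x w)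
    + 'D_(0, a s (x w)) (fun z => b z.1 z.2 0 i) (s, x w)).
  apply/funext => w; apply: etrans (smooth_derive_dirD _ _ _ (sb1 i)).
  by rewrite /dtb /=; congr ('D_ _ _ _); apply/pair_equal_spec; rewrite /= addr0 add0r.
apply: (adapted_momD fF) => //; last exact: adapted_derive1 (sb1 i) ha.
exact: (adapted_mom_smooth fF tge (smooth_derive _ (sb1 i)) sI hx).
Qed.

Lemma adapted_milstein_corr (r : R) i : A t (fun w => milstein_corr b r s (x w) 0 i).
Proof. exact: (adapted_vec_corr fF sb r tge sI hx). Qed.

End Coefficients.

(** The polynomials z, z^2 - 1 and (z^2 - 1)z have mean zero for a standard normal z independent of
    the coefficients. Every orthogonal part of a local error is brought to this form. *)
Lemma mean_noise_cubic (s t : R) (U1 U2 U3 : T -> R) : 0 <= s -> s < t ->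
  A s U1 -> A s U2 -> A s U3 -> let z := unit_noise W s t in
  let Y w := U1 w * z w + U2 w * (z w ^+ 2 - 1) + U3 w * ((z w ^+ 2 - 1) * z w) in
  all_moments P Y /\ E Y = 0.
Proof.
move=> s0 st h1 h2 h3 z Y; have [_ mz] := adapted_noise fF wW s0 st.
have [_ m1] := h1; have [_ m2] := h2; have [_ m3] := h3.
pose Y1 w := U1 w * z w; pose Y2 w := U2 w * z w ^+ 2; pose Y3 w := U3 w * z w ^+ 3.
pose Y4 w := U3 w * z w.
have n1 : all_moments P Y1 by exact: all_momentsM.
have n2 : all_moments P Y2 by apply: all_momentsM; [exact: m2|exact: all_momentsX].
have n3 : all_moments P Y3 by apply: all_momentsM; [exact: m3|exact: all_momentsX].
have n4 : all_moments P Y4 by exact: all_momentsM.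
have -> : Y = (fun w => Y1 w + (Y2 w - U2 w) + (Y3 w - Y4 w)).
  by apply/funext => w; rewrite /Y /Y1 /Y2 /Y3 /Y4; ring.
have k1 : all_moments P (fun w => Y2 w - U2 w) by exact: all_momentsB.
have k2 : all_moments P (fun w => Y3 w - Y4 w) by exact: all_momentsB.
have k3 : all_moments P (fun w => Y1 w + (Y2 w - U2 w)) by exact: all_momentsD.
split; first exact: all_momentsD.
rewrite meanD// meanD// (meanB n2 m2) (meanB n3 n4).
have -> : E Y1 = 0 by exact: (mean_noise1 fF wW s0 st h1).
have -> : E Y2 = E U2 by exact: (mean_noise2 fF wW s0 st h2).
have -> : E Y3 = 0 by exact: (mean_noise3 fF wW s0 st h3).
have -> : E Y4 = 0 by exact: (mean_noise1 fF wW s0 st h3).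
by rewrite !subrr !addr0.
Qed.

Definition sign_of (e : bool) : R := if e then 1 else -1.

Local Notation noise s rho := (unit_noise W s (s + rho ^+ 2)).

Section RKLocal.
Variables (s rho : R) (x : T -> 'rV[R]_n).
Hypotheses (ok : step_ok s rho) (hx : adapted_vec s x).
Let s0 := step_ge0 t00 ok.
Let st := step_lt ok.
Let t0' := step_end_ge0 t00 ok.
Let z := noise s rho.
Let M e i w := rk_martingale a b (fun=> rho) (fun=> s) x z (fun=> sign_of e) i w.

Lemma adapted_rk_martingale e i : A (s + rho ^+ 2) (M e i).
Proof.
have cst c : A (s + rho ^+ 2) (fun=> c) by exact: (adapted_mom_cst P fF t0' c).
have zA : A (s + rho ^+ 2) z := adapted_step_noise fF wW t00 ok.
have hx' := adapted_vecS fF s0 (ltW st) hx; have sI := step_I ok.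
have z1 : A (s + rho ^+ 2) (fun w => z w ^+ 2 - 1).
  by apply: (adapted_momB fF) => //; exact: (adapted_momX fF).
have zm : A (s + rho ^+ 2) (fun w => z w - sign_of e) by exact: (adapted_momB fF).
have zp : A (s + rho ^+ 2) (fun w => z w + sign_of e) by exact: (adapted_momD fF).
rewrite /M /rk_martingale; apply: (adapted_momB fF) => //.
  apply: (adapted_momM fF) => //; apply: (adapted_momD fF) => //; first apply: (adapted_momD fF) => //.
  - apply: (adapted_momM fF) => //; last exact: adapted_bDa.
    exact: (adapted_momM fF).
  - apply: (adapted_momM fF) => //; last exact: adapted_dtb.
    exact: (adapted_momM fF).
  - apply: (adapted_momM fF) => //; last exact: adapted_bbDDb.
    by apply: (adapted_momM fF) => //; exact: (adapted_momM fF).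
apply: (adapted_momM fF) => //; first by apply: (adapted_momM fF) => //; exact: (adapted_momM fF).
by apply: (adapted_momB fF) => //; [exact: adapted_milstein_corr|exact: adapted_bDb].
Qed.

Lemma rk_martingale_orthogonal i U : A s U ->
  E (fun w => U w * M true i w) + E (fun w => U w * M false i w) = 0.
Proof.
move=> hU; have [_ mU] := hU; have sI := step_I ok.
have [_ m1] := adapted_rk_martingale true i; have [_ m2] := adapted_rk_martingale false i.
rewrite -meanD; [|exact: all_momentsM|exact: all_momentsM].
have hD := adapted_bDa s0 sI hx i; have hT := adapted_dtb s0 sI hx i.
have hB := adapted_bbDDb s0 sI hx i; have hb := adapted_bDb s0 sI hx i.
have hc := adapted_milstein_corr s0 sI hx rho i.
(* Summing over both signs cancels what is linear in s and doubles the rest; these are the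
   coefficients of z, z^2 - 1 and (z^2 - 1)z that remain. *)
pose U1 w := rho ^+ 3 * (U w * (bDa a b i (s, x w) + dtb a b i (s, x w))).
pose U2 w := - rho ^+ 2 * (U w * (milstein_corr b rho s (x w) 0 i - bDb b i (s, x w))).
pose U3 w := (2^-1 * rho ^+ 3) * (U w * bbDDb b i (s, x w)).
have h1 : A s U1.
  by apply: (adapted_momZ fF) => //; apply: (adapted_momM fF) => //; exact: (adapted_momD fF).
have h2 : A s U2.
  by apply: (adapted_momZ fF) => //; apply: (adapted_momM fF) => //; exact: (adapted_momB fF).
have h3 : A s U3 by apply: (adapted_momZ fF) => //; exact: (adapted_momM fF).
have [_ <-] := mean_noise_cubic s0 st h1 h2 h3.
congr (Rintegral P setT _); apply/funext => w.
rewrite /M /rk_martingale /U1 /U2 /U3 /sign_of -/(z w).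
move: (bDa _ _ _ _) (dtb _ _ _ _) (bbDDb _ _ _) (bDb _ _ _) (milstein_corr _ _ _ _ _ _) => *.
by field.
Qed.

End RKLocal.
End LocalError.

Section RungeKuttaStepError.
Context {R : realType} {d : measure_display} {T : measurableType d}.
Variables (P : probability T R) (F : R -> set (set T)) (W : R -> T -> R).
Hypothesis fF : filtration F.
Hypothesis wW : wiener P F W.
Local Notation E f := (Rintegral P setT f).
Context {n : nat}.
Variables (a b : R -> 'rV[R]_n -> 'rV[R]_n) (t0 tm L : R).
Hypothesis t00 : 0 <= t0.
Hypothesis sa : forall i, smooth 3 t0 tm (fun z => a z.1 z.2 0 i).
Hypothesis sb : forall i, smooth 3 t0 tm (fun z => b z.1 z.2 0 i).
Hypothesis L1 : 1 <= L.
Hypothesis lipa : forall t x y, t0 <= t <= tm -> `|a t x - a t y| <= L * `|x - y|.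
Hypothesis lipb : forall t x y, t0 <= t <= tm -> `|b t x - b t y| <= L * `|x - y|.
Local Notation A := (adapted_mom P F).

Local Notation adapted_vec := (adapted_vec P F).
Local Notation step_ok := (step_ok t0 tm).
Local Notation noise s rho := (unit_noise W s (s + rho ^+ 2)).

(** Turns the pathwise bounds on local errors into mean squares: U is known at time s, so the noise
    contributes the independent factor [gauss_sum]. *)
Lemma mean_sqr_noise_bound (s t : R) (p : nat) (C r : R) (U Y : T -> R) : 0 <= s -> s < t ->
  A s U -> all_moments P Y ->
  (forall w, `|Y w| <= C * (U w * (1 + unit_noise W s t w ^+ 2)) ^+ p * r) ->
  E (fun w => Y w ^+ 2) <= C ^+ 2 * r ^+ 2 * gauss_sum (p * 2) * E (fun w => U w ^+ (p * 2)).
Proof.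
move=> s0 st hU mY h; have [_ mz] := adapted_noise fF wW s0 st.
have hU2 : A s (fun w => U w ^+ (p * 2)) by exact: (adapted_momX fF).
pose z := unit_noise W s t.
have mz1 : all_moments P (fun w => 1 + z w ^+ 2).
  by apply: all_momentsD; [exact: all_moments_cst|exact: all_momentsX].
pose Z w := U w ^+ (p * 2) * (1 + z w ^+ 2) ^+ (p * 2).
have mZ : all_moments P Z by apply: all_momentsM; [exact: hU2.2|exact: all_momentsX].
have -> : C ^+ 2 * r ^+ 2 * gauss_sum (p * 2) * E (fun w => U w ^+ (p * 2)) =
    E (fun w => C ^+ 2 * r ^+ 2 * Z w).
  by rewrite (meanZ _ mZ) (mean_noise_gauss_sum fF wW s0 st _ hU2); ring.
apply: mean_le; [exact: all_momentsX|exact: all_momentsZ|] => w.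
rewrite -[Y w ^+ 2]real_normK ?num_real//.
apply: (@le_trans _ _ ((C * (U w * (1 + z w ^+ 2)) ^+ p * r) ^+ 2)).
  by rewrite lerXn2r// nnegrE//; exact: le_trans (h w).
by rewrite /Z -exprMn !exprMn -!exprM le_eqVlt; apply/orP; left; apply/eqP; ring.
Qed.

Local Notation rk s rho x e w := (rk_step a b (rho ^+ 2) s (s + rho ^+ 2)
  (W (s + rho ^+ 2) w - W s w) (sign_of e) (x w)).
Local Notation ml s rho y w := (milstein_step a b (rho ^+ 2) s
  (W (s + rho ^+ 2) w - W s w) (y w)).

(** The intermediate point is the Milstein step from x: the Runge-Kutta step differs from it by the
    local error at x. Only moments of the Runge-Kutta state x enter, none of y. *)
Lemma rk_error_step : exists (C : R) (q : nat), 0 <= C /\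
  forall s rho (x y : T -> 'rV[R]_n), step_ok s rho -> adapted_vec s x -> adapted_vec s y ->
    2^-1 * (\sum_i (E (fun w => (rk s rho x true w 0 i - ml s rho y w 0 i) ^+ 2)
                  + E (fun w => (rk s rho x false w 0 i - ml s rho y w 0 i) ^+ 2)))
    <= (1 + C * rho ^+ 2) * (\sum_i E (fun w => (x w 0 i - y w 0 i) ^+ 2))
       + C * E (fun w => lyap (x w) ^+ q) * rho ^+ 6.
Proof.
have [C [C0 hC]] := error_step fF wW t00 sa sb L1 lipa lipb.
have [D [p [D0 hD]]] := rk_bound sa sb.
have gs0 := gauss_sum_ge0 (R := R) (p * 2).
pose K := D ^+ 2 * gauss_sum (p * 2) * 2 ^+ (p * 2).
have K0 : 0 <= K by rewrite /K !mulr_ge0 ?exprn_ge0.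
exists (C + C * K), (p * 2)%N; split=> [|s rho x y ok hx hy].
  by rewrite addr_ge0// mulr_ge0.
have s0 := step_ge0 t00 ok; have st := step_lt ok; have t0' := step_end_ge0 t00 ok.
have [_ _ r0 r1] := ok.
pose z := noise s rho.
pose M e i w := rk_martingale a b (fun=> rho) (fun=> s) x z (fun=> sign_of e) i w.
pose Q e i w := rk s rho x e w 0 i - ml s rho x w 0 i - M e i w.
have ok' := adapted_step_increment fF wW t00 ok.
have hx' := adapted_vecS fF s0 (ltW st) hx.
have mM e i : all_moments P (M e i) by have [] := adapted_rk_martingale fF wW t00 sa sb ok hx e i.
have mQ e i : all_moments P (Q e i).
  have [_ m1] := adapted_vec_rk fF sa sb (rho ^+ 2) (sign_of e) t0' (step_I ok) (step_I' ok) ok' hx' i.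
  have [_ m2] := adapted_vec_milstein fF sa sb (rho ^+ 2) t0' (step_I ok) ok' hx' i.
  by apply: all_momentsB; [exact: all_momentsB|exact: mM].
have orth i U : A s U -> E (fun w => U w * M true i w) + E (fun w => U w * M false i w) = 0.
  exact: (rk_martingale_orthogonal fF wW t00 sa sb ok hx).
have sgn1 e : sign_of e = 1 :> R \/ sign_of e = -1 :> R by case: e; [left|right].
have sgn2 e : sign_of e ^+ 2 = 1 :> R by case: e; rewrite /sign_of ?sqrrN expr1n.
pose V := E (fun w => lyap (x w) ^+ (p * 2)).
have V0 : 0 <= V by apply: mean_ge0 => w; rewrite exprn_ge0// ltW// lyap_gt0.
have hl : A s (fun w => 2 * lyap (x w)).
  by apply: (adapted_momZ fF) => //; exact: (adapted_mom_lyap fF).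
have bd (k : nat) (Y : T -> R) : all_moments P Y ->
    (forall w, `|Y w| <= D * (lyap (x w) * (1 + z w ^+ 2) * (1 + 1)) ^+ p * rho ^+ k) ->
    E (fun w => Y w ^+ 2) <= K * V * rho ^+ (k * 2).
  move=> mY hY; apply: le_trans (mean_sqr_noise_bound (p := p) (C := D) (r := rho ^+ k) s0 st hl mY _) _.
    move=> w; apply: le_trans (hY w) _; rewrite -/(z w).
    by have -> : 2 * lyap (x w) * (1 + z w ^+ 2) = lyap (x w) * (1 + z w ^+ 2) * (1 + 1) by ring.
  have -> : E (fun w => (2 * lyap (x w)) ^+ (p * 2)) = 2 ^+ (p * 2) * V.
    have [_ ml2] := adapted_momX fF s0 (p * 2) (adapted_mom_lyap fF s0 hx).
    by rewrite -meanZ//; congr (Rintegral P setT _); apply/funext => w; rewrite exprMn.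
  by rewrite -exprM /K le_eqVlt; apply/orP; left; apply/eqP; ring.
have EM e i : E (fun w => M e i w ^+ 2) <= K * V * rho ^+ 6.
  apply: (bd 3%N) => // w; have [h _] := hD i s rho (z w) (sign_of e) (x w) ok (sgn1 e).
  by move: h; rewrite sgn2.
have EQ e i : E (fun w => Q e i w ^+ 2) <= K * V * rho ^+ 8.
  apply: (bd 4%N) => // w; have [_ h] := hD i s rho (z w) (sign_of e) (x w) ok (sgn1 e).
  by move: h; rewrite sgn2 -(step_increment W ok).
have := hC s rho x y M Q (K * V) ok hx hy (mulr_ge0 K0 V0) mM mQ orth EM EQ.
have QE e i w : ml s rho x w 0 i + M e i w + Q e i w = rk s rho x e w 0 i by rewrite /Q; ring.
move=> h; apply: le_trans (le_trans _ h) _.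
  rewrite le_eqVlt; apply/orP; left; apply/eqP; congr (_ * _); apply: eq_bigr => i _.
  have eE e : E (fun w => (rk s rho x e w 0 i - ml s rho y w 0 i) ^+ 2) =
      E (fun w => (ml s rho x w 0 i + M e i w + Q e i w - ml s rho y w 0 i) ^+ 2).
    congr (Rintegral P setT _); apply/funext => w.
    exact (congr1 (fun u => (u - ml s rho y w 0 i) ^+ 2) (esym (QE e i w))).
  exact: (congr2 +%R (eE true) (eE false)).
have S0 : 0 <= \sum_i E (fun w => (x w 0 i - y w 0 i) ^+ 2).
  by apply: sumr_ge0 => i _; apply: mean_ge0 => w; exact: sqr_ge0.
apply: lerD.
  by apply: ler_wpM2r => //; rewrite lerD2l ler_wpM2r ?sqr_ge0// lerDl mulr_ge0.
apply: ler_wpM2r; first by rewrite exprn_ge0// ltW.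
by rewrite mulrA; apply: ler_wpM2r => //; rewrite lerDr.
Qed.

End RungeKuttaStepError.

(** * Two half steps against one step *)

Section TwoStepError.
Context {R : realType} {d : measure_display} {T : measurableType d}.
Variables (P : probability T R) (F : R -> set (set T)) (W : R -> T -> R).
Hypothesis fF : filtration F.
Hypothesis wW : wiener P F W.
Local Notation E f := (Rintegral P setT f).
Context {n : nat}.
Variables (a b : R -> 'rV[R]_n -> 'rV[R]_n) (t0 tm L : R).
Hypothesis t00 : 0 <= t0.
Hypothesis sa : forall i, smooth 3 t0 tm (fun z => a z.1 z.2 0 i).
Hypothesis sb : forall i, smooth 3 t0 tm (fun z => b z.1 z.2 0 i).
Hypothesis L1 : 1 <= L.
Hypothesis lipa : forall t x y, t0 <= t <= tm -> `|a t x - a t y| <= L * `|x - y|.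
Hypothesis lipb : forall t x y, t0 <= t <= tm -> `|b t x - b t y| <= L * `|x - y|.
Local Notation A := (adapted_mom P F).

Local Notation adapted_vec := (adapted_vec P F).
Local Notation step_ok := (step_ok t0 tm).
Local Notation noise s rho := (unit_noise W s (s + rho ^+ 2)).
Local Notation ml h s t x w := (milstein_step a b h s (W t w - W s w) (x w)).

Section TwoSteps.
Variables (s rho : R) (x : T -> 'rV[R]_n).
Hypotheses (ok1 : step_ok s rho) (ok2 : step_ok (s + rho ^+ 2) rho) (hx : adapted_vec s x).
Let s0 := step_ge0 t00 ok1.
Let st := step_lt ok1.
Let t0' := step_end_ge0 t00 ok1.
Let tu := step_lt ok2.
Let u0 := step_end_ge0 t00 ok2.
Let z1 := noise s rho.
Let z2 := noise (s + rho ^+ 2) rho.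
Let M i w := two_step_martingale a b (fun=> rho) (fun=> s) x z1 z2 i w.
Let x1 w := milstein_step a b (rho ^+ 2) s (rho * z1 w) (x w).
Let sI := step_I ok1.
Let tI := step_I ok2.

Let x1E w : ml (rho ^+ 2) s (s + rho ^+ 2) x w = x1 w.
Proof. by rewrite (step_increment W ok1). Qed.

Lemma adapted_first_step : adapted_vec (s + rho ^+ 2) (fun w => ml (rho ^+ 2) s (s + rho ^+ 2) x w).
Proof.
exact (adapted_vec_milstein fF sa sb (rho ^+ 2) t0' sI
  (adapted_step_increment fF wW t00 ok1) (adapted_vecS fF s0 (ltW st) hx)).
Qed.

Let hx1 : adapted_vec (s + rho ^+ 2) x1.
Proof. by move=> i; have := adapted_first_step i; under eq_fun do rewrite x1E. Qed.

Let D1 i w := bDa a b i (s, x w).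
Let D2 i w := milstein_corr b rho s (x w) 0 i - bDb b i (s, x w).
Let D3 i w := milstein_corr b (Num.sqrt 2 * rho) s (x w) 0 i - bDb b i (s, x w).
Let D4 i w := b (s + rho ^+ 2) (x1 w) 0 i - b s (x w) 0 i - rho * z1 w * bDb b i (s, x w).
Let D5 i w := milstein_corr b rho (s + rho ^+ 2) (x1 w) 0 i - bDb b i (s, x w).

Let hD1 i : A s (D1 i). Proof. exact: (adapted_bDa fF sa sb s0 sI hx). Qed.
Let hbDb i : A s (fun w => bDb b i (s, x w)). Proof. exact: (adapted_bDb fF sb s0 sI hx). Qed.
Let hD2 i : A s (D2 i).
Proof. by apply: (adapted_momB fF) => //; exact: (adapted_milstein_corr fF sb s0 sI hx). Qed.
Let hD3 i : A s (D3 i).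
Proof. by apply: (adapted_momB fF) => //; exact: (adapted_milstein_corr fF sb s0 sI hx). Qed.
Let up Y : A s Y -> A (s + rho ^+ 2) Y. Proof. exact: (adapted_momS fF s0 (ltW st)). Qed.
Let hz1 : A (s + rho ^+ 2) z1 := adapted_step_noise fF wW t00 ok1.
Let hD4 i : A (s + rho ^+ 2) (D4 i).
Proof.
apply: (adapted_momB fF) => //; first apply: (adapted_momB fF) => //.
- exact: (adapted_vec_b fF sb t0' tI hx1).
- by apply: up; exact: (adapted_vec_b fF sb s0 sI hx).
- by apply: (adapted_momM fF) => //; [exact: (adapted_momZ fF)|exact: up].
Qed.
Let hD5 i : A (s + rho ^+ 2) (D5 i).
Proof.
by apply: (adapted_momB fF) => //; [exact: (adapted_milstein_corr fF sb t0' tI hx1)|exact: up].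
Qed.

(** One part is a polynomial in [z1] with coefficients known at time s, the other a polynomial in
    [z2] with coefficients known at the middle time. The mixed term z1 z2 goes to the second part,
    where z1 is a known factor. *)
Let split_martingale U : A s U -> forall i, exists Y1 Y2,
  [/\ all_moments P Y1, all_moments P Y2, E Y1 = 0, E Y2 = 0 &
      forall w, U w * M i w = Y1 w + Y2 w].
Proof.
move=> hU i; have hU' := up hU.
pose U1 w := rho ^+ 3 * (U w * D1 i w).
pose U2 w := 2^-1 * rho ^+ 2 * (U w * (D2 i w - D3 i w)).
pose V1 w := U w * (rho * D4 i w - rho ^+ 2 * (z1 w * D3 i w)).
pose V2 w := 2^-1 * rho ^+ 2 * (U w * (D5 i w - D3 i w)).
have c0 t : 0 <= t -> A t (fun=> 0) by move=> tge; exact: (adapted_mom_cst P fF tge 0).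
have h1 : A s U1 by apply: (adapted_momZ fF) => //; exact: (adapted_momM fF).
have h2 : A s U2.
  by apply: (adapted_momZ fF) => //; apply: (adapted_momM fF) => //; exact: (adapted_momB fF).
have h3 : A (s + rho ^+ 2) V1.
  apply: (adapted_momM fF) => //; apply: (adapted_momB fF) => //; apply: (adapted_momZ fF) => //.
  by apply: (adapted_momM fF) => //; exact: up.
have h4 : A (s + rho ^+ 2) V2.
  apply: (adapted_momZ fF) => //; apply: (adapted_momM fF) => //; apply: (adapted_momB fF) => //.
  exact: up.
have [m1 e1] := mean_noise_cubic fF wW s0 st h1 h2 (c0 _ s0).
have [m2 e2] := mean_noise_cubic fF wW t0' tu h3 h4 (c0 _ t0').
eexists; eexists; split; [exact: m1|exact: m2|exact: e1|exact: e2|] => w.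
rewrite /M /two_step_martingale /U1 /U2 /V1 /V2 /= -/(z1 w) -/(z2 w) -/(x1 w).
rewrite -/(D1 i w) -/(D2 i w) -/(D3 i w) -/(D4 i w) -/(D5 i w).
by move: (D1 i w) (D2 i w) (D3 i w) (D4 i w) (D5 i w) => *; field.
Qed.

Lemma two_step_martingale_orthogonal i U : A s U -> E (fun w => U w * M i w) = 0.
Proof.
move=> /split_martingale/(_ i)[Y1 [Y2 [m1 m2 e1 e2 h]]].
have -> : (fun w => U w * M i w) = (fun w => Y1 w + Y2 w) by apply/funext.
by rewrite meanD// e1 e2 addr0.
Qed.

Lemma all_moments_two_step_martingale i : all_moments P (M i).
Proof.
have [Y1 [Y2 [m1 m2 _ _ h]]] := split_martingale (adapted_mom_cst P fF s0 1) i.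
have -> : M i = (fun w => Y1 w + Y2 w) by apply/funext => w; rewrite -h mul1r.
exact: all_momentsD.
Qed.

End TwoSteps.

(** This is [error_step] for the long step 2 rho^2, with the two short steps seen as a disturbed
    long step from x. *)
Lemma two_step_error : exists (C : R) (q : nat), 0 <= C /\
  forall s rho (x y : T -> 'rV[R]_n), t0 <= s -> s + 2 * rho ^+ 2 <= tm -> 0 < rho ->
    2 * rho ^+ 2 <= 1 -> adapted_vec s x -> adapted_vec s y ->
    \sum_i E (fun w => (milstein_step a b (rho ^+ 2) (s + rho ^+ 2)
          (W (s + 2 * rho ^+ 2) w - W (s + rho ^+ 2) w) (ml (rho ^+ 2) s (s + rho ^+ 2) x w) 0 i
        - ml (2 * rho ^+ 2) s (s + 2 * rho ^+ 2) y w 0 i) ^+ 2)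
    <= (1 + C * rho ^+ 2) * (\sum_i E (fun w => (x w 0 i - y w 0 i) ^+ 2))
       + C * E (fun w => lyap (x w) ^+ q) * rho ^+ 6.
Proof.
have [C [C0 hC]] := error_step fF wW t00 sa sb L1 lipa lipb.
have [D [p [D0 hD]]] := two_step_bound sa sb.
have gs0 := gauss_sum_ge0 (R := R) (p * 2).
pose K := D ^+ 2 * gauss_sum (p * 2) * gauss_sum (p * 2).
have K0 : 0 <= K by rewrite /K !mulr_ge0 ?exprn_ge0.
(* [error_step] is applied with root sqrt 2 rho; the factors are (sqrt 2)^2 = 2 and (sqrt 2)^6 =
   8. *)
exists (2 * C + 8 * (C * K)), (p * 2)%N; split=> [|s rho x y ts us r0 r1 hx hy].
  by rewrite addr_ge0 ?mulr_ge0.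
have r20 : 0 < rho ^+ 2 by rewrite exprn_gt0.
have rl1 : rho <= 1.
  rewrite -(@expr_le1 _ 2) ?(ltW r0)//.
  by apply: le_trans r1; rewrite mulr_natl mulr2n lerDr ltW.
have rr : s + rho ^+ 2 + rho ^+ 2 = s + 2 * rho ^+ 2 by rewrite mulr_natl mulr2n addrA.
have ok1 : step_ok s rho.
  by split => //; apply: le_trans us; rewrite -rr lerDl ltW.
have ok2 : step_ok (s + rho ^+ 2) rho.
  by split; rewrite ?rr// (le_trans ts)// lerDl ltW.
have sq2 : (Num.sqrt 2 * rho) ^+ 2 = 2 * rho ^+ 2 by rewrite exprMn sqr_sqrtr.
have ok : step_ok s (Num.sqrt 2 * rho).
  split; rewrite ?sq2//; first by rewrite mulr_gt0 ?sqrtr_gt0.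
  by rewrite -(@expr_le1 _ 2)// ?sq2// mulr_ge0 ?sqrtr_ge0 ?ltW.
have s0 := step_ge0 t00 ok1; have st := step_lt ok1; have t0' := step_end_ge0 t00 ok1.
have tu := step_lt ok2; have u0 := step_end_ge0 t00 ok2.
pose z1 := noise s rho; pose z2 := noise (s + rho ^+ 2) rho.
(* No sign occurs here, so the index e is a dummy and M is orthogonal to the past for each e. *)
pose M (e : bool) i w := two_step_martingale a b (fun=> rho) (fun=> s) x z1 z2 i w.
pose x1 w := ml (rho ^+ 2) s (s + rho ^+ 2) x w.
pose x2 w := milstein_step a b (rho ^+ 2) (s + rho ^+ 2)
          (W (s + 2 * rho ^+ 2) w - W (s + rho ^+ 2) w) (x1 w).
pose mx w := ml (2 * rho ^+ 2) s (s + 2 * rho ^+ 2) x w.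
pose Q (e : bool) i w := x2 w 0 i - mx w 0 i - M e i w.
have hx1 : adapted_vec (s + rho ^+ 2) x1 := adapted_first_step ok1 hx.
have mM e i : all_moments P (M e i) := all_moments_two_step_martingale ok1 ok2 hx i.
have inc1 w : W (s + rho ^+ 2) w - W s w = rho * z1 w := step_increment W ok1 w.
have inc2 w : W (s + 2 * rho ^+ 2) w - W (s + rho ^+ 2) w = rho * z2 w.
  by rewrite -rr; exact: step_increment.
have inc w : W (s + 2 * rho ^+ 2) w - W s w = rho * z1 w + rho * z2 w.
  by rewrite -inc1 -inc2 [RHS]addrC subrKA.
have mx2 i : all_moments P (fun w => x2 w 0 i).
  have := adapted_first_step ok2 hx1 i; rewrite rr => -[_]; exact.
have mmx i : all_moments P (fun w => mx w 0 i).
  have [_] := adapted_first_step ok hx i; rewrite sq2; exact.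
have mQ e i : all_moments P (Q e i) by apply: all_momentsB; [exact: all_momentsB|exact: mM].
have orth i U : A s U -> E (fun w => U w * M true i w) + E (fun w => U w * M false i w) = 0.
  by move=> hU; rewrite /M (two_step_martingale_orthogonal ok1 ok2 hx i hU) addr0.
pose V := E (fun w => lyap (x w) ^+ (p * 2)).
have V0 : 0 <= V by apply: mean_ge0 => w; rewrite exprn_ge0// ltW// lyap_gt0.
have hl := adapted_mom_lyap fF s0 hx.
have hz1 : A (s + rho ^+ 2) z1 := adapted_step_noise fF wW t00 ok1.
have hl1 : A (s + rho ^+ 2) (fun w => lyap (x w) * (1 + z1 w ^+ 2)).
  apply: (adapted_momM fF) => //; first exact: (adapted_momS fF s0 (ltW st) hl).
  by apply: (adapted_momD fF) => //; [exact: (adapted_mom_cst P fF t0' 1)|exact: (adapted_momX fF)].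
have bd (k : nat) (Y : T -> R) : all_moments P Y ->
    (forall w, `|Y w| <= D * (lyap (x w) * (1 + z1 w ^+ 2) * (1 + z2 w ^+ 2)) ^+ p * rho ^+ k) ->
    E (fun w => Y w ^+ 2) <= K * V * rho ^+ (k * 2).
  move=> mY hY; apply: le_trans (mean_sqr_noise_bound fF wW t0' tu hl1 mY hY) _.
  have -> : E (fun w => (lyap (x w) * (1 + z1 w ^+ 2)) ^+ (p * 2)) = V * gauss_sum (p * 2).
    rewrite -(mean_noise_gauss_sum fF wW s0 st (p * 2) (adapted_momX fF s0 (p * 2) hl)).
    by congr (Rintegral P setT _); apply/funext => w; rewrite exprMn.
  by rewrite -exprM /K le_eqVlt; apply/orP; left; apply/eqP; ring.
have pw (k : nat) : rho ^+ (k * 2) <= (Num.sqrt 2 * rho) ^+ (k * 2).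
  rewrite mulnC !exprM sq2; apply: lerXn2r; rewrite ?nnegrE.
  - exact: ltW.
  - by apply: mulr_ge0 => //; exact: ltW.
  - by rewrite mulr_natl mulr2n lerDr ltW.
have bd' (k : nat) (Y : T -> R) : all_moments P Y ->
    (forall w, `|Y w| <= D * (lyap (x w) * (1 + z1 w ^+ 2) * (1 + z2 w ^+ 2)) ^+ p * rho ^+ k) ->
    E (fun w => Y w ^+ 2) <= K * V * (Num.sqrt 2 * rho) ^+ (k * 2).
  move=> mY hY; apply: le_trans (bd k Y mY hY) _.
  by apply: ler_wpM2l; [exact: mulr_ge0|exact: pw].
have EM e i : E (fun w => M e i w ^+ 2) <= K * V * (Num.sqrt 2 * rho) ^+ 6.
  apply: (bd' 3%N) => // w.
  by have [h _] := hD i s rho (z1 w) (z2 w) (x w) ok1.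
have EQ e i : E (fun w => Q e i w ^+ 2) <= K * V * (Num.sqrt 2 * rho) ^+ 8.
  apply: (bd' 4%N) => // w.
  have [_ h] := hD i s rho (z1 w) (z2 w) (x w) ok1.
  by move: h; rewrite -inc -inc1 -inc2.
have := hC s _ x y M Q (K * V) ok hx hy (mulr_ge0 K0 V0) mM mQ orth EM EQ.
have QE e i w : mx w 0 i + M e i w + Q e i w = x2 w 0 i by rewrite /Q; ring.
rewrite sq2 => h; apply: le_trans (le_trans _ h) _.
  rewrite le_eqVlt; apply/orP; left; apply/eqP.
  have eE e i : E (fun w => (x2 w 0 i - ml (2 * rho ^+ 2) s (s + 2 * rho ^+ 2) y w 0 i) ^+ 2) =
      E (fun w => (mx w 0 i + M e i w + Q e i w - ml (2 * rho ^+ 2) s (s + 2 * rho ^+ 2) y w 0 i) ^+ 2).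
    congr (Rintegral P setT _); apply/funext => w.
    exact (congr1 (fun u => (u - ml (2 * rho ^+ 2) s (s + 2 * rho ^+ 2) y w 0 i) ^+ 2) (esym (QE e i w))).
  have half (u : R) : u = 2^-1 * (u + u) by lra.
  rewrite mulr_sumr; apply: eq_bigr => i _; apply: etrans (half _) _.
  exact: (congr1 (fun u => 2^-1 * u) (congr2 +%R (eE true i) (eE false i))).
have S0 : 0 <= \sum_i E (fun w => (x w 0 i - y w 0 i) ^+ 2).
  by apply: sumr_ge0 => i _; apply: mean_ge0 => w; exact: sqr_ge0.
have CK0 : 0 <= C * K by exact: mulr_ge0.
have -> : (Num.sqrt 2 * rho) ^+ 6 = 8 * rho ^+ 6.
  by rewrite (exprM _ 2 3) sq2; ring.
apply: lerD.
  apply: ler_wpM2r => //; rewrite lerD2l mulrA [C * 2]mulrC ler_wpM2r ?(ltW r20)//.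
  by rewrite lerDl mulr_ge0.
have -> : C * (K * V) * (8 * rho ^+ 6) = 8 * (C * K) * V * rho ^+ 6 by ring.
apply: ler_wpM2r; first by rewrite exprn_ge0// ltW.
by apply: ler_wpM2r => //; rewrite lerDr mulr_ge0.
Qed.

End TwoStepError.

(** * Global comparison of the schemes *)

Section Recursion.
Context {R : realType}.

Lemma discrete_gronwall (al be : R) (e : nat -> R) (m : nat) : 0 <= al -> 0 <= be -> e 0%N <= 0 ->
  (forall k, (k < m)%N -> e k.+1 <= (1 + al) * e k + be) ->
  e m <= (1 + al) ^+ m * (m%:R * be).
Proof.
move=> al0 be0 e0 h; have al1 : 1 <= 1 + al by rewrite lerDl.
suff : forall k, (k <= m)%N -> e k <= (1 + al) ^+ k * (k%:R * be) by exact.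
elim=> [_|k IH km]; first by rewrite mul0r mulr0.
apply: le_trans (h k km) _.
have h1 : (1 + al) * e k <= (1 + al) * ((1 + al) ^+ k * (k%:R * be)).
  by rewrite ler_wpM2l ?addr_ge0// IH// ltnW.
have h2 : be <= (1 + al) ^+ k.+1 * be by rewrite ler_peMl// exprn_ege1.
apply: le_trans (lerD h1 h2) _.
by rewrite mulrA -exprS -mulrDr -{2}[be]mul1r -mulrDl -natr1.
Qed.

Lemma compound_le_expR (c t : R) (m : nat) : 0 <= c -> 0 <= t -> (0 < m)%N ->
  (1 + c * (t / m%:R)) ^+ m <= expR (c * t).
Proof.
move=> c0 t0 m0; have mR : 0 < m%:R :> R by rewrite ltr0n.
have -> : c * t = (c * (t / m%:R)) *+ m.
  by rewrite -mulr_natr -!mulrA mulVf ?mulr1// gt_eqF.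
rewrite -[X in expR X]mulr_natl expRM_natl.
apply: lerXn2r; rewrite ?nnegrE ?expR_ge0 ?expR_ge1Dx//.
by rewrite addr_ge0// mulr_ge0// divr_ge0// ltW.
Qed.

Definition set_sign (sg : nat -> bool) (k : nat) (e : bool) : nat -> bool :=
  fun j => if j == k then e else sg j.

(* Only the first [k] signs are averaged over, the others are set to [true]. *)
Fixpoint sign_mean (k : nat) (f : (nat -> bool) -> R) : R :=
  if k is k'.+1 then
    2^-1 * (sign_mean k' (fun sg => f (set_sign sg k' true))
          + sign_mean k' (fun sg => f (set_sign sg k' false)))
  else f (fun=> true).

Lemma sign_mean_le k f g : (forall sg, f sg <= g sg) -> sign_mean k f <= sign_mean k g.
Proof.
elim: k f g => [|k IH] f g h /=; first exact: h.
by apply: ler_wpM2l; [rewrite invr_ge0|apply: lerD; apply: IH => sg; exact: h].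
Qed.

Lemma sign_mean_lin k (c : R) f g :
  sign_mean k (fun sg => c * f sg + g sg) = c * sign_mean k f + sign_mean k g.
Proof. by elim: k f g => [//|k IH] f g /=; rewrite !IH; ring. Qed.

Lemma sign_mean_cst k (c : R) : sign_mean k (fun=> c) = c.
Proof. by elim: k => [//|k IH] /=; rewrite IH; field. Qed.

(** The definition averages the last sign outermost. Moved innermost, the average can be taken with
    all earlier signs fixed, which is the form of the one-step estimates. *)
Lemma sign_meanS k f : sign_mean k.+1 f =
  sign_mean k (fun sg => 2^-1 * (f (set_sign sg k true) + f (set_sign sg k false))).
Proof.
rewrite /= [RHS](_ : _ = sign_mean k (fun sg => 2^-1 * f (set_sign sg k true)
   + 2^-1 * f (set_sign sg k false))).
  rewrite sign_mean_lin mulrDr; congr (_ + _).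
  rewrite [RHS](_ : _ = sign_mean k (fun sg => 2^-1 * f (set_sign sg k false) + 0)).
    by rewrite sign_mean_lin sign_mean_cst addr0.
  by congr sign_mean; apply/funext => sg; rewrite addr0.
by congr sign_mean; apply/funext => sg; rewrite mulrDr.
Qed.

End Recursion.

(** * Summation of the local errors over the grid *)

Section GlobalError.
Context {R : realType} {d : measure_display} {T : measurableType d}.
Variables (P : probability T R) (F : R -> set (set T)) (W : R -> T -> R).
Hypothesis fF : filtration F.
Hypothesis wW : wiener P F W.
Local Notation E f := (Rintegral P setT f).
Context {n : nat}.
Variables (a b : R -> 'rV[R]_n -> 'rV[R]_n) (t0 tm L : R).
Hypothesis t00 : 0 <= t0.
Hypothesis sa : forall i, smooth 3 t0 tm (fun z => a z.1 z.2 0 i).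
Hypothesis sb : forall i, smooth 3 t0 tm (fun z => b z.1 z.2 0 i).
Hypothesis L1 : 1 <= L.
Hypothesis lipa : forall t x y, t0 <= t <= tm -> `|a t x - a t y| <= L * `|x - y|.
Hypothesis lipb : forall t x y, t0 <= t <= tm -> `|b t x - b t y| <= L * `|x - y|.
Hypothesis groa : forall t x, t0 <= t <= tm -> `|a t x| <= L * (1 + `|x|).
Hypothesis grob : forall t x, t0 <= t <= tm -> `|b t x| <= L * (1 + `|x|).
Let L0 : 0 <= L. Proof. exact: le_trans L1. Qed.

Local Notation adapted_vec := (adapted_vec P F).
Local Notation step_ok := (step_ok t0 tm).
Hypothesis tt : t0 < tm.
Variable x0 : T -> 'rV[R]_n.
Hypothesis hx0 : adapted_vec t0 x0.

Local Notation H m := ((tm - t0) / m%:R).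
Local Notation rho m := (Num.sqrt (H m)).
Local Notation gr m k := (grid t0 (H m) k).
Local Notation Q m k := (fun w => milstein_scheme a b t0 (H m) (W^~ w) (x0 w) k).
Local Notation X m sg k := (fun w => rk_scheme a b t0 (H m) (W^~ w) (fun j => sign_of (sg j)) (x0 w) k).

Section Grid.
Variable m : nat.
Hypotheses (m0 : (0 < m)%N) (H1 : H m <= 1).

Lemma mesh_gt0 : 0 < H m. Proof. by rewrite divr_gt0 ?subr_gt0// ltr0n. Qed.
Lemma mesh_sqr : rho m ^+ 2 = H m. Proof. by rewrite sqr_sqrtr// ltW// mesh_gt0. Qed.

Lemma grid_last : gr m m = tm.
Proof. by rewrite /grid mulrC divfK ?gt_eqF ?ltr0n// addrC subrK. Qed.

Lemma grid_le k l : (k <= l)%N -> gr m k <= gr m l.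
Proof. by move=> kl; rewrite /grid lerD2l ler_wpM2r ?ler_nat// ltW// mesh_gt0. Qed.

Lemma grid_ge k : t0 <= gr m k.
Proof. by rewrite /grid lerDl mulr_ge0// ltW// mesh_gt0. Qed.

Lemma step_ok_grid k : (k < m)%N -> step_ok (gr m k) (rho m).
Proof.
move=> km; split; first exact: grid_ge.
- by rewrite mesh_sqr -gridS -[leRHS]grid_last grid_le.
- by rewrite sqrtr_gt0 mesh_gt0.
- by rewrite -(@expr_le1 _ 2)// mesh_sqr.
Qed.

Lemma grid_next k : gr m k.+1 = gr m k + rho m ^+ 2.
Proof. by rewrite mesh_sqr gridS. Qed.

Lemma milstein_schemeS k w : Q m k.+1 w = milstein_step a b (rho m ^+ 2) (gr m k)
  (W (gr m k + rho m ^+ 2) w - W (gr m k) w) (Q m k w).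
Proof. by rewrite /= -grid_next mesh_sqr. Qed.

Lemma rk_schemeS sg k w : X m sg k.+1 w = rk_step a b (rho m ^+ 2) (gr m k) (gr m k + rho m ^+ 2)
  (W (gr m k + rho m ^+ 2) w - W (gr m k) w) (sign_of (sg k)) (X m sg k w).
Proof. by rewrite /= -grid_next mesh_sqr. Qed.

Lemma grid0 : gr m 0 = t0. Proof. by rewrite /grid mul0r addr0. Qed.

Lemma adapted_milstein_scheme k : (k <= m)%N -> adapted_vec (gr m k) (Q m k).
Proof.
elim: k => [_|k IH km]; first by rewrite grid0.
have ok := step_ok_grid km; have s0 := step_ge0 t00 ok.
have -> : Q m k.+1 = (fun w => milstein_step a b (rho m ^+ 2) (gr m k)
  (W (gr m k + rho m ^+ 2) w - W (gr m k) w) (Q m k w)).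
  by apply/funext => w; exact: milstein_schemeS.
rewrite grid_next.
exact (adapted_vec_milstein fF sa sb (rho m ^+ 2) (step_end_ge0 t00 ok) (step_I ok)
  (adapted_step_increment fF wW t00 ok) (adapted_vecS fF s0 (ltW (step_lt ok)) (IH (ltnW km)))).
Qed.

Lemma adapted_rk_scheme sg k : (k <= m)%N -> adapted_vec (gr m k) (X m sg k).
Proof.
elim: k => [_|k IH km]; first by rewrite grid0.
have ok := step_ok_grid km; have s0 := step_ge0 t00 ok.
have -> : X m sg k.+1 = (fun w => rk_step a b (rho m ^+ 2) (gr m k) (gr m k + rho m ^+ 2)
  (W (gr m k + rho m ^+ 2) w - W (gr m k) w) (sign_of (sg k)) (X m sg k w)).
  by apply/funext => w; exact: rk_schemeS.
rewrite grid_next.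
exact (adapted_vec_rk fF sa sb (rho m ^+ 2) (sign_of (sg k)) (step_end_ge0 t00 ok) (step_I ok)
  (step_I' ok)
  (adapted_step_increment fF wW t00 ok) (adapted_vecS fF s0 (ltW (step_lt ok)) (IH (ltnW km)))).
Qed.

End Grid.

(** The state after k steps has seen only the first k signs; changing sign k therefore leaves the
    state before that step alone. *)
Lemma rk_scheme_eq m sg sg' k : (forall j, (j < k)%N -> sg j = sg' j) -> X m sg k = X m sg' k.
Proof.
move=> h; apply/funext => w; elim: k h => [//|k IH] h.
have e1 : X m sg k w = X m sg' k w by apply: IH => j jk; apply: h; exact: ltnW.
exact (congr2 (fun e y => rk_step a b (H m) (gr m k) (gr m k.+1)
  (W (gr m k.+1) w - W (gr m k) w) (sign_of e) y) (h k (ltnSn k)) e1).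
Qed.

Lemma rk_scheme_set_sign m sg k e : X m (set_sign sg k e) k = X m sg k.
Proof. by apply: rk_scheme_eq => j jk; rewrite /set_sign ltn_eqF. Qed.

Lemma rk_scheme_set_signS m sg k e w : X m (set_sign sg k e) k.+1 w =
  rk_step a b (H m) (gr m k) (gr m k.+1) (W (gr m k.+1) w - W (gr m k) w) (sign_of e) (X m sg k w).
Proof.
have e1 : set_sign sg k e k = e by rewrite /set_sign eqxx.
exact (congr2 (fun e y => rk_step a b (H m) (gr m k) (gr m k.+1)
  (W (gr m k.+1) w - W (gr m k) w) (sign_of e) y) e1 (congr1 (@^~ w) (rk_scheme_set_sign m sg k e))).
Qed.

Lemma milstein_scheme_moments (p : nat) : exists M : R, 0 <= M /\
  forall m k, (0 < m)%N -> H m <= 1 -> (k <= m)%N -> E (fun w => lyap (Q m k w) ^+ p) <= M.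
Proof.
have [C [C0 h]] := mean_lyap_milstein fF wW t00 sa sb L1 lipb groa grob p.
pose V := E (fun w => lyap (x0 w) ^+ p).
have V0 : 0 <= V by apply: mean_ge0 => w; rewrite exprn_ge0// ltW// lyap_gt0.
exists (expR (C * (tm - t0)) * V); split=> [|m k m0 H1 km].
  by rewrite mulr_ge0// expR_ge0.
have Hge := ltW (mesh_gt0 m0).
have al1 : 1 <= 1 + C * H m by rewrite lerDl mulr_ge0.
apply: (@le_trans _ _ ((1 + C * H m) ^+ k * V)).
  elim: k km => [_|k IH km]; first by rewrite mul1r.
  have ok := step_ok_grid m0 H1 km.
  under eq_Rintegral do rewrite milstein_schemeS//.
  apply: le_trans (h _ _ _ ok (adapted_milstein_scheme m0 H1 (ltnW km))) _.
  rewrite mesh_sqr// exprS -mulrA ler_wpM2l ?(le_trans ler01 al1)//; exact: IH (ltnW km).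
apply: ler_wpM2r => //; apply: (@le_trans _ _ ((1 + C * H m) ^+ m)).
  by rewrite ler_weXn2l.
by apply: compound_le_expR => //; rewrite subr_ge0 ltW.
Qed.

Lemma rk_scheme_moments (p : nat) : exists M : R, 0 <= M /\
  forall m k, (0 < m)%N -> H m <= 1 -> (k <= m)%N ->
    sign_mean k (fun sg => E (fun w => lyap (X m sg k w) ^+ p)) <= M.
Proof.
have [C [C0 h]] := mean_lyap_rk fF wW t00 sa sb L1 lipb groa grob p.
pose V := E (fun w => lyap (x0 w) ^+ p).
have V0 : 0 <= V by apply: mean_ge0 => w; rewrite exprn_ge0// ltW// lyap_gt0.
exists (expR (C * (tm - t0)) * V); split=> [|m k m0 H1 km].
  by rewrite mulr_ge0// expR_ge0.
have Hge := ltW (mesh_gt0 m0).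
have al1 : 1 <= 1 + C * H m by rewrite lerDl mulr_ge0.
apply: (@le_trans _ _ ((1 + C * H m) ^+ k * V)).
  elim: k km => [_|k IH km]; first by rewrite mul1r.
  have ok := step_ok_grid m0 H1 km.
  rewrite sign_meanS; apply: (@le_trans _ _ (sign_mean k (fun sg =>
      (1 + C * H m) * E (fun w => lyap (X m sg k w) ^+ p) + 0))).
    apply: sign_mean_le => sg.
    have := h _ _ _ ok (adapted_rk_scheme m0 H1 sg (ltnW km)).
    rewrite mesh_sqr// addr0 big_cons big_seq1 -gridS; apply: le_trans.
    apply: ler_wpM2l; first by rewrite invr_ge0.
    have eE e : E (fun w => lyap (X m (set_sign sg k e) k.+1 w) ^+ p) =
      E (fun w => lyap (rk_step a b (H m) (gr m k) (gr m k.+1)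
       (W (gr m k.+1) w - W (gr m k) w) (sign_of e) (X m sg k w)) ^+ p).
      apply: eq_Rintegral => w _.
      exact (congr1 (fun y => lyap y ^+ p) (rk_scheme_set_signS m sg k e w)).
    rewrite le_eqVlt; apply/orP; left; apply/eqP.
    exact (congr2 +%R (eE true) (eE false)).
  rewrite sign_mean_lin sign_mean_cst addr0 exprS -mulrA.
  by rewrite ler_wpM2l ?(le_trans ler01 al1)//; exact: IH (ltnW km).
apply: ler_wpM2r => //; apply: (@le_trans _ _ ((1 + C * H m) ^+ m)).
  by rewrite ler_weXn2l.
by apply: compound_le_expR => //; rewrite subr_ge0 ltW.
Qed.

(** A mean-square contribution of h^3 in each of m steps adds up to m h^3 = (tm - t0) h^2. *)
Lemma mesh_cube m (C M : R) : (0 < m)%N -> H m <= 1 -> 0 <= C -> 0 <= M ->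
  forall e : nat -> R, e 0%N = 0 ->
  (forall k, (k < m)%N -> e k.+1 <= (1 + C * H m) * e k + M * H m ^+ 3) ->
  e m <= expR (C * (tm - t0)) * (tm - t0) * M * H m ^+ 2.
Proof.
move=> m0 H1 C0 M0 e e0 h; have Hge := ltW (mesh_gt0 m0).
apply: le_trans (discrete_gronwall (al := C * H m) (be := M * H m ^+ 3) _ _ _ h) _.
- exact: mulr_ge0.
- by rewrite mulr_ge0 ?exprn_ge0.
- by rewrite e0.
have -> : m%:R * (M * H m ^+ 3) = (tm - t0) * M * H m ^+ 2.
  have mR : m%:R != 0 :> R by rewrite pnatr_eq0 -lt0n.
  by field.
have -> : expR (C * (tm - t0)) * (tm - t0) * M * H m ^+ 2 =
  expR (C * (tm - t0)) * ((tm - t0) * M * H m ^+ 2) by rewrite !mulrA.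
have tt0 : 0 <= tm - t0 by rewrite subr_ge0 ltW.
apply: ler_wpM2r; last exact: compound_le_expR.
by rewrite mulr_ge0 ?exprn_ge0// mulr_ge0.
Qed.

Lemma rk_milstein_error : exists K : R, 0 <= K /\ forall m, (0 < m)%N -> H m <= 1 ->
  sign_mean m (fun sg => \sum_i E (fun w => (X m sg m w 0 i - Q m m w 0 i) ^+ 2)) <= K * H m ^+ 2.
Proof.
have [C [q [C0 h]]] := rk_error_step fF wW t00 sa sb L1 lipa lipb.
have [M [M0 hM]] := rk_scheme_moments q.
exists (expR (C * (tm - t0)) * (tm - t0) * (C * M)); split=> [|m m0 H1].
  by rewrite !mulr_ge0 ?expR_ge0// subr_ge0 ltW.
pose S sg k := \sum_i E (fun w => (X m sg k w 0 i - Q m k w 0 i) ^+ 2).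
apply: (mesh_cube m0 H1 C0 (mulr_ge0 C0 M0) (e := fun k => sign_mean k (S^~ k))).
  rewrite /= /S big1// => i _; rewrite -[RHS](mean_cst P 0); apply: eq_Rintegral => w _.
  by rewrite subrr expr0n.
move=> k km; have ok := step_ok_grid m0 H1 km.
have Hge := ltW (mesh_gt0 m0).
rewrite sign_meanS; apply: (@le_trans _ _ (sign_mean k (fun sg => (1 + C * H m) * S sg k
    + ((C * H m ^+ 3) * E (fun w => lyap (X m sg k w) ^+ q) + 0)))).
  apply: sign_mean_le => sg.
  have := h _ _ _ _ ok (adapted_rk_scheme m0 H1 sg (ltnW km)) (adapted_milstein_scheme m0 H1 (ltnW km)).
  have -> : rho m ^+ 6 = H m ^+ 3 by rewrite (exprM _ 2 3) mesh_sqr.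
  rewrite mesh_sqr// addr0 -gridS [C * _ * _]mulrAC; apply: le_trans.
  have eE e : S (set_sign sg k e) k.+1 = \sum_i E (fun w => (rk_step a b (H m) (gr m k) (gr m k.+1)
      (W (gr m k.+1) w - W (gr m k) w) (sign_of e) (X m sg k w) 0 i - Q m k.+1 w 0 i) ^+ 2).
    apply: eq_bigr => i _; apply: eq_Rintegral => w _.
    exact (congr1 (fun y : 'rV[R]_n => (y 0 i - Q m k.+1 w 0 i) ^+ 2) (rk_scheme_set_signS m sg k e w)).
  rewrite big_split le_eqVlt; apply/orP; left; apply/eqP.
  exact (congr1 (fun u => 2^-1 * u) (congr2 +%R (eE true) (eE false))).
rewrite sign_mean_lin sign_mean_lin sign_mean_cst addr0 lerD2l [leRHS]mulrAC.
by apply: ler_wpM2l; [rewrite mulr_ge0 ?exprn_ge0|exact: hM (ltnW km)].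
Qed.

Lemma mesh_double m : H (m * 2)%N = H m / 2.
Proof. by rewrite natrM invfM mulrA. Qed.

Lemma grid_double m k : gr (m * 2) (k * 2) = gr m k.
Proof. by rewrite /grid mesh_double natrM mulrACA divff ?mulr1 ?pnatr_eq0. Qed.

Lemma milstein_double_error : exists K : R, 0 <= K /\ forall m, (0 < m)%N -> H m <= 1 ->
  \sum_i E (fun w => (Q (m * 2) (m * 2) w 0 i - Q m m w 0 i) ^+ 2) <= K * H m ^+ 2.
Proof.
have [C [q [C0 h]]] := two_step_error fF wW t00 sa sb L1 lipa lipb.
have [M [M0 hM]] := milstein_scheme_moments q.
exists (expR (C * (tm - t0)) * (tm - t0) * (C * M)); split=> [|m m0 H1].
  by rewrite !mulr_ge0 ?expR_ge0// subr_ge0 ltW.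
have Hge := ltW (mesh_gt0 m0); have H20 : 0 <= H m / 2 by rewrite divr_ge0.
have m20 : (0 < m * 2)%N by rewrite muln_gt0 m0.
have H2 : H (m * 2) <= 1.
  by rewrite mesh_double; apply: le_trans H1; rewrite ler_pdivrMr// ler_peMr// ler1n.
pose S k := \sum_i E (fun w => (Q (m * 2) (k * 2) w 0 i - Q m k w 0 i) ^+ 2).
apply: (mesh_cube m0 H1 C0 (mulr_ge0 C0 M0) (e := S)).
  rewrite /S big1// => i _; rewrite -[RHS](mean_cst P 0); apply: eq_Rintegral => w _.
  by rewrite subrr expr0n.
move=> k km; pose r := rho (m * 2).
have r2 : r ^+ 2 = H m / 2 by rewrite mesh_sqr// mesh_double.
have r22 : 2 * r ^+ 2 = H m by rewrite r2 mulrC divfK.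
have k2 : (k * 2 <= m * 2)%N by rewrite leq_mul2r ltnW// orbT.
have hx := adapted_milstein_scheme m20 H2 k2; rewrite grid_double in hx.
have hy := adapted_milstein_scheme m0 H1 (ltnW km).
have [s1 s2 _ _] := step_ok_grid m0 H1 km; rewrite mesh_sqr// in s2.
have r0 : 0 < r by rewrite sqrtr_gt0 mesh_gt0.
have := h (gr m k) r _ _ s1; rewrite r22 => /(_ _ _ s2 r0 H1 hx hy) {}h.
have g1 : gr m k + r ^+ 2 = gr (m * 2) (k * 2).+1 by rewrite gridS grid_double r2 mesh_double.
have g2 : gr m k + H m = gr (m * 2) (k.+1 * 2) by rewrite -gridS grid_double.
have r2' : r ^+ 2 = H (m * 2) by rewrite r2 mesh_double.
apply: (@le_trans _ _ ((1 + C * r ^+ 2) * S k + C * E (fun w => lyap (Q (m * 2) (k * 2) w) ^+ q) * r ^+ 6)).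
  (* The times in [two_step_error] equal the grid points of the fine scheme but are written
     differently; stated for variables, the equality becomes a substitution. *)
  have e1 h' t t1 t2 : h' = H (m * 2) -> t = gr (m * 2) (k * 2) -> t1 = gr (m * 2) (k * 2).+1 ->
      t2 = gr (m * 2) (k.+1 * 2) -> forall w, milstein_step a b h' t1 (W t2 w - W t1 w)
        (milstein_step a b h' t (W t1 w - W t w) (Q (m * 2) (k * 2) w)) = Q (m * 2) (k.+1 * 2) w.
    by move=> -> -> -> -> w; exact (erefl _).
  have {}e1 := e1 _ _ _ _ r2' (esym (grid_double m k)) g1 g2.
  have e2 t : t = gr m k.+1 -> forall w,
      milstein_step a b (H m) (gr m k) (W t w - W (gr m k) w) (Q m k w) = Q m k.+1 w.
    by move=> -> w; exact (erefl _).
  have {}e2 := e2 _ (esym (gridS t0 (H m) k)).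
  apply: le_trans h; rewrite le_eqVlt; apply/orP; left; apply/eqP.
  apply: eq_bigr => i _; apply: eq_Rintegral => w _.
  exact (congr2 (fun y z : 'rV[R]_n => (y 0 i - z 0 i) ^+ 2) (esym (e1 w)) (esym (e2 w))).
have S0 : 0 <= S k by apply: sumr_ge0 => i _; apply: mean_ge0 => w; exact: sqr_ge0.
apply: lerD.
  by apply: ler_wpM2r => //; rewrite lerD2l ler_wpM2l// r2 ler_pdivrMr// ler_peMr// ler1n.
apply: ler_pM.
- by rewrite mulr_ge0// mean_ge0// => w; rewrite exprn_ge0// ltW// lyap_gt0.
- by rewrite exprn_ge0// ltW.
- by apply: ler_wpM2l => //; exact: hM.
- rewrite (exprM _ 2 3) r2; apply: lerXn2r; rewrite ?nnegrE//.
  by rewrite ler_pdivrMr// ler_peMr// ler1n.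
Qed.

(* The factor 3/2 in [(u + v)^2 <= 3 u^2 + 3/2 v^2] is beaten by the factor 1/4
   that halving the mesh gives, so the dyadic errors add up to a bounded multiple
   of the first one. *)
Lemma milstein_dyadic_error : exists K : R, 0 <= K /\ forall j m, (0 < m)%N -> H m <= 1 ->
  \sum_i E (fun w => (Q (m * 2 ^ j) (m * 2 ^ j) w 0 i - Q m m w 0 i) ^+ 2) <= K * H m ^+ 2.
Proof.
have alg (x y z : R) : (z - x) ^+ 2 <= 3 * (y - x) ^+ 2 + (3 / 2) * (z - y) ^+ 2.
  by have := sqr_ge0 (2 * (y - x) - (z - y)); lra.
have [K [K0 h]] := milstein_double_error.
(* The constant reproduces itself in the induction: 3 + (3/2)(6/4) = 21/4 <= 6. *)
exists (6 * K); split=> [|j]; first exact: mulr_ge0.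
elim: j => [|j IH] m m0 H1; have Hge := ltW (mesh_gt0 m0).
  have K6 : 0 <= 6 * K * H m ^+ 2 by apply: mulr_ge0; [exact: mulr_ge0|exact: exprn_ge0].
  rewrite muln1 big1// => i _; rewrite -[RHS](mean_cst P 0).
  by apply: eq_Rintegral => w _; rewrite subrr expr0n.
have m20 : (0 < m * 2)%N by rewrite muln_gt0 m0.
have H2 : H (m * 2) <= 1.
  by rewrite mesh_double; apply: le_trans H1; rewrite ler_pdivrMr// ler_peMr// ler1n.
have mj m' : (0 < m')%N -> (0 < m' * 2 ^ j)%N by move=> ?; rewrite muln_gt0 expn_gt0 andbT.
have Hj : H (m * 2 * 2 ^ j) <= 1.
  apply: le_trans H2; apply: ler_wpM2l; first by rewrite subr_ge0 ltW.
  by rewrite lef_pV2 ?posrE ?ltr0n ?mj// ler_nat leq_pmulr// expn_gt0.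
have aQ m' i : (0 < m')%N -> H m' <= 1 -> all_moments P (fun w => Q m' m' w 0 i).
  by move=> m'0 H'; have [] := adapted_milstein_scheme m'0 H' (leqnn m') i.
rewrite expnS mulnA.
apply: (@le_trans _ _ (\sum_i (3 * E (fun w => (Q (m * 2) (m * 2) w 0 i - Q m m w 0 i) ^+ 2)
  + (3 / 2) * E (fun w => (Q (m * 2 * 2 ^ j) (m * 2 * 2 ^ j) w 0 i - Q (m * 2) (m * 2) w 0 i) ^+ 2)))).
  apply: ler_sum => i _.
  have a1 := aQ _ i m0 H1; have a2 := aQ _ i m20 H2; have a3 := aQ _ i (mj _ m20) Hj.
  have b1 := all_momentsX 2 (all_momentsB a2 a1).
  have b2 := all_momentsX 2 (all_momentsB a3 a2).
  have b3 := all_momentsX 2 (all_momentsB a3 a1).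
  rewrite -(meanZ _ b1) -(meanZ _ b2) -meanD; [|exact: all_momentsZ|exact: all_momentsZ].
  apply: mean_le; [exact: b3|by apply: all_momentsD; exact: all_momentsZ|] => w.
  exact: alg.
rewrite big_split -!mulr_sumr /=.
have h1 := h m m0 H1; have h2 := IH (m * 2)%N m20 H2.
apply: le_trans (lerD (ler_wpM2l _ h1) (ler_wpM2l _ h2)) _ => //.
rewrite mesh_double -subr_ge0 (_ : _ - _ = 3 / 4 * (K * H m ^+ 2)); last by move: (H m) => u; field.
by apply: mulr_ge0; [exact: divr_ge0|apply: mulr_ge0 => //; exact: exprn_ge0].
Qed.

End GlobalError.

(** * The Ito integral *)

Section SquareIntegrals.
Context {R : realType} {d : measure_display} {T : measurableType d}.
Variable P : probability T R.
Local Notation lam := (@lebesgue_measure R).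

(** The counterpart of [mean_le_comb] for nonnegative functions whose integrals may be infinite. *)
Lemma ge0_integral_le_comb {d' : measure_display} {X : measurableType d'}
  (mu : {measure set X -> \bar R}) (D : set X) (s : seq (R * (X -> R))) (Y : X -> R) :
  measurable D -> measurable_fun D Y ->
  foldr (fun (p : R * (X -> R)) Q => [/\ 0 <= p.1, measurable_fun D p.2, forall x, D x -> 0 <= p.2 x & Q]) True s ->
  (forall x, D x -> 0 <= Y x <= foldr (fun (p : R * (X -> R)) acc => p.1 * p.2 x + acc) 0 s) ->
  (\int[mu]_(x in D) (Y x)%:E <=
     foldr (fun (p : R * (X -> R)) acc => p.1%:E * \int[mu]_(x in D) (p.2 x)%:E + acc) 0 s)%E.
Proof.
move=> mD mY hs hY.
pose f s x : R := foldr (fun (p : R * (X -> R)) acc => p.1 * p.2 x + acc) 0 s.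
have [mf f0 <-] : [/\ measurable_fun D (f s), forall x, D x -> 0 <= f s x &
    (\int[mu]_(x in D) (f s x)%:E =
     foldr (fun (p : R * (X -> R)) acc => p.1%:E * \int[mu]_(x in D) (p.2 x)%:E + acc) 0 s)%E].
  elim: s hs {hY} => [_|p s IH [p0 mp hp /IH[mf f0 fE]]] /=.
    by split => //; [exact: measurable_cst|rewrite integral0].
  have mp' : measurable_fun D (fun x => p.1 * p.2 x) by apply: measurable_funM.
  split=> [|x Dx|].
  - exact: measurable_funD.
  - by rewrite addr_ge0 ?f0// mulr_ge0 ?hp.
  have g1 x : D x -> (0 <= (p.2 x)%:E)%E by move=> Dx; rewrite lee_fin hp.
  have g2 x : D x -> (0 <= (p.1 * p.2 x)%:E)%E by move=> Dx; rewrite lee_fin mulr_ge0 ?hp.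
  have g3 x : D x -> (0 <= (f s x)%:E)%E by move=> Dx; rewrite lee_fin f0.
  have e1 := mp; have e2 := mp'; have e3 := mf.
  move/measurable_EFinP in e1; move/measurable_EFinP in e2; move/measurable_EFinP in e3.
  under eq_integral do rewrite EFinD.
  rewrite ge0_integralD// fE; congr (_ + _)%E.
  by under eq_integral do rewrite EFinM; rewrite ge0_integralZl.
apply: ge0_le_integral => //.
- by move=> x Dx; rewrite lee_fin; case/andP: (hY x Dx).
- exact/measurable_EFinP.
- exact/measurable_EFinP.
- by move=> x Dx; rewrite lee_fin; case/andP: (hY x Dx).
Qed.

Definition jointly_measurable (D : set R) (Y : R -> T -> R) : Prop :=
  measurable_fun (D `*` setT) (fun z : measurableTypeR R * T => Y z.1 z.2).

Section Iterated.
Variables (D : set R) (Y : R -> T -> R).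
Hypotheses (mD : measurable D) (mY : jointly_measurable D Y).
Hypothesis Y0 : forall t w, 0 <= Y t w.

Let mDT : measurable (D `*` [set: T]). Proof. exact: measurableX. Qed.
(** Extension by zero outside D, because Tonelli's theorem is applied on the whole product. *)
Let f (z : measurableTypeR R * T) : \bar R := ((fun z => (Y z.1 z.2)%:E) \_ (D `*` setT)) z.
Let mf : measurable_fun setT f.
Proof.
apply/(measurable_restrictT _ mDT); exact/measurable_EFinP.
Qed.
Let f0 z : (0 <= f z)%E. Proof. by rewrite /f patchE; case: ifPn => // _; rewrite lee_fin. Qed.

Let fE t w : f (t, w) = (((fun t => (Y t w)%:E)) \_ D) t.
Proof.
rewrite /f !patchE; congr (if _ then _ else _).
by apply/idP/idP; rewrite !inE => //= -[].
Qed.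

Lemma iterated_integralE : (\int[P]_w \int[lam]_(t in D) (Y t w)%:E =
  \int[lam \x P]_(z in D `*` setT) (Y z.1 z.2)%:E)%E.
Proof.
rewrite [RHS]integral_mkcond -/f (fubini_tonelli2 f mf f0).
apply: eq_integral => w _; rewrite integral_mkcond /fubini_G.
by apply: eq_integral => t _; rewrite fE.
Qed.

Lemma iterated_integral_swap : (\int[P]_w \int[lam]_(t in D) (Y t w)%:E =
  \int[lam]_(t in D) \int[P]_w (Y t w)%:E)%E.
Proof.
rewrite iterated_integralE integral_mkcond -/f (fubini_tonelli1 f mf f0).
rewrite [RHS]integral_mkcond; apply: eq_integral => t _; rewrite /fubini_F patchE.
case: ifPn => tD.
  by apply: eq_integral => w _; rewrite fE patchE tD.
by rewrite (eq_integral (cst 0%E)) ?integral0// => w _; rewrite fE patchE (negPf tD).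
Qed.

Lemma measurable_section w : measurable_fun D (fun t => Y t w).
Proof.
apply/measurable_EFinP/(measurable_restrictT _ mD).
have -> : (fun t => (Y t w)%:E) \_ D = f \o (fun t => (t, w)) by apply/funext => t; rewrite /= fE.
by apply: measurableT_comp => //; exact: pair2_measurable.
Qed.

Lemma measurable_inner : measurable_fun setT (fun w => \int[lam]_(t in D) (Y t w)%:E)%E.
Proof.
have := measurable_fun_fubini_tonelli_G (m1 := lam) f mf f0; apply: eq_measurable_fun => w _.
by rewrite /fubini_G [RHS]integral_mkcond; apply: eq_integral => t _; rewrite fE.
Qed.

End Iterated.
End SquareIntegrals.

(** * Ito isometry for step integrals *)

Section ItoIsometry.
Context {R : realType} {d : measure_display} {T : measurableType d}.
Variables (P : probability T R) (F : R -> set (set T)) (W : R -> T -> R).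
Hypothesis fF : filtration F.
Hypothesis wW : wiener P F W.
Local Notation E f := (Rintegral P setT f).
Local Notation A := (adapted_mom P F).
Local Notation lam := (@lebesgue_measure R).
Local Notation dW s t w := (W t w - W s w).

Lemma adapted_increment (s t : R) : 0 <= s -> s <= t -> A t (fun w => dW s t w).
Proof.
move=> s0; rewrite le_eqVlt => /orP[/eqP <-|st].
  under eq_fun do rewrite subrr; exact: (adapted_mom_cst P fF s0 0).
have t0 := le_trans s0 (ltW st).
under eq_fun do rewrite (increment_scale W st).
by apply: (adapted_momZ fF) => //; exact: (adapted_noise fF wW).
Qed.

Lemma mean_increment1 (s t : R) U : 0 <= s -> s <= t -> A s U -> E (fun w => U w * dW s t w) = 0.
Proof.
move=> s0; rewrite le_eqVlt => /orP[/eqP <-|st] hU.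
  by under eq_Rintegral do rewrite subrr mulr0; rewrite mean_cst.
under eq_Rintegral do rewrite (increment_scale W st) mulrCA.
have [_ mz] := adapted_noise fF wW s0 st; have [_ mU] := hU.
by rewrite meanZ ?(mean_noise1 fF wW s0 st hU) ?mulr0//; exact: all_momentsM.
Qed.

Lemma mean_increment2 (s t : R) U : 0 <= s -> s <= t -> A s U ->
  E (fun w => U w * dW s t w ^+ 2) = E U * (t - s).
Proof.
move=> s0; rewrite le_eqVlt => /orP[/eqP <-|st] hU.
  by under eq_Rintegral do rewrite subrr expr0n mulr0; rewrite mean_cst subrr mulr0.
under eq_Rintegral do rewrite (increment_scale W st) exprMn sqr_sqrtr ?subr_ge0 ?(ltW st)// mulrCA.
have [_ mz] := adapted_noise fF wW s0 st; have [_ mU] := hU.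
rewrite meanZ ?(mean_noise2 fF wW s0 st hU) 1?mulrC//.
by apply: all_momentsM => //; exact: all_momentsX.
Qed.

(** Only the common part of the two intervals contributes, with its length as variance. By symmetry
    a1 <= a2; if the intervals do not overlap, all but the second increment is known at a2. *)
Lemma mean_increment_product (a1 b1 a2 b2 : R) v1 v2 :
  0 <= a1 -> a1 <= b1 -> 0 <= a2 -> a2 <= b2 -> A a1 v1 -> A a2 v2 ->
  E (fun w => v1 w * dW a1 b1 w * (v2 w * dW a2 b2 w)) =
  E (fun w => v1 w * v2 w) * Num.max 0 (Num.min b1 b2 - Num.max a1 a2).
Proof.
wlog a12 : a1 b1 a2 b2 v1 v2 / a1 <= a2 => [H|] a10 ab1 a20 ab2 h1 h2.
  case: (leP a1 a2) => [a12|/ltW a21].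
    by have := H _ _ _ _ _ _ a12 a10 ab1 a20 ab2 h1 h2; rewrite (max_idPr a12).
  have := H _ _ _ _ _ _ a21 a20 ab2 a10 ab1 h2 h1; rewrite (max_idPr a21) minC.
  by under eq_Rintegral do rewrite mulrC; under [in RHS]eq_Rintegral do rewrite mulrC.
rewrite (max_idPr a12); have b10 := le_trans a10 ab1; have b20 := le_trans a20 ab2.
have h1' := adapted_momS fF a10 a12 h1.
case: (leP b1 a2) => [ba|/ltW ba].
  have -> : Num.max 0 (Num.min b1 b2 - a2) = 0.
    by apply/max_idPl; rewrite subr_le0 ge_min ba.
  have hU : A a2 (fun w => v1 w * dW a1 b1 w * v2 w).
    apply: (adapted_momM fF) => //; apply: (adapted_momM fF) => //.
    exact: adapted_momS fF _ _ _ b10 ba (adapted_increment a10 ab1).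
  rewrite mulr0 -[RHS](mean_increment1 a20 ab2 hU); apply: eq_Rintegral => w _.
  by rewrite mulrA.
pose c := Num.min b1 b2; have ac : a2 <= c by rewrite le_min ba.
have c0 := le_trans a20 ac.
have -> : Num.max 0 (c - a2) = c - a2 by apply/max_idPr; rewrite subr_ge0.
have cb1 : c <= b1 by rewrite ge_min lexx.
have cb2 : c <= b2 by rewrite ge_min lexx orbT.
have hU : A a2 (fun w => v1 w * v2 w) by exact: (adapted_momM fF).
have hp : A a2 (fun w => v1 w * v2 w * dW a1 a2 w).
  by apply: (adapted_momM fF) => //; exact: adapted_increment.
have hx : A c (fun w => v1 w * v2 w * dW a2 c w).
  apply: (adapted_momM fF) => //; last exact: adapted_increment.
  exact: (adapted_momS fF a20 ac hU).
pose Y1 w := v1 w * v2 w * dW a1 a2 w * dW a2 b2 w.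
pose Y2 w := v1 w * v2 w * dW a2 c w ^+ 2.
pose Y3 w := v1 w * v2 w * dW a2 c w * dW c b1 w.
pose Y4 w := v1 w * v2 w * dW a2 c w * dW c b2 w.
have [_ i1] := adapted_increment a20 ab2; have [_ i2] := adapted_increment a20 ac.
have [_ i3] := adapted_increment c0 cb1; have [_ i4] := adapted_increment c0 cb2.
have [_ mU] := hU; have [_ mp] := hp; have [_ mx] := hx.
have m1 : all_moments P Y1 by exact: all_momentsM.
have m2 : all_moments P Y2 by apply: all_momentsM => //; exact: all_momentsX.
have m3 : all_moments P Y3 by exact: all_momentsM.
have m4 : all_moments P Y4 by exact: all_momentsM.
transitivity (E (fun w => Y1 w + (Y2 w + (Y3 w + Y4 w)))).
  apply: eq_Rintegral => w _.
  (* Both increments are cut at a2 and at c. As c is one of b1 and b2, one of the two tails is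
     zero. *)
  have z : dW c b1 w * dW c b2 w = 0.
    by rewrite /c; case: (leP b1 b2) => _; rewrite subrr ?mul0r ?mulr0.
  have -> : v1 w * dW a1 b1 w * (v2 w * dW a2 b2 w) = Y1 w + (Y2 w + (Y3 w + Y4 w))
     + v1 w * v2 w * (dW c b1 w * dW c b2 w) by rewrite /Y1 /Y2 /Y3 /Y4; ring.
  by rewrite z mulr0 addr0.
have m34 := all_momentsD m3 m4; have m234 := all_momentsD m2 m34.
rewrite (meanD m1 m234) (meanD m2 m34) (meanD m3 m4).
rewrite (mean_increment1 a20 ab2 hp) (mean_increment1 c0 cb1 hx) (mean_increment1 c0 cb2 hx).
by rewrite (mean_increment2 a20 ac hU) addr0 addr0 add0r.
Qed.

Lemma integral_step_sum (I : finType) (u v : R) (c lo hi : I -> R) :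
  (forall i, u <= lo i) -> (forall i, hi i <= v) ->
  (\int[lam]_(t in `[u, v]) (\sum_i c i * (lo i <= t < hi i)%R%:R)%:E =
   (\sum_i c i * Num.max 0 (hi i - lo i))%:E)%E.
Proof.
move=> ulo hiv.
pose f i t : R := (lo i <= t < hi i)%R%:R.
have fE i : f i = \1_(`[lo i, hi i[ : set R).
  by apply/funext => t; rewrite indicE /f mem_setE in_itv.
have fi i : lam.-integrable `[u, v] (fun t => (f i t)%:E).
  rewrite fE; apply: integrableS (integrable_indic_itv (lo i) (hi i) true true) => //.
under eq_integral do rewrite -sumEFin.
have mI : measurable (`[u, v] : set (measurableTypeR R)) by exact: measurable_itv.
have fci i : lam.-integrable `[u, v] (fun t => (c i * f i t)%:E).
  have -> : (fun t => (c i * f i t)%:E) = (fun t => (c i)%:E * (f i t)%:E)%E.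
    by apply/funext => t; rewrite EFinM.
  exact: integrableZl (fi i).
rewrite (integral_sum mI fci) -sumEFin; apply: eq_bigr => i _.
rewrite (integralZl mI (fi i) (c i)) EFinM; congr (_ * _)%E.
rewrite fE.
rewrite integral_indic//.
have -> : [set` `[lo i, hi i[] `&` [set` `[u, v]] = [set` `[lo i, hi i[].
  apply/setIidPl => t /=; rewrite !in_itv /= => /andP[h1 h2].
  by rewrite (le_trans (ulo i) h1) (le_trans (ltW h2) (hiv i)).
apply: etrans (lebesgue_measure_itv `[lo i, hi i[) _; rewrite /= lte_fin; case: ltP => h.
  by rewrite -EFinB; congr (_%:E); apply/esym/max_idPr; rewrite subr_ge0 ltW.
by congr (_%:E); apply/esym/max_idPl; rewrite subr_le0.
Qed.

Section StepFamily.
Variables (I : finType) (u v : R) (val : I -> T -> R) (lo hi : I -> R).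
Hypotheses (u0 : 0 <= u) (ulo : forall i, u <= lo i) (lohi : forall i, lo i <= hi i).
Hypotheses (hiv : forall i, hi i <= v) (hval : forall i, A (lo i) (val i)).

Let lo0 i : 0 <= lo i. Proof. exact: le_trans u0 (ulo i). Qed.
Let mval i : all_moments P (val i). Proof. by have [] := hval i. Qed.
Let minc i : all_moments P (fun w => dW (lo i) (hi i) w).
Proof. by have [] := adapted_increment (lo0 i) (lohi i). Qed.
Let mterm i : all_moments P (fun w => val i w * dW (lo i) (hi i) w).
Proof. exact: all_momentsM. Qed.

Lemma all_moments_step_integral : all_moments P (fun w => \sum_i val i w * dW (lo i) (hi i) w).
Proof. exact: all_moments_sum. Qed.

(** Both sides are double sums over pairs of intervals, weighted by the lengths of the overlaps. The
    intervals may overlap, so a difference of step processes on unrelated grids is covered by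
    indexing with a sum type. *)
Lemma ito_isometry :
  (\int[P]_w ((\sum_i val i w * dW (lo i) (hi i) w) ^+ 2)%:E =
   \int[P]_w \int[lam]_(t in `[u, v])
     ((\sum_i val i w * (lo i <= t < hi i)%R%:R) ^+ 2)%:E)%E.
Proof.
pose len (p : I * I) := Num.max 0 (Num.min (hi p.1) (hi p.2) - Num.max (lo p.1) (lo p.2)).
have sqr_sum (x : I -> R) : (\sum_i x i) ^+ 2 = \sum_p x p.1 * x p.2.
  rewrite expr2 mulr_suml -(pair_bigA _ (fun i j => x i * x j)) /=.
  by apply: eq_bigr => i _; rewrite mulr_sumr.
have mvv (p : I * I) : all_moments P (fun w => val p.1 w * val p.2 w) by exact: all_momentsM.
transitivity (E (fun w => \sum_p val p.1 w * val p.2 w * len p))%:E.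
  rewrite meanE; last by apply: all_momentsX; exact: all_moments_step_integral.
  congr (_%:E); under eq_Rintegral do rewrite sqr_sum.
  rewrite mean_sum; last by move=> p _; exact: all_momentsM.
  rewrite mean_sum; last by move=> p _; apply: all_momentsM => //; exact: all_moments_cst.
  apply: eq_bigr => p _; rewrite mean_increment_product//.
  under [RHS]eq_Rintegral do rewrite mulrC.
  by rewrite meanZ// mulrC.
rewrite -meanE; last first.
  by apply: all_moments_sum => p _; apply: all_momentsM => //; exact: all_moments_cst.
apply: eq_integral => w _.
under [RHS]eq_integral do rewrite sqr_sum.
rewrite -(integral_step_sum (u := u) (v := v) (fun p : I * I => val p.1 w * val p.2 w)
  (lo := fun p => Num.max (lo p.1) (lo p.2)) (hi := fun p => Num.min (hi p.1) (hi p.2))).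
- apply: eq_integral => t _; congr (_%:E); apply: eq_bigr => p _.
  rewrite mulrACA -natrM mulnb ge_max lt_min; congr (_ * _%:R).
  by do 4 case: (_ <= _) || case: (_ < _).
- by move=> p; rewrite le_max ulo.
- by move=> p; rewrite ge_min hiv.
Qed.

End StepFamily.
End ItoIsometry.

Section ItoDistance.
Context {R : realType} {d : measure_display} {T : measurableType d}.
Variables (P : probability T R) (F : R -> set (set T)) (W : R -> T -> R).
Hypothesis fF : filtration F.
Hypothesis wW : wiener P F W.
Local Notation E f := (Rintegral P setT f).
Local Notation A := (adapted_mom P F).
Local Notation lam := (@lebesgue_measure R).
Local Notation dW s t w := (W t w - W s w).

Lemma jointly_measurable_step (I : finType) (D : set R) (val : I -> T -> R) (lo hi : I -> R) :
  measurable D -> (forall i, measurable_fun setT (val i)) ->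
  jointly_measurable D (fun t w => \sum_i val i w * (lo i <= t < hi i)%R%:R).
Proof.
move=> mD mval; apply: measurable_funTS; apply: measurable_sum => i.
apply: measurable_funM; first exact: measurableT_comp (mval i) measurable_snd.
have -> : (fun z : measurableTypeR R * T => (lo i <= z.1 < hi i)%R%:R : R) =
    \1_([set` `[lo i, hi i[]) \o fst.
  by apply/funext => z /=; rewrite indicE mem_setE in_itv.
by apply: measurableT_comp => //; apply: measurable_indic.
Qed.

Lemma jointly_measurableB (D : set R) (Y Z : R -> T -> R) : jointly_measurable D Y ->
  jointly_measurable D Z -> jointly_measurable D (fun t w => Y t w - Z t w).
Proof. by move=> mY mZ; exact: measurable_funB. Qed.

Lemma jointly_measurableX (D : set R) (Y : R -> T -> R) k : jointly_measurable D Y ->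
  jointly_measurable D (fun t w => Y t w ^+ k).
Proof. by move=> mY; exact: measurable_funX. Qed.

Section Elementary.
Variables (u v : R) (phi : simple_process (R := R) (T := T)).
Hypotheses (u0 : 0 <= u) (phiE : elementary F u v phi).
Let k := sp_size phi.
Let lo (i : 'I_k) := sp_grid phi i.
Let hi (i : 'I_k) := sp_grid phi i.+1.

Let grid_mono i j : (i <= j)%N -> (j <= k)%N -> sp_grid phi i <= sp_grid phi j.
Proof.
elim: j => [|j IH]; first by rewrite leqn0 => /eqP ->.
rewrite leq_eqVlt ltnS => /orP[/eqP -> //|ij jk].
exact: le_trans (IH ij (ltnW jk)) (elementary_nondecreasing phiE jk).
Qed.

Lemma elementary_lower (i : 'I_k) : u <= lo i.
Proof. by rewrite -(elementary_first phiE); apply: grid_mono => //; exact: ltnW. Qed.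

Lemma elementary_step (i : 'I_k) : lo i <= hi i.
Proof. by apply: grid_mono; [exact: leqnSn|exact: ltn_ord]. Qed.

Lemma elementary_upper (i : 'I_k) : hi i <= v.
Proof. by rewrite -(elementary_last phiE); exact: grid_mono. Qed.

Lemma elementary_adapted_mom (i : 'I_k) : A (lo i) (sp_val phi i).
Proof.
have [M hM] := elementary_bounded phiE.
have ad := elementary_adapted phiE (ltn_ord i); split => //.
have lo0 : 0 <= lo i := le_trans u0 (elementary_lower i).
apply: (all_moments_dom (Z := fun=> M)); first exact: all_moments_cst.
  exact: rv_measurable_fun (filtration_sub fF lo0) ad.
by move=> w; apply: le_trans (hM i w (ltn_ord i)) (ler_norm _).
Qed.

End Elementary.

(** The step values have all moments but need not be bounded, so the step process is compared with
    the approximating sequence in the definition of J, by the isometry applied to their difference.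
    The 4 comes from using (x + y)^2 <= 2x^2 + 2y^2 twice. *)
Lemma ito_integral_step_dist (u v : R) (Y : R -> T -> R) (J : T -> R) (I : finType)
    (val : I -> T -> R) (lo hi : I -> R) :
  0 <= u -> ito_integral P F W u v Y J ->
  (forall i, u <= lo i) -> (forall i, lo i <= hi i) -> (forall i, hi i <= v) ->
  (forall i, A (lo i) (val i)) ->
  (\int[P]_w ((J w - \sum_i val i w * dW (lo i) (hi i) w) ^+ 2)%:E <=
   4%:E * \int[P]_w \int[lam]_(t in `[u, v])
     ((Y t w - \sum_i val i w * (lo i <= t < hi i)%R%:R) ^+ 2)%:E)%E.
Proof.
move=> u0 [[mY _ _] [mJ [phi [ephi cY cJ]]]] ulo lohi hiv hval.
pose psi t w : R := \sum_i val i w * (lo i <= t < hi i)%R%:R.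
pose Ipsi w := \sum_i val i w * dW (lo i) (hi i) w.
have mI : measurable (`[u, v] : set R) by exact: measurable_itv.
have mIT : measurable ((`[u, v] : set R) `*` [set: T]) by exact: measurableX.
have mval i : measurable_fun setT (val i) by have [_ []] := hval i.
have mpsi : jointly_measurable `[u, v] psi by exact: jointly_measurable_step.
have mIpsi : measurable_fun setT Ipsi.
  by have [] := all_moments_step_integral fF wW u0 ulo lohi hval.
have mphi j : jointly_measurable `[u, v] (fun t w => sp_eval (phi j) t w).
  apply: (@jointly_measurable_step _ _ (fun i : 'I_(sp_size (phi j)) => sp_val (phi j) i)) => // i.
  by have [_ []] := elementary_adapted_mom u0 (ephi j) i.
have hphi j i := elementary_adapted_mom u0 (ephi j) i.
have mIphi j : measurable_fun setT (fun w => sp_integral W (phi j) w).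
  by have [] := all_moments_step_integral fF wW u0 (elementary_lower (ephi j))
    (elementary_step (ephi j)) (hphi j).
pose dd (X1 X2 : R -> T -> R) := (\int[P]_w \int[lam]_(t in `[u, v]) ((X1 t w - X2 t w) ^+ 2)%:E)%E.
have ddE X1 X2 : jointly_measurable `[u, v] X1 -> jointly_measurable `[u, v] X2 ->
    dd X1 X2 = (\int[lam \x P]_(z in (`[u, v] : set R) `*` setT) ((X1 z.1 z.2 - X2 z.1 z.2) ^+ 2)%:E)%E.
  move=> m1 m2; apply: (iterated_integralE P mI (jointly_measurableX 2 (jointly_measurableB m1 m2))).
  by move=> t w; exact: sqr_ge0.
have q2 (x y z : R) : 0 <= (x - y) ^+ 2 <= 2 * (x - z) ^+ 2 + (2 * (z - y) ^+ 2 + 0).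
  by rewrite sqr_ge0; have := sqr_ge0 (x - z - (z - y)); lra.
have dist_sum (j : nat) :
    (\int[P]_w ((sp_integral W (phi j) w - Ipsi w) ^+ 2)%:E = dd (sp_eval (phi j)) psi)%E.
  (* The difference of the two step processes as one family, the second with its values negated. *)
  pose val' (s : 'I_(sp_size (phi j)) + I) w : R :=
    match s with inl i => sp_val (phi j) i w | inr i => (-1) * val i w end.
  pose lo' (s : 'I_(sp_size (phi j)) + I) :=
    match s with inl i => sp_grid (phi j) i | inr i => lo i end.
  pose hi' (s : 'I_(sp_size (phi j)) + I) :=
    match s with inl i => sp_grid (phi j) i.+1 | inr i => hi i end.
  have h1 s : u <= lo' s by case: s => [i|i] //=; exact: elementary_lower (ephi j) i.
  have h2 s : lo' s <= hi' s by case: s => [i|i] //=; exact: elementary_step (ephi j) i.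
  have h3 s : hi' s <= v by case: s => [i|i] //=; exact: elementary_upper (ephi j) i.
  have h4 s : A (lo' s) (val' s).
    case: s => [i|i] /=; first exact: hphi.
    by apply: (adapted_momZ fF) => //; exact: le_trans u0 (ulo i).
  have := ito_isometry fF wW u0 h1 h2 h3 h4.
  rewrite /dd /psi /sp_eval => iso; apply: etrans (etrans _ iso) _.
    apply: eq_integral => w _; congr (_%:E); congr (_ ^+ 2).
    rewrite big_sumType /=; congr (_ + _).
    by rewrite /Ipsi -sumrN; apply: eq_bigr => i _; rewrite mulN1r mulNr.
  apply: eq_integral => w _; apply: eq_integral => t _; congr (_%:E); congr (_ ^+ 2).
  rewrite big_sumType /=; congr (_ + _).
  by rewrite -sumrN; apply: eq_bigr => i _; rewrite mulN1r mulNr.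
pose Aj j := (\int[P]_w ((J w - sp_integral W (phi j) w) ^+ 2)%:E)%E.
pose Bj j := dd Y (sp_eval (phi j)).
have bound j : (\int[P]_w ((J w - Ipsi w) ^+ 2)%:E <= 2%:E * Aj j + (4%:E * Bj j + 4%:E * dd Y psi))%E.
  have h1 := ge0_integral_le_comb (D := setT) (P : {measure set T -> \bar R})
    (s := [:: (2, fun w => (J w - sp_integral W (phi j) w) ^+ 2);
              (2, fun w => (sp_integral W (phi j) w - Ipsi w) ^+ 2)])
    (Y := fun w => (J w - Ipsi w) ^+ 2) measurableT.
  apply: le_trans (h1 _ _ _) _ => /=.
  - by apply: measurable_funX; exact: measurable_funB.
  - split => //; first by apply: measurable_funX; exact: measurable_funB.
      by move=> w _; exact: sqr_ge0.
    split => //; first by apply: measurable_funX; exact: measurable_funB.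
    by move=> w _; exact: sqr_ge0.
  - by move=> w _; exact: q2.
  rewrite adde0 leeD2l// dist_sum.
  have h2 := ge0_integral_le_comb (D := (`[u, v] : set R) `*` [set: T]) (lam \x P)%E
    (s := [:: (2, fun z => (Y z.1 z.2 - sp_eval (phi j) z.1 z.2) ^+ 2);
              (2, fun z => (Y z.1 z.2 - psi z.1 z.2) ^+ 2)])
    (Y := fun z => (sp_eval (phi j) z.1 z.2 - psi z.1 z.2) ^+ 2) mIT.
  have : (dd (sp_eval (phi j)) psi <= 2%:E * Bj j + (2%:E * dd Y psi + 0))%E.
    rewrite /Bj !ddE//; apply: h2 => /=.
    - exact (jointly_measurableX 2 (jointly_measurableB (mphi j) mpsi)).
    - split => //; first exact (jointly_measurableX 2 (jointly_measurableB mY (mphi j))).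
        by move=> w _; exact: sqr_ge0.
      split => //; first exact (jointly_measurableX 2 (jointly_measurableB mY mpsi)).
      by move=> w _; exact: sqr_ge0.
    - move=> z _; have := q2 (sp_eval (phi j) z.1 z.2) (psi z.1 z.2) (Y z.1 z.2).
      by rewrite -(sqrrN (sp_eval (phi j) z.1 z.2 - Y z.1 z.2)) opprB.
  have two0 : (0 <= 2%:E :> \bar R)%E by rewrite lee_fin.
  rewrite adde0 => /(lee_wpmul2l two0) h3; apply: le_trans h3 _.
  rewrite ge0_muleDr; last 2 first.
  - by rewrite mule_ge0//; apply: integral_ge0 => w _; apply: integral_ge0 => t _; rewrite lee_fin sqr_ge0.
  - by rewrite mule_ge0//; apply: integral_ge0 => w _; apply: integral_ge0 => t _; rewrite lee_fin sqr_ge0.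
  by rewrite !muleA -!EFinM -natrM.
(* Both approximation errors vanish in the limit and leave the distance from Y to the step
   process. *)
have cv : ((fun j => 2%:E * Aj j + (4%:E * Bj j + 4%:E * dd Y psi))%E @ \oo -->
    (2%:E * 0 + (4%:E * 0 + 4%:E * dd Y psi))%E).
  have dd0 : (0 <= 4%:E * dd Y psi)%E.
    by rewrite mule_ge0//; apply: integral_ge0 => w _; apply: integral_ge0 => t _; rewrite lee_fin sqr_ge0.
  apply: cvgeD; first by rewrite !mule0 add0e; case: (4%:E * dd Y psi)%E.
    exact: cvgeZl.
  apply: cvgeD; [by rewrite mule0; case: (4%:E * dd Y psi)%E|exact: cvgeZl|exact: cvg_cst].
rewrite !mule0 !add0e in cv.
rewrite -(cvg_lim _ cv)//; apply: lime_ge; first by apply/cvg_ex; eexists; exact: cv.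
exact: nearW.
Qed.

End ItoDistance.

Section CauchySchwarz.
Context {R : realType}.
Local Notation lam := (@lebesgue_measure R).

(** Cauchy-Schwarz against the constant 1, from the nonnegativity of the integral of (f - m)^2 with
    m the average of f. *)
Lemma sqr_Rintegral_le (u v : R) (f : R -> R) : u <= v ->
  lam.-integrable `[u, v] (EFin \o f) ->
  (((\int[lam]_(t in `[u, v]) f t) ^+ 2)%:E <=
   (v - u)%:E * \int[lam]_(t in `[u, v]) (f t ^+ 2)%:E)%E.
Proof.
move=> uv fi; pose D : set (measurableTypeR R) := [set` `[u, v]].
have mD : measurable D by exact: measurable_itv.
have lamD : fine (lam D) = v - u.
  rewrite lebesgue_measure_itv /= lte_fin; move: uv; rewrite le_eqVlt.
  by case/orP => [/eqP <-|->]; rewrite ?ltxx/= ?subrr.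
move: uv; rewrite le_eqVlt => /orP[/eqP uv|uv].
  (* On a one-point interval the average is undefined, and both sides are 0. *)
  by rewrite -uv set_itv1 Rintegral_set1 expr0n /= subrr mul0e.
have vu0 : 0 < v - u by rewrite subr_gt0.
have [mf _] := integrableP _ _ _ fi; have mfR : measurable_fun D f by exact/measurable_EFinP.
have f20 : (0 <= \int[lam]_(t in D) (f t ^+ 2)%:E)%E.
  by apply: integral_ge0 => t _; rewrite lee_fin sqr_ge0.
have [fy|fy] := eqVneq (\int[lam]_(t in D) (f t ^+ 2)%:E)%E +oo%E.
  by rewrite [X in (_ * X)%E]fy gt0_muley ?leey// lte_fin.
have f2i : lam.-integrable D (EFin \o (fun t => f t ^+ 2)).
  apply/integrableP; split; first by apply/measurable_EFinP; exact: measurable_funX.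
  under eq_integral do rewrite /= ger0_norm ?sqr_ge0//.
  by rewrite ltey.
have ci (c : R) : lam.-integrable D (EFin \o (fun=> c)).
  have lamDy : (lam D < +oo)%E by rewrite lebesgue_measure_itv /= lte_fin uv ltry.
  by apply: measurable_bounded_integrable => //; exact: bounded_cst.
pose I := \int[lam]_(t in D) f t; pose m := I / (v - u).
have fZi : lam.-integrable D (EFin \o (fun t => (- 2 * m) * f t)).
  by have := integrableZl mD (- 2 * m) fi; apply: eq_integrable => // t _; rewrite /= EFinM.
have h : 0 <= \int[lam]_(t in D) ((f t ^+ 2 + (- 2 * m) * f t) + m ^+ 2).
  by apply: Rintegral_ge0 => t _; have := sqr_ge0 (f t - m); lra.
have fsi : lam.-integrable D (EFin \o (fun t => f t ^+ 2 + (- 2 * m) * f t)).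
  by have := integrableD mD f2i fZi; apply: eq_integrable.
rewrite (RintegralD mD fsi (ci _)) (RintegralD mD f2i fZi) in h.
have e1 : \int[lam]_(t in D) (- 2 * m * f t) = - 2 * m * I by exact: RintegralZl.
have e2 : \int[lam]_(t in D) (m ^+ 2) = m ^+ 2 * (v - u).
  by apply: etrans (Rintegral_cst _ mD _) _; congr (_ * _).
rewrite e1 e2 in h.
have -> : (\int[lam]_(t in D) (f t ^+ 2)%:E)%E = (\int[lam]_(t in D) (f t ^+ 2))%:E.
  by rewrite /Rintegral fineK// ge0_fin_numE// ltey.
rewrite -EFinM lee_fin -/I; move: h; set K := Rintegral _ _ _ => h.
rewrite mulrC -ler_pdivrMr//.
have -> : I ^+ 2 / (v - u) = - (- 2 * m * I + m ^+ 2 * (v - u)).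
  by rewrite /m; field; rewrite gt_eqF.
by rewrite -subr_ge0 opprK addrA.
Qed.

End CauchySchwarz.

Section Joint.
Context {R : realType} {d : measure_display} {T : measurableType d}.

(** The process is extended by zero outside D. The time change [th] will be the identity or the last
    grid time before t. *)
Lemma jointly_measurable_vector {n : nat} (D : set R) (f : R * 'rV[R]_n -> R) (th : R -> R)
    (X : R -> T -> 'rV[R]_n) : measurable D -> continuous f ->
  measurable_fun [set: measurableTypeR R] th ->
  (forall i, jointly_measurable D (fun t w => X t w 0 i)) ->
  jointly_measurable D (fun t w => f (th t, X t w)).
Proof.
move=> mD cf mth hX; have mDT : measurable (D `*` [set: T]) by exact: measurableX.
pose Y (z : measurableTypeR R * T) : 'rV[R]_n :=
  \row_i ((fun z => X z.1 z.2 0 i) \_ (D `*` [set: T])) z.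
have mY i : measurable_fun setT (fun z => Y z 0 i).
  under eq_fun do rewrite mxE.
  by apply/(measurable_restrictT _ mDT); exact: hX.
have := measurable_fun_vector cf (measurableT_comp mth measurable_fst) mY.
move=> /(measurable_funS measurableT (@subsetT _ (D `*` [set: T]))).
apply: eq_measurable_fun => z; rewrite inE => Dz; congr (f (_, _)).
by apply/rowP => i; rewrite mxE patchE mem_set.
Qed.

Lemma jointly_measurableD (D : set R) (Y Z : R -> T -> R) : jointly_measurable D Y ->
  jointly_measurable D Z -> jointly_measurable D (fun t w => Y t w + Z t w).
Proof. by move=> mY mZ; exact: measurable_funD. Qed.

Lemma jointly_measurableS (D D' : set R) (Y : R -> T -> R) : measurable D -> D' `<=` D ->
  jointly_measurable D Y -> jointly_measurable D' Y.
Proof.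
move=> mD DD; apply: measurable_funS; first exact: measurableX.
by move=> z [z1 z2]; split => //; exact: DD.
Qed.

Lemma jointly_measurable_sum (I : Type) (s : seq I) (D : set R) (Y : I -> R -> T -> R) :
  (forall i, jointly_measurable D (Y i)) -> jointly_measurable D (fun t w => \sum_(i <- s) Y i t w).
Proof. by move=> hY; exact: measurable_sum. Qed.

End Joint.

(** * Convergence of the Milstein scheme *)

Section CoefficientPaths.
Context {R : realType} {d : measure_display} {T : measurableType d}.
Variables (P : probability T R) (F : R -> set (set T)) (W : R -> T -> R).
Hypothesis fF : filtration F.
Hypothesis wW : wiener P F W.
Local Notation E f := (Rintegral P setT f).
Context {n : nat}.
Variables (a b : R -> 'rV[R]_n -> 'rV[R]_n) (t0 tm L : R).
Hypothesis t00 : 0 <= t0.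
Hypothesis sa : forall i, smooth 3 t0 tm (fun z => a z.1 z.2 0 i).
Hypothesis sb : forall i, smooth 3 t0 tm (fun z => b z.1 z.2 0 i).
Hypothesis L1 : 1 <= L.
Hypothesis lipa : forall t x y, t0 <= t <= tm -> `|a t x - a t y| <= L * `|x - y|.
Hypothesis lipb : forall t x y, t0 <= t <= tm -> `|b t x - b t y| <= L * `|x - y|.
Hypothesis groa : forall t x, t0 <= t <= tm -> `|a t x| <= L * (1 + `|x|).
Hypothesis grob : forall t x, t0 <= t <= tm -> `|b t x| <= L * (1 + `|x|).
Let L0 : 0 <= L. Proof. exact: le_trans L1. Qed.
Local Notation A := (adapted_mom P F).

Local Notation adapted_vec := (adapted_vec P F).
Local Notation lam := (@lebesgue_measure R).
Local Notation dW s t w := (W t w - W s w).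
Hypothesis tt : t0 < tm.
Variable X : R -> T -> 'rV[R]_n.
Hypothesis solX : ito_solution P F W a b t0 tm X.
Hypothesis hx0 : adapted_vec t0 (X t0).

Let mI s t : measurable ([set` `[s, t]] : set R). Proof. exact: measurable_itv. Qed.

Let mI' s t : measurable ([set` `[s, t]] : set (measurableTypeR R)).
Proof. exact: measurable_itv. Qed.

Let mIT : measurable ([set` `[t0, tm]] `*` [set: T] : set (measurableTypeR R * T)).
Proof. by apply: measurableX => //; exact: mI. Qed.

Lemma jointly_measurable_solution i : jointly_measurable `[t0, tm] (fun t w => X t w 0 i).
Proof. exact: ito_class_measurable (solution_class solX i). Qed.

Lemma jointly_measurable_lyap : jointly_measurable `[t0, tm] (fun t w => lyap (X t w)).
Proof.
apply: jointly_measurableD; first exact: measurable_cst.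
apply: jointly_measurable_sum => i; apply: jointly_measurableX.
exact: jointly_measurable_solution.
Qed.

Lemma jointly_measurable_coef (f : R -> 'rV[R]_n -> 'rV[R]_n) i :
  smooth 3 t0 tm (fun z => f z.1 z.2 0 i) ->
  jointly_measurable `[t0, tm] (fun t w => f t (X t w) 0 i).
Proof.
move=> sf; apply: (jointly_measurable_vector (f := fun z => f z.1 z.2 0 i) (th := id)) => //.
  exact: smooth_continuous sf.
exact: jointly_measurable_solution.
Qed.

Lemma measurable_solution t i : t0 <= t <= tm -> measurable_fun setT (fun w => X t w 0 i).
Proof.
move=> tI; apply: rv_measurable_fun (ito_class_adapted (solution_class solX i) tI).
by apply: (filtration_sub fF); case/andP: tI => + _; exact: le_trans.
Qed.

Lemma integrable_lyap_solution : (lam \x P)%E.-integrable ([set` `[t0, tm]] `*` setT)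
  (fun z => (lyap (X z.1 z.2))%:E).
Proof.
have e1 : (\int[lam]_(s in `[t0, tm]) 1%:E)%E = (tm - t0)%:E.
  rewrite integral_cst ?mul1e; last exact: mI.
  by apply: etrans (lebesgue_measure_itv _) _; rewrite /= lte_fin tt.
have i1 : (lam \x P)%E.-integrable ([set` `[t0, tm]] `*` setT) (fun=> 1%:E).
  apply/integrableP; split; first exact: measurable_cst.
  under eq_integral do rewrite /= normr1.
  rewrite -(iterated_integralE P (Y := fun _ _ => 1) (mI t0 tm)) //; last exact: measurable_cst.
  under eq_integral do rewrite e1.
  by rewrite integral_cst// [X in (_ * X)%E]probability_setT mule1 ltry.
have iX i : (lam \x P)%E.-integrable ([set` `[t0, tm]] `*` setT) (fun z => (X z.1 z.2 0 i ^+ 2)%:E).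
  have mX := jointly_measurableX 2 (jointly_measurable_solution i).
  apply/integrableP; split; first exact/measurable_EFinP.
  under eq_integral do rewrite /= ger0_norm ?sqr_ge0//.
  rewrite -(iterated_integralE P (mI t0 tm) mX) => [|t w]; last exact: sqr_ge0.
  exact: ito_class_square (solution_class solX i).
have h := integrableD mIT i1 (integrable_sum mIT (index_enum 'I_n) (P := xpredT) (fun i _ => iX i)).
move: h; apply: eq_integrable => // z _.
by rewrite /lyap EFinD -sumEFin.
Qed.

Lemma lyap_solution_fin : exists K : R, 0 <= K /\
  (\int[P]_w \int[lam]_(t in `[t0, tm]) (lyap (X t w))%:E = K%:E)%E.
Proof.
have fin := integrable_fin_num mIT integrable_lyap_solution.
rewrite (iterated_integralE P (mI t0 tm) jointly_measurable_lyap); last first.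
  by move=> t w; exact: ltW (lyap_gt0 _).
eexists; split; last by rewrite -(fineK fin).
by apply: fine_ge0; apply: integral_ge0 => z _; rewrite lee_fin ltW// lyap_gt0.
Qed.

(** Makes the drift integrable in time along almost every path, as the pathwise Cauchy-Schwarz
    inequality requires. *)
Lemma ae_lyap_solution_fin :
  {ae P, forall w, (\int[lam]_(t in `[t0, tm]) (lyap (X t w))%:E < +oo)%E}.
Proof.
have l0 t w : 0 <= lyap (X t w) := ltW (lyap_gt0 _).
have m1 := measurable_inner (mI t0 tm) jointly_measurable_lyap l0.
have [K [K0 hK]] := lyap_solution_fin.
have i0 w : (0 <= \int[lam]_(t in `[t0, tm]) (lyap (X t w))%:E)%E.
  by apply: integral_ge0 => t _; rewrite lee_fin.
have h : P.-integrable setT (fun w => \int[lam]_(t in `[t0, tm]) (lyap (X t w))%:E)%E.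
  apply/integrableP; split => //.
  by under eq_integral do rewrite gee0_abs//; rewrite hK ltry.
have := integrable_ae measurableT h; apply: filterS => w /(_ I).
by rewrite ge0_fin_numE.
Qed.

Lemma coef_sqr_le (f : R -> 'rV[R]_n -> 'rV[R]_n) i t x :
  (forall t x, t0 <= t <= tm -> `|f t x| <= L * (1 + `|x|)) -> t0 <= t <= tm ->
  f t x 0 i ^+ 2 <= 2 * L ^+ 2 * lyap x.
Proof.
move=> gf tI; rewrite -real_normK ?num_real//.
apply: (@le_trans _ _ ((L * (1 + `|x|)) ^+ 2)).
  rewrite lerXn2r ?nnegrE ?mulr_ge0 ?addr_ge0//.
  exact: le_trans (coord_norm_le _ _) (gf _ _ tI).
have -> : 2 * L ^+ 2 * lyap x = L ^+ 2 * (2 * lyap x) by ring.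
rewrite exprMn; apply: ler_wpM2l; first exact: sqr_ge0.
by have := norm_sqr_le_lyap x; have := sqr_ge0 (1 - `|x|); lra.
Qed.

Lemma coef_le (f : R -> 'rV[R]_n -> 'rV[R]_n) i t x :
  (forall t x, t0 <= t <= tm -> `|f t x| <= L * (1 + `|x|)) -> t0 <= t <= tm ->
  `|f t x 0 i| <= 2 * L * lyap x.
Proof.
move=> gf tI; apply: le_trans (coord_norm_le _ _) _; apply: le_trans (gf _ _ tI) _.
have -> : 2 * L * lyap x = L * (lyap x + lyap x) by ring.
apply: ler_wpM2l => //; apply: lerD; first exact: lyap_ge1.
exact: norm_le_lyap.
Qed.

Section Distance.
Variables (t : R) (i : 'I_n) (I : finType) (va vb : I -> T -> R) (lo hi : I -> R).
Hypotheses (tI : t0 <= t <= tm) (ulo : forall j, t0 <= lo j) (lohi : forall j, lo j <= hi j).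
Hypotheses (hit : forall j, hi j <= t) (ha : forall j, A (lo j) (va j)).
Hypothesis hb : forall j, A (lo j) (vb j).
Let al s w := \sum_j va j w * (lo j <= s < hi j)%R%:R.
Let be s w := \sum_j vb j w * (lo j <= s < hi j)%R%:R.

(** The equation of X is compared with any step approximation of its coefficients. The drift
    contributes 2 times the length of the interval, by Cauchy-Schwarz, and the volatility 8 = 2 * 4
    by [ito_integral_step_dist]. *)
Lemma solution_dist :
  (\int[P]_w ((X t w 0 i - (X t0 w 0 i
      + \sum_j (va j w * (hi j - lo j) + vb j w * dW (lo j) (hi j) w))) ^+ 2)%:E <=
   (2 * (tm - t0))%:E * \int[P]_w \int[lam]_(s in `[t0, t]) ((a s (X s w) 0 i - al s w) ^+ 2)%:E +
   8%:E * \int[P]_w \int[lam]_(s in `[t0, t]) ((b s (X s w) 0 i - be s w) ^+ 2)%:E)%E.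
Proof.
have [J [hJ Xeq]] := solution_eq solX i tI.
have [_ [mJ _]] := hJ; have /andP[t0t ttm] := tI.
have sub : [set` `[t0, t]] `<=` [set` `[t0, tm]].
  by move=> s /=; rewrite !in_itv /= => /andP[-> h]; exact: le_trans h ttm.
have mva j : measurable_fun setT (va j) by have [_ []] := ha j.
have ja : jointly_measurable `[t0, t] (fun s w => a s (X s w) 0 i).
  exact: jointly_measurableS (mI t0 tm) sub (jointly_measurable_coef (sa i)).
have jal : jointly_measurable `[t0, t] al by exact: jointly_measurable_step (mI t0 t) mva.
have jd := jointly_measurableX 2 (jointly_measurableB ja jal).
have d0 s w : 0 <= (a s (X s w) 0 i - al s w) ^+ 2 by exact: sqr_ge0.
pose inner w := (\int[lam]_(s in `[t0, t]) ((a s (X s w) 0 i - al s w) ^+ 2)%:E)%E.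
have min : measurable_fun setT inner by exact: measurable_inner (mI t0 t) jd d0.
have in0 w : (0 <= inner w)%E by apply: integral_ge0 => s _; rewrite lee_fin.
pose Iw w := \sum_j vb j w * dW (lo j) (hi j) w.
have mIw : measurable_fun setT Iw.
  by have [] := all_moments_step_integral fF wW t00 ulo lohi hb.
have mJI : measurable_fun setT (fun w => (J w - Iw w) ^+ 2).
  by apply: measurable_funX; exact: measurable_funB.
have mX := measurable_solution i tI.
have mX0 := measurable_solution (t := t0) i (introT andP (conj (lexx t0) (ltW tt))).
have msum : measurable_fun setT
    (fun w => \sum_j (va j w * (hi j - lo j) + vb j w * dW (lo j) (hi j) w)).
  have [] : all_moments P (fun w => \sum_j (va j w * (hi j - lo j) + vb j w * dW (lo j) (hi j) w)) => //.
  apply: all_moments_sum => j _; apply: all_momentsD.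
    by apply: all_momentsM; [case: (ha j)|exact: all_moments_cst].
  apply: all_momentsM; first by case: (hb j).
  by have [] := adapted_increment fF wW (le_trans t00 (ulo j)) (lohi j).
have key : {ae P, forall w, setT w -> (((X t w 0 i - (X t0 w 0 i
      + \sum_j (va j w * (hi j - lo j) + vb j w * dW (lo j) (hi j) w))) ^+ 2)%:E <=
    (2 * (tm - t0))%:E * inner w + 2%:E * ((J w - Iw w) ^+ 2)%:E)%E}.
  apply: filterS2 Xeq ae_lyap_solution_fin => w Xw fw _.
  have ma : measurable_fun `[t0, t] (fun s => a s (X s w) 0 i) := measurable_section (mI t0 t) ja w.
  have mal : measurable_fun `[t0, t] (al^~ w) := measurable_section (mI t0 t) jal w.
  have ml : measurable_fun `[t0, tm] (fun s => lyap (X s w)).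
    exact: measurable_section (mI t0 tm) jointly_measurable_lyap w.
  have li : lam.-integrable `[t0, tm] (fun s => (lyap (X s w))%:E).
    apply/integrableP; split; first exact/measurable_EFinP.
    by under eq_integral do rewrite /= ger0_norm ?(ltW (lyap_gt0 _))//.
  have ai : lam.-integrable `[t0, t] (EFin \o (fun s => a s (X s w) 0 i)).
    have li' : lam.-integrable `[t0, t] (fun s => (2 * L)%:E * (lyap (X s w))%:E)%E.
      by apply: integrableZl => //; exact: (integrableS (mI' t0 tm) (mI' t0 t) sub li).
    apply: (le_integrable (mI' t0 t) _ _ li'); first exact/measurable_EFinP.
    move=> s /=; rewrite in_itv /= => /andP[s1 s2]; rewrite lee_fin.
    apply: le_trans (ler_norm _); apply: coef_le groa _.
    by rewrite s1 (le_trans s2 ttm).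
  have alE := integral_step_sum (va^~ w) ulo hit.
  have ali : lam.-integrable `[t0, t] (EFin \o al^~ w).
    have -> : EFin \o al^~ w = (fun s => \sum_j ((va j w)%:E * (\1_([set` `[lo j, hi j[]) s)%:E)%E) :> (R -> \bar R).
      apply/funext => s; rewrite /= /al -sumEFin; apply: eq_bigr => j _.
      by rewrite EFinM indicE mem_setE in_itv.
    apply: integrable_sum => [|j _]; first exact: mI'.
    apply: integrableZl; first exact: mI'.
    by apply: integrableS (integrable_indic_itv (lo j) (hi j) true true) => //; exact: mI'.
  have dE : \int[lam]_(s in `[t0, t]) (a s (X s w) 0 i - al s w) =
      \int[lam]_(s in `[t0, t]) a s (X s w) 0 i - \sum_j va j w * (hi j - lo j).
    apply: etrans (RintegralB (mI' t0 t) ai ali) _; congr (_ - _).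
    rewrite /Rintegral alE /=; apply: eq_bigr => j _; congr (_ * _).
    by apply/max_idPr; rewrite subr_ge0.
  have di : lam.-integrable `[t0, t] (EFin \o (fun s => a s (X s w) 0 i - al s w)).
    by have := integrableB (mI' t0 t) ai ali; apply: eq_integrable => //.
  have cs := sqr_Rintegral_le t0t di; rewrite dE in cs.
  rewrite Xw big_split /=.
  set Ra := \int[_]_(s in _) _ in cs *; set Sa := \sum_j va j w * _ in cs *.
  have -> : X t0 w 0 i + Ra + J w - (X t0 w 0 i + (Sa + \sum_j vb j w * dW (lo j) (hi j) w)) =
      (Ra - Sa) + (J w - Iw w) by rewrite /Iw; ring.
  apply: (@le_trans _ _ ((2 * (Ra - Sa) ^+ 2)%:E + (2 * (J w - Iw w) ^+ 2)%:E)%E).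
    rewrite -EFinD lee_fin; have := sqr_ge0 (Ra - Sa - (J w - Iw w)).
    by move: (Ra - Sa) (J w - Iw w) => x y; lra.
  apply: leeD => //; rewrite EFinM [(2 * (tm - t0))%:E]EFinM -muleA; apply: lee_wpmul2l => //.
  apply: le_trans cs _; apply: lee_wpmul2r; first exact: in0.
  by rewrite lee_fin lerB.
have sq0 w : (0 <= ((J w - Iw w) ^+ 2)%:E)%E by rewrite lee_fin sqr_ge0.
have c0 : (0 <= (2 * (tm - t0))%:E)%E by rewrite lee_fin mulr_ge0// subr_ge0 ltW.
have eJI : measurable_fun setT (fun w => ((J w - Iw w) ^+ 2)%:E) by exact/measurable_EFinP.
have m1 : measurable_fun setT (fun w => (2 * (tm - t0))%:E * inner w)%E.
  exact: measurable_funeM.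
have m2 : measurable_fun setT (fun w => 2%:E * ((J w - Iw w) ^+ 2)%:E)%E.
  exact: measurable_funeM.
have n1 w : (0 <= (2 * (tm - t0))%:E * inner w)%E by exact: mule_ge0.
have n2 w : (0 <= 2%:E * ((J w - Iw w) ^+ 2)%:E)%E by exact: mule_ge0.
apply: le_trans (ae_ge0_le_integral measurableT _ _ _ _ key) _.
- by move=> w _; rewrite lee_fin sqr_ge0.
- apply/measurable_EFinP; apply: measurable_funX; apply: measurable_funB => //.
  exact: measurable_funD.
- by move=> w _; exact: adde_ge0.
- exact: emeasurable_funD.
rewrite (ge0_integralD _ measurableT) ?ge0_integralZl//.
apply: leeD => //.
have := ito_integral_step_dist fF wW t00 hJ ulo lohi hit hb.
move=> h; apply: le_trans (lee_wpmul2l _ h) _ => //.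
by rewrite muleA -EFinM -natrM.
Qed.

End Distance.
End CoefficientPaths.

Section ProductIntegral.
Context {R : realType} {d : measure_display} {T : measurableType d}.
Variable P : probability T R.
Local Notation lam := (@lebesgue_measure R).

Definition iint (D : set R) (Y : R -> T -> R) : \bar R :=
  (\int[lam \x P]_(z in D `*` setT) (Y z.1 z.2)%:E)%E.

Variables (D : set R) (Y : R -> T -> R).
Hypotheses (mD : measurable D) (mY : jointly_measurable D Y).
Hypothesis Y0 : forall t w, 0 <= Y t w.

Lemma iint_subset (D1 : set R) : measurable D1 -> D1 `<=` D -> (iint D1 Y <= iint D Y)%E.
Proof.
move=> m1 sub; apply: ge0_subset_integral.
- exact: measurableX.
- exact: measurableX.
- exact/measurable_EFinP.
- by move=> z _; rewrite lee_fin.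
- by move=> z [z1 z2]; split => //; exact: sub.
Qed.

Lemma iint_setU (D1 D2 : set R) : measurable D1 -> measurable D2 -> D = D1 `|` D2 ->
  [disjoint D1 & D2] -> iint D Y = (iint D1 Y + iint D2 Y)%E.
Proof.
move=> m1 m2 DE; rewrite disj_set2E => /eqP d12; rewrite /iint.
have -> : D `*` [set: T] = (D1 `*` setT) `|` (D2 `*` setT).
  by rewrite DE; apply/seteqP; split => z /=; tauto.
apply: ge0_integral_setU.
- exact: measurableX.
- exact: measurableX.
- apply/measurable_EFinP; apply: measurable_funS mY; first exact: measurableX.
  by rewrite DE => z /=; tauto.
- by move=> z _; rewrite lee_fin.
- rewrite disj_set2E; apply/eqP/seteqP; split => // z /= [[z1 _] [z2 _]].
  by have : (D1 `&` D2) z.1 by []; rewrite d12.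
Qed.

Lemma iint_le_section (M : R) : 0 <= M ->
  (forall t, D t -> (\int[P]_w (Y t w)%:E <= M%:E)%E) -> (iint D Y <= M%:E * lam D)%E.
Proof.
move=> M0 h; rewrite /iint -iterated_integralE// iterated_integral_swap//.
rewrite -integral_cst//; apply: ge0_le_integral => //.
- by move=> t _; apply: integral_ge0 => w _; rewrite lee_fin.
- have mDT : measurable (D `*` [set: T] : set (measurableTypeR R * T)) by exact: measurableX.
  pose f (z : measurableTypeR R * T) : \bar R := ((fun z => (Y z.1 z.2)%:E) \_ (D `*` setT)) z.
  have mf : measurable_fun setT f.
    by apply/(measurable_restrictT _ mDT); exact/measurable_EFinP.
  have f0 z : (0 <= f z)%E by rewrite /f patchE; case: ifPn => // _; rewrite lee_fin.
  have := measurable_fun_fubini_tonelli_F (m2 := P) f mf f0.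
  move=> /(measurable_funS measurableT (@subsetT _ D)); apply: eq_measurable_fun => t Dt.
  apply: eq_integral => w _; rewrite /f patchE mem_set//.
  by split => //; move: Dt; rewrite inE.
Qed.

Lemma iint_le_comb (s : seq (R * (R -> T -> R))) (Z : R -> T -> R) :
  jointly_measurable D Z ->
  foldr (fun (p : R * (R -> T -> R)) Q =>
    [/\ 0 <= p.1, jointly_measurable D p.2, forall t w, 0 <= p.2 t w & Q]) True s ->
  (forall t w, D t -> 0 <= Z t w <=
     foldr (fun (p : R * (R -> T -> R)) acc => p.1 * p.2 t w + acc) 0 s) ->
  (iint D Z <= foldr (fun (p : R * (R -> T -> R)) acc => p.1%:E * iint D p.2 + acc) 0 s)%E.
Proof.
move=> mZ hs hZ.
have mDT : measurable (D `*` [set: T] : set (measurableTypeR R * T)) by exact: measurableX.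
have := ge0_integral_le_comb (lam \x P)%E
  (s := [seq (p.1, fun z : measurableTypeR R * T => p.2 z.1 z.2) | p <- s]) mDT mZ.
rewrite !foldr_map => h; apply: h => [|z [Dz _]]; last by rewrite foldr_map; exact: hZ.
by elim: s hs {hZ} => [//|p s IH [h1 h2 h3 /IH h4]] /=.
Qed.

End ProductIntegral.

(** * Moments of the solution and accumulated Milstein corrections *)

Section SolutionRegularity.
Context {R : realType} {d : measure_display} {T : measurableType d}.
Variables (P : probability T R) (F : R -> set (set T)) (W : R -> T -> R).
Hypothesis fF : filtration F.
Hypothesis wW : wiener P F W.
Local Notation E f := (Rintegral P setT f).
Context {n : nat}.
Variables (a b : R -> 'rV[R]_n -> 'rV[R]_n) (t0 tm L : R).
Hypothesis t00 : 0 <= t0.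
Hypothesis sa : forall i, smooth 3 t0 tm (fun z => a z.1 z.2 0 i).
Hypothesis sb : forall i, smooth 3 t0 tm (fun z => b z.1 z.2 0 i).
Hypothesis L1 : 1 <= L.
Hypothesis lipa : forall t x y, t0 <= t <= tm -> `|a t x - a t y| <= L * `|x - y|.
Hypothesis lipb : forall t x y, t0 <= t <= tm -> `|b t x - b t y| <= L * `|x - y|.
Hypothesis groa : forall t x, t0 <= t <= tm -> `|a t x| <= L * (1 + `|x|).
Hypothesis grob : forall t x, t0 <= t <= tm -> `|b t x| <= L * (1 + `|x|).
Let L0 : 0 <= L. Proof. exact: le_trans L1. Qed.
Local Notation A := (adapted_mom P F).

Local Notation adapted_vec := (adapted_vec P F).
Local Notation lam := (@lebesgue_measure R).
Local Notation dW s t w := (W t w - W s w).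
Hypothesis tt : t0 < tm.
Variable X : R -> T -> 'rV[R]_n.
Hypothesis solX : ito_solution P F W a b t0 tm X.
Hypothesis hx0 : adapted_vec t0 (X t0).

Let mI s t : measurable ([set` `[s, t]] : set R). Proof. exact: measurable_itv. Qed.

Local Notation H m := ((tm - t0) / m%:R).
Local Notation rho m := (Num.sqrt (H m)).
Local Notation gr m k := (grid t0 (H m) k).
Local Notation Q m k := (fun w => milstein_scheme a b t0 (H m) (W^~ w) (X t0 w) k).

Let jl := jointly_measurable_lyap solX.
Let l0 t w : 0 <= lyap (X t w). Proof. exact: ltW (lyap_gt0 _). Qed.
Let TT : 0 <= tm - t0. Proof. by rewrite subr_ge0 ltW. Qed.

Lemma iint_le_lyap : exists K : R, 0 <= K /\
  forall (t : R) (Y : R -> T -> R) (c : R), t <= tm -> 0 <= c -> jointly_measurable `[t0, t] Y ->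
    (forall s w, t0 <= s <= t -> 0 <= Y s w <= c * lyap (X s w)) ->
    (\int[P]_w \int[lam]_(s in `[t0, t]) (Y s w)%:E <= (c * K)%:E)%E.
Proof.
have [K [K0 hK]] := lyap_solution_fin tt solX.
exists K; split => // t Y c ttm c0 jY hY.
have sub : [set` `[t0, t]] `<=` [set` `[t0, tm]].
  by move=> s /=; rewrite !in_itv /= => /andP[-> h]; exact: le_trans h ttm.
(* Y is nonnegative only for times in the interval, whereas the swap of integrals is stated for
   functions nonnegative everywhere. *)
pose Z s w : R := Num.max 0 (Y s w).
have jZ : jointly_measurable `[t0, t] Z.
  by apply: measurable_maxr; [exact: measurable_cst|exact: jY].
have ZE s w : s \in `[t0, t] -> Z s w = Y s w.
  by rewrite in_itv /= => sI; apply/max_idPr; case/andP: (hY s w sI).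
have -> : (\int[P]_w \int[lam]_(s in `[t0, t]) (Y s w)%:E =
   \int[P]_w \int[lam]_(s in `[t0, t]) (Z s w)%:E)%E.
  apply: eq_integral => w _; apply: eq_integral => s sI; rewrite ZE//.
  by move: sI; rewrite inE.
rewrite (iterated_integralE P (mI t0 t) jZ); last by move=> s w; rewrite le_max lexx.
have jl' := jointly_measurableS (mI t0 tm) sub jl.
apply: (@le_trans _ _ (c%:E * iint P `[t0, t] (fun s w => lyap (X s w)) + 0)%E).
  apply: (iint_le_comb P (mI t0 t) (s := [:: (c, fun s w => lyap (X s w))])) => //=.
  move=> s w sI; have sI' : s \in `[t0, t] by [].
  by rewrite ZE// addr0; apply: hY; move: sI'; rewrite in_itv.
rewrite adde0 EFinM; apply: lee_wpmul2l => //.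
rewrite -hK (iterated_integralE P (mI t0 tm) jl) => [|s w]; last exact: l0.
apply: ge0_subset_integral.
- by apply: measurableX => //; exact: mI.
- by apply: measurableX => //; exact: mI.
- exact/measurable_EFinP.
- by move=> z _; rewrite lee_fin.
- by move=> z [z1 z2]; split => //; exact: sub.
Qed.

(** [solution_dist] with an empty family bounds X_t - X_t0 by the time integrals of the squared
    coefficients, which are finite because the solution is square integrable in time and
    probability. *)
Lemma solution_moment : exists M : R, 0 <= M /\
  forall t, t0 <= t <= tm -> (\int[P]_w (lyap (X t w))%:E <= M%:E)%E.
Proof.
have [K [K0 hK]] := iint_le_lyap.
pose c := 2 * L ^+ 2; have c0 : 0 <= c by rewrite mulr_ge0 ?sqr_ge0.
pose B := 2 * (tm - t0) * (c * K) + 8 * (c * K).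
have B0 : 0 <= B by rewrite addr_ge0 ?mulr_ge0.
pose V i := E (fun w => X t0 w 0 i ^+ 2).
have V0 i : 0 <= V i by apply: mean_ge0 => w; exact: sqr_ge0.
exists (1 + \sum_i (2 * B + 2 * V i)); split=> [|t tI].
  by rewrite addr_ge0// sumr_ge0// => i _; rewrite addr_ge0 ?mulr_ge0.
have /andP[t0t ttm] := tI.
have mX i : measurable_fun setT (fun w => X t w 0 i) := measurable_solution fF t00 solX i tI.
have mX0 i : measurable_fun setT (fun w => X t0 w 0 i) by have [_ []] := hx0 i.
have sub : [set` `[t0, t]] `<=` [set` `[t0, tm]].
  by move=> s /=; rewrite !in_itv /= => /andP[-> h]; exact: le_trans h ttm.
have coefB (f : R -> 'rV[R]_n -> 'rV[R]_n) i : smooth 3 t0 tm (fun z => f z.1 z.2 0 i) ->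
    (forall t x, t0 <= t <= tm -> `|f t x| <= L * (1 + `|x|)) ->
    (\int[P]_w \int[lam]_(s in `[t0, t]) (f s (X s w) 0 i ^+ 2)%:E <= (c * K)%:E)%E.
  move=> sf gf; apply: hK => //.
    apply: jointly_measurableX; apply: jointly_measurableS (mI t0 tm) sub _.
    exact (jointly_measurable_coef solX sf).
  move=> s w /andP[s1 s2]; rewrite sqr_ge0 (coef_sqr_le L1 _ _ gf)//.
  by rewrite s1 (le_trans s2).
have hi i : (\int[P]_w (X t w 0 i ^+ 2)%:E <= (2 * B + 2 * V i)%:E)%E.
  have h := solution_dist fF wW t00 sa L1 groa tt solX i (I := 'I_0)
    (va := fun _ _ => 0) (vb := fun _ _ => 0) (lo := fun=> t0) (hi := fun=> t0) tI
    (fun _ => lexx _) (fun _ => lexx _) (fun _ => t0t)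
    (fun _ => adapted_mom_cst P fF t00 0) (fun _ => adapted_mom_cst P fF t00 0).
  have e0 (f : R -> 'rV[R]_n -> 'rV[R]_n) : (\int[P]_w \int[lam]_(s in `[t0, t])
      ((f s (X s w) 0 i - \sum_(j < 0) 0 * (t0 <= s < t0)%R%:R) ^+ 2)%:E =
      \int[P]_w \int[lam]_(s in `[t0, t]) (f s (X s w) 0 i ^+ 2)%:E)%E.
    by apply: eq_integral => w _; apply: eq_integral => s _; rewrite big_ord0 subr0.
  have sB : (\int[P]_w ((X t w 0 i - X t0 w 0 i) ^+ 2)%:E <= B%:E)%E.
    move: h; under eq_integral do rewrite big_ord0 addr0.
    move=> /le_trans; apply; rewrite /B [leRHS]EFinD; apply: leeD.
      rewrite [leRHS]EFinM; apply: lee_wpmul2l; first by rewrite lee_fin mulr_ge0.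
      exact (eq_ind_r (fun u => (u <= (c * K)%:E)%E) (coefB a i (sa i) groa) (e0 a)).
    rewrite [leRHS]EFinM; apply: lee_wpmul2l => //.
    exact (eq_ind_r (fun u => (u <= (c * K)%:E)%E) (coefB b i (sb i) grob) (e0 b)).
  have := ge0_integral_le_comb (D := setT) (P : {measure set T -> \bar R})
    (s := [:: (2, fun w => (X t w 0 i - X t0 w 0 i) ^+ 2); (2, fun w => X t0 w 0 i ^+ 2)])
    (Y := fun w => X t w 0 i ^+ 2) measurableT (measurable_funX 2 (mX i)) _ _.
  move=> h'; apply: le_trans (h' _ _) _ => /=.
  - split => //; first by apply: measurable_funX; exact: measurable_funB.
      by move=> w _; exact: sqr_ge0.
    by split => //; [exact: measurable_funX|move=> w _; exact: sqr_ge0].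
  - move=> w _; rewrite sqr_ge0 /=; move: (X t w 0 i) (X t0 w 0 i) => x y.
    by have := sqr_ge0 (x - y - y); lra.
  rewrite adde0 [leRHS]EFinD [(2 * B)%:E]EFinM [(2 * V i)%:E]EFinM; apply: leeD.
    exact: lee_wpmul2l.
  by rewrite (meanE (all_momentsX 2 _))//; case: (hx0 i).
under eq_integral do rewrite /lyap EFinD -sumEFin.
have e2 i : measurable_fun setT (fun w => (X t w 0 i ^+ 2)%:E).
  by apply/measurable_EFinP; exact: measurable_funX.
rewrite (ge0_integralD _ measurableT)//; last 2 first.
- by move=> w _; apply: sume_ge0 => i _; rewrite lee_fin sqr_ge0.
- exact: emeasurable_sum.
rewrite integral_cst// [X in (_ * X)%E]probability_setT mule1 EFinD leeD2l//.
rewrite (ge0_integral_sum _ measurableT)//; last by move=> i w _; rewrite lee_fin sqr_ge0.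
by rewrite -sumEFin; apply: lee_sum.
Qed.

(** The sum of the first k Milstein corrections: what the scheme has beyond the Euler sum of the
    coefficients along itself. *)
Let corr m k i w := Q m k w 0 i - (X t0 w 0 i
  + \sum_(l < k) (H m * a (gr m l) (Q m l w) 0 i
      + dW (gr m l) (gr m l.+1) w * b (gr m l) (Q m l w) 0 i)).

(** The corrections are orthogonal increments of mean square O(h^2), so m of them add up to O(h)
    only. *)
Lemma correction_bound : exists K : R, 0 <= K /\ forall m k i, (0 < m)%N -> H m <= 1 -> (k <= m)%N ->
  all_moments P (corr m k i) /\ E (fun w => corr m k i w ^+ 2) <= K * H m.
Proof.
have [M [M0 hM]] := milstein_scheme_moments fF wW t00 sa sb L1 lipb groa grob tt hx0 1.
have gs0 := gauss_sum_ge0 (R := R) 2.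
pose K := L ^+ 4 * M * gauss_sum 2; have K0 : 0 <= K by rewrite !mulr_ge0// exprn_ge0.
exists (K * (tm - t0)); split=> [|m k i m0 H1]; first exact: mulr_ge0.
have Hge := ltW (mesh_gt0 tt m0).
suff h : (k <= m)%N -> A (gr m k) (corr m k i) /\
    E (fun w => corr m k i w ^+ 2) <= k%:R * (H m ^+ 2 * K).
  move=> km; have [[_ h1] h2] := h km; split => //; apply: le_trans h2 _.
  have -> : K * (tm - t0) * H m = m%:R * (H m ^+ 2 * K).
    by field; rewrite pnatr_eq0 -lt0n.
  by rewrite ler_wpM2r ?ler_nat// mulr_ge0 ?sqr_ge0.
elim: k => [_|k IH km].
  have -> : corr m 0 i = fun=> 0 by apply/funext => w; rewrite /corr /= big_ord0 addr0 subrr.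
  rewrite grid0; split; first exact: (adapted_mom_cst P fF t00 0).
  by under eq_Rintegral do rewrite expr0n; rewrite mean_cst mul0r.
have [hC EC] := IH (ltnW km).
have ok := step_ok_grid tt m0 H1 km.
have s0 := step_ge0 t00 ok; have st := step_lt ok; have t0' := step_end_ge0 t00 ok.
have [_ _ r0 r1] := ok.
have zA := adapted_step_noise fF wW t00 ok; have [_ zM] := zA.
pose z := unit_noise W (gr m k) (gr m k + rho m ^+ 2).
have hQ := adapted_milstein_scheme fF wW t00 sa sb tt hx0 m0 H1 (ltnW km).
pose c w := milstein_corr b (rho m) (gr m k) (Q m k w) 0 i.
have hc : A (gr m k) c := adapted_vec_corr fF sb (rho m) s0 (step_I ok) hQ i.
(* Each new correction is h/2 times c(z^2 - 1), with c known at the beginning of the step. *)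
have CS : corr m k.+1 i = fun w => corr m k i w + H m / 2 * (c w * (z w ^+ 2 - 1)).
  apply/funext => w; rewrite /corr.
  pose g (l : nat) := H m * a (gr m l) (Q m l w) 0 i
      + dW (gr m l) (gr m l.+1) w * b (gr m l) (Q m l w) 0 i.
  have -> : \sum_(l < k.+1) g l = \sum_(l < k) g l + g k by rewrite big_ord_recr.
  rewrite /g.
  have -> : Q m k.+1 w 0 i = Q m k w 0 i + (H m * a (gr m k) (Q m k w) 0 i
      + dW (gr m k) (gr m k.+1) w * b (gr m k) (Q m k w) 0 i
      + (dW (gr m k) (gr m k.+1) w ^+ 2 - H m) / 2 * c w) by exact: milstein_stepE.
  have inc : dW (gr m k) (gr m k.+1) w = rho m * z w.
    by rewrite (grid_next tt m0); exact: step_increment.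
  have -> : dW (gr m k) (gr m k.+1) w ^+ 2 = H m * z w ^+ 2.
    by rewrite inc exprMn mesh_sqr.
  move: (Q m k w 0 i) (\sum_(l < k) _) (a _ _ _ _) (b _ _ _ _) (dW _ _ _) (c w) (z w) => *.
  by move: (H m) => *; field.
have mz1 : all_moments P (fun w => z w ^+ 2 - 1).
  by apply: all_momentsB; [exact: all_momentsX|exact: all_moments_cst].
have z1A : A (gr m k + rho m ^+ 2) (fun w => z w ^+ 2 - 1).
  by apply: (adapted_momB fF) => //; [exact: (adapted_momX fF)|exact: (adapted_mom_cst P fF t0' 1)].
have up Y : A (gr m k) Y -> A (gr m k + rho m ^+ 2) Y by exact: (adapted_momS fF s0 (ltW st)).
have hCS : A (gr m k.+1) (corr m k.+1 i).
  rewrite CS (grid_next tt m0); apply: (adapted_momD fF) => //; first exact: up.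
  apply: (adapted_momZ fF) => //; apply: (adapted_momM fF) => //; exact: up.
split => //; rewrite CS.
pose Y1 w := corr m k i w ^+ 2; pose Y2 w := corr m k i w * c w * (z w ^+ 2 - 1).
pose Y3 w := c w ^+ 2 * (1 + z w ^+ 2) ^+ 2.
have [_ mC] := hC; have [_ mc] := hc.
have hCc : A (gr m k) (fun w => corr m k i w * c w) by exact: (adapted_momM fF).
have hc2 : A (gr m k) (fun w => c w ^+ 2) by exact: (adapted_momX fF).
have mY : all_moments P (fun w => (corr m k i w + H m / 2 * (c w * (z w ^+ 2 - 1))) ^+ 2).
  by have [_ mm] := hCS; have := all_momentsX 2 mm; rewrite CS.
have m1 : all_moments P Y1 by exact: all_momentsX.
have m2 : all_moments P Y2 by apply: all_momentsM => //; case: hCc.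
have m3 : all_moments P Y3.
  apply: all_momentsM; first by case: hc2.
  by apply: all_momentsX; apply: all_momentsD; [exact: all_moments_cst|exact: all_momentsX].
have E2 : E Y2 = 0.
  have [_] := mean_noise_cubic fF wW s0 st (adapted_mom_cst P fF s0 0) hCc (adapted_mom_cst P fF s0 0).
  by move=> <-; apply: eq_Rintegral => w _; rewrite /Y2 !mul0r add0r addr0.
have E3 : E Y3 <= 2 * L ^+ 4 * M * gauss_sum 2.
  rewrite (mean_noise_gauss_sum fF wW s0 st 2 hc2) ler_wpM2r//.
  have [_ ml] := adapted_mom_lyap fF s0 hQ.
  apply: (@le_trans _ _ (E (fun w => 2 * L ^+ 4 * lyap (Q m k w) ^+ 1))).
    apply: mean_le; [by case: hc2|by apply: all_momentsZ; exact: all_momentsX|] => w.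
    rewrite expr1 -[c w ^+ 2]real_normK ?num_real//.
    apply: (@le_trans _ _ ((L ^+ 2 * (1 + `|Q m k w|)) ^+ 2)).
      rewrite lerXn2r ?nnegrE ?mulr_ge0 ?addr_ge0 ?sqr_ge0//.
      exact: le_trans (coord_norm_le _ _) (milstein_corr_growth L1 lipb grob _ (step_I ok) r0 r1).
    have -> : 2 * L ^+ 4 * lyap (Q m k w) = L ^+ 4 * (2 * lyap (Q m k w)) by ring.
    rewrite exprMn -exprM; apply: ler_wpM2l; first exact: exprn_ge0.
    have := norm_sqr_le_lyap (Q m k w); have := sqr_ge0 (1 - `|Q m k w|).
    by move: `|_| (lyap _) => u v; lra.
  rewrite meanZ; last exact: all_momentsX.
  by apply: ler_wpM2l; [rewrite mulr_ge0 ?exprn_ge0|exact: hM (ltnW km)].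
have := mean_le_comb (s := [:: (1, Y1); (H m, Y2); (H m ^+ 2 / 4, Y3)]) mY.
move=> h; apply: le_trans (h _ _) _ => [|w|] /=.
- by split; [exact: m1|split; [exact: m2|split; [exact: m3|]]].
- rewrite /Y1 /Y2 /Y3; have Z0 := sqr_ge0 (z w).
  have h1 : (z w ^+ 2 - 1) ^+ 2 <= (1 + z w ^+ 2) ^+ 2.
    by move: (z w ^+ 2) Z0 => Z Z0; nra.
  have h2 : H m ^+ 2 / 4 * (c w ^+ 2 * (z w ^+ 2 - 1) ^+ 2) <=
      H m ^+ 2 / 4 * (c w ^+ 2 * (1 + z w ^+ 2) ^+ 2).
    apply: ler_wpM2l; first by rewrite divr_ge0 ?sqr_ge0.
    by apply: ler_wpM2l => //; exact: sqr_ge0.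
  move: h2; move: (corr m k i w) (c w) (z w ^+ 2) (H m) => x y u v h2.
  by apply: le_trans (lerD (lexx _) (lerD (lexx _) (lerD h2 (lexx 0))));
    rewrite le_eqVlt; apply/orP; left; apply/eqP; field.
have -> : k.+1%:R * (H m ^+ 2 * K) = k%:R * (H m ^+ 2 * K) + H m ^+ 2 * K.
  by rewrite -natr1 mulrDl mul1r.
rewrite E2 mulr0 add0r addr0 mul1r; apply: lerD => //.
apply: le_trans (ler_wpM2l _ E3) _; first by rewrite divr_ge0 ?sqr_ge0.
have -> : H m ^+ 2 / 4 * (2 * L ^+ 4 * M * gauss_sum 2) = 2^-1 * (H m ^+ 2 * K).
  by rewrite /K; move: (H m) (gauss_sum 2) => u v; field.
by rewrite ler_piMl ?mulr_ge0 ?sqr_ge0// invf_le1// ler1n.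
Qed.

End SolutionRegularity.

(** * Coefficients frozen at the grid times *)

Section MeshDefect.
Context {R : realType} {d : measure_display} {T : measurableType d}.
Variables (P : probability T R) (F : R -> set (set T)) (W : R -> T -> R).
Hypothesis fF : filtration F.
Hypothesis wW : wiener P F W.
Context {n : nat}.
Variables (a b : R -> 'rV[R]_n -> 'rV[R]_n) (t0 tm L : R).
Hypothesis t00 : 0 <= t0.
Hypothesis sa : forall i, smooth 3 t0 tm (fun z => a z.1 z.2 0 i).
Hypothesis sb : forall i, smooth 3 t0 tm (fun z => b z.1 z.2 0 i).
Hypothesis L1 : 1 <= L.
Hypothesis lipa : forall t x y, t0 <= t <= tm -> `|a t x - a t y| <= L * `|x - y|.
Hypothesis lipb : forall t x y, t0 <= t <= tm -> `|b t x - b t y| <= L * `|x - y|.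
Hypothesis groa : forall t x, t0 <= t <= tm -> `|a t x| <= L * (1 + `|x|).
Hypothesis grob : forall t x, t0 <= t <= tm -> `|b t x| <= L * (1 + `|x|).
Let L0 : 0 <= L. Proof. exact: le_trans L1. Qed.

Local Notation adapted_vec := (adapted_vec P F).
Hypothesis tt : t0 < tm.
Variable X : R -> T -> 'rV[R]_n.
Hypothesis solX : ito_solution P F W a b t0 tm X.
Hypothesis hx0 : adapted_vec t0 (X t0).

Let mI s t : measurable ([set` `[s, t]] : set R). Proof. exact: measurable_itv. Qed.

Local Notation H m := ((tm - t0) / m%:R).
Local Notation gr m k := (grid t0 (H m) k).
Local Notation Q m k := (fun w => milstein_scheme a b t0 (H m) (W^~ w) (X t0 w) k).

(** The cells are closed on the left, so the end time tm has index m; the sums over cells below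
    therefore have [m.+1] terms. *)
Definition mesh_index (m : nat) (t : R) : nat := Num.truncn ((t - t0) / H m).
Local Notation kx m t := (mesh_index m t).

Section MeshIndex.
Variable m : nat.
Hypothesis m0 : (0 < m)%N.
Let H0 : 0 < H m. Proof. exact: mesh_gt0. Qed.

Lemma mesh_indexP t l : t0 <= t -> (gr m l <= t < gr m l.+1) = (l == kx m t).
Proof.
move=> t0t; have u0 : 0 <= (t - t0) / H m by rewrite divr_ge0 ?subr_ge0// ltW.
have -> : (gr m l <= t < gr m l.+1) = (l%:R <= (t - t0) / H m < l.+1%:R).
  by rewrite ler_pdivlMr// ltr_pdivrMr// /grid lerBrDl ltrBlDl.
apply/idP/eqP => [h|->]; last exact: Num.Theory.truncn_itv.
by apply/esym; exact: Num.Theory.truncn_def.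
Qed.

Lemma mesh_index_itv t : t0 <= t -> gr m (kx m t) <= t < gr m (kx m t).+1.
Proof. by move=> t0t; rewrite mesh_indexP. Qed.

Lemma mesh_index_le t : t0 <= t -> t <= tm -> (kx m t <= m)%N.
Proof.
move=> t0t ttm; have /andP[h _] := mesh_index_itv t0t.
have := le_trans h ttm; rewrite -[leRHS](grid_last t0 tm m0) /grid lerD2l ler_pM2r// ler_nat.
exact.
Qed.

Lemma mesh_index_lt t k : t0 <= t -> (kx m t < k)%N = (t < gr m k).
Proof.
move=> t0t; have /andP[h1 h2] := mesh_index_itv t0t; apply/idP/idP => h.
  by apply: lt_le_trans h2 _; exact: grid_le.
rewrite ltnNge; apply/negP => kk.
by have := le_lt_trans (le_trans (grid_le tt m0 kk) h1) h; rewrite ltxx.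
Qed.

Lemma step_sumE k (v : nat -> R) t : t0 <= t ->
  \sum_(l < k) v l * (gr m l <= t < gr m l.+1)%R%:R = if (kx m t < k)%N then v (kx m t) else 0.
Proof.
move=> t0t; under eq_bigr do rewrite mesh_indexP//.
case: ifPn => h.
  rewrite (bigD1 (Ordinal h))//= eqxx mulr1 big1 ?addr0// => l /negPf lh.
  by move: lh; rewrite -val_eqE /= => ->; rewrite mulr0.
apply: big1 => l _; rewrite ltn_eqF ?mulr0//.
by rewrite (leq_trans (ltn_ord l))// leqNgt.
Qed.

End MeshIndex.

Definition defect m t w : R := \sum_i (X t w 0 i - Q m (kx m t) w 0 i) ^+ 2.

(** The cost of freezing only the time argument while the state stays at X. The scheme does not
    occur in it, so it can be treated by dominated convergence. *)
Definition time_defect m t w : R :=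
  \sum_i ((a t (X t w) 0 i - a (gr m (kx m t)) (X t w) 0 i) ^+ 2
        + (b t (X t w) 0 i - b (gr m (kx m t)) (X t w) 0 i) ^+ 2).

Lemma defect_ge0 m t w : 0 <= defect m t w.
Proof. by apply: sumr_ge0 => i _; exact: sqr_ge0. Qed.

Lemma time_defect_ge0 m t w : 0 <= time_defect m t w.
Proof. by apply: sumr_ge0 => i _; rewrite addr_ge0 ?sqr_ge0. Qed.

Lemma jointly_measurable_on (D : set R) (Y Z : R -> T -> R) :
  (forall t w, D t -> Y t w = Z t w) -> jointly_measurable D Y -> jointly_measurable D Z.
Proof.
by move=> h; apply: eq_measurable_fun => z; rewrite inE => -[Dz _]; exact: h.
Qed.

Let itv_ge s t : [set` `[t0, t]] s -> t0 <= s.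
Proof. by rewrite /= in_itv /= => /andP[]. Qed.

Let itv_le s t : [set` `[t0, t]] s -> s <= t.
Proof. by rewrite /= in_itv /= => /andP[]. Qed.

Section Measurability.
Variable m : nat.
Hypotheses (m0 : (0 < m)%N) (H1 : H m <= 1).

Lemma jointly_measurable_scheme i : jointly_measurable `[t0, tm] (fun t w => Q m (kx m t) w 0 i).
Proof.
apply: (@jointly_measurable_on _ (fun t w => \sum_(l < m.+1)
    Q m l w 0 i * (gr m l <= t < gr m l.+1)%R%:R)).
  move=> t w tI; rewrite (step_sumE m0 _ (fun l => Q m l w 0 i) (itv_ge tI)) ltnS.
  by rewrite (mesh_index_le m0 (itv_ge tI) (itv_le tI)).
apply: jointly_measurable_step (mI t0 tm) _ => l.
have [_ []] := adapted_milstein_scheme fF wW t00 sa sb tt hx0 m0 H1 (ltn_ord l) i.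
exact.
Qed.

Lemma jointly_measurable_delay (f : R -> 'rV[R]_n -> 'rV[R]_n) i :
  smooth 3 t0 tm (fun z => f z.1 z.2 0 i) ->
  jointly_measurable `[t0, tm] (fun t w => f (gr m (kx m t)) (X t w) 0 i).
Proof.
move=> sf; pose th (t : R) := \sum_(l < m.+1) gr m l * (gr m l <= t < gr m l.+1)%R%:R.
apply: (@jointly_measurable_on _ (fun t w => f (th t) (X t w) 0 i)).
  move=> t w tI; rewrite /th (step_sumE m0 _ (fun l => gr m l) (itv_ge tI)) ltnS.
  by rewrite (mesh_index_le m0 (itv_ge tI) (itv_le tI)).
apply: (jointly_measurable_vector (f := fun z => f z.1 z.2 0 i)).
- exact: mI.
- exact: smooth_continuous sf.
- apply: measurable_sum => l; apply: measurable_funM; first exact: measurable_cst.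
  have -> : (fun t => (gr m l <= t < gr m l.+1)%R%:R : R) = \1_([set` `[gr m l, gr m l.+1[]).
    by apply/funext => t; rewrite indicE mem_setE in_itv.
  by apply: measurable_indic; exact: measurable_itv.
- exact: jointly_measurable_solution solX.
Qed.

Lemma jointly_measurable_defect : jointly_measurable `[t0, tm] (defect m).
Proof.
apply: jointly_measurable_sum => i; apply: jointly_measurableX; apply: jointly_measurableB.
  exact (jointly_measurable_solution solX i).
exact: jointly_measurable_scheme.
Qed.

Lemma jointly_measurable_time_defect : jointly_measurable `[t0, tm] (time_defect m).
Proof.
apply: jointly_measurable_sum => i; apply: jointly_measurableD;
  apply: jointly_measurableX; apply: jointly_measurableB.
- exact (jointly_measurable_coef solX (sa i)).
- exact: jointly_measurable_delay.
- exact (jointly_measurable_coef solX (sb i)).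
- exact: jointly_measurable_delay.
Qed.

End Measurability.
End MeshDefect.

Section DefectRecursion.
Context {R : realType} {d : measure_display} {T : measurableType d}.
Variables (P : probability T R) (F : R -> set (set T)) (W : R -> T -> R).
Hypothesis fF : filtration F.
Hypothesis wW : wiener P F W.
Local Notation E f := (Rintegral P setT f).
Context {n : nat}.
Variables (a b : R -> 'rV[R]_n -> 'rV[R]_n) (t0 tm L : R).
Hypothesis t00 : 0 <= t0.
Hypothesis sa : forall i, smooth 3 t0 tm (fun z => a z.1 z.2 0 i).
Hypothesis sb : forall i, smooth 3 t0 tm (fun z => b z.1 z.2 0 i).
Hypothesis L1 : 1 <= L.
Hypothesis lipa : forall t x y, t0 <= t <= tm -> `|a t x - a t y| <= L * `|x - y|.
Hypothesis lipb : forall t x y, t0 <= t <= tm -> `|b t x - b t y| <= L * `|x - y|.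
Hypothesis groa : forall t x, t0 <= t <= tm -> `|a t x| <= L * (1 + `|x|).
Hypothesis grob : forall t x, t0 <= t <= tm -> `|b t x| <= L * (1 + `|x|).
Let L0 : 0 <= L. Proof. exact: le_trans L1. Qed.
Local Notation A := (adapted_mom P F).

Local Notation adapted_vec := (adapted_vec P F).
Local Notation lam := (@lebesgue_measure R).
Local Notation dW s t w := (W t w - W s w).
Hypothesis tt : t0 < tm.
Variable X : R -> T -> 'rV[R]_n.
Hypothesis solX : ito_solution P F W a b t0 tm X.
Hypothesis hx0 : adapted_vec t0 (X t0).

Let mI s t : measurable ([set` `[s, t]] : set R). Proof. exact: measurable_itv. Qed.

Local Notation H m := ((tm - t0) / m%:R).
Local Notation gr m k := (grid t0 (H m) k).
Local Notation Q m k := (fun w => milstein_scheme a b t0 (H m) (W^~ w) (X t0 w) k).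

Local Notation kx m t := (mesh_index t0 tm m t).
Local Notation defect := (defect W a b t0 tm X).
Local Notation tdefect := (time_defect a b t0 tm X).
Let TT : 0 <= tm - t0. Proof. by rewrite subr_ge0 ltW. Qed.

Lemma sum_sqr_norm (x y : 'rV[R]_n) : `|x - y| ^+ 2 <= \sum_i (x 0 i - y 0 i) ^+ 2.
Proof.
have -> : \sum_i (x 0 i - y 0 i) ^+ 2 = lyap (x - y) - 1.
  by rewrite /lyap addrC addKr; apply: eq_bigr => i _; rewrite !mxE.
exact: norm_sqr_le_lyap.
Qed.

Section CoefficientDefect.
Variables (m : nat) (t : R) (i : 'I_n) (f : R -> 'rV[R]_n -> 'rV[R]_n) (rr gg M : R).
Hypotheses (m0 : (0 < m)%N) (H1 : H m <= 1) (t0t : t0 <= t) (ttm : t <= tm).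
Hypothesis sf : smooth 3 t0 tm (fun z => f z.1 z.2 0 i).
Hypothesis lipf : forall t x y, t0 <= t <= tm -> `|f t x - f t y| <= L * `|x - y|.
Hypothesis grof : forall t x, t0 <= t <= tm -> `|f t x| <= L * (1 + `|x|).
Hypothesis td : forall s w, (f s (X s w) 0 i - f (gr m (kx m s)) (X s w) 0 i) ^+ 2 <= tdefect m s w.
Hypothesis hrr : (iint P `[t0, tm] (tdefect m) <= rr%:E)%E.
Hypothesis hgg : (iint P `[t0, gr m (kx m t)[ (defect m) <= gg%:E)%E.
Hypotheses (M0 : 0 <= M) (hM : forall t, t0 <= t <= tm -> (\int[P]_w (lyap (X t w))%:E <= M%:E)%E).
Let k := kx m t.
Let val (l : 'I_k) w := f (gr m l) (Q m l w) 0 i.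
Let Z s w := (f s (X s w) 0 i - \sum_(l < k) val l w * (gr m l <= s < gr m l.+1)%R%:R) ^+ 2.
Let km : (k <= m)%N. Proof. exact: mesh_index_le. Qed.

Lemma adapted_scheme_coef l : (l < k)%N -> A (gr m l) (fun w => f (gr m l) (Q m l w) 0 i).
Proof.
move=> lk; have lm : (l < m)%N := leq_trans lk km.
have ok := step_ok_grid tt m0 H1 lm.
have hQ := adapted_milstein_scheme fF wW t00 sa sb tt hx0 m0 H1 (ltnW lm).
exact: (adapted_mom_smooth fF (step_ge0 t00 ok) sf (step_I ok) hQ).
Qed.

(** The time interval is cut at the last grid point before t. Before it, the time is frozen first
    and then X is replaced by the scheme; after it, the step process is zero and the coefficient
    itself is integrated over a length at most h. *)
Lemma coef_defect :
  (\int[P]_w \int[lam]_(s in `[t0, t]) (Z s w)%:E <= (2 * rr + 2 * L ^+ 2 * gg + 2 * L ^+ 2 * M * H m)%:E)%E.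
Proof.
have alg (x y z u v c : R) : (x - z) ^+ 2 <= u -> (z - y) ^+ 2 <= c * v ->
    (x - y) ^+ 2 <= 2 * u + (2 * c * v + 0).
  by move=> h1 h2; have := sqr_ge0 (x - z - (z - y)); lra.
have /andP[g1 g2] := mesh_index_itv tt m0 t0t.
have t0g : t0 <= gr m k by exact: grid_ge.
have sub : [set` `[t0, t]] `<=` [set` `[t0, tm]].
  by move=> s /=; rewrite !in_itv /= => /andP[-> h]; exact: le_trans h ttm.
have jZ : jointly_measurable `[t0, t] Z.
  apply: jointly_measurableX; apply: jointly_measurableB.
    exact (jointly_measurableS (mI t0 tm) sub (jointly_measurable_coef solX sf)).
  apply: jointly_measurable_step (mI t0 t) _ => l.
  by have [_ []] := adapted_scheme_coef (ltn_ord l).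
have Z0 s w : 0 <= Z s w by exact: sqr_ge0.
pose D1 : set R := [set` `[t0, gr m k[]; pose D2 : set R := [set` `[gr m k, t]].
have m1 : measurable D1 by exact: measurable_itv.
have m2 : measurable D2 by exact: measurable_itv.
have s1 : D1 `<=` [set` `[t0, t]].
  by move=> s /=; rewrite /D1 /= !in_itv /= => /andP[-> h]; exact: ltW (lt_le_trans h g1).
have s2 : D2 `<=` [set` `[t0, t]].
  by move=> s /=; rewrite /D2 /= !in_itv /= => /andP[h ->]; rewrite (le_trans t0g h).
have s1' := subset_trans s1 sub; have s2' := subset_trans s2 sub.
rewrite (iterated_integralE P (mI t0 t) jZ Z0).
have DU : [set` `[t0, t]] = D1 `|` D2.
  apply/seteqP; split => [s|s [/s1|/s2]] //; rewrite /D1 /D2 /= !in_itv /= => /andP[h1 h2].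
  by case: (ltP s (gr m k)) => h; [left|right]; apply/andP.
have dj : [disjoint D1 & D2].
  rewrite disj_set2E; apply/eqP/seteqP; split => // s []; rewrite /D1 /D2 /= !in_itv /=.
  by move=> /andP[_ h1] /andP[h2 _]; have := lt_le_trans h1 h2; rewrite ltxx.
rewrite -/(iint P _ Z) (iint_setU P (mI t0 t) jZ Z0 m1 m2 DU dj) [leRHS]EFinD.
have L20 : 0 <= 2 * L ^+ 2 by rewrite mulr_ge0 ?sqr_ge0.
apply: leeD.
  have jt := jointly_measurable_time_defect sa sb tt solX m0.
  have jd := jointly_measurable_defect fF wW t00 sa sb tt solX hx0 m0 H1.
  apply: (@le_trans _ _ (2%:E * iint P D1 (tdefect m)
      + ((2 * L ^+ 2)%:E * iint P D1 (defect m) + 0))%E).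
    apply: (iint_le_comb P m1 (s := [:: (2, tdefect m); (2 * L ^+ 2, defect m)])) => /=.
    - exact (jointly_measurableS (mI t0 t) s1 jZ).
    - split => //; first exact (jointly_measurableS (mI t0 tm) s1' jt).
        exact: time_defect_ge0.
      split => //; first exact (jointly_measurableS (mI t0 tm) s1' jd).
      exact: defect_ge0.
    - move=> s w sD; rewrite Z0 /=; have := s1' _ sD; rewrite /= in_itv /= => sI.
      have /andP[t0s _] := sI.
      have lk : (kx m s < k)%N.
        by rewrite (mesh_index_lt tt m0 _ t0s); move: sD; rewrite /D1 /= in_itv /= => /andP[].
      rewrite /Z /val (step_sumE tt m0 k (fun l => f (gr m l) (Q m l w) 0 i) t0s) lk.
      have gI : t0 <= gr m (kx m s) <= tm.
        rewrite grid_ge//=; have /andP[h _] := mesh_index_itv tt m0 t0s.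
        by apply: le_trans h _; case/andP: sI.
      have h1 := td s w.
      have h2 : (f (gr m (kx m s)) (X s w) 0 i - f (gr m (kx m s)) (Q m (kx m s) w) 0 i) ^+ 2 <=
          L ^+ 2 * defect m s w.
        rewrite -real_normK ?num_real//.
        apply: (@le_trans _ _ ((L * `|X s w - Q m (kx m s) w|) ^+ 2)).
          rewrite lerXn2r ?nnegrE ?mulr_ge0//.
          have := coord_norm_le (f (gr m (kx m s)) (X s w) - f (gr m (kx m s)) (Q m (kx m s) w)) i.
          by rewrite !mxE => h; apply: le_trans h _; exact: lipf.
        by rewrite exprMn; apply: ler_wpM2l; [exact: sqr_ge0|exact: sum_sqr_norm].
      exact: alg h1 h2.
  rewrite adde0 [leRHS]EFinD; apply: leeD.
    rewrite [leRHS]EFinM; apply: lee_wpmul2l => //; apply: le_trans hrr.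
    exact: (iint_subset P (mI t0 tm) jt (@time_defect_ge0 _ _ _ _ a b t0 tm X m) m1 s1').
  by rewrite [leRHS]EFinM; apply: lee_wpmul2l.
have jl := jointly_measurable_lyap solX.
have jl2 := jointly_measurableS (mI t0 tm) s2' jl.
have l0 s w : 0 <= lyap (X s w) := ltW (lyap_gt0 _).
apply: (@le_trans _ _ ((2 * L ^+ 2)%:E * iint P D2 (fun s w => lyap (X s w)) + 0)%E).
  apply: (iint_le_comb P m2 (s := [:: (2 * L ^+ 2, fun s w => lyap (X s w))])) => //=.
    exact (jointly_measurableS (mI t0 t) s2 jZ).
  move=> s w sD; rewrite Z0 /= addr0; have := s2' _ sD; rewrite /= in_itv /= => sI.
  have /andP[t0s _] := sI.
  rewrite /Z /val (step_sumE tt m0 k (fun l => f (gr m l) (Q m l w) 0 i) t0s).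
  rewrite (mesh_index_lt tt m0 _ t0s) ltNge.
  have -> : gr m k <= s by move: sD; rewrite /D2 /= in_itv /= => /andP[].
  by rewrite /= subr0 (coef_sqr_le L1 _ _ grof).
rewrite adde0 -mulrA [leRHS]EFinM; apply: lee_wpmul2l => //.
apply: le_trans (iint_le_section m2 jl2 l0 M0 _) _.
  by move=> s sD; apply: hM; have := s2' _ sD; rewrite /= in_itv.
rewrite [leRHS]EFinM; apply: lee_wpmul2l => //; rewrite /D2 lebesgue_measure_itv /= lte_fin.
case: ifP => _; last by rewrite lee_fin ltW// mesh_gt0.
by rewrite -EFinB lee_fin lerBlDl; apply: ltW; move: g2; rewrite gridS.
Qed.

End CoefficientDefect.

(** The integral inequality for Gronwall: X is compared with the Euler sum along the scheme by
    [solution_dist], and the scheme differs from that sum by the corrections. On the right the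
    defect occurs only up to the last grid point before t. *)
Lemma defect_recursion : exists K : R, 0 <= K /\ forall m t rr gg, (0 < m)%N -> H m <= 1 ->
  t0 <= t -> t <= tm -> 0 <= rr -> 0 <= gg ->
  (iint P `[t0, tm] (tdefect m) <= rr%:E)%E ->
  (iint P `[t0, gr m (kx m t)[ (defect m) <= gg%:E)%E ->
  (\int[P]_w (defect m t w)%:E <= (K * (rr + gg + H m))%:E)%E.
Proof.
have [M [M0 hM]] := solution_moment fF wW t00 sa sb L1 groa grob tt solX hx0.
have [Kc [Kc0 hKc]] := correction_bound fF wW t00 sa sb L1 lipb groa grob tt hx0.
pose c1 := 2 * (2 * (tm - t0) + 8); pose c2 := 2 * L ^+ 2.
have c10 : 0 <= c1 by rewrite mulr_ge0// addr_ge0// mulr_ge0.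
have c20 : 0 <= c2 by rewrite mulr_ge0 ?sqr_ge0.
exists (n%:R * (c1 * (2 + c2 + c2 * M) + 2 * Kc)); split.
  by rewrite mulr_ge0// addr_ge0 ?mulr_ge0// !addr_ge0// mulr_ge0.
move=> m t rr gg m0 H1 t0t ttm rr0 gg0 hrr hgg; have Hge := ltW (mesh_gt0 tt m0).
have tI : t0 <= t <= tm by rewrite t0t.
pose k := kx m t; have km : (k <= m)%N by exact: mesh_index_le.
have /andP[g1 _] := mesh_index_itv tt m0 t0t.
have mX i : measurable_fun setT (fun w => X t w 0 i) := measurable_solution fF t00 solX i tI.
have mQ i : measurable_fun setT (fun w => Q m k w 0 i).
  by have [_ []] := adapted_milstein_scheme fF wW t00 sa sb tt hx0 m0 H1 km i.
have mD i : measurable_fun setT (fun w => (X t w 0 i - Q m k w 0 i) ^+ 2).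
  by apply: measurable_funX; exact: measurable_funB.
pose D := 2 * rr + c2 * gg + c2 * M * H m.
have D0 : 0 <= D by rewrite /D !addr_ge0 ?mulr_ge0.
have ei i : (\int[P]_w ((X t w 0 i - Q m k w 0 i) ^+ 2)%:E <= (c1 * D + 2 * (Kc * H m))%:E)%E.
  have tda s w : (a s (X s w) 0 i - a (gr m (kx m s)) (X s w) 0 i) ^+ 2 <= tdefect m s w.
    apply: (@le_trans _ _ ((a s (X s w) 0 i - a (gr m (kx m s)) (X s w) 0 i) ^+ 2
       + (b s (X s w) 0 i - b (gr m (kx m s)) (X s w) 0 i) ^+ 2)); first by rewrite lerDl sqr_ge0.
    by rewrite /time_defect (bigD1 i)//= lerDl sumr_ge0// => j _; rewrite addr_ge0 ?sqr_ge0.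
  have tdb s w : (b s (X s w) 0 i - b (gr m (kx m s)) (X s w) 0 i) ^+ 2 <= tdefect m s w.
    apply: (@le_trans _ _ ((a s (X s w) 0 i - a (gr m (kx m s)) (X s w) 0 i) ^+ 2
       + (b s (X s w) 0 i - b (gr m (kx m s)) (X s w) 0 i) ^+ 2)); first by rewrite lerDr sqr_ge0.
    by rewrite /time_defect (bigD1 i)//= lerDl sumr_ge0// => j _; rewrite addr_ge0 ?sqr_ge0.
  have Da := coef_defect m0 H1 t0t ttm (sa i) lipa groa tda hrr hgg M0 hM.
  have Db := coef_defect m0 H1 t0t ttm (sb i) lipb grob tdb hrr hgg M0 hM.
  have h := solution_dist fF wW t00 sa L1 groa tt solX i (I := 'I_k)
    (va := fun l w => a (gr m l) (Q m l w) 0 i) (vb := fun l w => b (gr m l) (Q m l w) 0 i)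
    (lo := fun l => gr m l) (hi := fun l => gr m l.+1) tI
    (fun l => grid_ge tt m0 l) (fun l => grid_le tt m0 (leqnSn l))
    (fun l => le_trans (grid_le tt m0 (ltn_ord l)) g1)
    (fun l => adapted_scheme_coef m0 H1 t0t ttm (sa i) (ltn_ord l))
    (fun l => adapted_scheme_coef m0 H1 t0t ttm (sb i) (ltn_ord l)).
  pose S w := \sum_(l < k) (a (gr m l) (Q m l w) 0 i * (gr m l.+1 - gr m l)
      + b (gr m l) (Q m l w) 0 i * dW (gr m l) (gr m l.+1) w).
  pose Y1 w := X t w 0 i - (X t0 w 0 i + S w).
  pose Y2 w := Q m k w 0 i - (X t0 w 0 i + S w).
  have [mc Ec] : all_moments P Y2 /\ E (fun w => Y2 w ^+ 2) <= Kc * H m.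
    have gd l : gr m l.+1 - gr m l = H m by rewrite gridS addrC addKr.
    have -> : Y2 = (fun w => Q m k w 0 i - (X t0 w 0 i + \sum_(l < k) (H m * a (gr m l) (Q m l w) 0 i
        + dW (gr m l) (gr m l.+1) w * b (gr m l) (Q m l w) 0 i))).
      apply/funext => w; apply: (congr1 (fun u => Q m k w 0 i - (X t0 w 0 i + u))).
      by apply: eq_bigr => l _; rewrite gd; congr (_ + _); exact: mulrC.
    exact: hKc.
  have mY1 : measurable_fun setT Y1.
    have -> : Y1 = (fun w => (X t w 0 i - Q m k w 0 i) + Y2 w).
      by apply/funext => w; rewrite /Y1 /Y2 addrA subrK.
    by apply: measurable_funD; [exact: measurable_funB|case: mc].
  have := ge0_integral_le_comb (D := setT) (P : {measure set T -> \bar R})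
    (s := [:: (2, fun w => Y1 w ^+ 2); (2, fun w => Y2 w ^+ 2)])
    (Y := fun w => (X t w 0 i - Q m k w 0 i) ^+ 2) measurableT (mD i).
  move=> h'; apply: le_trans (h' _ _) _ => /=.
  - split => //; [exact: measurable_funX|by move=> w _; exact: sqr_ge0|].
    by split => //; [apply: measurable_funX; case: mc|move=> w _; exact: sqr_ge0].
  - move=> w _; rewrite sqr_ge0 /=.
    have -> : X t w 0 i - Q m k w 0 i = Y1 w - Y2 w by rewrite /Y1 /Y2 opprB addrA subrK.
    by have := sqr_ge0 (Y1 w + Y2 w); move: (Y1 w) (Y2 w) => u v; lra.
  rewrite adde0 [leRHS]EFinD; apply: leeD; last first.
    rewrite [leRHS]EFinM; apply: lee_wpmul2l => //.
    by rewrite (meanE (all_momentsX 2 mc)) lee_fin.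
  have -> : c1 * D = 2 * (2 * (tm - t0) * D + 8 * D) by rewrite /c1; ring.
  rewrite [leRHS]EFinM; apply: lee_wpmul2l => //.
  apply: le_trans h _; rewrite [leRHS]EFinD [(2 * (tm - t0) * D)%:E]EFinM [(8 * D)%:E]EFinM.
  apply: leeD.
    by apply: lee_wpmul2l; [rewrite lee_fin mulr_ge0|exact Da].
  by apply: lee_wpmul2l; [rewrite lee_fin|exact Db].
have -> : (\int[P]_w (defect m t w)%:E = \sum_i \int[P]_w ((X t w 0 i - Q m k w 0 i) ^+ 2)%:E)%E.
  rewrite -ge0_integral_sum//; last 2 first.
  - by move=> i; exact/measurable_EFinP.
  - by move=> i w _; rewrite lee_fin sqr_ge0.
  by apply: eq_integral => w _; rewrite sumEFin.
apply: le_trans (lee_sum _ (fun i _ => ei i)) _.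
rewrite sumEFin sumr_const card_ord lee_fin -[_ *+ n]mulr_natl -mulrA ler_wpM2l//.
rewrite -subr_ge0.
have -> : (c1 * (2 + c2 + c2 * M) + 2 * Kc) * (rr + gg + H m) - (c1 * D + 2 * (Kc * H m)) =
   c1 * (2 * (gg + H m) + c2 * (rr + H m) + c2 * M * (rr + gg)) + 2 * Kc * (rr + gg).
  by rewrite /D; move: (H m) => u; ring.
have e1 : 0 <= rr + gg by exact: addr_ge0.
have e2 : 0 <= gg + H m by exact: addr_ge0.
have e3 : 0 <= rr + H m by exact: addr_ge0.
apply: addr_ge0; last by apply: mulr_ge0 => //; exact: mulr_ge0.
apply: mulr_ge0 => //; apply: addr_ge0; last by apply: mulr_ge0 => //; exact: mulr_ge0.
by apply: addr_ge0; exact: mulr_ge0.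
Qed.

End DefectRecursion.

(** * Gronwall argument and convergence without rate *)

Section MilsteinConvergence.
Context {R : realType} {d : measure_display} {T : measurableType d}.
Variables (P : probability T R) (F : R -> set (set T)) (W : R -> T -> R).
Hypothesis fF : filtration F.
Hypothesis wW : wiener P F W.
Local Notation E f := (Rintegral P setT f).
Context {n : nat}.
Variables (a b : R -> 'rV[R]_n -> 'rV[R]_n) (t0 tm L : R).
Hypothesis t00 : 0 <= t0.
Hypothesis sa : forall i, smooth 3 t0 tm (fun z => a z.1 z.2 0 i).
Hypothesis sb : forall i, smooth 3 t0 tm (fun z => b z.1 z.2 0 i).
Hypothesis L1 : 1 <= L.
Hypothesis lipa : forall t x y, t0 <= t <= tm -> `|a t x - a t y| <= L * `|x - y|.
Hypothesis lipb : forall t x y, t0 <= t <= tm -> `|b t x - b t y| <= L * `|x - y|.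
Hypothesis groa : forall t x, t0 <= t <= tm -> `|a t x| <= L * (1 + `|x|).
Hypothesis grob : forall t x, t0 <= t <= tm -> `|b t x| <= L * (1 + `|x|).
Let L0 : 0 <= L. Proof. exact: le_trans L1. Qed.

Local Notation adapted_vec := (adapted_vec P F).
Local Notation lam := (@lebesgue_measure R).
Hypothesis tt : t0 < tm.
Variable X : R -> T -> 'rV[R]_n.
Hypothesis solX : ito_solution P F W a b t0 tm X.
Hypothesis hx0 : adapted_vec t0 (X t0).

Let mI s t : measurable ([set` `[s, t]] : set R). Proof. exact: measurable_itv. Qed.

Local Notation H m := ((tm - t0) / m%:R).
Local Notation gr m k := (grid t0 (H m) k).
Local Notation Q m k := (fun w => milstein_scheme a b t0 (H m) (W^~ w) (X t0 w) k).

Local Notation kx m t := (mesh_index t0 tm m t).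
Local Notation sdefect := (defect W a b t0 tm X).
Local Notation time_defect := (time_defect a b t0 tm X).
Let TT : 0 <= tm - t0. Proof. by rewrite subr_ge0 ltW. Qed.

(** The time integral of the defect is bounded cell by cell along the grid. The majorant is a real
    sequence, so the finiteness of these integrals comes out of the same induction. *)
Lemma defect_gronwall : exists K : R, 0 <= K /\ forall m rr, (0 < m)%N -> H m <= 1 -> 0 <= rr ->
  (iint P `[t0, tm] (time_defect m) <= rr%:E)%E ->
  (\int[P]_w (sdefect m tm w)%:E <= (K * (rr + H m))%:E)%E.
Proof.
have [K [K0 hK]] := defect_recursion fF wW t00 sa sb L1 lipa lipb groa grob tt solX hx0.
pose B := expR (K * (tm - t0)) * ((tm - t0) * K).
have B0 : 0 <= B by rewrite /B !mulr_ge0// expR_ge0.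
exists (K * (1 + B)); split=> [|m rr m0 H1 rr0 hrr]; first by rewrite mulr_ge0// addr_ge0.
have Hge := ltW (mesh_gt0 tt m0).
(* On cell k the defect is at most K(rr + x k + h), integrated over the length h. *)
pose x := fix x (k : nat) : R := if k is k'.+1 then (1 + K * H m) * x k' + H m * (K * (rr + H m)) else 0.
have x0 k : 0 <= x k.
  elim: k => [//|k IH] /=; apply: addr_ge0; apply: mulr_ge0 => //.
    by apply: addr_ge0 => //; exact: mulr_ge0.
  by apply: mulr_ge0 => //; exact: addr_ge0.
have jd := jointly_measurable_defect fF wW t00 sa sb tt solX hx0 m0 H1.
have d0 := @defect_ge0 _ _ _ W _ a b t0 tm X m.
have hx k : (k <= m)%N -> (iint P `[t0, gr m k[ (sdefect m) <= (x k)%:E)%E.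
  elim: k => [_|k IH km].
    rewrite grid0 /iint set_itv_ge ?bnd_simp ?ltxx//.
    by rewrite set0X integral_set0.
  pose D1 : set R := [set` `[t0, gr m k[]; pose D2 : set R := [set` `[gr m k, gr m k.+1[].
  have m1 : measurable D1 by exact: measurable_itv.
  have m2 : measurable D2 by exact: measurable_itv.
  have mD : measurable ([set` `[t0, gr m k.+1[] : set R) by exact: measurable_itv.
  have g1 : t0 <= gr m k by exact: grid_ge.
  have g2 : gr m k <= gr m k.+1 by exact: grid_le.
  have g3 : gr m k.+1 <= tm by rewrite -[leRHS](grid_last t0 tm m0); exact: grid_le.
  have sub : [set` `[t0, gr m k.+1[] `<=` [set` `[t0, tm]].
    by move=> s /=; rewrite !in_itv /= => /andP[-> h]; exact: ltW (lt_le_trans h g3).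
  have s2 : D2 `<=` [set` `[t0, tm]].
    move=> s; rewrite /D2 /= !in_itv /= => /andP[h1 h2].
    by rewrite (le_trans g1 h1) (ltW (lt_le_trans h2 g3)).
  have DU : [set` `[t0, gr m k.+1[] = D1 `|` D2.
    apply/seteqP; split => [s|s [|]]; rewrite /D1 /D2 /= !in_itv /= => /andP[h1 h2].
    - by case: (ltP s (gr m k)) => h; [left|right]; apply/andP.
    - by rewrite h1 (lt_le_trans h2).
    - by rewrite h2 (le_trans g1).
  have dj : [disjoint D1 & D2].
    rewrite disj_set2E; apply/eqP/seteqP; split => // s []; rewrite /D1 /D2 /= !in_itv /=.
    by move=> /andP[_ h1] /andP[h2 _]; have := lt_le_trans h1 h2; rewrite ltxx.
  have jd' := jointly_measurableS (mI t0 tm) sub jd.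
  rewrite (iint_setU P mD jd' d0 m1 m2 DU dj).
  have -> : x k.+1 = x k + (K * (rr + x k + H m)) * H m by rewrite /=; ring.
  rewrite [leRHS]EFinD; apply: leeD; first exact: IH (ltnW km).
  have M0 : 0 <= K * (rr + x k + H m) by apply: mulr_ge0 => //; rewrite !addr_ge0.
  apply: le_trans (iint_le_section m2 (jointly_measurableS (mI t0 tm) s2 jd) d0 M0 _) _.
    move=> s sD; have := s2 _ sD; rewrite /= in_itv /= => /andP[t0s stm].
    have ks : kx m s = k.
      by apply/esym/eqP; rewrite -(mesh_indexP tt m0).
    apply: hK => //; rewrite ks; exact: IH (ltnW km).
  rewrite [leRHS]EFinM; apply: lee_wpmul2l; first by rewrite lee_fin.
  rewrite /D2 lebesgue_measure_itv /= lte_fin; case: ifP => _; last by rewrite lee_fin.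
  by rewrite -EFinB lee_fin gridS addrC addKr.
have xm : x m <= B * (rr + H m).
  apply: le_trans (discrete_gronwall (al := K * H m) (be := H m * (K * (rr + H m))) (e := x)
    _ _ _ (fun k _ => lexx _)) _.
  - exact: mulr_ge0.
  - by apply: mulr_ge0 => //; apply: mulr_ge0 => //; exact: addr_ge0.
  - exact: lexx.
  have -> : m%:R * (H m * (K * (rr + H m))) = (tm - t0) * (K * (rr + H m)).
    by rewrite mulrA [m%:R * _]mulrC divfK// pnatr_eq0 -lt0n.
  have -> : B * (rr + H m) = expR (K * (tm - t0)) * ((tm - t0) * (K * (rr + H m))).
    by rewrite /B; ring.
  apply: ler_wpM2r; last exact: compound_le_expR.
  by apply: mulr_ge0 => //; apply: mulr_ge0 => //; exact: addr_ge0.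
have ktm : kx m tm = m.
  apply/esym/eqP; rewrite -(mesh_indexP tt m0 m (ltW tt)) (grid_last t0 tm m0) lexx /=.
  by rewrite gridS (grid_last t0 tm m0) ltrDl mesh_gt0.
have h := hK m tm rr (x m) m0 H1 (ltW tt) (lexx _) rr0 (x0 m) hrr.
rewrite ktm in h; apply: le_trans (h (hx m (leqnn m))) _; rewrite lee_fin.
rewrite -mulrA ler_wpM2l//.
have -> : (1 + B) * (rr + H m) = rr + B * (rr + H m) + H m by ring.
by rewrite lerD2r lerD2l.
Qed.

Lemma defect_last m w : (0 < m)%N -> sdefect m tm w = \sum_i (X tm w 0 i - Q m m w 0 i) ^+ 2.
Proof.
move=> m0; rewrite /defect; have -> // : kx m tm = m.
apply/esym/eqP; rewrite -(mesh_indexP tt m0 m (ltW tt)) (grid_last t0 tm m0) lexx /=.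
by rewrite gridS (grid_last t0 tm m0) ltrDl mesh_gt0.
Qed.

Lemma cvg_seq_sum (I : Type) (s : seq I) (u : I -> nat -> R) (l : I -> R) :
  (forall i, u i @ \oo --> l i) ->
  (fun m => \sum_(i <- s) u i m) @ \oo --> \sum_(i <- s) l i.
Proof.
move=> h; elim: s => [|i s IH].
  by rewrite big_nil; under eq_fun do rewrite big_nil; exact: cvg_cst.
rewrite big_cons; under eq_fun do rewrite big_cons.
by apply: cvgD; [exact: h|exact: IH].
Qed.

(** The last grid time before s is within h of s, and f is continuous at the fixed state x. *)
Lemma delay_cvg (f : R -> 'rV[R]_n -> 'rV[R]_n) i (s : R) (x : 'rV[R]_n) :
  smooth 3 t0 tm (fun z => f z.1 z.2 0 i) -> t0 <= s -> s <= tm ->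
  (fun m => (f s x 0 i - f (gr m.+1 (kx m.+1 s)) x 0 i) ^+ 2) @ \oo --> (0 : R).
Proof.
move=> sf t0s stm; have cont := smooth_continuous sf.
have eta : (fun m => gr m.+1 (kx m.+1 s)) @ \oo --> s.
  apply/cvgrPdist_le => e e0; near=> m.
  have /andP[h1 h2] := mesh_index_itv tt (ltn0Sn m) t0s.
  rewrite ger0_norm ?subr_ge0//; apply: (@le_trans _ _ (H m.+1)).
    by rewrite lerBlDl ltW//; move: h2; rewrite gridS.
  rewrite ler_pdivrMr ?ltr0n// mulrC -ler_pdivrMr//.
  apply: (@le_trans _ _ m%:R); last by rewrite ler_nat.
  near: m; exact: nbhs_infty_ger.
have hp : (fun m => (gr m.+1 (kx m.+1 s), x)) @ \oo --> (s, x).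
  exact: (cvg_pair eta (cvg_cst x)).
have h : (fun m => f (gr m.+1 (kx m.+1 s)) x 0 i) @ \oo --> f s x 0 i.
  exact: (cvg_comp _ _ hp (cont (s, x))).
have h2 : (fun m => f s x 0 i - f (gr m.+1 (kx m.+1 s)) x 0 i) @ \oo --> (0 : R).
  by rewrite -(subrr (f s x 0 i)); apply: cvgB; [exact: cvg_cst|exact: h].
rewrite -(mul0r (0 : R)); exact: (cvgM h2 h2).
Unshelve. all: by end_near. Qed.

(** Dominated convergence over time and probability; pointwise convergence is [delay_cvg], and
    linear growth supplies a multiple of [lyap (X t)] as majorant. *)
Lemma time_defect_cvg : (fun m => iint P `[t0, tm] (time_defect m.+1)) @ \oo --> 0%E.
Proof.
pose D : set (measurableTypeR R * T) := [set` `[t0, tm]] `*` [set: T].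
have mD : measurable D by apply: measurableX => //; exact: mI.
(* Each coefficient contributes 8 L^2 to every coordinate, since (u - v)^2 <= 2u^2 + 2v^2 and each
   square is at most 2 L^2 [lyap]. *)
pose c : R := n%:R * (16 * L ^+ 2).
have il : (lam \x P)%E.-integrable D (fun z => (c * lyap (X z.1 z.2))%:E).
  have := integrableZl mD c (integrable_lyap_solution tt solX).
  by apply: eq_integrable => // z _; rewrite EFinM.
have jt m := jointly_measurable_time_defect sa sb tt solX (ltn0Sn m).
have [] := @dominated_convergence _ _ _ (lam \x P)%E D mD
  (fun m z => (time_defect m.+1 z.1 z.2)%:E) (cst 0%E) (fun z => (c * lyap (X z.1 z.2))%:E).
- by move=> m; apply/measurable_EFinP; exact: jt.
- exact: measurable_cst.
- apply: aeW => z [z1 _]; apply: cvg_EFin; first exact: nearW.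
  move: z1; rewrite /= in_itv /= => /andP[t0z ztm].
  have cf f i sf := @delay_cvg f i z.1 (X z.1 z.2) sf t0z ztm.
  rewrite [X in _ --> X](_ : _ = \sum_(i < n) ((0 : R) + 0)); last by rewrite big1// => i _; rewrite addr0.
  apply: (@cvg_seq_sum _ (index_enum 'I_n) _ (fun=> 0 + 0)) => i.
  by apply: cvgD; [exact: cf (sa i)|exact: cf (sb i)].
- exact: il.
- apply: aeW => z m [z1 _]; move: z1; rewrite /= in_itv /= => zI; have /andP[t0z ztm] := zI.
  rewrite lee_fin ger0_norm ?time_defect_ge0//.
  have eI : t0 <= gr m.+1 (kx m.+1 z.1) <= tm.
    rewrite grid_ge//=; have /andP[h _] := mesh_index_itv tt (ltn0Sn m) t0z.
    exact: le_trans h ztm.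
  have cb (f : R -> 'rV[R]_n -> 'rV[R]_n) i :
      (forall t x, t0 <= t <= tm -> `|f t x| <= L * (1 + `|x|)) ->
      (f z.1 (X z.1 z.2) 0 i - f (gr m.+1 (kx m.+1 z.1)) (X z.1 z.2) 0 i) ^+ 2 <=
      8 * L ^+ 2 * lyap (X z.1 z.2).
    move=> gf; have h1 := coef_sqr_le L1 i (X z.1 z.2) gf zI.
    have h2 := coef_sqr_le L1 i (X z.1 z.2) gf eI.
    move: h1 h2; move: (f _ _ _ _) (f _ _ _ _) (L ^+ 2) (lyap _) => u v l y.
    by have := sqr_ge0 (u + v); lra.
  apply: (@le_trans _ _ (\sum_(i < n) (16 * L ^+ 2 * lyap (X z.1 z.2)))).
    apply: ler_sum => i _; have h1 := cb a i groa; have h2 := cb b i grob.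
    apply: le_trans (lerD h1 h2) _; rewrite le_eqVlt; apply/orP; left; apply/eqP.
    by move: (lyap _) => y; ring.
  by rewrite sumr_const card_ord -[_ *+ n]mulr_natl /c mulrA.
move=> _ _; rewrite integral_cst// mul0e; apply.
Unshelve. all: by end_near. Qed.

Lemma milstein_converges (e : R) : 0 < e -> exists N : nat, forall m, (N <= m)%N -> (0 < m)%N ->
  H m <= 1 -> (\int[P]_w (\sum_i (X tm w 0 i - Q m m w 0 i) ^+ 2)%:E <= e%:E)%E.
Proof.
move=> e0; have [K [K0 hK]] := defect_gronwall.
have K1 : 0 < K + 1 by rewrite ltr_wpDl.
(* The factor 2 shares e between the time defect and the mesh; K + 1 keeps the quotient meaningful
   at K = 0. *)
pose d' := e / (2 * (K + 1)); have d0 : 0 < d' by rewrite divr_gt0// mulr_gt0.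
have [N1 _ h1] : \forall m \near \oo, (iint P `[t0, tm] (time_defect m.+1) <= d'%:E)%E.
  have := time_defect_cvg; move/fine_cvgP => [fin /cvgrPdist_le /(_ d' d0) h].
  near=> m; have f1 : iint P `[t0, tm] (time_defect m.+1) \is a fin_num by near: m.
  rewrite -(fineK f1) lee_fin; have : `|0 - fine (iint P `[t0, tm] (time_defect m.+1))| <= d' by near: m.
  by rewrite sub0r normrN; apply: le_trans; exact: ler_norm.
have [N2 _ h2] : \forall m \near \oo, (tm - t0) / d' <= m%:R by exact: nbhs_infty_ger.
exists (maxn N1.+1 N2) => m; rewrite geq_max => /andP[m1 m2] m0 H1.
have mm : m = m.-1.+1 by rewrite prednK.
have r1 : (iint P `[t0, tm] (time_defect m) <= d'%:E)%E.
  by rewrite mm; apply: h1 => /=; rewrite -ltnS -mm.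
have r2 : H m <= d'.
  by rewrite ler_pdivrMr ?ltr0n// mulrC -ler_pdivrMr//; exact: h2.
have := hK m d' m0 H1 (ltW d0) r1; under eq_integral do rewrite defect_last//.
move=> /le_trans; apply; rewrite lee_fin.
apply: (@le_trans _ _ (K * (d' + d'))); first by rewrite ler_wpM2l// lerD2l.
have -> : e = (K + 1) * (d' + d') by rewrite /d'; field; rewrite gt_eqF.
by rewrite ler_wpM2r ?addr_ge0 ?(ltW d0)// lerDl.
Unshelve. all: by end_near. Qed.

End MilsteinConvergence.

(** * Random signs *)

Section FairSigns.
Context {R : realType} {d : measure_display} {T : measurableType d}.
Variables (P : probability T R) (W : R -> T -> R) (n : nat) (x0 : T -> 'rV[R]_n).
Variable S : nat -> {RV P >-> R}.
Hypothesis rS : random_signs W x0 S.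
Hypothesis sN : noise_sigma W x0 `<=` measurable.
Local Notation E f := (Rintegral P setT f).
Local Notation N := (noise_sigma W x0).

(** A boolean sign for every outcome; it represents S j outside the null set where S j is neither 1
    nor -1. *)
Definition plus_sign (w : T) (j : nat) : bool := S j w == 1.
Definition sign_cylinder (s : seq nat) (e : nat -> bool) : set T :=
  \big[setI/setT]_(j <- s) [set w | plus_sign w j = e j].

Lemma plus_signE j e : [set w | plus_sign w j = e] = S j @^-1` (if e then [set 1] else ~` [set 1]).
Proof.
apply/seteqP; split=> w /=; rewrite /plus_sign; case: e => /=.
- by move/eqP.
- by move/eqP.
- by move->; rewrite eqxx.
- by move=> h; apply/eqP.
Qed.

Lemma sigma_plus_sign j e : sigma_rv (S j) [set w | plus_sign w j = e].
Proof.
rewrite plus_signE; exists (if e then [set 1] else ~` [set 1]); last by rewrite setTI.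
by case: e; [|apply: measurableC]; exact: measurable_set1.
Qed.

Lemma measurable_plus_sign j e : measurable [set w | plus_sign w j = e].
Proof.
rewrite plus_signE -[X in measurable X]setTI; apply: measurable_funP => //.
by case: e; [|apply: measurableC]; exact: measurable_set1.
Qed.

Lemma prob_plus_sign j e : P [set w | plus_sign w j = e] = (2^-1)%:E.
Proof.
have h : P [set w | plus_sign w j = true] = (2^-1)%:E.
  rewrite -(rS.1 j).1; congr (P _); apply/seteqP; split=> w /=; rewrite /plus_sign.
    by move/eqP.
  by move->; rewrite eqxx.
case: e => //.
have -> : [set w | plus_sign w j = false] = ~` [set w | plus_sign w j = true].
  by apply/seteqP; split=> w /=; case: (plus_sign w j).
rewrite probability_setC; last exact: measurable_plus_sign.
by rewrite [X in (_ - X)%E]h -EFinB; congr EFin; field.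
Qed.

Lemma measurable_sign_cylinder s e : measurable (sign_cylinder s e).
Proof. by apply: bigsetI_measurable => j _; exact: measurable_plus_sign. Qed.

Lemma prob_sign_cylinder s e B : uniq s -> N B ->
  P (B `&` sign_cylinder s e) = (fine (P B) * 2^-1 ^+ size s)%:E.
Proof.
move=> us NB.
(* The noise has index [None], so B and the sign events belong to one independent family. *)
have := rS.2 (None :: map Some s)
  (fun o => if o is Some j then [set w | plus_sign w j = e j] else B).
rewrite !big_cons !big_map => -> //.
- congr EFin; congr (_ * _).
  rewrite (eq_bigr (fun=> 2^-1)) => [|j _]; last by rewrite prob_plus_sign.
  by rewrite big_const_seq count_predT iter_mulr_1.
- rewrite /= map_inj_uniq ?us ?andbT => [|x y []//].
  by apply/mapP => -[].
- by move=> [j|] _; [exact (sigma_plus_sign j (e j))|].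
Qed.

Let sigN : sigma_algebra setT N. Proof. exact: smallest_sigma_algebra. Qed.

(** Preimages under an indicator are empty, everything, the cylinder or its complement, which leaves
    four cases. *)
Lemma indep_sign_cylinder s e : uniq s ->
  independent P N (sigma_rv (\1_(sign_cylinder s e) : T -> R)).
Proof.
move=> us B _ NB [D mD <-]; rewrite setTI; set C := sign_cylinder s e.
have mC : measurable C := measurable_sign_cylinder s e.
have mB : measurable B := sN NB.
have NT : N setT by case: sigN => h0 hD _; have := hD _ h0; rewrite setD0.
have PC : P C = (2^-1 ^+ size s)%:E.
  by rewrite -[C in LHS]setTI prob_sign_cylinder// [X in fine X]probability_setT/= mul1r.
have PBf : P B \is a fin_num by exact: fin_num_measure.
have PBC : P (B `&` C) = (P B * P C)%E.
  by rewrite prob_sign_cylinder// PC EFinM fineK.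
have PBC' : P (B `&` ~` C) = (P B * P (~` C))%E.
  rewrite probability_setC// muleBr// mule1.
  rewrite -PBC -setDE measureD//.
  by rewrite ltey_eq fin_num_measure.
rewrite preimage_indic; case: ifPn => _; case: ifPn => _ //.
- by rewrite setIT [X in (_ * X)%E]probability_setT mule1.
- by rewrite setI0 measure0 mule0.
Qed.

Lemma all_moments_sign_cylinder s e : all_moments P (\1_(sign_cylinder s e) : T -> R).
Proof.
apply: (all_moments_dom (all_moments_cst P 1)) => [|w].
  by apply: measurable_indic; exact: measurable_sign_cylinder.
by rewrite indicE; case: (_ \in _); rewrite ?normr0 ?normr1.
Qed.

Lemma mean_sign_cylinder s e : uniq s -> E (\1_(sign_cylinder s e) : T -> R) = 2^-1 ^+ size s.
Proof.
move=> us; have NT : N setT by case: sigN => h0 hD _; have := hD _ h0; rewrite setD0.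
rewrite /Rintegral integral_indic//; last exact: measurable_sign_cylinder.
have := congr1 fine (prob_sign_cylinder e us NT); rewrite [fine (P setT)](_ : _ = 1).
  by rewrite mul1r /= => <-; rewrite setIC.
by rewrite [X in fine X]probability_setT.
Qed.

(* Conditioning on the signs one at a time: the signs in [s] are prescribed by [e]. *)
Lemma mean_plus_sign_cylinder (k : nat) (f : (nat -> bool) -> T -> R) s e :
  (forall sg sg', (forall j, (j < k)%N -> sg j = sg' j) -> f sg = f sg') ->
  (forall sg, rv_measurable N (f sg) /\ all_moments P (f sg)) ->
  uniq s -> (forall j, j \in s -> (k <= j)%N) ->
  all_moments P (fun w => f (plus_sign w) w * \1_(sign_cylinder s e) w) /\
  E (fun w => f (plus_sign w) w * \1_(sign_cylinder s e) w) =
    2^-1 ^+ size s * sign_mean k (fun sg => E (f sg)).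
Proof.
elim: k f s e => [|k IH] f s e fk fN us sk.
  have [mf hf] := fN (fun=> true).
  have fE w : f (plus_sign w) w = f (fun=> true) w by rewrite (fk _ (fun=> true)).
  under eq_fun do rewrite fE; split; first exact: all_momentsM hf (all_moments_sign_cylinder s e).
  by rewrite (mean_indep (@indep_sign_cylinder s e us) mf (fun _ h => h) hf (all_moments_sign_cylinder s e)) mean_sign_cylinder// mulrC.
have ks : k \notin s by apply/negP => /sk; rewrite ltnn.
pose fe u sg := f (set_sign sg k u).
have cylE u : sign_cylinder (k :: s) (set_sign e k u) =
    [set w | plus_sign w k = u] `&` sign_cylinder s e.
  rewrite /sign_cylinder big_cons /set_sign eqxx; congr (_ `&` _).
  apply: eq_big_seq => j js; case: eqP => // jk; by rewrite -jk js in ks.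
(* The value of sign k is fixed in each of the two terms, and the cylinder is refined
   accordingly. *)
have split_sign w : f (plus_sign w) w * \1_(sign_cylinder s e) w =
    fe true (plus_sign w) w * \1_(sign_cylinder (k :: s) (set_sign e k true)) w +
    fe false (plus_sign w) w * \1_(sign_cylinder (k :: s) (set_sign e k false)) w.
  have hf : f (plus_sign w) w = fe (plus_sign w k) (plus_sign w) w.
    rewrite /fe; congr (_ w); apply: fk => j jk; rewrite /set_sign.
    by case: eqP => // ->.
  have hi u : (w \in [set w | plus_sign w k = u]) = (plus_sign w k == u).
    by apply/idP/eqP; rewrite inE.
  by rewrite hf !cylE !indicE !in_setI !hi; case: (plus_sign w k) => /=;
    rewrite ?mulr0 ?addr0 ?add0r.
have fek u sg sg' : (forall j, (j < k)%N -> sg j = sg' j) -> fe u sg = fe u sg'.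
  move=> h; apply: fk => j jk; rewrite /set_sign; case: (eqVneq j k) => // nk.
  by apply: h; rewrite ltn_neqAle nk -ltnS.
have feN u sg : rv_measurable N (fe u sg) /\ all_moments P (fe u sg) by exact: fN.
have us' : uniq (k :: s) by rewrite /= ks.
have sk' j : j \in k :: s -> (k <= j)%N by rewrite inE => /orP[/eqP->//|/sk/ltnW].
have [mt Et] := IH (fe true) (k :: s) (set_sign e k true) (fek true) (feN true) us' sk'.
have [mf Ef] := IH (fe false) (k :: s) (set_sign e k false) (fek false) (feN false) us' sk'.
under eq_fun do rewrite split_sign; split; first exact: all_momentsD mt mf.
by rewrite (meanD mt mf) Et Ef -mulrDr /= exprSr -mulrA.
Qed.

Lemma mean_plus_sign (k : nat) (f : (nat -> bool) -> T -> R) :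
  (forall sg sg', (forall j, (j < k)%N -> sg j = sg' j) -> f sg = f sg') ->
  (forall sg, rv_measurable N (f sg) /\ all_moments P (f sg)) ->
  all_moments P (fun w => f (plus_sign w) w) /\
  E (fun w => f (plus_sign w) w) = sign_mean k (fun sg => E (f sg)).
Proof.
move=> fk fN; have := @mean_plus_sign_cylinder k f [::] (fun=> true) fk fN isT.
rewrite /sign_cylinder big_nil expr0 mul1r; under eq_fun do rewrite indicT mulr1.
by exact.
Qed.

End FairSigns.

(** * Measurability with respect to the noise *)

Section NoiseMeasurability.
Context {R : realType} {d : measure_display} {T : measurableType d}.
Variables (P : probability T R) (F : R -> set (set T)) (W : R -> T -> R).
Hypothesis fF : filtration F.
Hypothesis wW : wiener P F W.
Context {n : nat}.
Variables (a b : R -> 'rV[R]_n -> 'rV[R]_n) (t0 tm L : R).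
Hypothesis t00 : 0 <= t0.
Hypothesis sa : forall i, smooth 3 t0 tm (fun z => a z.1 z.2 0 i).
Hypothesis sb : forall i, smooth 3 t0 tm (fun z => b z.1 z.2 0 i).

Hypothesis tt : t0 < tm.
Variable X : R -> T -> 'rV[R]_n.
Hypothesis hx0 : adapted_vec P F t0 (X t0).

Local Notation H m := ((tm - t0) / m%:R).
Local Notation rho m := (Num.sqrt (H m)).
Local Notation gr m k := (grid t0 (H m) k).
Local Notation Q m k := (fun w => milstein_scheme a b t0 (H m) (W^~ w) (X t0 w) k).
Local Notation X1 m sg k := (fun w => rk_scheme a b t0 (H m) (W^~ w) (fun j => sign_of (sg j)) (X t0 w) k).
Local Notation N := (noise_sigma W (X t0)).
Local Notation NF := (fun _ : R => noise_sigma W (X t0)).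
Local Notation noise_vec := (adapted_vec P NF).

Lemma noise_sigma_sub : N `<=` measurable.
Proof.
apply: smallest_sub; first exact: sigma_algebra_measurable.
move=> B [[i _] hB|[t /= t0' hB]].
  by case: (hx0 i) => h _; apply: (filtration_sub fF t00); exact: h.
by apply: (filtration_sub fF t0'); exact: (wiener_adapted wW t0').
Qed.

(** The filtration is constant in time. With it the adaptedness lemmas show that the schemes with
    prescribed signs are functions of the noise alone, hence independent of the random signs. *)
Lemma noise_filtration : filtration NF.
Proof.
by split=> [t _|t _|s t _ _] //; [exact: smallest_sigma_algebra|exact: noise_sigma_sub].
Qed.

Lemma noise_measurable_wiener t : 0 <= t -> rv_measurable N (W t).
Proof. by move=> t0' B hB; apply: sub_sigma_algebra; right; exists t. Qed.

Lemma noise_vec_start t : noise_vec t (X t0).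
Proof.
move=> i; split; last by case: (hx0 i).
by move=> B hB; apply: sub_sigma_algebra; left; exists i.
Qed.

Section NoiseMeasurable.
Variable m : nat.
Hypotheses (m0 : (0 < m)%N) (H1 : H m <= 1).

Lemma noise_increment k : (k < m)%N ->
  adapted_mom P NF (gr m k.+1) (fun w => W (gr m k + rho m ^+ 2) w - W (gr m k) w).
Proof.
move=> km; have ok := step_ok_grid tt m0 H1 km.
split; last by case: (adapted_step_increment fF wW t00 ok).
exact (rv_measurableB (filtration_sigma noise_filtration t00)
  (noise_measurable_wiener (step_end_ge0 t00 ok)) (noise_measurable_wiener (step_ge0 t00 ok))).
Qed.

Lemma noise_milstein_scheme k : (k <= m)%N -> noise_vec (gr m k) (Q m k).
Proof.
elim: k => [_|k IH km]; first exact: noise_vec_start.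
have ok := step_ok_grid tt m0 H1 km.
have -> : Q m k.+1 = (fun w => milstein_step a b (rho m ^+ 2) (gr m k)
  (W (gr m k + rho m ^+ 2) w - W (gr m k) w) (Q m k w)).
  by apply/funext => w; exact: milstein_schemeS.
exact (adapted_vec_milstein noise_filtration sa sb (rho m ^+ 2) (le_trans t00 (grid_ge tt m0 k.+1))
  (step_I ok) (noise_increment km) (IH (ltnW km))).
Qed.

Lemma noise_rk_scheme sg k : (k <= m)%N -> noise_vec (gr m k) (X1 m sg k).
Proof.
elim: k => [_|k IH km]; first exact: noise_vec_start.
have ok := step_ok_grid tt m0 H1 km.
have -> : X1 m sg k.+1 = (fun w => rk_step a b (rho m ^+ 2) (gr m k) (gr m k + rho m ^+ 2)
  (W (gr m k + rho m ^+ 2) w - W (gr m k) w) (sign_of (sg k)) (X1 m sg k w)).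
  by apply/funext => w; exact: rk_schemeS.
exact (adapted_vec_rk noise_filtration sa sb (rho m ^+ 2) (sign_of (sg k))
  (le_trans t00 (grid_ge tt m0 k.+1)) (step_I ok) (step_I' ok)
  (noise_increment km) (IH (ltnW km))).
Qed.

End NoiseMeasurable.

Local Notation meas_vec x := (forall i, measurable_fun setT (fun w => (x w : 'rV[R]_n) 0 i)).

Lemma measurable_vecD (x y : T -> 'rV[R]_n) : meas_vec x -> meas_vec y ->
  meas_vec (fun w => x w + y w).
Proof. by move=> hx hy i; under eq_fun do rewrite mxE; exact: measurable_funD. Qed.

Lemma measurable_vecZ (c : T -> R) (x : T -> 'rV[R]_n) : measurable_fun setT c -> meas_vec x ->
  meas_vec (fun w => c w *: x w).
Proof. by move=> hc hx i; under eq_fun do rewrite mxE; exact: measurable_funM. Qed.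

Lemma measurable_rk_scheme (h : R) (S : nat -> T -> R) k : 0 <= h ->
  (forall j, measurable_fun setT (S j)) ->
  meas_vec (fun w => rk_scheme a b t0 h (W^~ w) (S^~ w) (X t0 w) k).
Proof.
move=> h0 mS; elim: k => [i|k IH].
  by case: (hx0 i) => _ [].
have g0 l : 0 <= grid t0 h l by rewrite addr_ge0// mulr_ge0.
have mW l : measurable_fun setT (W (grid t0 h l)).
  exact: rv_measurable_fun (filtration_sub fF (g0 l)) (wiener_adapted wW (g0 l)).
have ma s (x : T -> 'rV[R]_n) : meas_vec x -> meas_vec (fun w => a s (x w)).
  by move=> hx i; exact (measurable_fun_vector (smooth_continuous (sa i)) (measurable_cst s) hx).
have mb s (x : T -> 'rV[R]_n) : meas_vec x -> meas_vec (fun w => b s (x w)).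
  by move=> hx i; exact (measurable_fun_vector (smooth_continuous (sb i)) (measurable_cst s) hx).
have mdW : measurable_fun setT (fun w => W (grid t0 h k.+1) w - W (grid t0 h k) w).
  exact (measurable_funB (mW k.+1) (mW k)).
have mSr : measurable_fun setT (fun w => S k w * Num.sqrt h).
  exact (measurable_funM (mS k) (measurable_cst (Num.sqrt h))).
have mc (c : R) (x : T -> 'rV[R]_n) : meas_vec x -> meas_vec (fun w => c *: x w).
  exact (measurable_vecZ (measurable_cst c)).
set x := (fun w => rk_scheme a b t0 h (W^~ w) (S^~ w) (X t0 w) k) in IH.
pose K1 w := h *: a (grid t0 h k) (x w) +
  (W (grid t0 h k.+1) w - W (grid t0 h k) w - S k w * Num.sqrt h) *: b (grid t0 h k) (x w).
have mK1 : meas_vec K1.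
  exact (measurable_vecD (mc h _ (ma _ _ IH)) (measurable_vecZ (measurable_funB mdW mSr) (mb _ _ IH))).
have mxK : meas_vec (fun w => x w + K1 w) by exact (measurable_vecD IH mK1).
exact (measurable_vecD IH (mc 2^-1 _ (measurable_vecD mK1 (measurable_vecD (mc h _ (ma _ _ mxK))
  (measurable_vecZ (measurable_funD mdW mSr) (mb _ _ mxK)))))).
Qed.

End NoiseMeasurability.

Section RandomSigns.
Context {R : realType} {d : measure_display} {T : measurableType d}.
Variables (P : probability T R) (F : R -> set (set T)) (W : R -> T -> R).
Hypothesis fF : filtration F.
Hypothesis wW : wiener P F W.
Local Notation E f := (Rintegral P setT f).
Context {n : nat}.
Variables (a b : R -> 'rV[R]_n -> 'rV[R]_n) (t0 tm L : R).
Hypothesis t00 : 0 <= t0.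
Hypothesis sa : forall i, smooth 3 t0 tm (fun z => a z.1 z.2 0 i).
Hypothesis sb : forall i, smooth 3 t0 tm (fun z => b z.1 z.2 0 i).
Hypothesis L1 : 1 <= L.
Hypothesis lipa : forall t x y, t0 <= t <= tm -> `|a t x - a t y| <= L * `|x - y|.
Hypothesis lipb : forall t x y, t0 <= t <= tm -> `|b t x - b t y| <= L * `|x - y|.
Hypothesis groa : forall t x, t0 <= t <= tm -> `|a t x| <= L * (1 + `|x|).
Hypothesis grob : forall t x, t0 <= t <= tm -> `|b t x| <= L * (1 + `|x|).

Local Notation adapted_vec := (adapted_vec P F).
Hypothesis tt : t0 < tm.
Variable X : R -> T -> 'rV[R]_n.
Hypothesis hx0 : adapted_vec t0 (X t0).

Local Notation H m := ((tm - t0) / m%:R).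
Local Notation gr m k := (grid t0 (H m) k).
Local Notation Q m k := (fun w => milstein_scheme a b t0 (H m) (W^~ w) (X t0 w) k).
Local Notation N := (noise_sigma W (X t0)).

(** The events S j = 1 and S j = -1 are disjoint, each of probability 1/2, so nothing else has
    positive probability. *)
Lemma random_sign_ae (S : nat -> {RV P >-> R}) : random_signs W (X t0) S ->
  {ae P, forall w, forall j, S j w = sign_of (plus_sign S w j)}.
Proof.
move=> rS; apply: ae_foralln => j; have [P1 P2] := rS.1 j.
have m1 c : measurable [set w | S j w = c].
  by rewrite -[X in measurable X]setTI; exact: (measurable_funP (S j) measurableT [set c] (measurable_set1 c)).
exists (~` ([set w | S j w = 1] `|` [set w | S j w = -1])); split.
- by apply: measurableC; exact: measurableU.
- have mU : measurable ([set w | S j w = 1] `|` [set w | S j w = -1]) by exact: measurableU.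
  have dis : [set w | S j w = 1] `&` [set w | S j w = -1] = set0.
    by apply/seteqP; split=> // w [/= -> /eqP]; rewrite (gt_eqF (lt_trans (ltrN10 R) ltr01)).
  have PU : P ([set w | S j w = 1] `|` [set w | S j w = -1]) = 1%:E.
    apply: (etrans (measureU P (m1 1) (m1 (-1)) dis)).
    by apply: (etrans (congr2 (fun u v => (u + v)%E) P1 P2)); rewrite -EFinD; congr EFin; field.
  apply: (etrans (probability_setC P mU)); apply: (etrans (congr1 (fun u => (1%:E - u)%E) PU)).
  by rewrite -EFinB subrr.
- move=> w /= h [h1|h1]; apply: h; rewrite /plus_sign h1.
    by rewrite eqxx.
  by rewrite (lt_eqF (lt_trans (ltrN10 R) ltr01)).
Qed.

(** For each prescribed sign sequence the error is noise measurable, so [mean_plus_sign] turns its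
    mean under the random signs into the finite average bounded by [rk_milstein_error]. *)
Lemma rk_random_sign_error : exists K : R, 0 <= K /\ forall m (S : nat -> {RV P >-> R}),
  (0 < m)%N -> random_signs W (X t0) S -> H m <= 1 -> forall i,
  (\int[P]_w ((rk_scheme a b t0 (H m) (W^~ w) (S^~ w) (X t0 w) m 0 i - Q m m w 0 i) ^+ 2)%:E
    <= (K * H m ^+ 2)%:E)%E.
Proof.
have [K [K0 hK]] := rk_milstein_error fF wW t00 sa sb L1 lipa lipb groa grob tt hx0.
exists K; split=> // m S m0 rS H1 i.
pose X1 sg w := rk_scheme a b t0 (H m) (W^~ w) (fun j => sign_of (sg j)) (X t0 w) m.
pose f sg w := (X1 sg w 0 i - Q m m w 0 i) ^+ 2.
have NF := noise_filtration fF wW t00 hx0.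
have gm0 : 0 <= gr m m by exact: le_trans t00 (grid_ge tt m0 m).
have fN sg : rv_measurable N (f sg) /\ all_moments P (f sg).
  have h1 := noise_rk_scheme fF wW t00 sa sb tt hx0 m0 H1 sg (leqnn m) i.
  have h2 := noise_milstein_scheme fF wW t00 sa sb tt hx0 m0 H1 (leqnn m) i.
  exact (adapted_momX NF gm0 2 (adapted_momB NF gm0 h1 h2)).
have fk sg sg' : (forall j, (j < m)%N -> sg j = sg' j) -> f sg = f sg'.
  move=> h; apply/funext => w.
  exact (congr1 (fun y : T -> 'rV[R]_n => (y w 0 i - Q m m w 0 i) ^+ 2) (@rk_scheme_eq _ _ _ W _ a b t0 tm (X t0) m sg sg' m h)).
have [mf Ef] := mean_plus_sign rS (noise_sigma_sub fF wW t00 hx0) fk fN.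
have mS : forall j, measurable_fun setT (S j) by move=> j; exact: measurable_funP.
have mX := measurable_rk_scheme fF wW t00 sa sb hx0 m (ltW (mesh_gt0 tt m0)) mS i.
have mQ : measurable_fun setT (fun w => Q m m w 0 i).
  by have [_ []] := noise_milstein_scheme fF wW t00 sa sb tt hx0 m0 H1 (leqnn m) i.
have mM : measurable_fun setT (fun w => ((rk_scheme a b t0 (H m) (W^~ w) (S^~ w) (X t0 w) m 0 i - Q m m w 0 i) ^+ 2)%:E).
  exact/measurable_EFinP/measurable_funX/measurable_funB.
have mf' : measurable_fun setT (fun w => (f (plus_sign S w) w)%:E).
  by apply/measurable_EFinP; exact: mf.1.
rewrite (_ : integral _ _ _ = (\int[P]_w (f (plus_sign S w) w)%:E)%E); last first.
  apply: ge0_ae_eq_integral => // [w _|w _|]; try by rewrite lee_fin sqr_ge0.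
  apply: filterS (random_sign_ae rS) => w hw _.
  have -> : S^~ w = (fun j => sign_of (plus_sign S w j)) by apply/funext => j; exact: hw.
  by [].
rewrite (meanE mf) Ef lee_fin; apply: le_trans (hK m m0 H1).
apply: sign_mean_le => sg; rewrite (bigD1 i)//=.
rewrite -[leLHS]addr0; apply: lerD => //; apply: sumr_ge0 => j _.
by apply: mean_ge0 => w; exact: sqr_ge0.
Qed.

End RandomSigns.

Lemma mean_square_split {R : realType} {d : measure_display} {T : measurableType d}
  (P : probability T R) (Y U V Z : T -> R) (u v z : R) :
  measurable_fun setT Y -> measurable_fun setT U -> measurable_fun setT V -> measurable_fun setT Z ->
  (forall w, Y w = U w + V w + Z w) ->
  (\int[P]_w (U w ^+ 2)%:E <= u%:E)%E -> (\int[P]_w (V w ^+ 2)%:E <= v%:E)%E ->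
  (\int[P]_w (Z w ^+ 2)%:E <= z%:E)%E ->
  (\int[P]_w (Y w ^+ 2)%:E <= (3 * u + (3 * v + 3 * z))%:E)%E.
Proof.
move=> mY mU mV mZ YE hu hv hz.
have alg (p q r : R) : (p + q + r) ^+ 2 <= 3 * p ^+ 2 + (3 * q ^+ 2 + 3 * r ^+ 2).
  by have := sqr_ge0 (p - q); have := sqr_ge0 (p - r); have := sqr_ge0 (q - r); nra.
have h3 : 0 <= 3 :> R by [].
have sq (f : T -> R) : measurable_fun setT f ->
    measurable_fun setT (fun w => f w ^+ 2) /\ forall w, setT w -> 0 <= f w ^+ 2.
  by move=> mf; split=> [|w _]; [exact: measurable_funX|exact: sqr_ge0].
have [mU2 U2] := sq _ mU; have [mV2 V2] := sq _ mV; have [mZ2 Z2] := sq _ mZ.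
have [mY2 Y2] := sq _ mY.
have := @ge0_integral_le_comb _ _ _ P setT
  [:: (3, fun w => U w ^+ 2); (3, fun w => V w ^+ 2); (3, fun w => Z w ^+ 2)]
  (fun w => Y w ^+ 2) measurableT mY2.
move=> /= /(_ _ _)/le_trans-> //.
- by move=> w _; rewrite sqr_ge0 YE addr0 alg.
- rewrite adde0 (_ : (3 * u + (3 * v + 3 * z))%:E = 3%:E * u%:E + (3%:E * v%:E + 3%:E * z%:E))%E.
    by apply: leeD; [|apply: leeD]; apply: lee_wpmul2l; rewrite // lee_fin.
  by rewrite -!EFinM -!EFinD.
Qed.

(** * Assembly of the mean-square bound *)

Section StrongError.
Context {R : realType} {d : measure_display} {T : measurableType d}.
Variables (P : probability T R) (F : R -> set (set T)) (W : R -> T -> R).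
Hypothesis fF : filtration F.
Hypothesis wW : wiener P F W.
Local Notation E f := (Rintegral P setT f).
Context {n : nat}.
Variables (a b : R -> 'rV[R]_n -> 'rV[R]_n) (t0 tm L : R).
Hypothesis t00 : 0 <= t0.
Hypothesis sa : forall i, smooth 3 t0 tm (fun z => a z.1 z.2 0 i).
Hypothesis sb : forall i, smooth 3 t0 tm (fun z => b z.1 z.2 0 i).
Hypothesis L1 : 1 <= L.
Hypothesis lipa : forall t x y, t0 <= t <= tm -> `|a t x - a t y| <= L * `|x - y|.
Hypothesis lipb : forall t x y, t0 <= t <= tm -> `|b t x - b t y| <= L * `|x - y|.
Hypothesis groa : forall t x, t0 <= t <= tm -> `|a t x| <= L * (1 + `|x|).
Hypothesis grob : forall t x, t0 <= t <= tm -> `|b t x| <= L * (1 + `|x|).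

Local Notation adapted_vec := (adapted_vec P F).
Hypothesis tt : t0 < tm.
Variable X : R -> T -> 'rV[R]_n.
Hypothesis solX : ito_solution P F W a b t0 tm X.
Hypothesis hx0 : adapted_vec t0 (X t0).

Local Notation H m := ((tm - t0) / m%:R).
Local Notation Q m k := (fun w => milstein_scheme a b t0 (H m) (W^~ w) (X t0 w) k).

Lemma rk_strong_error : exists B : R, 0 <= B /\ forall m (S : nat -> {RV P >-> R}),
  (0 < m)%N -> random_signs W (X t0) S -> H m <= 1 -> forall i,
  let err := fun w => global_error a b t0 tm W S X m w 0 i in
  measurable_fun setT err /\ (\int[P]_w (err w ^+ 2)%:E <= (B * H m ^+ 2)%:E)%E.
Proof.
have alg (p q r s : R) : p - s = (p - q) + (q - r) + (r - s) by ring.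
have [K [K0 hK]] := rk_random_sign_error fF wW t00 sa sb L1 lipa lipb groa grob tt hx0.
have [K' [K0' hK']] := milstein_dyadic_error fF wW t00 sa sb L1 lipa lipb groa grob tt hx0.
exists (3 * K + (3 * K' + 3)); split=> [|m S m0 rS H1 i err].
  by rewrite !addr_ge0// mulr_ge0.
have Hm0 := mesh_gt0 tt m0.
(* The required accuracy is h^2 itself. The number of halvings depends on m, but the dyadic constant
   K' does not depend on that number. *)
have [M hM] := milstein_converges fF wW t00 sa sb L1 lipa lipb groa grob tt solX hx0 (exprn_gt0 2 Hm0).
pose p := (m * 2 ^ M)%N.
have Mp : (M <= p)%N by rewrite (leq_trans (ltnW (ltn_expl M (ltnSn 1))))// leq_pmull.
have p0 : (0 < p)%N by rewrite muln_gt0 m0 expn_gt0.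
have Hp : H p <= 1.
  apply: le_trans H1; rewrite ler_wpM2l ?subr_ge0 ?(ltW tt)//.
  by rewrite lef_pV2 ?posrE ?ltr0n// ler_nat leq_pmulr// expn_gt0.
have mS : forall j, measurable_fun setT (S j) by move=> j; exact: measurable_funP.
have mX := measurable_rk_scheme fF wW t00 sa sb hx0 m (ltW Hm0) mS i.
have am q (q0 : (0 < q)%N) (Hq : H q <= 1) : all_moments P (fun w => Q q q w 0 i).
  by have [] := noise_milstein_scheme fF wW t00 sa sb tt hx0 q0 Hq (leqnn q) i.
have mQ q (q0 : (0 < q)%N) (Hq : H q <= 1) : measurable_fun setT (fun w => Q q q w 0 i).
  by have [] := am q q0 Hq.
have tmI : t0 <= tm <= tm by rewrite lexx ltW.
have mE := measurable_solution fF t00 solX i tmI.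
pose Y1 w : R := rk_scheme a b t0 (H m) (W^~ w) (S^~ w) (X t0 w) m 0 i.
have errE w : err w = (Y1 w - Q m m w 0 i) + (Q m m w 0 i - Q p p w 0 i) + (Q p p w 0 i - X tm w 0 i).
  have -> : err w = Y1 w - X tm w 0 i by rewrite /err /global_error mxE [X in _ + X]mxE.
  exact: alg.
have m1 := measurable_funB mX (mQ m m0 H1).
have m2 := measurable_funB (mQ m m0 H1) (mQ p p0 Hp).
have m3 := measurable_funB (mQ p p0 Hp) mE.
have merr : measurable_fun setT err.
  by apply: eq_measurable_fun (measurable_funD (measurable_funD m1 m2) m3) => w _; exact/esym/errE.
split=> //.
have i1 := hK m S m0 rS H1 i.
have i2 : (\int[P]_w ((Q m m w 0 i - Q p p w 0 i) ^+ 2)%:E <= (K' * H m ^+ 2)%:E)%E.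
  have am2 := all_momentsX 2 (all_momentsB (am p p0 Hp) (am m m0 H1)).
  under eq_integral do rewrite -sqrrN opprB.
  rewrite (meanE am2) lee_fin; apply: le_trans (hK' M m m0 H1).
  rewrite (bigD1 i)//= -[leLHS]addr0; apply: lerD; first exact: lexx.
  by apply: sumr_ge0 => j _; apply: mean_ge0 => w; exact: sqr_ge0.
have i3 : (\int[P]_w ((Q p p w 0 i - X tm w 0 i) ^+ 2)%:E <= (H m ^+ 2)%:E)%E.
  apply: le_trans (hM p Mp p0 Hp); apply: ge0_le_integral => //.
  - by move=> w _; rewrite lee_fin sqr_ge0.
  - exact/measurable_EFinP/measurable_funX.
  - apply/measurable_EFinP; apply: measurable_sum => j; apply/measurable_funX/measurable_funB.
      exact (measurable_solution fF t00 solX j tmI).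
    by have [_ []] := noise_milstein_scheme fF wW t00 sa sb tt hx0 p0 Hp (leqnn p) j.
  - move=> w _; rewrite lee_fin (bigD1 i)//= -[leLHS]addr0; apply: lerD.
      by rewrite -sqrrN opprB.
    by apply: sumr_ge0 => j _; exact: sqr_ge0.
have := mean_square_split merr m1 m2 m3 errE i1 i2 i3.
by congr (_ <= EFin _)%E; ring.
Qed.

End StrongError.

(** The second moment is the variance plus the squared mean; both summands are nonnegative, so each
    is at most e. *)
Lemma square_integral_bounds {R : realType} {d : measure_display} {T : measurableType d}
  (P : probability T R) (Y : T -> R) (e : R) : measurable_fun setT Y ->
  (\int[P]_w (Y w ^+ 2)%:E <= e%:E)%E ->
  [/\ Y \in Lfun P 2%:E, (`|'E_P[Y]| <= (Num.sqrt e)%:E)%E & ('V_P[Y] <= e%:E)%E].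
Proof.
move=> mY Ye.
have LY : Y \in Lfun P 2%:E.
  apply/andP; split; rewrite inE//= /finite_norm unlock /=.
  apply: poweR_lty; apply: le_lt_trans (ltry e); apply: le_trans Ye.
  rewrite le_eqVlt; apply/orP; left; apply/eqP; apply: eq_integral => w _.
  by rewrite powR_mulrn// real_normK ?num_real.
have LY1 : Y \in Lfun P 1 by apply: Lfun_subset12 LY; rewrite ?fin_num_measure.
have fE := expectation_fin_num LY1.
have E2 : ('E_P[Y ^+ 2] <= e%:E)%E by rewrite unlock.
have V := varianceE LY.
have V1 : ('V_P[Y] <= e%:E)%E.
  rewrite V; apply: le_trans E2; rewrite leeBlDr; last by rewrite fin_numX.
  by rewrite leeDl// -(fineK fE) -EFin_expe lee_fin sqr_ge0.
split=> //.
have := variance_ge0 P Y; rewrite V sube_ge0; last first.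
  by apply/orP; left; rewrite fin_numX.
move=> /le_trans /(_ E2); rewrite -(fineK fE) -EFin_expe lee_fin => h.
by rewrite /= lee_fin -sqrtr_sqr ler_wsqrtr.
Qed.

Lemma adapted_vec_initial {R : realType} {d : measure_display} {T : measurableType d} {n : nat}
  (P : probability T R) (F : R -> set (set T)) (t : R) (x : T -> 'rV[R]_n) :
  F t `<=` measurable -> (forall i, rv_measurable (F t) (fun w => x w 0 i)) ->
  (forall p : nat, ('E_P[fun w => (`|x w| ^+ p)%R] < +oo)%E) -> adapted_vec P F t x.
Proof.
move=> Fm hx hp i; split=> //; have mx j := rv_measurable_fun Fm (hx j); split=> [|q]; first exact: mx.
have := hp q.*2; rewrite unlock; apply: le_lt_trans.
have cn : continuous (fun z : R * 'rV[R]_n => `|z.2|).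
  by move=> z; apply: (@continuous_comp _ _ _ snd (fun y : 'rV[R]_n => `|y|));
    [exact: cvg_snd|exact: norm_continuous].
have mn := measurable_fun_vector cn (measurable_cst (0 : R)) mx.
apply: ge0_le_integral => //.
- by move=> w _; rewrite lee_fin even_expr_ge0.
- exact/measurable_EFinP/measurable_funX.
- exact/measurable_EFinP/measurable_funX.
- move=> w _; rewrite lee_fin -(ger0_norm (even_expr_ge0 q (x w 0 i))) normrX.
  by apply: lerXn2r; rewrite ?nnegrE// coord_norm_le.
Qed.

Lemma linear_growth_pair {R : realType} {n : nat} (a b : R -> 'rV[R]_n -> 'rV[R]_n) (t0 tm : R) N :
  sufficiently_smooth N t0 tm a -> sufficiently_smooth N t0 tm b ->
  exists L : R, [/\ 1 <= L,
    forall t x y, t0 <= t <= tm -> `|a t x - a t y| <= L * `|x - y|,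
    forall t x y, t0 <= t <= tm -> `|b t x - b t y| <= L * `|x - y|,
    forall t x, t0 <= t <= tm -> `|a t x| <= L * (1 + `|x|) &
    forall t x, t0 <= t <= tm -> `|b t x| <= L * (1 + `|x|)].
Proof.
move=> [la sa] [lb sb].
have [La [La1 ha]] := linear_growth la (fun i => smooth_poly_growth (sa i)).
have [Lb [Lb1 hb]] := linear_growth lb (fun i => smooth_poly_growth (sb i)).
have lea : La <= Num.max La Lb by rewrite le_max lexx.
have leb : Lb <= Num.max La Lb by rewrite le_max lexx orbT.
exists (Num.max La Lb); split=> [|t x y tI|t x y tI|t x tI|t x tI].
- exact: le_trans La1 lea.
- by apply: le_trans ((ha t tI).1 x y) _; rewrite ler_wpM2r.
- by apply: le_trans ((hb t tI).1 x y) _; rewrite ler_wpM2r.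
- by apply: le_trans ((ha t tI).2 x) _; rewrite ler_wpM2r// addr_ge0.
- by apply: le_trans ((hb t tI).2 x) _; rewrite ler_wpM2r// addr_ge0.
Qed.

Theorem theorem3 (R : realType) :
  exists N : nat,
  forall (n : nat) (d : measure_display) (T : measurableType d)
    (P : probability T R) (F : R -> set (set T)) (W : R -> T -> R)
    (a b : R -> 'rV[R]_n -> 'rV[R]_n) (t0 tm : R) (X : R -> T -> 'rV[R]_n),
  0 <= t0 -> t0 < tm ->
  sufficiently_smooth N t0 tm a ->
  sufficiently_smooth N t0 tm b ->
  filtration F ->
  wiener P F W ->
  ito_solution P F W a b t0 tm X ->
  (forall p : nat, ('E_P[fun w => (`|X t0 w| ^+ p)%R] < +oo)%E) ->
  exists C h0 : R, 0 < h0 /\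
  forall (m : nat) (S : nat -> {RV P >-> R}),
  (0 < m)%N ->
  random_signs W (X t0) S ->
  let h := (tm - t0) / m%:R in
  h <= h0 ->
  forall i : 'I_n,
  let err := fun w => global_error a b t0 tm W S X m w 0 i in
  [/\ err \in Lfun P 2%:E,
      (`|'E_P[err]| <= (C * h)%:E)%E &
      ('V_P[err] <= (C * h ^+ 2)%:E)%E].
Proof.
(* Three derivatives: in K2 the volatility is expanded to second order with a remainder O(rho^3). *)
exists 3%N => n d T P F W a b t0 tm X t00 tt ha hb fF wW solX hp.
have [L [L1 lipa lipb groa grob]] := linear_growth_pair ha hb.
have tI : t0 <= t0 <= tm by rewrite lexx ltW.
have hx0 := adapted_vec_initial (filtration_sub fF t00)
  (fun i => ito_class_adapted (solution_class solX i) tI) hp.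
have [B [B0 hB]] :=
  rk_strong_error fF wW t00 ha.2 hb.2 L1 lipa lipb groa grob tt solX hx0.
(* One constant serves mean and variance, as sqrt B <= B + 1. The bound h <= 1 makes the root of the
   step at most 1, as [step_ok] demands. *)
exists (B + 1), 1; split=> // m S m0 rS h h1 i err.
have [merr ierr] := hB m S m0 rS h1 i.
have h0 : 0 <= h := ltW (mesh_gt0 tt m0).
have [LY EY VY] := square_integral_bounds merr ierr; split=> //.
- apply: le_trans EY _; rewrite lee_fin sqrtrM// sqrtr_sqr (ger0_norm h0) ler_wpM2r//.
  rewrite -[leRHS]ger0_norm ?addr_ge0// -sqrtr_sqr ler_wsqrtr//.
  by rewrite expr2 mulrDl mul1r -[leLHS]add0r lerD ?lerDl// mulr_ge0 ?addr_ge0.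
- by apply: le_trans VY _; rewrite lee_fin ler_wpM2r ?exprn_ge0// lerDl.
Qed.
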